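(* Fix an integer $d\ge4$ and let $A=\begin{pmatrix}0&1\\-1&d\end{pmatrix}$. Let $\begin{pmatrix} r_{-1}\\ r_0\end{pmatrix}\in\mathbb{Z}_{>0}^2$ and $\begin{pmatrix} d_{-1}\\ d_0\end{pmatrix}\in\mathbb{Z}^2$ be relatively prime vectors (i.e. $\gcd(r_{-1},d_{-1})=\gcd(r_0,d_0)=1$) such that $d\,r_{-1}r_0-r_{-1}^2-r_0^2=3d-10$ and $d=\begin{vmatrix} r_{-1}&d_{-1}\\ r_0&d_0\end{vmatrix}$. Then $\begin{pmatrix} r_{-1}\\ r_0\end{pmatrix}=A^n\begin{pmatrix}3\\1\end{pmatrix}$ or $A^n\begin{pmatrix}d-3\\1\end{pmatrix}$ for some $n\in\mathbb{Z}$. Let $\theta\in\mathbb{Q}-\frac{d}{2(3d-10)}\sqrt{d^2-4}$. If $d\neq5,10$, then all two-periodic elliptic helices over $X$ with $d$-dimensional consecutive Hom spaces and negative limit slope $\theta$ are in the same numerical class. For $d=10$, there are no two-periodic elliptic helices with $10$-dimensional consecutive Hom spaces and negative limit slope $\theta$ unless $\theta\in\mathbb{Z}-\sqrt6$, in which case there are two numerical classes of such helices. For $d=5$, there are no two-periodic elliptic helices with $5$-dimensional consecutive Hom spaces and negative limit slope $\theta$ unless $\theta\in\mathbb{Z}+\frac12-\frac12\sqrt{21}$, in which case there are two distinct numerical classes of such helices.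
   Context: $k$ is an algebraically closed field of characteristic zero and $X$ a smooth elliptic curve over $k$. An object $\mathcal{E}$ of $\mathsf{Coh}\,X$ is elliptically exceptional if $\operatorname{Ext}^j(\mathcal{E},\mathcal{E})\cong k$ for $j=0,1$ and is zero otherwise, and for every $\mathcal{F}\in\mathsf{Coh}\,X$ the natural pairing $\operatorname{Hom}(\mathcal{E},\mathcal{F})\otimes\operatorname{Ext}^1(\mathcal{F},\mathcal{E})\to\operatorname{Ext}^1(\mathcal{E},\mathcal{E})=k$ is non-degenerate. $\mathcal{F}$ left mutates through $\mathcal{E}$ if $\operatorname{Ext}^j(\mathcal{E},\mathcal{F})=0$ for $j\neq0$ and the evaluation map $\operatorname{Hom}(\mathcal{E},\mathcal{F})\otimes_k\mathcal{E}\to\mathcal{F}$ is surjective; its kernel is the left mutation. A two-periodic elliptic helix is a sequence $\underline{\mathcal{E}}=(\mathcal{E}_i)_{i\in\mathbb{Z}}$ of elliptically exceptional objects of $\mathsf{Coh}\,X$ such that $\operatorname{Ext}^1(\mathcal{E}_i,\mathcal{E}_j)=0$ for all $i<j$, and for all $i$, $\mathcal{E}_i$ left mutates through $\mathcal{E}_{i-1}$ with left mutation isomorphic to $\mathcal{E}_{i-2}$. All terms are simple vector bundles, and $\dim\operatorname{Hom}(\mathcal{E}_i,\mathcal{E}_{i+1})$ is independent of $i$; ''$d$-dimensional consecutive Hom spaces'' means this dimension is $d$. The negative limit slope is $\lim_{n\to-\infty}\deg\mathcal{E}_n/\operatorname{rank}\mathcal{E}_n$. Numerical classes: the twist of $\underline{\mathcal{E}}$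 by a line bundle $\mathcal{L}$ on $X$ is $(\mathcal{L}\otimes\mathcal{E}_i)_i$; the shift by $m\in\mathbb{Z}$ is $(\mathcal{E}_{i+m})_i$. Helices $\underline{\mathcal{E}},\underline{\mathcal{F}}$ are numerically equal if $\operatorname{rank}\mathcal{E}_i=\operatorname{rank}\mathcal{F}_i$ and $\deg\mathcal{E}_i=\deg\mathcal{F}_i$ for all $i$, and are in the same numerical class if they are numerically equal after shifting and twisting. *)

(* Defs.v *)
(* A smooth projective curve over an algebraically closed field k is described
   through its function field K/k, as in Hartshorne I.6: the closed points are
   the valuation rings of K/k, the topology is the cofinite one, and the
   regular functions on U are the elements of K lying in the local ring of
   every point of U.  Coherent sheaves are actual sheaves of modules over this
   sheaf of rings, and Ext is Yoneda Ext in the category of coherent sheaves. *)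
From HB Require Import structures.
From mathcomp Require Import all_boot all_order all_algebra.
From mathcomp Require Import all_classical all_reals all_analysis.
From Stdlib Require Import Relation_Operators.
Import Order.TTheory GRing.Theory Num.Theory.
Import numFieldNormedType.Exports.

Set Implicit Arguments.
Unset Strict Implicit.
Unset Printing Implicit Defensive.

Local Open Scope classical_set_scope.
Local Open Scope ring_scope.

(* The elliptic curve y^2 = x^3 + a x + b (every elliptic curve over k has such
   an equation when k has characteristic 0), given by its function field
   K = k(x, y): x is transcendental over k and every element of K has the form
   (p(x) + q(x) y) / r(x). *)
Record ellipticCurve (k : closedFieldType) := EllipticCurve {
  funField : fieldType;
  cst : {rmorphism k -> funField};
  weierA : k;
  weierB : k;
  weier_smooth : 4 * weierA ^+ 3 + 27 * weierB ^+ 2 != 0;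
  coordX : funField;
  coordY : funField;
  weier_eq : coordY ^+ 2 = coordX ^+ 3 + cst weierA * coordX + cst weierB;
  coordX_transc : forall p : {poly k}, p != 0 -> (map_poly cst p).[coordX] != 0;
  funField_gen : forall f : funField, exists p q r : {poly k},
    r != 0 /\
    f = ((map_poly cst p).[coordX] + (map_poly cst q).[coordX] * coordY)
          / (map_poly cst r).[coordX] }.

Section Curve.
Variables (k : closedFieldType) (X : ellipticCurve k).
Local Notation K := (funField X).

Definition is_place (O : set K) : Prop :=
  [/\ forall c : k, O (cst X c),
      forall f g, O f -> O g -> O (f - g) /\ O (f * g),
      forall f, O f \/ O f^-1
    & exists f, ~ O f].

Definition point := {O : set K | `[< is_place O >]}.

Definition regular_at (P : point) : set K := val P.

(* The order of vanishing at P of f != 0. *)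
Definition unit_at (P : point) (u : K) : Prop :=
  [/\ u != 0, regular_at P u & regular_at P u^-1].

Definition uniformizer (P : point) (t : K) : Prop :=
  [/\ t != 0, regular_at P t, ~ unit_at P t
    & forall f, regular_at P f -> ~ unit_at P f ->
        exists2 g, regular_at P g & f = t * g].

Definition ord (P : point) (f : K) : int :=
  xget 0 [set n | exists t u, [/\ uniformizer P t, unit_at P u & f = u * t ^ n]].

(* The nonempty Zariski open sets.  The empty open set is left out: sections
   over it vanish, so it carries no information. *)
Record opens := Opens {
  open_set :> set point;
  open_cofinite : finite_set (~` open_set) }.

Definition regular (U : set point) : set K :=
  [set f | forall P, U P -> regular_at P f].

(* Sheaves of modules over the structure sheaf.  For convenience [res] and
   [act] are total; they are only meaningful, and only constrained, for V
   contained in U and for f regular on U respectively. *)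
Record module_sheaf := ModuleSheaf {
  sec :> opens -> zmodType;
  res : forall U V : opens, sec U -> sec V;
  act : forall U : opens, K -> sec U -> sec U;
  resD : forall U V : opens, V `<=` U ->
    forall s t : sec U, res V (s + t) = res V s + res V t;
  res_id : forall (U : opens) (s : sec U), res U s = s;
  res_comp : forall U V W : opens, V `<=` U -> W `<=` V ->
    forall s : sec U, res W (res V s) = res W s;
  actDr : forall (U : opens) f, regular U f ->
    forall s t : sec U, act f (s + t) = act f s + act f t;
  actDl : forall (U : opens) f g, regular U f -> regular U g ->
    forall s : sec U, act (f + g) s = act f s + act g s;
  actM : forall (U : opens) f g, regular U f -> regular U g ->
    forall s : sec U, act (f * g) s = act f (act g s);
  act1 : forall (U : opens) (s : sec U), act 1 s = s;
  res_act : forall U V : opens, V `<=` U -> forall f, regular U f ->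
    forall s : sec U, res V (act f s) = act f (res V s);
  glue : forall (U : opens) (C : set opens),
    (forall V, C V -> V `<=` U) ->
    (forall P, open_set U P -> exists2 V, C V & open_set V P) ->
    forall s : (forall V, sec V),
    (forall V V' W : opens, C V -> C V' -> W `<=` V -> W `<=` V' ->
      res W (s V) = res W (s V')) ->
    exists! t : sec U, forall V, C V -> res V t = s V }.

Arguments res {m U} V s.
Arguments act {m U} f s.

(* Every section over an open subset of U is locally a combination of the e_i,
   and every relation between the e_i is locally a combination of the a_j. *)
Definition presented (F : module_sheaf) (U : opens) n (e : 'I_n -> F U)
    m (a : 'I_m -> 'I_n -> K) : Prop :=
  [/\ forall j i, regular U (a j i),
      forall j, \sum_i act (a j i) (e i) = 0,
      forall V : opens, V `<=` U -> forall (s : F V) Q, open_set V Q ->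
        exists W : opens, [/\ W `<=` V, open_set W Q &
          exists f : 'I_n -> K, (forall i, regular W (f i)) /\
            res W s = \sum_i act (f i) (res W (e i))]
    & forall V : opens, V `<=` U -> forall f : 'I_n -> K,
        (forall i, regular V (f i)) -> \sum_i act (f i) (res V (e i)) = 0 ->
        forall Q, open_set V Q -> exists W : opens, [/\ W `<=` V, open_set W Q &
          exists c : 'I_m -> K, (forall j, regular W (c j)) /\
            forall i, f i = \sum_j c j * a j i]].

(* Coherent = locally of finite presentation, since X is noetherian. *)
Definition coherent (F : module_sheaf) : Prop :=
  forall P : point, exists U : opens, open_set U P /\
    exists n (e : 'I_n -> F U) m (a : 'I_m -> 'I_n -> K), presented e a.

Record coh := Coh {
  coh_sheaf :> module_sheaf;
  cohP : coherent coh_sheaf }.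

Record hom (F G : module_sheaf) := Hom {
  hom_fun :> forall U, F U -> G U;
  homD : forall U (s t : F U), hom_fun (s + t) = hom_fun s + hom_fun t;
  homZ : forall U f (s : F U), regular U f ->
    hom_fun (act f s) = act f (hom_fun s);
  hom_res : forall U V : opens, V `<=` U -> forall s : F U,
    hom_fun (res V s) = res V (hom_fun s) }.

Arguments hom_fun {F G} h U s : rename.

Lemma regular_cst (U : set point) (c : k) : regular U (cst X c).
Proof.
by move=> P _; rewrite /regular_at; have /asboolP[] := valP P.
Qed.

Definition hom_id (F : module_sheaf) : hom F F.
Proof. by exists (fun U s => s). Defined.

Definition hom_scalar (c : k) (F : module_sheaf) : hom F F.
Proof.
exists (fun U s => act (cst X c) s).
- by move=> U s t; apply: actDr; apply: regular_cst.
- move=> U f s Uf.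
  by rewrite -!actM ?(mulrC f) //; apply: regular_cst.
- by move=> U V VU s; rewrite res_act //; apply: regular_cst.
Defined.

Definition hom_zero (F G : module_sheaf) (f : hom F G) : Prop :=
  forall U s, f U s = 0.

(* f is a k-basis of Hom(F, G). *)
Definition hom_basis (F G : module_sheaf) n (f : 'I_n -> hom F G) : Prop :=
  forall g : hom F G, exists! c : 'rV[k]_n,
    forall U s, g U s = \sum_i act (cst X (c 0 i)) (f i U s).

Definition hom_dim (F G : module_sheaf) (n : nat) : Prop :=
  exists f : 'I_n -> hom F G, hom_basis f.

Definition short_exact (B M A : module_sheaf) (i : hom B M) (p : hom M A) :=
  [/\ forall U, injective (i U),
      forall U s, p U (i U s) = 0,
      forall U s, p U s = 0 -> exists t, i U t = s
    & forall (U : opens) (s : A U) P, open_set U P ->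
        exists V : opens, [/\ V `<=` U, open_set V P & exists t, p V t = res V s]].

(* Extensions 0 -> B -> ext_mid -> A -> 0. *)
Record ext1 (A B : coh) := Ext1 {
  ext_mid : coh;
  ext_inj : hom B ext_mid;
  ext_prj : hom ext_mid A;
  ext_exact : short_exact ext_inj ext_prj }.

(* [yext n A B] is the type of exact sequences
   0 -> B -> M_(n+1) -> ... -> M_1 -> A -> 0, whose classes form Ext^(n+1),
   presented as splices of short exact sequences. *)
Fixpoint yext (n : nat) (A B : coh) : Type :=
  if n is n'.+1 then {C : coh & (ext1 A C * yext n' C B)%type} else ext1 A B.

Definition ext1_mor (A B A' B' : coh) (f : hom A A') (g : hom B B')
    (xi : ext1 A B) (zeta : ext1 A' B') : Prop :=
  exists m : hom (ext_mid xi) (ext_mid zeta), forall U,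
    (forall b, m U (ext_inj xi U b) = ext_inj zeta U (g U b)) /\
    (forall s, ext_prj zeta U (m U s) = f U (ext_prj xi U s)).

(* Morphisms of exact sequences inducing f on A and g on B. *)
Fixpoint yext_mor (n : nat) (A B A' B' : coh) (f : hom A A') (g : hom B B') :
    yext n A B -> yext n A' B' -> Prop :=
  match n with
  | 0 => @ext1_mor A B A' B' f g
  | n'.+1 => fun xi zeta => exists h : hom (projT1 xi) (projT1 zeta),
      ext1_mor f h (projT2 xi).1 (projT2 zeta).1 /\
      yext_mor h g (projT2 xi).2 (projT2 zeta).2
  end.

Definition yext_equiv (n : nat) (A B : coh) : yext n A B -> yext n A B -> Prop :=
  clos_refl_sym_trans _ (yext_mor (hom_id A) (hom_id B)).

(* Ext^j(A, B) = 0; for j > 0 this says that the nonempty set of Yoneda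
   classes has a single element. *)
Definition Ext_vanishes (j : nat) (A B : coh) : Prop :=
  if j is n.+1 then forall xi zeta : yext n A B, yext_equiv xi zeta
  else forall f : hom A B, hom_zero f.

(* zeta represents c times the class of xi (pushout along c : B -> B). *)
Definition ext1_scale (A B : coh) (c : k) (xi zeta : ext1 A B) : Prop :=
  ext1_mor (hom_id A) (hom_scalar c B) xi zeta.

(* Ext^1(A, B) has a one-element k-basis. *)
Definition Ext1_dim1 (A B : coh) : Prop :=
  exists xi0 : ext1 A B, forall xi : ext1 A B,
    exists! c : k, ext1_scale c xi0 xi.

(* The class of xi is zero. *)
Definition split_ext (A B : coh) (xi : ext1 A B) : Prop :=
  exists r : hom A (ext_mid xi), forall U a, ext_prj xi U (r U a) = a.

(* zeta represents the pullback f^* xi. *)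
Definition ext1_pullback (A A' B : coh) (f : hom A A')
    (xi : ext1 A' B) (zeta : ext1 A B) : Prop :=
  ext1_mor f (hom_id B) zeta xi.

(* Both kernels of Hom(E, F) x Ext^1(F, E) -> Ext^1(E, E) are trivial. *)
Definition pairing_nondegenerate (E F : coh) : Prop :=
  (forall f : hom E F, ~ hom_zero f ->
     exists (xi : ext1 F E) (zeta : ext1 E E),
       ext1_pullback f xi zeta /\ ~ split_ext zeta) /\
  (forall xi : ext1 F E, ~ split_ext xi ->
     exists (f : hom E F) (zeta : ext1 E E),
       ext1_pullback f xi zeta /\ ~ split_ext zeta).

Definition elliptically_exceptional (E : coh) : Prop :=
  [/\ hom_dim E E 1, Ext1_dim1 E E,
      forall j, (1 < j)%N -> Ext_vanishes j E E
    & forall F : coh, pairing_nondegenerate E F].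

(* A basis f of Hom(E, F) identifies the evaluation map with
   ev : E^n -> F, t |-> \sum_i f_i(t_i). *)
Definition eval_surjective (E F : coh) n (f : 'I_n -> hom E F) : Prop :=
  forall (U : opens) (s : F U) P, open_set U P ->
    exists V : opens, [/\ V `<=` U, open_set V P &
      exists t : 'I_n -> E V, \sum_i f i V (t i) = res V s].

(* (g_i)_i : G -> E^n is a kernel of ev. *)
Definition eval_kernel (E F G : coh) n (f : 'I_n -> hom E F)
    (g : 'I_n -> hom G E) : Prop :=
  forall U : opens,
    (forall s, \sum_i f i U (g i U s) = 0) /\
    (forall t : 'I_n -> E U, \sum_i f i U (t i) = 0 ->
       exists! s, forall i, g i U s = t i).

(* F left mutates through E and the left mutation is isomorphic to G. *)
Definition left_mutation (E F G : coh) : Prop :=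
  (forall j, j != 0%N -> Ext_vanishes j E F) /\
  exists n (f : 'I_n -> hom E F) (g : 'I_n -> hom G E),
    [/\ hom_basis f, eval_surjective f & eval_kernel f g].

Definition elliptic_helix (E : int -> coh) : Prop :=
  [/\ forall i, elliptically_exceptional (E i),
      forall i j, i < j -> Ext_vanishes 1 (E i) (E j)
    & forall i, left_mutation (E (i - 1)) (E i) (E (i - 2))].

(* The sections e_i identify F restricted to U with a free module. *)
Definition frame (F : module_sheaf) (U : opens) r (e : 'I_r -> F U) : Prop :=
  forall V : opens, V `<=` U -> forall s : F V, exists! f : 'rV[K]_r,
    (forall i, regular V (f 0 i)) /\
    s = \sum_i act (f 0 i) (res V (e i)).

Definition has_rank (F : module_sheaf) (r : nat) : Prop :=
  exists (U : opens) (e : 'I_r -> F U), frame e.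

Definition rank (F : module_sheaf) : nat := xget 0%N [set r | has_rank F r].

(* The degree of a vector bundle, as the degree of its determinant: if e is a
   frame over some open set then e_1 /\ ... /\ e_r is a rational section of
   det F, whose order at P is that of the determinant of the matrix g P
   expressing e in a frame defined around P. *)
Definition has_degree (F : module_sheaf) (n : int) : Prop :=
  exists r (U : opens) (e : 'I_r -> F U) (g : point -> 'M[K]_r),
    [/\ frame e,
        forall P, exists (V W : opens) (e' : 'I_r -> F V),
          [/\ open_set V P, frame e', W `<=` U, W `<=` V &
            forall j, (forall i, regular W (g P i j)) /\
              res W (e j) = \sum_i act (g P i j) (res W (e' i))]
      & n = \sum_(P \in [set: point]) ord P (\det (g P))].

(* Only meaningful for vector bundles; all terms of an elliptic helix are. *)
Definition degree (F : module_sheaf) : int := xget 0 [set n | has_degree F n].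

Definition line_bundle (L : coh) : Prop :=
  forall P : point, exists U : opens, open_set U P /\
    exists e : 'I_1 -> L U, frame e.

Definition bilinear_map (L E G : module_sheaf)
    (b : forall U, L U -> E U -> G U) : Prop :=
  [/\ forall U s s' t, b U (s + s') t = b U s t + b U s' t,
      forall U s t t', b U s (t + t') = b U s t + b U s t',
      forall (U : opens) f s t, regular U f ->
        b U (act f s) t = act f (b U s t) /\ b U s (act f t) = act f (b U s t)
    & forall U V : opens, V `<=` U ->
        forall s t, b V (res V s) (res V t) = res V (b U s t)].

(* T is a tensor product of L and E over the structure sheaf. *)
Definition is_tensor (L E T : module_sheaf) : Prop :=
  exists b : forall U, L U -> E U -> T U, bilinear_map b /\
    forall (G : module_sheaf) (b' : forall U, L U -> E U -> G U),
      bilinear_map b' ->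
      (exists h : hom T G, forall U s t, h U (b U s t) = b' U s t) /\
      (forall h h' : hom T G,
         (forall U s t, h U (b U s t) = h' U (b U s t)) ->
         forall U x, h U x = h' U x).

Definition shift_helix (m : int) (E : int -> coh) : int -> coh :=
  fun i => E (i + m).

(* Each E'_i is a tensor product of L and E_i. *)
Definition is_twist (L : coh) (E E' : int -> coh) : Prop :=
  line_bundle L /\ forall i, is_tensor L (E i) (E' i).

Definition numerically_equal (E F : int -> coh) : Prop :=
  forall i, rank (E i) = rank (F i) /\ degree (E i) = degree (F i).

Definition same_numerical_class (E F : int -> coh) : Prop :=
  exists (m : int) (L : coh) (E' : int -> coh),
    is_twist L (shift_helix m E) E' /\ numerically_equal E' F.

Definition negative_limit_slope (R : realType) (E : int -> coh) (theta : R) :=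
  (fun n : nat => (degree (E (- n%:Z)))%:~R / (rank (E (- n%:Z)))%:R : R)
    @ \oo --> theta.

(* Two-periodic elliptic helices with d-dimensional consecutive Hom spaces and
   negative limit slope theta. *)
Definition helix_with (R : realType) (d : nat) (theta : R) (E : int -> coh) :=
  [/\ elliptic_helix E,
      forall i, hom_dim (E i) (E (i + 1)) d
    & negative_limit_slope E theta].

Definition exactly_two_classes (S : (int -> coh) -> Prop) : Prop :=
  exists E F, [/\ S E, S F, ~ same_numerical_class E F &
    forall G, S G -> same_numerical_class G E \/ same_numerical_class G F].

End Curve.

Definition mx22 (a b c d : int) : 'M[int]_2 :=
  \matrix_(i < 2, j < 2)
    if i == 0 then (if j == 0 then a else b) else (if j == 0 then c else d).

Definition cv2 (a b : int) : 'cV[int]_2 :=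
  \col_(i < 2) if i == 0 then a else b.

(* Main.v *)
Require Import Defs.
From HB Require Import structures.
From mathcomp Require Import all_boot all_order all_algebra.
From mathcomp Require Import all_classical all_reals all_analysis.
From Stdlib Require Import Relation_Operators.
From mathcomp Require Import perm.
From mathcomp Require Import zify ring lra.
Import Defs.
Import Order.TTheory GRing.Theory Num.Theory.
Import numFieldNormedType.Exports.
Set Implicit Arguments.
Unset Strict Implicit.
Unset Printing Implicit Defensive.
Local Open Scope classical_set_scope.
Local Open Scope ring_scope.

(** Points of the curve are the valuation rings of K. A vector bundle is a family
    of lattices in K^r, one at each point and standard at almost all of them, and
    a homomorphism is a matrix over K that respects the lattices. In this form
    Riemann-Roch is proved by changing the lattices at one point at a time, down
    to trivial bundles. As the genus is one, chi(E, F) = rk E deg F - rk F deg E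
    has no constant term and is antisymmetric. The class of a function in the
    one-dimensional space H^1(O), called lam below, pairs Hom(F, E) with
    H^1(E, F) injectively on one side; antisymmetry makes the pairing perfect,
    which is Serre duality.

    A coherent sheaf maps onto a bundle with torsion kernel (coh_structure), and
    Ext^1 of bundles is H^1 (cls_ex, cls_mor). It follows that simple bundles are
    elliptically exceptional: the pairing is non-degenerate (pairing_left,
    pairing_right), and Yoneda sequences of length at least two are trivial
    (yext_trivial). Conversely the terms of a helix are simple; they are bundles
    when the limit slope is not 0 (helix_data). Mutation is a construction on
    pairs of simple bundles (mutation), and by duality it can be continued in
    both directions (pair_helix).

    Ranks and degrees satisfy x_(i - 2) + x_i = d x_(i - 1), so that the form
    quad is constant on ranks. Since d^2 - 4 is not a square, the coefficient of
    its root in the limit slope determines quad, which is 3 d - 10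
    (quad_of_limit). A positive sequence with this value of quad descends to the
    consecutive terms 3, 1 or d - 3, 1 (rank_descent): these are the two kinds of
    helices. The slope and the ranks determine the degrees
    (degrees_determined), so helices of the same kind and slope are in the same
    class. Helices of both kinds with the same slope can only exist if 3 d - 10
    divides d (d - 6), that is d = 4, 5, 6, 10 or 30 (exceptional_d). For d = 4
    and d = 6 the kinds agree, and d = 30 is impossible because a simple bundle
    of integral slope has rank one (simple_integral_slope). For d = 5 and d = 10
    both kinds exist: one starts from the kernel of O^n -> O(n) (start_pair), the
    other is its dual (kind_dual). They are in different classes, because twists
    preserve ranks (tensor_rank) and the term 1 occurs once (unique_one). *)

(** * Rank sequences *)

Definition recurrent (d : nat) (r : int -> int) : Prop :=
  forall i, r (i - 2) + r i = d%:Z * r (i - 1).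

Lemma int_ind_both (Q : int -> Prop) (j : int) : Q j ->
  (forall i, Q i -> Q (i + 1)) -> (forall i, Q i -> Q (i - 1)) -> forall i, Q i.
Proof.
move=> Qj up down i; have [n|n] : (exists n : nat, i = j + n%:Z) \/ (exists n : nat, i = j - n%:Z).
- by case: (leP j i) => h; [left; exists `|i - j|%N|right; exists `|j - i|%N]; lia.
- case: n => n ->; elim: n => [|n IH]; first by rewrite addr0.
  by have := up _ IH; congr Q; lia.
- case: n => n ->; elim: n => [|n IH]; first by rewrite subr0.
  by have := down _ IH; congr Q; lia.
Qed.

Lemma rec_prev (D a b c : int) : a + b = D * c -> a = D * c - b.
Proof. by move=> <-; rewrite addrK. Qed.

Lemma rec_next (D a b c : int) : a + b = D * c -> b = D * c - a.
Proof. by move=> <-; rewrite addrC addKr. Qed.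

Lemma recurrent_eq d r s (j l : int) : recurrent d r -> recurrent d s ->
  r (j - 1) = s (l - 1) -> r j = s l -> forall i, r (i + j) = s (i + l).
Proof.
move=> hr hs e1 e2 i; suff [] : r (i + j - 1) = s (i + l - 1) /\ r (i + j) = s (i + l) by [].
pattern i; apply: (@int_ind_both _ 0) => {i} [|i [h1 h2]|i [h1 h2]]; first by rewrite !add0r.
- split; first by have := h2; congr (r _ = s _); lia.
  have := hr (i + 1 + j); have := hs (i + 1 + l).
  have -> : i + 1 + j - 2 = i + j - 1 by lia.
  have -> : i + 1 + l - 2 = i + l - 1 by lia.
  have -> : i + 1 + j - 1 = i + j by lia.
  have -> : i + 1 + l - 1 = i + l by lia.
  by move=> /rec_next -> /rec_next ->; rewrite h1 h2.
have := hr (i + j); have := hs (i + l).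
have -> : i - 1 + j - 1 = i + j - 2 by lia.
have -> : i - 1 + l - 1 = i + l - 2 by lia.
have -> : i - 1 + j = i + j - 1 by lia.
have -> : i - 1 + l = i + l - 1 by lia.
by move=> /rec_prev ea /rec_prev eb; split=> //; rewrite ea eb h1 h2.
Qed.

(** The quadratic form preserved by (x, y) |-> (y, d y - x). *)
Definition quad (d : nat) (x y : int) : int := d%:Z * x * y - x ^+ 2 - y ^+ 2.

Lemma recurrent_quad d r (i j : int) : recurrent d r -> quad d (r (i - 1)) (r i) = quad d (r (j - 1)) (r j).
Proof.
move=> hr; pattern i; apply: (@int_ind_both _ j) => {i} [//|i <-|i <-].
  have := hr (i + 1); have -> : i + 1 - 2 = i - 1 by lia.
  rewrite addrK /quad => /rec_next ->.
  ring.
have := hr i; have -> : i - 1 - 1 = i - 2 by lia.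
move=> /rec_prev ->; rewrite /quad; ring.
Qed.

(** The neighbours x and z of y satisfy x z = quad d x y + y^2. *)
Lemma recurrent_pos d r j : recurrent d r -> 0 < r (j - 1) -> 0 < r j -> 0 < quad d (r (j - 1)) (r j) ->
  forall i, 0 < r i.
Proof.
move=> hr p1 p2 pq i; suff [] : 0 < r (i - 1) /\ 0 < r i by [].
have Q i' : quad d (r (i' - 1)) (r i') = quad d (r (j - 1)) (r j) := recurrent_quad i' j hr.
pattern i; apply: (@int_ind_both _ j) => {i} [//|i [h1 h2]|i [h1 h2]]; split=> //; rewrite ?addrK //.
  have := hr (i + 1); have -> : i + 1 - 2 = i - 1 by lia.
  rewrite addrK => e; have := Q i; move: pq; rewrite -(Q i) /quad !expr2.
  move: (r (i + 1)) (r (i - 1)) (r i) e h1 h2 => z x y e h1 h2 q _.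
  have : 0 < x * z by have -> : x * z = d%:Z * x * y - x * x; [rewrite (rec_next e); ring|nia].
  by rewrite pmulr_rgt0.
have := hr i; have -> : i - 1 - 1 = i - 2 by lia.
move: pq; rewrite -(Q i) /quad !expr2.
move: (r (i - 2)) (r (i - 1)) (r i) h1 h2 => z x y h1 h2 q e.
have : 0 < y * z by have -> : y * z = d%:Z * x * y - y * y; [rewrite (rec_prev e); ring|nia].
by rewrite pmulr_rgt0.
Qed.

(** On this range (d - 2) x^2 <= quad d x y < 4 (d - 2), so x = 1, and the
    condition on y becomes (y - 3)(y - (d - 3)) = 0. *)
Lemma reduced_pair (d : nat) (x y : int) : (4 <= d)%N -> 0 < x -> x <= y -> y <= d%:Z * x - y ->
  quad d x y = 3 * d%:Z - 10 -> x = 1 /\ (y = 3 \/ y = d%:Z - 3).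
Proof.
move=> d4 x0 xy yz q; have x1 : x = 1.
  have h : 0 <= (y - x) * (d%:Z * x - y - x).
    have h4 : 4 * x <= d%:Z * x by apply: ler_wpM2r; lia.
    by apply: mulr_ge0; lia.
  have h2 : (d%:Z - 2) * (x * x) <= 3 * d%:Z - 10.
    by move: q h; rewrite /quad !expr2; lia.
  case: (ltP x 2) => hx; first lia.
  have : 4 <= x * x by nia.
  move=> h4; have : (d%:Z - 2) * 4 <= (d%:Z - 2) * (x * x) by apply: ler_wpM2l; lia.
  lia.
split=> //; have : (y - 3) * (y - (d%:Z - 3)) = 0.
  by move: q; rewrite /quad x1 !expr2; lia.
by move=> /eqP; rewrite mulf_eq0 => /orP [/eqP h|/eqP h]; [left|right]; lia.
Qed.

(** Moving towards the smallest terms of the sequence ends at a reduced pair. *)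
Lemma rank_descent (d : nat) r : (4 <= d)%N -> recurrent d r -> (forall i, 0 < r i) ->
  quad d (r (-1)) (r 0) = 3 * d%:Z - 10 ->
  exists j, r j = 1 /\ (r (j - 1) = 3 \/ r (j - 1) = d%:Z - 3).
Proof.
move=> d4 hr pr q.
have Q i : quad d (r (i - 1)) (r i) = 3 * d%:Z - 10.
  by rewrite -q (recurrent_quad i 0 hr) sub0r.
suff h n : forall i, r (i - 1) + r i <= n%:Z ->
    exists j, r j = 1 /\ (r (j - 1) = 3 \/ r (j - 1) = d%:Z - 3).
  apply: (h `|(r (-1) + r 0)%R|%N 0%R); rewrite sub0r; exact: lez_abs.
elim: n => [|n IH] i hn; first by have := pr i; have := pr (i - 1); lia.
have p1 := pr i; have p2 := pr (i - 1).
have e1 : r (i - 2) = d%:Z * r (i - 1) - r i by have := hr i; lia.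
have e2 : r (i + 1) = d%:Z * r i - r (i - 1).
  by have := hr (i + 1); rewrite addrK (_ : i + 1 - 2 = i - 1); lia.
case: (leP (r (i - 1)) (r i)) => hxy.
  case: (ltP (r (i - 2)) (r i)) => hz.
    by apply: (IH (i - 1)); rewrite (_ : i - 1 - 1 = i - 2); lia.
  have [|h1 h2] := reduced_pair d4 p2 hxy _ (Q i); first by rewrite -e1.
  exists (i - 1); split=> //; rewrite (_ : i - 1 - 1 = i - 2); last lia.
  by rewrite e1 h1 mulr1; case: h2 => ->; [right|left]; lia.
case: (ltP (r (i + 1)) (r (i - 1))) => hz.
  by apply: (IH (i + 1)); rewrite addrK; lia.
have [||h1 h2] := reduced_pair d4 p1 (ltW hxy) _ _; first by rewrite -e2.
  by rewrite -(Q i) /quad; ring.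
by exists i.
Qed.

(** From y > x follows d y - x > y, so an increase propagates. *)
Lemma grows (d : nat) r (j : int) : (4 <= d)%N -> recurrent d r -> 0 < r j -> r j < r (j + 1) ->
  forall n : nat, 0 < r (j + n%:Z) /\ r (j + n%:Z) < r (j + n%:Z + 1).
Proof.
move=> d4 hr p g; elim=> [|n [h1 h2]]; first by rewrite addr0.
have -> : j + n.+1%:Z = j + n%:Z + 1 by lia.
have := hr (j + n%:Z + 1 + 1); rewrite addrK (_ : j + n%:Z + 1 + 1 - 2 = j + n%:Z); last lia.
move: (r _) (r _) (r _) h1 h2 => z y x h1 h2 e; split; first lia.
have : 4 * y <= d%:Z * y by apply: ler_wpM2r; lia.
lia.
Qed.

Lemma recurrent_rev d r : recurrent d r -> recurrent d (fun i => r (- i)).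
Proof.
move=> hr i; have := hr (- i + 2); rewrite addrK.
have -> : - (i - 2) = - i + 2 by lia.
have -> : - (i - 1) = - i + 2 - 1 by lia.
by rewrite addrC.
Qed.

(** The ranks of a helix of either kind contain the term 1 only once, unless d
    is 4; this is how a shift is recognised. *)
Lemma unique_one (d : nat) r (j l : int) : (4 <= d)%N -> recurrent d r -> r j = 1 -> 1 < r (j - 1) ->
  1 < r (j + 1) -> r l = 1 -> l = j.
Proof.
move=> d4 hr e1 e2 e3 el; case: (ltgtP l j) => // h.
  have hr' := recurrent_rev hr.
  have [||h1 h2] := @grows d (fun i => r (- i)) (- j) d4 hr' _ _ (`|j - l|%N.-1); rewrite ?opprK ?e1 //.
    by rewrite (_ : - (- j + 1) = j - 1); lia.
  move: h2; rewrite (_ : - (- j + (`|j - l|.-1)%N%:Z + 1) = l) ?el; [|lia].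
  by move: h1 => /=; lia.
have [||h1 h2] := @grows d r j d4 hr _ _ (`|l - j|%N.-1); rewrite ?e1 //.
move: h2; rewrite (_ : j + (`|l - j|.-1)%N%:Z + 1 = l) ?el; [|lia].
by lia.
Qed.

(** * Orbits of vectors of ranks *)

Lemma mul_mx22 d x y : mx22 0 1 (-1) d *m cv2 x y = cv2 y (- x + d * y).
Proof.
apply/matrixP => i j; rewrite !mxE big_ord_recl big_ord1 !mxE /=.
by case: (i == 0) => /=; rewrite ?mul0r ?add0r ?mul1r ?mulN1r.
Qed.

Lemma cv2E (w : 'cV[int]_2) : w = cv2 (w 0 0) (w 1 0).
Proof.
by apply/matrixP => i j; rewrite mxE ord1; case: i => [[|[|//]] hi] /=; congr (w _ _); exact: val_inj.
Qed.

Lemma mx22_unit d : mx22 0 1 (-1) d \is a GRing.unit.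
Proof.
have e : mx22 d (-1) 1 0 *m mx22 0 1 (-1) d = 1%:M.
  apply/matrixP => i j; rewrite !mxE big_ord_recl big_ord1 !mxE /=.
  by case: i => [[|[|//]] hi]; case: j => [[|[|//]] hj] //=; ring.
have [_ u] := mulmx1_unit e; exact: u.
Qed.

Lemma orbit_recurrent (d : nat) (v : 'cV[int]_2) :
  recurrent d (fun i => (mx22 0 1 (-1) d%:Z ^ i *m v) 1 0) /\
  forall i, (mx22 0 1 (-1) d%:Z ^ (i : int) *m v) 0 0 = (mx22 0 1 (-1) d%:Z ^ (i - 1) *m v) 1 0.
Proof.
set A := mx22 0 1 (-1) d%:Z; have uA : A \is a GRing.unit := mx22_unit d.
have step i : A ^ (i : int) *m v = A *m (A ^ (i - 1) *m v).
  by rewrite mulmxA -[A *m _]/(A * A ^ (i - 1)) -{2}[A]expr1z -exprzDr //; congr (A ^ _ *m v); lia.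
have h i : (A ^ (i : int) *m v) 0 0 = (A ^ (i - 1) *m v) 1 0.
  by rewrite step [A ^ (i - 1) *m v]cv2E mul_mx22 !mxE.
split=> // i; have -> : i - 2 = i - 1 - 1 by lia.
rewrite -h [in X in _ + X = _]step [A ^ (i - 1) *m v]cv2E mul_mx22 !mxE /=; ring.
Qed.

Lemma orbits (d : nat) (x y : int) : (4 <= d)%N -> 0 < x -> 0 < y -> quad d x y = 3 * d%:Z - 10 ->
  exists n : int, cv2 x y = mx22 0 1 (-1) d%:Z ^ n *m cv2 3 1 \/
                  cv2 x y = mx22 0 1 (-1) d%:Z ^ n *m cv2 (d%:Z - 3) 1.
Proof.
move=> d4 x0 y0 q; set A := mx22 0 1 (-1) d%:Z; have uA : A \is a GRing.unit := mx22_unit d.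
pose r (i : int) := (A ^ i *m cv2 x y) 1 0.
have [hr hr0] : recurrent d r /\ forall i : int, (A ^ i *m cv2 x y) 0 0 = r (i - 1) := orbit_recurrent d (cv2 x y).
have r0 : r 0 = y by rewrite /r expr0z mul1mx mxE.
have r1 : r (-1) = x by have := hr0 0; rewrite expr0z mul1mx mxE /= sub0r => <-.
have pr : forall i, 0 < r i.
  have := recurrent_pos (j := 0) hr; rewrite sub0r r1 r0 q => h; apply: h => //; lia.
have [|j [e1 e2]] := rank_descent d4 hr pr; first by rewrite r1 r0.
have ev : cv2 x y = A ^ (- j) *m cv2 (r (j - 1)) (r j).
  rewrite -hr0 -[r j]/((A ^ j *m cv2 x y) 1 0) -cv2E mulmxA -[A ^ _ *m A ^ _]/(A ^ (- j) * A ^ j).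
  by rewrite -exprzDr // addNr expr0z mul1mx.
by exists (- j); rewrite ev e1; case: e2 => ->; [left|right].
Qed.

(** * Limit slopes *)

Definition helix_numbers (d : nat) (r delta : int -> int) : Prop :=
  [/\ forall i, 0 < r i, forall i, r (i - 2) + r i = d%:Z * r (i - 1),
      forall i, delta (i - 2) + delta i = d%:Z * delta (i - 1)
    & forall i, r (i - 1) * delta i - r i * delta (i - 1) = d%:Z].

Section Slopes.
Variables (R : realType) (d : nat).
Hypothesis d4 : (4 <= d)%N.

Let s : R := Num.sqrt (d%:R ^+ 2 - 4).

(** The smaller root of x^2 - d x + 1. For the limit slope theta the sequence
    delta_i - theta r_i is multiplied by it at each step to the left. *)
Definition mu : R := (d%:R - Num.sqrt (d%:R ^+ 2 - 4)) / 2.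

Lemma d_ge4R : 4 <= d%:R :> R. Proof. by rewrite (ler_nat R 4). Qed.

Lemma sqr_s : s ^+ 2 = d%:R ^+ 2 - 4.
Proof. by rewrite sqr_sqrtr //; have := d_ge4R; nra. Qed.

Lemma s_ge0 : 0 <= s. Proof. exact: sqrtr_ge0. Qed.

Lemma mu_eq : mu ^+ 2 = d%:R * mu - 1.
Proof. by have := sqr_s; rewrite /mu -/s; move: s => x e; field: e. Qed.

Lemma mu_gt0 : 0 < mu.
Proof. by have := sqr_s; have := s_ge0; have := d_ge4R; rewrite /mu -/s; nra. Qed.

Lemma mu_lt1 : mu < 1.
Proof. by have := sqr_s; have := s_ge0; have := d_ge4R; rewrite /mu -/s; nra. Qed.

(** d^2 - 4 lies strictly between two consecutive squares. *)
Lemma sqrt_irr (a b : int) : a%:~R + b%:~R * s = 0 -> b = 0.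
Proof.
move=> e; have e2 : a ^+ 2 = b ^+ 2 * (d%:Z ^+ 2 - 4).
  have eD : (d%:Z ^+ 2 - 4)%:~R = s ^+ 2 :> R by rewrite sqr_s rmorphB /= rmorphXn.
  apply: (@intr_inj R); transitivity ((b ^+ 2)%:~R * (d%:Z ^+ 2 - 4)%:~R : R); last by rewrite -intrM.
  rewrite eD !rmorphXn /= -exprMn -sqrrN; congr (_ ^+ 2).
  by move/eqP: e; rewrite addrC addr_eq0 => /eqP ->.
apply: contrapT => /eqP b0.
have : (b %| a)%Z.
  rewrite -(@dvdz_pexp2r _ _ 2) //; apply/dvdzP; exists (d%:Z ^+ 2 - 4).
  by rewrite e2 mulrC.
move=> /dvdzP [c ec]; move: e2; rewrite ec exprMn mulrC => /(mulfI (expf_neq0 2 b0)).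
rewrite !expr2 => h; have h1 : `|c| < d%:Z by rewrite -ltr_sqr ?nnegrE // -normrX ger0_norm ?sqr_ge0 // expr2 h; lia.
have : d%:Z - 1 < `|c|.
  by rewrite -ltr_sqr ?nnegrE //; [rewrite -normrX ger0_norm ?sqr_ge0 // !expr2 h; lia|lia].
lia.
Qed.

Lemma mu_irr (a b : int) : a%:~R = mu * b%:~R -> a = 0 /\ b = 0.
Proof.
move=> e; have b0 : b = 0.
  apply: (@sqrt_irr (a + a - d%:Z * b)); rewrite rmorphB rmorphD rmorphM /= e /mu -/s.
  by rewrite -[d%:Z%:~R]/(d%:R : R); field.
by split=> //; apply: (@intr_inj R); rewrite e b0 mulr0.
Qed.

Variables (r delta : int -> int).
Hypothesis hn : helix_numbers d r delta.

Let rr i : R := (r i)%:~R.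
Let dd i : R := (delta i)%:~R.

Lemma r_pos i : 1 <= rr i.
Proof. by have [p _ _ _] := hn; rewrite /rr (ler_int R 1); have := p i; lia. Qed.

Lemma rec_real (x : int -> int) i : recurrent d x ->
  (x (i - 2))%:~R + (x i)%:~R = d%:R * (x (i - 1))%:~R :> R.
Proof. by move=> hx; rewrite -rmorphD hx rmorphM. Qed.

Lemma step_down (a b c : R) : a + c = d%:R * b -> b = mu * c -> a = mu * b.
Proof.
move=> e hb; have -> : a = d%:R * b - c by rewrite -e addrK.
rewrite hb mulrA -[in X in _ - X](mul1r c) -mulrBl -mu_eq; ring.
Qed.

Lemma step_up (a b c : R) : a + c = d%:R * b -> a = mu * b -> b = mu * c.
Proof.
move=> e ha; have -> : c = d%:R * b - a by rewrite -e addrC addKr.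
rewrite ha -mulrBl mulrA mulrBr [mu * d%:R]mulrC -expr2 mu_eq; ring.
Qed.

Lemma contracts (theta : R) : theta * (rr (-1) - mu * rr 0) = dd (-1) - mu * dd 0 ->
  forall i, dd (i - 1) - theta * rr (i - 1) = mu * (dd i - theta * rr i).
Proof.
have [_ h1 h2 _] := hn; move=> h.
have step i : (dd (i - 2) - theta * rr (i - 2)) + (dd i - theta * rr i) = d%:R * (dd (i - 1) - theta * rr (i - 1)).
  rewrite addrACA (rec_real i h2) -opprD -mulrDr (rec_real i h1) /rr /dd; ring.
move=> i; pattern i; apply: (@int_ind_both _ 0) => {i} [|i IH|i IH].
- by rewrite sub0r -[LHS]opprB -[in LHS]opprB opprK; move: h; rewrite !mulrBr => h; apply/eqP; rewrite -subr_eq0; apply/eqP;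
    rewrite -(subrr (theta * rr (-1) - theta * (mu * rr 0))) {1}h; ring.
- have := step (i + 1); rewrite addrK (_ : i + 1 - 2 = i - 1); last lia.
  by move=> e; exact: step_up e IH.
have := step i; rewrite (_ : i - 1 - 1 = i - 2); last lia.
by move=> e; exact: step_down e IH.
Qed.

Lemma denominator : rr (-1) - mu * rr 0 != 0.
Proof.
rewrite subr_eq0; apply/eqP => /mu_irr [_ e]; have [p _ _ _] := hn.
by have := p 0; rewrite e.
Qed.

Local Notation slope := (fun n : nat => dd (- n%:Z) / rr (- n%:Z)).

(** The slope at - n differs from theta by mu^n y / r_(- n), where y is
    delta_0 - theta r_0. *)
Lemma slope_cvg (theta : R) : theta * (rr (-1) - mu * rr 0) = dd (-1) - mu * dd 0 ->
  slope @ \oo --> theta.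
Proof.
move=> h; pose y := dd 0 - theta * rr 0.
have yE (n : nat) : dd (- n%:Z) - theta * rr (- n%:Z) = mu ^+ n * y.
  elim: n => [|n IH]; first by rewrite oppr0 expr0 mul1r.
  have -> : - n.+1%:Z = - n%:Z - 1 by lia.
  by rewrite (contracts h) IH exprS mulrA.
have m0 := mu_gt0; have m1 := mu_lt1.
have cm : (fun n => mu ^+ n * `|y|) @ \oo --> (0 : R).
  rewrite -(mul0r `|y|); apply: cvgMl; apply: cvg_expr; by rewrite ger0_norm // ltW.
apply: (@squeeze_cvgr _ _ _ _ (fun n => theta - mu ^+ n * `|y|) (fun n => theta + mu ^+ n * `|y|)).
- apply: nearW => n; rewrite -ler_distl distrC.
  have r1 := r_pos (- n%:Z); have r0 : rr (- n%:Z) != 0 by rewrite gt_eqF //; lra.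
  have -> : theta - dd (- n%:Z) / rr (- n%:Z) = - (mu ^+ n * y) / rr (- n%:Z).
    by rewrite -yE; field.
  rewrite normrM normrN normrM normfV (ger0_norm (exprn_ge0 n (ltW m0))) (@ger0_norm _ (rr _)); last lra.
  rewrite ler_pdivrMr; last lra.
  by apply: ler_peMr => //; apply: mulr_ge0; [apply: exprn_ge0; lra|].
- by rewrite -[X in _ --> X]subr0; apply: cvgB => //; exact: cvg_cst.
by rewrite -[X in _ --> X]addr0; apply: cvgD => //; exact: cvg_cst.
Qed.

Lemma slope_limit (theta : R) : slope @ \oo --> theta ->
  theta * (rr (-1) - mu * rr 0) = dd (-1) - mu * dd 0.
Proof.
move=> h; pose t := (dd (-1) - mu * dd 0) / (rr (-1) - mu * rr 0).
have ht : t * (rr (-1) - mu * rr 0) = dd (-1) - mu * dd 0 by rewrite /t divfK ?denominator.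
have -> // : theta = t.
exact: (cvg_unique _ h (slope_cvg ht)).
Qed.

(** Rationalising the limit slope gives 2 theta quad = A - d s with an integer
    A and s the root of d^2 - 4. As s is irrational, its coefficient in theta
    determines quad. *)
Lemma quad_of_limit (theta : R) (q : rat) : theta * (rr (-1) - mu * rr 0) = dd (-1) - mu * dd 0 ->
  theta = ratr q - d%:R / (2 * (3 * d%:R - 10)) * s ->
  quad d (r (-1)) (r 0) = 3 * d%:Z - 10.
Proof.
move=> h eq; have [_ _ _ hc] := hn.
pose N := quad d (r (-1)) (r 0); pose M : int := 3 * d%:Z - 10.
pose B := delta (-1) * r (-1) + delta 0 * r 0.
pose A := d%:Z * (delta (-1) * r 0 + delta 0 * r (-1)) - (B + B).
have d4R := d_ge4R.
have e1 : 2 * theta * N%:~R = A%:~R - d%:R * s.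
  have hc0 : rr (-1) * dd 0 - rr 0 * dd (-1) = d%:R.
    by have := hc 0; rewrite sub0r => /(congr1 (fun z : int => z%:~R : R)); rewrite rmorphB !rmorphM.
  rewrite /N /A /B /quad !(rmorphB, rmorphD, rmorphM, rmorphXn) /= -/(rr 0) -/(rr (-1)) -/(dd 0) -/(dd (-1)).
  rewrite -[d%:Z%:~R]/(d%:R : R).
  have me := mu_eq; have se : s = d%:R - 2 * mu by rewrite /mu -/s; field.
  have -> : d%:R * rr (-1) * rr 0 - rr (-1) ^+ 2 - rr 0 ^+ 2 =
      - ((rr (-1) - mu * rr 0) * (rr (-1) - (d%:R - mu) * rr 0)).
    by move: me; move: (rr 0) (rr (-1)) mu d%:R => a b c e me; rewrite !expr2 in me *; ring: me.
  rewrite mulrN mulrA -(mulrA 2) h se -{3}hc0.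
  by move: me; move: (rr 0) (rr (-1)) (dd 0) (dd (-1)) mu => a b a' b' c me; rewrite !expr2 in me *; ring: me.
pose num := numq q; pose den := denq q.
have den0 : den%:~R != 0 :> R by rewrite intr_eq0 denq_neq0.
have M0 : M%:~R != 0 :> R by rewrite intr_eq0; apply/eqP; rewrite /M; lia.
have eM : 3 * d%:R - 10 = M%:~R :> R.
  by rewrite /M rmorphB rmorphM.
have e2 : 2 * theta * den%:~R * M%:~R = 2 * num%:~R * M%:~R - d%:R * den%:~R * s.
  have eqq : ratr q = num%:~R / den%:~R :> R by [].
  by rewrite eq eM eqq; field; rewrite den0 M0.
have key (a b c u n e : int) : 2 * theta * n%:~R = a%:~R - e%:~R * s ->
    2 * theta * b%:~R * c%:~R = 2 * u%:~R * c%:~R - e%:~R * b%:~R * s ->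
    (a * b * c - (u * c * n + u * c * n))%:~R + (e * b * (n - c))%:~R * s = 0 :> R.
  move=> g1 g2; have g3 : (2 * theta * n%:~R) * (b%:~R * c%:~R) = (2 * theta * b%:~R * c%:~R) * n%:~R by ring.
  rewrite g1 g2 in g3; move/eqP: g3; rewrite -subr_eq0 => /eqP <-.
  by rewrite !(rmorphB, rmorphD, rmorphM) /=; ring.
have := key A den M num N d%:Z e1 e2.
move=> /sqrt_irr /eqP; rewrite !mulf_eq0 (negPf (denq_neq0 q)) orbF => /orP [|/eqP].
  by rewrite eqz_nat; move: d4; case: (d).
by rewrite /N /M => /subr0_eq.
Qed.

(** The two degree sequences differ by integers a and b at i - 1 and i, with a
    = mu b, and mu is irrational. *)
Lemma degrees_determined (delta' : int -> int) (theta : R) i :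
  dd (i - 1) - theta * rr (i - 1) = mu * (dd i - theta * rr i) ->
  (delta' (i - 1))%:~R - theta * rr (i - 1) = mu * ((delta' i)%:~R - theta * rr i) ->
  delta i = delta' i.
Proof.
move=> h1 h2; have [_ e] : delta (i - 1) - delta' (i - 1) = 0 /\ delta i - delta' i = 0.
  by apply: mu_irr; rewrite !rmorphB /=; move: h1 h2; rewrite /dd; lra.
exact: subr0_eq.
Qed.

Lemma slope_at_one (theta : R) i : dd (i - 1) - theta * rr (i - 1) = mu * (dd i - theta * rr i) ->
  r i = 1 -> (theta - dd i) * (rr (i - 1) - mu) = - d%:R.
Proof.
have [_ _ _ hc] := hn; move=> h ri; have := hc i; rewrite ri mul1r.
move=> /(congr1 (fun z : int => z%:~R : R)); rewrite rmorphB !rmorphM /= -/(rr (i - 1)) -/(dd i) -/(dd (i - 1)).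
rewrite -[d%:Z%:~R]/(d%:R : R) => <-; move: h; rewrite {2}/rr ri; move: (rr _) (dd _) (dd _) => a b c; lra.
Qed.

End Slopes.

(** (3 - mu)(d - 3 - mu) = 3 d - 10, so the limit slopes of the two kinds of
    sequences are b - d (d - 3 - mu) / (3 d - 10) and b' - d (3 - mu) / (3 d - 10)
    for integers b and b'. *)
Lemma slope_value (R : realType) (d : nat) (b theta : R) (x : int) : (4 <= d)%N -> x = 3 \/ x = d%:Z - 3 ->
  (theta - b) * (x%:~R - mu R d) = - d%:R <->
  (theta - b) * (3 * d%:R - 10) = - d%:R * (d%:R - x%:~R - mu R d).
Proof.
move=> d4 hx; have me := @mu_eq R d d4; have dR := @d_ge4R R d d4; have m1 := @mu_lt1 R d d4; have m0 := @mu_gt0 R d d4.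
have e : (x%:~R - mu R d) * (d%:R - x%:~R - mu R d) = 3 * d%:R - 10.
  have -> : (x%:~R - mu R d) * (d%:R - x%:~R - mu R d) = x%:~R * (d%:R - x%:~R) - (d%:R * mu R d - mu R d ^+ 2) by ring.
  rewrite me; case: hx => ->; last rewrite rmorphB /= -[d%:Z%:~R]/(d%:R : R).
    by rewrite -[(3 : int)%:~R]/(3%:R : R); ring.
  by rewrite -[(3 : int)%:~R]/(3%:R : R); ring.
have N0 : 3 * d%:R - 10 != 0 :> R by rewrite gt_eqF //; lra.
have : (x%:~R - mu R d) * (d%:R - x%:~R - mu R d) != 0 by rewrite e.
rewrite mulf_eq0 negb_or => /andP [a0 b0].
split=> [h|]; first by rewrite -e mulrA h.
by rewrite -e mulrA => /(mulIf b0).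
Qed.

Lemma two_kinds (R : realType) (d : nat) (b b' : int) (theta : R) : (4 <= d)%N ->
  (theta - b%:~R) * (3%:~R - mu R d) = - d%:R ->
  (theta - b'%:~R) * ((d%:Z - 3)%:~R - mu R d) = - d%:R ->
  (b - b') * (3 * d%:Z - 10) = d%:Z * (d%:Z - 6).
Proof.
move=> d4 /slope_value h1 /slope_value h2; have {}h1 := h1 d4 (or_introl erefl); have {}h2 := h2 d4 (or_intror erefl).
apply: (@intr_inj R); rewrite !(rmorphM, rmorphB) /=.
move: h1 h2; rewrite rmorphB /= -[(3 : int)%:~R]/(3%:R : R) -[(10 : int)%:~R]/(10%:R : R) -[(6 : int)%:~R]/(6%:R : R) -[d%:Z%:~R]/(d%:R : R).
lra.
Qed.

(** With N = 3 d - 10, 9 d (d - 6) = (N + 10) (N - 8), so N divides 80. *)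
Lemma exceptional_d (d : nat) (c : int) : (4 <= d)%N -> c * (3 * d%:Z - 10) = d%:Z * (d%:Z - 6) ->
  d \in [:: 4; 5; 6; 10; 30].
Proof.
move=> d4 h; have e : 80 = (3 * d%:Z - 8 - 9 * c) * (3 * d%:Z - 10) by lia.
have d30 : (d <= 30)%N.
  move: e; move: (3 * d%:Z - 8 - 9 * c) => l e; have l0 : 0 < l by nia.
  have : 1 * (3 * d%:Z - 10) <= l * (3 * d%:Z - 10) by apply: ler_wpM2r; lia.
  lia.
move: d4 d30 h; clear; do 31 (case: d => [|d] //; try (by lia)).
Qed.

(** * Finite-dimensional quotients *)

Section QDim.
Variables (k K : fieldType) (cst : {rmorphism k -> K}).

Definition ksub (M : lmodType K) (U : set M) : Prop :=
  U 0 /\ forall (c : k) u v, U u -> U v -> U (cst c *: u + v).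

Definition sumS (M : lmodType K) (U V : set M) : set M :=
  [set w | exists u v, [/\ U u, V v & w = u + v]].

Definition klin (M : lmodType K) n (c : 'rV[k]_n) (f : 'I_n -> M) : M :=
  \sum_i cst (c 0 i) *: f i.

(** The quotient V/U is recorded through a k-linear surjection of V onto k^n
    with kernel U, which is only meaningful on V. *)
Definition coords (M : lmodType K) (V U : set M) n (phi : M -> 'rV[k]_n) : Prop :=
  [/\ forall c u v, V u -> V v -> phi (cst c *: u + v) = c *: phi u + phi v,
      forall w, exists2 v, V v & phi v = w
    & forall v, V v -> (phi v = 0 <-> U v)].

Definition qdim (M : lmodType K) (V U : set M) (n : nat) : Prop :=
  exists phi : M -> 'rV[k]_n, coords V U phi.

Section Sub.
Variables (M : lmodType K).
Implicit Types (U V T : set M).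

Lemma ksub0 U : ksub U -> U 0. Proof. by case. Qed.

Lemma ksubD U u v : ksub U -> U u -> U v -> U (u + v).
Proof. by move=> [_ h] Uu Uv; have := h 1 u v Uu Uv; rewrite rmorph1 scale1r. Qed.

Lemma ksubZ U c u : ksub U -> U u -> U (cst c *: u).
Proof. by move=> [h0 h] Uu; have := h c u 0 Uu h0; rewrite addr0. Qed.

Lemma ksubN U u : ksub U -> U u -> U (- u).
Proof.
by move=> kU Uu; have := ksubZ (-1) kU Uu; rewrite rmorphN1 scaleN1r.
Qed.

Lemma ksubB U u v : ksub U -> U u -> U v -> U (u - v).
Proof. by move=> kU Uu Uv; apply: ksubD => //; apply: ksubN. Qed.

Lemma ksub_klin U n (c : 'rV[k]_n) f : ksub U -> (forall i, U (f i)) -> U (klin c f).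
Proof.
move=> kU Uf; rewrite /klin; elim/big_rec: _ => [|i u _ Uu]; first exact: ksub0.
by apply: ksubD => //; apply: ksubZ.
Qed.

Lemma ksubI U V : ksub U -> ksub V -> ksub (U `&` V).
Proof.
move=> [U0 hU] [V0 hV]; split=> // c u v [Uu Vu] [Uv Vv].
by split; [apply: hU | apply: hV].
Qed.

Lemma ksub_sumS U V : ksub U -> ksub V -> ksub (sumS U V).
Proof.
move=> [U0 hU] [V0 hV]; split; first by exists 0, 0; rewrite addr0.
move=> c _ _ [u [v [Uu Vv ->]]] [u' [v' [Uu' Vv' ->]]].
exists (cst c *: u + u'), (cst c *: v + v'); split; [exact: hU|exact: hV|].
by rewrite scalerDr addrACA.
Qed.

Lemma ksub_set0 : ksub [set (0 : M)].
Proof. by split=> // c u v /= -> ->; rewrite scaler0 addr0. Qed.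

Lemma ksubT : ksub [set: M]. Proof. by []. Qed.

Lemma klinL n c (u v : 'rV[k]_n) (f : 'I_n -> M) : klin (c *: u + v) f = cst c *: klin u f + klin v f.
Proof.
rewrite /klin scaler_sumr -big_split /=; apply: eq_bigr => i _.
by rewrite !mxE rmorphD rmorphM scalerDl scalerA.
Qed.

Lemma klin0 n (f : 'I_n -> M) : klin 0 f = 0.
Proof. by rewrite /klin big1 // => i _; rewrite mxE rmorph0 scale0r. Qed.

Lemma coords0 V U n (phi : M -> 'rV[k]_n) : ksub V -> coords V U phi -> phi 0 = 0.
Proof.
move=> [V0 _] [h _ _]; have := h (-1) 0 0 V0 V0.
by rewrite scaler0 addr0 scaleN1r addNr.
Qed.

Lemma coords_klin V U n (phi : M -> 'rV[k]_n) m (c : 'rV[k]_m) (f : 'I_m -> M) :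
  ksub V -> coords V U phi -> (forall i, V (f i)) ->
  phi (klin c f) = \sum_i c 0 i *: phi (f i).
Proof.
move=> kV cphi Vf; have [h _ _] := cphi; have phi0 := coords0 kV cphi; rewrite /klin.
suff /(_ (index_enum 'I_m)) [] : forall s : seq 'I_m,
  V (\sum_(i <- s) cst (c 0 i) *: f i) /\
  phi (\sum_(i <- s) cst (c 0 i) *: f i) = \sum_(i <- s) c 0 i *: phi (f i) by [].
elim=> [|i s [IHV IH]]; first by rewrite !big_nil; split=> //; exact: ksub0.
rewrite !big_cons; split; first by apply: (proj2 kV).
by rewrite h // IH.
Qed.

Lemma coords_basis V U n (phi : M -> 'rV[k]_n) : coords V U phi ->
  exists f : 'I_n -> M, (forall i, V (f i)) /\ forall i, phi (f i) = delta_mx 0 i.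
Proof.
move=> [_ h _]; have /choice [f hf] i : exists v, V v /\ phi v = delta_mx 0 i.
  by have [v ? ?] := h (delta_mx 0 i); exists v.
by exists f; split=> i; case: (hf i).
Qed.

Lemma coords_section V U n (phi : M -> 'rV[k]_n) : ksub V -> coords V U phi ->
  exists f : 'I_n -> M, (forall i, V (f i)) /\
    (forall c, phi (klin c f) = c) /\
    forall v, V v -> U (v - klin (phi v) f).
Proof.
move=> kV cphi; have [f [Vf ef]] := coords_basis cphi.
have phik c : phi (klin c f) = c.
  rewrite (coords_klin _ kV cphi Vf) [RHS]row_sum_delta.
  by apply: eq_bigr => i _; rewrite ef.
exists f; do 2![split=> //] => v Vv.
have [h _ hU] := cphi.
apply/hU; first by apply: ksubB => //; apply: ksub_klin.
rewrite addrC -scaleN1r -(rmorphN1 cst) h //; last exact: ksub_klin.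
by rewrite phik scaleN1r addNr.
Qed.

Lemma qdim_le V U n m : ksub V -> qdim V U n -> qdim V U m -> (n <= m)%N.
Proof.
move=> kV [phi cphi] [psi cpsi].
have [f [Vf [phik _]]] := coords_section kV cphi.
pose A : 'M[k]_(n, m) := \matrix_i psi (f i).
suff fA : row_free A by rewrite -(eqP fA) rank_leq_col.
rewrite -kermx_eq0; apply/rowV0P => c /sub_kermxP cA.
have : U (klin c f).
  apply/(let: And3 _ _ h := cpsi in h _ (ksub_klin c kV Vf)).
  rewrite (coords_klin _ kV cpsi Vf) -[RHS]cA mulmx_sum_row.
  by apply: eq_bigr => j _; rewrite rowK.
move/(let: And3 _ _ h := cphi in h _ (ksub_klin c kV Vf)).
by rewrite phik.
Qed.

Lemma qdim_uniq V U n m : ksub V -> qdim V U n -> qdim V U m -> n = m.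
Proof.
by move=> kV hn hm; apply/eqP; rewrite eqn_leq !(@qdim_le V U).
Qed.

Lemma qdim_add U V T a b : ksub V -> ksub T -> U `<=` V -> V `<=` T ->
  qdim V U a -> qdim T V b -> qdim T U (a + b).
Proof.
move=> kV kT UV VT [phi cphi] [psi cpsi].
have [f [Tf [psik psiV]]] := coords_section kT cpsi.
have [lphi sphi kphi] := cphi; have [lpsi spsi kpsi] := cpsi.
exists (fun t => row_mx (phi (t - klin (psi t) f)) (psi t)); split.
- move=> c u v Tu Tv; rewrite lpsi // klinL.
  rewrite scale_row_mx add_row_mx; congr row_mx.
  rewrite -lphi; try exact: psiV.
  by congr phi; rewrite scalerBr opprD addrACA.
- move=> w; have [v Vv ev] := sphi (lsubmx w).
  have pv : psi v = 0 by apply/kpsi => //; exact: VT.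
  have Tk : T (klin (rsubmx w) f) by exact: ksub_klin.
  have e : psi (v + klin (rsubmx w) f) = rsubmx w.
    have := lpsi 1 v _ (VT _ Vv) Tk.
    by rewrite rmorph1 !scale1r => ->; rewrite pv add0r psik.
  exists (v + klin (rsubmx w) f); first by apply: ksubD => //; exact: VT.
  by rewrite e addrK ev hsubmxK.
- move=> v Tv; split.
  + rewrite -[0]row_mx0 => /eq_row_mx [e1 e2].
    apply/kphi; first by apply/kpsi.
    by rewrite -e1 e2 klin0 subr0.
  + move=> Uv.
    have Vv : V v by exact: UV.
    have e2 : psi v = 0 by apply/kpsi.
    rewrite e2 -[RHS]row_mx0; congr row_mx; apply/kphi => //.
      by have := psiV v Tv; rewrite e2.
    by rewrite klin0 subr0.
Qed.

Lemma linset_basis n (S : set 'rV[k]_n) : S 0 ->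
  (forall c u v, S u -> S v -> S (c *: u + v)) ->
  exists B : 'M[k]_n, forall v : 'rV_n, S v <-> (v <= B)%MS.
Proof.
move=> S0 hS.
pose good r := `[< exists B : 'M[k]_n,
  (forall u : 'rV_n, (u <= B)%MS -> S u) /\ \rank B = r >].
have g0 : exists r, good r.
  exists 0%N; apply/asboolP; exists 0; split; last by rewrite mxrank0.
  by move=> u; rewrite submx0 => /eqP ->.
have gle r : good r -> (r <= n)%N.
  by move=> /asboolP[B [_ <-]]; exact: rank_leq_row.
case: (ex_maxnP g0 gle) => r /asboolP[B [hB rB]] rmax.
exists B => v; split; last exact: hB.
move=> Sv; apply: contrapT => /negP nvB.
have : (\rank (B + v)%MS <= r)%N.
  apply: rmax; apply/asboolP; exists (B + v)%MS; split=> // u.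
  case/sub_addsmxP => -[u1 u2] /= ->.
  rewrite addrC [u2]mx11_scalar mul_scalar_mx; apply: hS => //.
  by apply: hB; rewrite submxMl.
have : (B < B + v)%MS.
  rewrite ltmxE addsmxSl /=; apply: contra nvB.
  by apply: submx_trans; exact: addsmxSr.
by move/rank_ltmx; rewrite rB => h1 h2; have := leq_trans h1 h2; rewrite ltnn.
Qed.

Lemma qdim_split V U T n : ksub V -> ksub T -> U `<=` V -> V `<=` T ->
  qdim T U n -> exists a b, [/\ qdim V U a, qdim T V b & (a + b)%N = n].
Proof.
move=> kV kT UV VT qT; have [phi cphi] := qT; have [lphi sphi kphi] := cphi.
have [B hB] : exists B : 'M[k]_n, forall v : 'rV_n,
    (exists2 w, V w & phi w = v) <-> (v <= B)%MS.
  apply: linset_basis.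
    by exists 0; [exact: ksub0 | exact: coords0 kT cphi].
  move=> c _ _ [u Vu <-] [v Vv <-].
  by exists (cst c *: u + v); [apply: (proj2 kV) | apply: lphi; apply: VT].
have inV v : T v -> (phi v <= B)%MS -> V v.
  move=> Tv /hB [w Vw ew]; have : U (v - w).
    apply/kphi; first by apply: ksubB => //; exact: VT.
    rewrite addrC -scaleN1r -(rmorphN1 cst) lphi //; last exact: VT.
    by rewrite ew scaleN1r addNr.
  by move/UV => h; rewrite -(subrK w v); apply: ksubD.
have qV : qdim V U (\rank B).
  exists (fun v => phi v *m pinvmx (row_base B)); split.
  - by move=> c u v Vu Vv; rewrite lphi ?mulmxDl ?scalemxAl //; exact: VT.
  - move=> w; have /hB [v Vv ev] : (w *m row_base B <= B)%MS.
      by rewrite (submx_trans (submxMl _ _)) // eq_row_base.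
    exists v => //; rewrite ev; apply: (row_free_inj (row_base_free B)).
    by rewrite mulmxKpV // submxMl.
  - move=> v Vv; rewrite -(kphi v (VT _ Vv)); split=> [e|->]; last by rewrite mul0mx.
    have : (phi v <= row_base B)%MS by rewrite eq_row_base; apply/hB; exists v.
    by move/mulmxKpV <-; rewrite e mul0mx.
have qT' : qdim T V (\rank (cokermx B)).
  exists (fun v => phi v *m col_base (cokermx B)); split.
  - by move=> c u v Tu Tv; rewrite lphi // mulmxDl scalemxAl.
  - move=> w; have : (w <= col_base (cokermx B))%MS.
      by apply: submx_full; exact: col_base_full.
    by case/submxP => u ->; have [v Tv ev] := sphi u; exists v; rewrite ?ev.
  - move=> v Tv; have -> : V v <-> (phi v <= B)%MS.
      by split=> [Vv|/(inV _ Tv)//]; apply/hB; exists v.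
    rewrite submxE; split=> [e|/eqP e].
      by rewrite -(mulmx_base (cokermx B)) mulmxA e mul0mx.
    apply: (row_free_inj (row_base_free (cokermx B))).
    by rewrite -mulmxA mulmx_base e mul0mx.
exists (\rank B), (\rank (cokermx B)); split=> //.
by apply: (qdim_uniq kT _ qT); apply: qdim_add qV qT'.
Qed.

End Sub.

(** An injective k-linear map of quotients that is onto carries coordinates
    in both directions. *)
Section Transport.
Variables (M N : lmodType K) (f : M -> N) (V U : set M) (V' U' : set N).
Hypotheses (kV : ksub V) (kU' : ksub U').
Hypothesis fL : forall c u v, V u -> V v -> f (cst c *: u + v) = cst c *: f u + f v.
Hypothesis fV : forall v, V v -> V' (f v).
Hypothesis fU : forall v, V v -> (U' (f v) <-> U v).
Hypothesis fS : forall v', V' v' -> exists2 v, V v & U' (v' - f v).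

Lemma qdim_pull n : ksub V' -> qdim V' U' n -> qdim V U n.
Proof.
move=> kV' [phi [lphi sphi kphi]]; exists (phi \o f); split.
- by move=> c u v Vu Vv /=; rewrite fL // lphi //; apply: fV.
- move=> w; have [v' Vv' <-] := sphi w; have [v Vv h] := fS Vv'.
  exists v => //=; have Vf := fV Vv.
  have Vd : V' (v' - f v) by apply: ksubB.
  move/kphi : h => /(_ Vd) h.
  rewrite -(subrK (f v) v') -(scale1r (v' - f v)) -(rmorph1 cst) lphi //.
  by rewrite h scaler0 add0r.
- by move=> v Vv /=; rewrite -fU // kphi //; apply: fV.
Qed.

Lemma qdim_push n : ksub V' -> U' `<=` V' -> qdim V U n -> qdim V' U' n.
Proof.
move=> kV' UV' [phi [lphi sphi kphi]].
have /choice [s sP] v' : exists v, V' v' -> V v /\ U' (v' - f v).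
  have [/fS [v ? ?]|?] := pselect (V' v'); first by exists v.
  by exists 0.
have uniq v' v : V' v' -> V v -> U' (v' - f v) -> phi (s v') = phi v.
  move=> Vv' Vv h; have [Vs hs'] := sP _ Vv'.
  have e : phi (cst (-1) *: v + s v') = 0.
    apply/kphi; first by apply: (proj2 kV).
    apply/fU; first by apply: (proj2 kV).
    rewrite fL // rmorphN1 scaleN1r.
    have := ksubB kU' h hs'; rewrite opprB [_ - v']addrC addrACA.
    by rewrite subrr add0r.
  by move: e; rewrite lphi // scaleN1r => /eqP; rewrite addrC subr_eq0 => /eqP.
exists (phi \o s); split=> /=.
- move=> c u v Vu Vv; have [Vsu hu] := sP _ Vu; have [Vsv hv] := sP _ Vv.
  rewrite -lphi //; apply: uniq; [exact: (proj2 kV')|exact: (proj2 kV)|].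
  rewrite fL // opprD addrACA -scalerBr; exact: (proj2 kU').
- move=> w; have [v Vv <-] := sphi w; exists (f v); first exact: fV.
  by apply: uniq => //; [exact: fV | rewrite subrr; exact: ksub0].
- move=> v' Vv'; have [Vs h] := sP _ Vv'.
  rewrite kphi // -fU //; split=> h'.
    by rewrite -(subrK (f (s v')) v'); apply: ksubD.
  by rewrite -[f _](subKr v') ; apply: ksubB.
Qed.
End Transport.

Section Modular.
Variables (M : lmodType K).
Implicit Types (U V T : set M).

(** V / U is an extension of (V + T) / (U + T) by (V & T) / (U & T). *)
Lemma qdim_modular U V T n : ksub U -> ksub V -> ksub T -> U `<=` V ->
  qdim V U n -> exists a b,
  [/\ qdim (V `&` T) (U `&` T) a, qdim (sumS V T) (sumS U T) b & (a + b)%N = n].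
Proof.
move=> kU kV kT UV qV.
pose Z := sumS U (V `&` T).
have kVT := ksubI kV kT.
have kZ : ksub Z by apply: ksub_sumS.
have UZ : U `<=` Z by move=> u Uu; exists u, 0; rewrite addr0; split=> //; exact: ksub0.
have ZV : Z `<=` V.
  by move=> _ [u [v [/UV Vu [Vv _] ->]]]; exact: ksubD.
have [a [b [qa qb <-]]] := qdim_split kZ kV UZ ZV qV.
exists a, b; split=> //.
- apply: (@qdim_pull _ _ id (V `&` T) (U `&` T) Z U) qa => //.
  + by move=> v VTv; exists 0, v; rewrite add0r; split=> //; exact: ksub0.
  + by move=> v [Vv Tv]; split=> [|[]].
  + move=> _ [u [v [Uu VTv ->]]]; exists v => //; by rewrite addrK.
- apply: (@qdim_push _ _ id V Z (sumS V T) (sumS U T)) qb => //.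
  + exact: ksub_sumS.
  + by move=> v Vv; exists v, 0; rewrite addr0; split=> //; exact: ksub0.
  + move=> v Vv; split=> -[u [t [Uu Tt e]]].
      exists u, t; split=> //; split=> //.
      by rewrite -(addKr u t) -e addrC; apply: ksubB => //; apply: UV.
    by exists u, t; split=> //; case: Tt.
  + move=> _ [v [t [Vv Tt ->]]]; exists v => //; exists 0, t.
    by split=> //; [exact: ksub0 | rewrite addrC addKr add0r].
  + exact: ksub_sumS.
  + by move=> _ [u [t [Uu Tt ->]]]; exists u, t; split=> //; apply: UV.
Qed.

Lemma qdim_set0 n (V : set M) : qdim V [set 0] n -> ksub V ->
  exists f : 'I_n -> M, (forall i, V (f i)) /\
    forall v, V v -> exists! c : 'rV[k]_n, v = klin c f.
Proof.
move=> [phi cphi] kV; have [f [Vf [fk h]]] := coords_section kV cphi.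
exists f; split=> // v Vv; exists (phi v); split.
  by apply/eqP; rewrite -subr_eq0; apply/eqP; apply: h.
by move=> c ->; rewrite fk.
Qed.

Lemma qdim_of_basis n (V : set M) (f : 'I_n -> M) : ksub V -> (forall i, V (f i)) ->
  (forall v, V v -> exists! c : 'rV[k]_n, v = klin c f) -> qdim V [set 0] n.
Proof.
move=> kV Vf h; pose phi v := xget 0 [set c : 'rV[k]_n | v = klin c f].
have phiP v : V v -> v = klin (phi v) f.
  by move=> /h [c [e _]]; rewrite /phi; case: xgetP => // /(_ c).
have uniq v c : V v -> v = klin c f -> phi v = c.
  by move=> Vv e; have [c' [_ u]] := h _ Vv; rewrite -(u _ e) -(u _ (phiP _ Vv)).
exists phi; split.
- move=> c u v Vu Vv; apply: uniq; first exact: (proj2 kV).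
  by rewrite klinL -!phiP.
- by move=> w; exists (klin w f); [exact: ksub_klin | apply: uniq => //; exact: ksub_klin].
- move=> v Vv; split=> [e|/= ->].
    by rewrite /= (phiP v Vv) e klin0.
  by apply: uniq; [exact: ksub0 | rewrite klin0].
Qed.
End Modular.
End QDim.

Section Basis.
Variables (k K : fieldType) (cst : {rmorphism k -> K}).

Definition basis (M : lmodType K) (V : set M) n (f : 'I_n -> M) : Prop :=
  (forall i, V (f i)) /\ forall v, V v -> exists! c : 'rV[k]_n, v = klin cst c f.

Lemma basis_of_free (M : lmodType K) (V : set M) n (f : 'I_n -> M) :
  ksub cst V -> qdim cst V [set 0] n -> (forall i, V (f i)) ->
  (forall c : 'rV[k]_n, klin cst c f = 0 -> c = 0) -> basis V f.
Proof.
move=> kV [phi cphi] Vf hf; split=> // v Vv; have [lphi sphi kphi] := cphi.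
pose A : 'M[k]_n := \matrix_i phi (f i).
have pk c : phi (klin cst c f) = c *m A.
  rewrite (coords_klin c kV cphi Vf) mulmx_sum_row.
  by apply: eq_bigr => i _; rewrite rowK.
have kn c : V (klin cst c f) by exact: ksub_klin.
have uA : A \in unitmx.
  rewrite -row_free_unit -kermx_eq0; apply/rowV0P => c /sub_kermxP.
  by rewrite -pk => /(kphi _ (kn _)).1 /hf.
have e : v = klin cst (phi v *m invmx A) f.
  set u := klin _ _ _; have Vd : V (v - u) by exact: (ksubB kV Vv (kn _)).
  have : phi (v - u) = 0.
    have -> : v - u = cst (-1) *: u + v by rewrite rmorphN1 scaleN1r addrC.
    by rewrite lphi // /u ?pk ?mulmxKV // scaleN1r addNr.
  by move=> /(kphi _ Vd).1 /= /subr0_eq.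
exists (phi v *m invmx A); split=> // c ec.
by rewrite ec pk mulmxK.
Qed.

Lemma basis_free (M : lmodType K) (V : set M) n (f : 'I_n -> M) : ksub cst V -> basis V f ->
  forall c, klin cst c f = 0 -> c = 0.
Proof.
move=> kV [_ h] c e; have [c0 [_ u]] := h _ (ksub0 kV).
by rewrite -(u _ (esym e)) (u 0) // klin0.
Qed.

End Basis.

(** * Subgroups as abelian groups *)

Section SubZ.
Variables (V : zmodType) (S : set V).
Hypothesis hS : S 0 /\ forall u v, S u -> S v -> S (u - v).

(** The proof that S is a subgroup is a parameter of the type, so that the
    group structure can be inferred from the type. *)
Record subZ (h : S 0 /\ forall u v, S u -> S v -> S (u - v)) := SubZ { subZ_val : V; subZ_valP : `[< S subZ_val >] }.
Local Notation T := (subZ hS).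
HB.instance Definition _ := [isSub of T for @subZ_val hS].
HB.instance Definition _ := [Choice of T by <:].

Lemma subZ_P (x : T) : S (subZ_val x).
Proof. by apply/asboolP; exact: subZ_valP. Qed.

Definition mkZ x (h : S x) : T := @SubZ hS x (asboolT h).

Lemma subZ_eq (x y : T) : subZ_val x = subZ_val y -> x = y.
Proof. exact: val_inj. Qed.

Lemma S_opp x : S x -> S (- x).
Proof. by move=> Sx; rewrite -[- x]add0r; apply: (proj2 hS) => //; exact: (proj1 hS). Qed.
Lemma S_add x y : S x -> S y -> S (x + y).
Proof. by move=> Sx Sy; rewrite -[y]opprK; apply: (proj2 hS) => //; exact: S_opp. Qed.

Definition zeroZ : T := mkZ (proj1 hS).
Definition oppZ (x : T) : T := mkZ (S_opp (subZ_P x)).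
Definition addZ (x y : T) : T := mkZ (S_add (subZ_P x) (subZ_P y)).

Lemma addZA : associative addZ. Proof. by move=> x y z; apply: subZ_eq; exact: addrA. Qed.
Lemma addZC : commutative addZ. Proof. by move=> x y; apply: subZ_eq; exact: addrC. Qed.
Lemma add0Z : left_id zeroZ addZ. Proof. by move=> x; apply: subZ_eq; exact: add0r. Qed.
Lemma addNZ : left_inverse zeroZ oppZ addZ. Proof. by move=> x; apply: subZ_eq; exact: addNr. Qed.

HB.instance Definition _ := GRing.isZmodule.Build T addZA addZC add0Z addNZ.
End SubZ.

(** * The function field *)

Section Curve.
Variables (k : closedFieldType) (X : ellipticCurve k).
Hypothesis char_k : [pchar k] =i pred0.
Local Notation K := (funField X).
Local Notation C := (cst X).

Section Places.
Local Notation x := (coordX X).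
Local Notation y := (coordY X).
Implicit Types (p q r : {poly k}) (f g s : K) (P Q : point X).

Lemma two_neq0 : (2 : k) != 0.
Proof.
apply/negP => e; have := char_k 2%N.
by rewrite [in RHS]inE [LHS]inE /= e.
Qed.

Lemma double_neq0 (b : k) : b != 0 -> b + b != 0.
Proof.
by move=> b0; rewrite -mulr2n -mulr_natl mulf_neq0 // two_neq0.
Qed.

Definition cp (p : {poly k}) : K := (map_poly C p).[x].

Fact cp_additive : zmod_morphism cp.
Proof. by move=> p q; rewrite /cp rmorphB hornerD hornerN. Qed.
Fact cp_multiplicative : monoid_morphism cp.
Proof.
by split=> [|p q]; rewrite /cp ?rmorph1 ?hornerC // rmorphM hornerM.
Qed.
HB.instance Definition _ := GRing.isZmodMorphism.Build {poly k} K cp cp_additive.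
HB.instance Definition _ :=
  GRing.isMonoidMorphism.Build {poly k} K cp cp_multiplicative.

Lemma cpX : cp 'X = x.
Proof. by rewrite /cp map_polyX hornerX. Qed.

Lemma cpC c : cp c%:P = C c.
Proof. by rewrite /cp map_polyC hornerC. Qed.

Lemma cpXa a : cp ('X - a%:P) = x - C a.
Proof. by rewrite rmorphB /= cpX cpC. Qed.

Lemma cp_eq0 p : (cp p == 0) = (p == 0).
Proof.
apply/idP/idP => [|/eqP ->]; last by rewrite rmorph0.
by apply: contraLR => p0; exact: coordX_transc.
Qed.

Definition wpol : {poly k} := 'X^3 + (weierA X)%:P * 'X + (weierB X)%:P.

Lemma cp_wpol : cp wpol = y ^+ 2.
Proof.
by rewrite /wpol !rmorphD rmorphXn rmorphM /= !cpC cpX weier_eq.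
Qed.

Lemma size_wpol : size wpol = 4%N.
Proof.
rewrite /wpol -addrA size_polyDl size_polyXn //.
apply: leq_ltn_trans (size_polyD _ _) _; rewrite gtn_max.
rewrite (leq_ltn_trans (size_polyC_leq1 _)) // andbT.
apply: leq_ltn_trans (size_polyMleq _ _) _.
by have := size_polyC_leq1 (weierA X); rewrite size_polyX; lia.
Qed.

Lemma wpol_neq0 : wpol != 0.
Proof. by rewrite -size_poly_eq0 size_wpol. Qed.

Lemma y_neq0 : y != 0.
Proof.
apply/eqP => y0; have := wpol_neq0.
by rewrite -cp_eq0 cp_wpol y0 expr0n eqxx.
Qed.

Lemma curve_sqrt a : exists b, b ^+ 2 = wpol.[a].
Proof.
have /closed_rootP [b] : size ('X^2 - (wpol.[a])%:P) != 1%N by rewrite size_XnsubC.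
by rewrite /root !hornerE subr_eq0 => /eqP; exists b.
Qed.

Definition ev (p q : {poly k}) : K := cp p + cp q * y.

Lemma evM p q p' q' :
  ev p q * ev p' q' = ev (p * p' + q * q' * wpol) (p * q' + q * p').
Proof. by rewrite /ev !rmorphD !rmorphM /= cp_wpol; ring. Qed.

Lemma evB p q p' q' : ev p q - ev p' q' = ev (p - p') (q - q').
Proof. by rewrite /ev !rmorphB; ring. Qed.

Lemma evD p q p' q' : ev p q + ev p' q' = ev (p + p') (q + q').
Proof. by rewrite /ev !rmorphD; ring. Qed.

Lemma ev_poly p : ev p 0 = cp p.
Proof. by rewrite /ev rmorph0 mul0r addr0. Qed.

Lemma ev_cst c : ev c%:P 0 = C c.
Proof. by rewrite ev_poly cpC. Qed.

Lemma ev_conj p q : ev p q * ev p (- q) = cp (p ^+ 2 - q ^+ 2 * wpol).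
Proof. by rewrite evM /ev; rewrite !rmorphD !rmorphM !rmorphN rmorphM /= !rmorphXn /=; ring. Qed.

Lemma size_gt0 p : p != 0 -> (0 < size p)%N. Proof. by rewrite size_poly_gt0. Qed.

(** The two terms have degrees of different parity, wpol being of degree 3. *)
Lemma norm_size p q : q != 0 ->
  size (p ^+ 2 - q ^+ 2 * wpol) = maxn (2 * size p).-1 (2 * size q + 2).
Proof.
move=> q0.
have sq : size (q ^+ 2 * wpol) = (2 * size q + 2)%N.
  rewrite size_mul ?expf_neq0 ?wpol_neq0 // size_wpol expr2 size_mul //.
  have := size_gt0 q0.
  by case: (size q) => // n _; lia.
have [->|p0] := eqVneq p 0.
  by rewrite expr0n /= sub0r size_polyN sq size_poly0 muln0 max0n.
have sp : size (p ^+ 2) = (2 * size p).-1.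
  by rewrite expr2 size_mul // mul2n addnn.
have p1 := size_gt0 p0.
have [h|h] := ltnP (2 * size p).-1 (2 * size q + 2).
  by rewrite addrC size_polyDl size_polyN sq ?sp //; lia.
by rewrite size_polyDl ?size_polyN ?sq ?sp //; lia.
Qed.

Lemma norm_neq0 p q : ~~ ((p == 0) && (q == 0)) -> p ^+ 2 - q ^+ 2 * wpol != 0.
Proof.
have [->|q0] := eqVneq q 0.
  by rewrite andbT expr0n mul0r subr0 => p0; rewrite expf_neq0.
by move=> _; rewrite -size_poly_eq0 norm_size //; lia.
Qed.

Lemma ev_eq0 p q : (ev p q == 0) = (p == 0) && (q == 0).
Proof.
apply/idP/idP => [e|/andP[/eqP -> /eqP ->]]; last by rewrite ev_poly rmorph0.
apply: contraLR (e) => h; have := norm_neq0 h; rewrite -cp_eq0 -ev_conj.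
by rewrite mulf_eq0 negb_or => /andP[].
Qed.

Lemma ev_inj p q p' q' : ev p q = ev p' q' -> p = p' /\ q = q'.
Proof.
move/eqP; rewrite -subr_eq0 evB ev_eq0 !subr_eq0.
by case/andP => /eqP -> /eqP ->.
Qed.

Lemma ev_gen f : exists p q r, r != 0 /\ f = ev p q / cp r.
Proof. exact: funField_gen. Qed.

(** * Valuation rings *)

Section Valuation.
Variable P : point X.
Local Notation O := (regular_at P).

Lemma reg_place : is_place O.
Proof. by have /asboolP := valP P. Qed.

Lemma regC c : O (C c). Proof. by case: reg_place. Qed.
Lemma reg0 : O 0. Proof. by have := regC 0; rewrite rmorph0. Qed.
Lemma reg1 : O 1. Proof. by have := regC 1; rewrite rmorph1. Qed.
Lemma regB f g : O f -> O g -> O (f - g).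
Proof. by case: reg_place => _ h _ _ Of Og; case: (h f g). Qed.
Lemma regM f g : O f -> O g -> O (f * g).
Proof. by case: reg_place => _ h _ _ Of Og; case: (h f g). Qed.
Lemma regN f : O f -> O (- f).
Proof. by move=> Of; rewrite -sub0r; apply: regB => //; exact: reg0. Qed.
Lemma regD f g : O f -> O g -> O (f + g).
Proof. by move=> Of Og; rewrite -[g]opprK; apply: regB => //; exact: regN. Qed.
Lemma regX f n : O f -> O (f ^+ n).
Proof.
move=> Of; elim: n => [|n IH]; first exact: reg1.
by rewrite exprS; apply: regM.
Qed.
Lemma reg_or f : O f \/ O f^-1. Proof. by case: reg_place. Qed.
Lemma reg_sum (I : Type) (r : seq I) (Q : pred I) (F : I -> K) :
  (forall i, Q i -> O (F i)) -> O (\sum_(i <- r | Q i) F i).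
Proof.
by move=> h; elim/big_rec: _ => [|i f Qi Of]; [exact: reg0 | apply: regD => //; exact: h].
Qed.
Lemma reg_prod (I : Type) (r : seq I) (Q : pred I) (F : I -> K) :
  (forall i, Q i -> O (F i)) -> O (\prod_(i <- r | Q i) F i).
Proof.
by move=> h; elim/big_rec: _ => [|i f Qi Of]; [exact: reg1 | apply: regM => //; exact: h].
Qed.
Lemma reg_sqr f : O (f ^+ 2) -> O f.
Proof.
move=> Of; case: (reg_or f) => // Of'; have [->|f0] := eqVneq f 0; first exact: reg0.
by rewrite -(mulfK f0 f) -expr2; apply: regM.
Qed.
Lemma reg_cp p : O x -> O (cp p).
Proof.
move=> Ox; elim/poly_ind: p => [|p c IH]; first by rewrite rmorph0; exact: reg0.
rewrite rmorphD rmorphM /= cpX cpC; apply: regD (regC c); exact: regM.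
Qed.
Lemma reg_y : O x -> O y.
Proof. by move=> Ox; apply: reg_sqr; rewrite -cp_wpol; exact: reg_cp. Qed.
Lemma reg_ev p q : O x -> O (ev p q).
Proof.
move=> Ox; apply: regD; first exact: reg_cp.
by apply: regM; [exact: reg_cp | exact: reg_y].
Qed.

Definition van (f : K) : Prop := f = 0 \/ ~ O f^-1.

Lemma van_reg f : van f -> O f.
Proof. by case=> [->|h]; [exact: reg0 | case: (reg_or f)]. Qed.

Lemma van_unit f : O f -> ~ van f -> unit_at P f.
Proof.
move=> Of nv; split=> //; first by apply/eqP => f0; apply: nv; left.
by apply: contrapT => h; apply: nv; right.
Qed.

Lemma unit_nvan f : unit_at P f -> ~ van f.
Proof. by move=> [/eqP f0 _ h] []. Qed.

Lemma unit_neq0 f : unit_at P f -> f != 0. Proof. by case. Qed.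
Lemma unit_reg f : unit_at P f -> O f. Proof. by case. Qed.

Lemma unit1 : unit_at P 1.
Proof. by split; [exact: oner_neq0 | exact: reg1 | rewrite invr1; exact: reg1]. Qed.

Lemma unitM f g : unit_at P f -> unit_at P g -> unit_at P (f * g).
Proof.
move=> [f0 Of Of'] [g0 Og Og']; split; [by rewrite mulf_neq0|exact: regM|].
by rewrite invfM; apply: regM.
Qed.

Lemma unitV f : unit_at P f -> unit_at P f^-1.
Proof. by move=> [f0 Of Of']; split; rewrite ?invr_eq0 ?invrK. Qed.

Lemma unitX f n : unit_at P f -> unit_at P (f ^+ n).
Proof.
move=> uf; elim: n => [|n IH]; first exact: unit1.
by rewrite exprS; apply: unitM.
Qed.

Lemma unitN f : unit_at P f -> unit_at P (- f).
Proof.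
by move=> [f0 Of Of']; split; rewrite ?oppr_eq0 ?invrN //; exact: regN.
Qed.

Lemma unitC c : c != 0 -> unit_at P (C c).
Proof.
by move=> c0; split; rewrite ?fmorph_eq0 //; [|rewrite -fmorphV]; exact: regC.
Qed.

Lemma vanM g f : O g -> van f -> van (g * f).
Proof.
move=> Og; have [->|g0] := eqVneq g 0; first by left; rewrite mul0r.
case=> [->|h]; first by left; rewrite mulr0.
right=> h'; apply: h; have -> : f^-1 = g * (g * f)^-1 by rewrite invfM mulrA divff ?mul1r.
exact: regM.
Qed.

Lemma vanN f : van f -> van (- f).
Proof. by case=> [->|h]; [left; rewrite oppr0|right=> h'; apply: h; have := regN h'; rewrite invrN opprK]. Qed.

Lemma vanD f g : van f -> van g -> van (f + g).
Proof.
move=> vf vg; have [e|fg0] := eqVneq (f + g) 0; first by left.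
have [f0|f0] := eqVneq f 0; first by rewrite f0 add0r.
have [g0|g0] := eqVneq g 0; first by rewrite g0 addr0.
right=> h.
have key a b : a != 0 -> b != 0 -> a + b != 0 -> O (a + b)^-1 -> O (a / b) -> O b^-1.
  move=> a0 b0 ab0 h1 h2; have -> : b^-1 = (a / b + 1) * (a + b)^-1 by field; rewrite ab0.
  by apply: regM => //; apply: regD => //; exact: reg1.
case: (reg_or (f / g)) => hd.
  by case: vg => [/eqP|]; [rewrite (negPf g0)|apply; apply: key h hd].
case: vf => [/eqP|]; [by rewrite (negPf f0)|apply; apply: (key g f) => //].
- by rewrite addrC.
- by rewrite addrC.
- by rewrite -invf_div.
Qed.

Lemma vanB f g : van f -> van g -> van (f - g).
Proof. by move=> vf vg; apply: vanD => //; apply: vanN. Qed.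

Lemma unitD u f : unit_at P u -> van f -> unit_at P (u + f).
Proof.
move=> uu vf; apply: van_unit; first by apply: regD; [exact: unit_reg | exact: van_reg].
by move=> h; apply: (unit_nvan uu); rewrite -(addrK f u); apply: vanB.
Qed.

Lemma van_mul f g : O f -> O g -> van (f * g) -> van f \/ van g.
Proof.
move=> Of Og; apply: contraPP => /not_orP [/(van_unit Of) uf /(van_unit Og) ug].
exact: unit_nvan (unitM uf ug).
Qed.

Lemma vanXn f n : van f -> (0 < n)%N -> van (f ^+ n).
Proof.
case: n => // n vf _; rewrite exprSr; apply: vanM => //.
by apply: regX; exact: van_reg.
Qed.

Lemma vanC c : van (C c) -> c = 0.
Proof.
by move=> h; apply/eqP; apply: contraPT h => c0; exact/unit_nvan/unitC.
Qed.

Lemma unitXz f (n : int) : unit_at P f -> unit_at P (f ^ n).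
Proof. by case: n => n uf; [exact: unitX | rewrite NegzE -exprnN; exact/unitV/unitX]. Qed.

Lemma van_expz t (n : int) : van t -> unit_at P (t ^ n) -> n = 0.
Proof.
case: n => [[|n]|n] vt ut //.
  by case: (unit_nvan ut); exact: vanXn.
by move: ut => /unitV; rewrite NegzE -exprnN invrK => /unit_nvan; case; exact: vanXn.
Qed.

Lemma reg_expz t (n : int) u : t != 0 -> van t -> unit_at P u ->
  (O (u * t ^ n) <-> 0 <= n).
Proof.
move=> t0 vt uu; split; last first.
  case: n => // n _; apply: regM; first exact: unit_reg.
  by apply: regX; exact: van_reg.
case: n => // n h; have : unit_at P (t ^+ n.+1); last first.
  by move/unit_nvan; case; exact: vanXn.
split; [by rewrite expf_neq0|by apply: regX; exact: van_reg|].
have -> : (t ^+ n.+1)^-1 = u^-1 * (u * t ^ Negz n).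
  by rewrite mulrA mulVf ?mul1r ?unit_neq0 // NegzE -exprnN.
by apply: regM => //; case: uu.
Qed.

End Valuation.

(** * Affine places *)

Definition inA (f : K) : Prop := exists p q, f = ev p q.

Lemma inAM f g : inA f -> inA g -> inA (f * g).
Proof. by move=> [p [q ->]] [p' [q' ->]]; rewrite evM; do 2!eexists. Qed.
Lemma inAD f g : inA f -> inA g -> inA (f + g).
Proof. by move=> [p [q ->]] [p' [q' ->]]; rewrite evD; do 2!eexists. Qed.
Lemma inAB f g : inA f -> inA g -> inA (f - g).
Proof. by move=> [p [q ->]] [p' [q' ->]]; rewrite evB; do 2!eexists. Qed.
Lemma inA_cp p : inA (cp p). Proof. by exists p, 0; rewrite ev_poly. Qed.
Lemma inA_C c : inA (C c). Proof. by exists c%:P, 0; rewrite ev_cst. Qed.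
Section AffinePoint.
Variables (a b : k).
Hypothesis curve_ab : b ^+ 2 = wpol.[a].

(** Elements of the coordinate ring that do not vanish, resp. vanish, at
    the point (a, b). *)
Definition nv (s : K) : Prop := exists p q, s = ev p q /\ p.[a] + q.[a] * b != 0.
Definition zv (s : K) : Prop := exists p q, s = ev p q /\ p.[a] + q.[a] * b = 0.

Lemma nv_zv s : nv s -> zv s -> False.
Proof.
by move=> [p [q [-> h]]] [p' [q' [/ev_inj [<- <-] e]]]; rewrite e eqxx in h.
Qed.

Lemma nv_or_zv f : inA f -> nv f \/ zv f.
Proof.
move=> [p [q ->]]; have [e|e] := eqVneq (p.[a] + q.[a] * b) 0.
  by right; exists p, q.
by left; exists p, q.
Qed.

Lemma nv_inA s : nv s -> inA s. Proof. by move=> [p [q [-> _]]]; exists p, q. Qed.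
Lemma zv_inA s : zv s -> inA s. Proof. by move=> [p [q [-> _]]]; exists p, q. Qed.

Lemma horner_evM p q p' q' w : b ^+ 2 = w.[a] ->
  (p * p' + q * q' * w).[a] + (p * q' + q * p').[a] * b
  = (p.[a] + q.[a] * b) * (p'.[a] + q'.[a] * b).
Proof. by move=> e; rewrite !(hornerD, hornerM) -e; ring. Qed.

Lemma nvM s s' : nv s -> nv s' -> nv (s * s').
Proof.
move=> [p [q [-> h]]] [p' [q' [-> h']]]; rewrite evM.
do 2!eexists; split; first by [].
by rewrite horner_evM ?mulf_neq0.
Qed.

Lemma zvM s f : inA f -> zv s -> zv (s * f).
Proof.
move=> [p' [q' ->]] [p [q [-> h]]]; rewrite evM.
do 2!eexists; split; first by [].
by rewrite horner_evM // h mul0r.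
Qed.

Lemma nv_neq0 s : nv s -> s != 0.
Proof.
move=> ns; apply/eqP => s0; apply: (nv_zv ns); exists 0, 0.
by rewrite ev_poly rmorph0 s0 horner0 mul0r addr0.
Qed.

Lemma nv1 : nv 1.
Proof. by exists 1, 0; rewrite ev_poly rmorph1 hornerC horner0 mul0r addr0 oner_neq0. Qed.

Lemma nvX s n : nv s -> nv (s ^+ n).
Proof. by move=> ns; elim: n => [|n IH]; [exact: nv1 | rewrite exprS; exact: nvM]. Qed.

Lemma nv_cp p : p.[a] != 0 -> nv (cp p).
Proof. by move=> h; exists p, 0; rewrite ev_poly horner0 mul0r addr0. Qed.

(** A local parameter at (a, b): by smoothness y is one when b = 0. *)
Definition tpar : K := if b == 0 then y else x - C a.

Lemma zv_tpar : zv tpar.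
Proof.
rewrite /tpar; have [b0|_] := eqVneq b 0.
  by exists 0, 1; rewrite b0 /ev rmorph0 rmorph1 add0r mul1r horner0 mulr0 addr0.
by exists ('X - a%:P), 0; rewrite ev_poly cpXa hornerXsubC subrr horner0 mul0r addr0.
Qed.

Lemma tpar_neq0 : tpar != 0.
Proof.
rewrite /tpar; have [_|_] := eqVneq b 0.
  exact: y_neq0.
by rewrite -cpXa cp_eq0 polyXsubC_eq0.
Qed.

Lemma wpol_factor : exists c, wpol - (b ^+ 2)%:P = c * ('X - a%:P).
Proof.
apply/factor_theorem; rewrite /root !hornerE /= ; apply/eqP.
have := curve_ab; rewrite /wpol !hornerE /= => ->; ring.
Qed.

Lemma y_factor : exists c, (y - C b) * (y + C b) = cp c * (x - C a).
Proof.
have [c ec] := wpol_factor; exists c.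
rewrite -cpXa -rmorphM -ec rmorphB /= cp_wpol cpC rmorphXn /=; ring.
Qed.

Lemma wpol_factor0 : b = 0 -> exists c, wpol = c * ('X - a%:P) /\ c.[a] != 0.
Proof.
move=> b0; have [c] := wpol_factor; rewrite b0 expr0n subr0 => e; exists c; split=> //.
have e1 : (wpol^`()).[a] = c.[a].
  by rewrite e derivM derivXsubC hornerD !hornerM hornerXsubC subrr mulr0 add0r hornerC mulr1.
have e2 : (wpol^`()).[a] = 3 * a ^+ 2 + weierA X.
  rewrite /wpol !derivD derivXn derivM !derivC derivX mul0r add0r mulr1 addr0.
  by rewrite hornerD hornerMn hornerXn hornerC mulr_natl.
apply/eqP => c0; have := weier_smooth X.
have eA : weierA X = - (3 * a ^+ 2).
  by apply/eqP; rewrite -addr_eq0 addrC -e2 e1 c0.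
have eB : weierB X = 2 * a ^+ 3.
  have := curve_ab; rewrite b0 expr0n /= /wpol !hornerE /= eA => /esym e3.
  by move/eqP: e3; rewrite addrC addr_eq0 => /eqP ->; ring.
by rewrite eA eB => /negP; apply; apply/eqP; ring.
Qed.

(** If b is not 0 then y + b does not vanish and (y - b)(y + b) is a multiple
    of x - a. If b = 0 then y^2 is x - a times a polynomial that does not
    vanish at a. *)
Lemma zv_step f : zv f -> exists s g, [/\ nv s, inA g & f * s = tpar * g].
Proof.
move=> [p [q [-> h]]]; rewrite /tpar; have [b0|b0] := eqVneq b 0.
  have [c [ec c0]] := wpol_factor0 b0.
  have /factor_theorem [p1 ep] : root p a by rewrite /root -h b0 mulr0 addr0.
  exists (cp c), (cp (q * c) + cp p1 * y); split; first exact: nv_cp.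
    by exists (q * c), p1.
  rewrite ep /ev !rmorphM /= mulrDl [in RHS]mulrDr.
  have := cp_wpol; rewrite ec rmorphM /= => e.
  rewrite [RHS](_ : _ = y * (cp q * cp c) + cp p1 * y ^+ 2); last by ring.
  by rewrite -e; ring.
have [c e] := y_factor.
have /factor_theorem [p1 ep] : root (p + q * b%:P) a.
  by rewrite /root !hornerE /= h.
exists (y + C b), (ev (p1 * b%:P + q * c) p1); split; last first.
- have -> : ev p q = cp (p + q * b%:P) + cp q * (y - C b).
    by rewrite /ev rmorphD rmorphM /= cpC; ring.
  rewrite ep rmorphM /= cpXa mulrDl -[cp q * _ * _]mulrA e.
  by rewrite /ev rmorphD !rmorphM /= cpC; ring.
- by do 2!eexists.
- exists b%:P, 1; split; first by rewrite /ev rmorph1 mul1r cpC addrC.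
  by rewrite !hornerC mul1r double_neq0.
Qed.

Lemma cp_param p : p != 0 ->
  exists n s s', [/\ nv s, nv s' & cp p * s = tpar ^+ n * s'].
Proof.
have Xa : exists n s s', [/\ nv s, nv s' & (x - C a) * s = tpar ^+ n * s'].
  rewrite /tpar; have [b0|b0] := eqVneq b 0; last first.
    by exists 1%N, 1, 1; rewrite expr1; split=> //; exact: nv1.
  have [c [ec c0]] := wpol_factor0 b0; exists 2%N, (cp c), 1; split.
  - exact: nv_cp.
  - exact: nv1.
  by rewrite -cp_wpol ec rmorphM /= cpXa mulr1 mulrC.
move=> p0; have [m [q]] := multiplicity_XsubC p a; rewrite p0 /= => qa ->.
have [n [s [s' [ns ns' e]]]] := Xa.
exists (n * m)%N, (s ^+ m), (cp q * s' ^+ m); split; [exact: nvX| |].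
  by apply: nvM; [exact: nv_cp | exact: nvX].
rewrite rmorphM rmorphXn /= cpXa -mulrA -exprMn e exprMn -exprM; ring.
Qed.

(** A factor of f is also a factor of the norm of f, which bounds the number
    of factors equal to the local parameter. *)
Lemma ev_param f : inA f -> f != 0 ->
  exists n s s', [/\ nv s, nv s' & f * s = tpar ^+ n * s'].
Proof.
move=> [p [q ->]] f0; rewrite ev_eq0 in f0.
have [n0 [s0 [s0' [ns0 ns0' e0]]]] := cp_param (norm_neq0 f0).
have claim n : (exists j s s', [/\ nv s, nv s' & ev p q * s = tpar ^+ j * s']) \/
    (exists s g, [/\ nv s, inA g & ev p q * s = tpar ^+ n * g]).
  elim: n => [|n [IH|[s [g [ns Ag e]]]]]; [right|by left|].
    by exists 1, (ev p q); rewrite mulr1 expr0 mul1r; split; [exact: nv1|exists p, q|].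
  have [ng|zg] := nv_or_zv Ag; first by left; exists n, s, g.
  have [s1 [g1 [ns1 Ag1 e1]]] := zv_step zg; right.
  exists (s * s1), g1; split=> //; first exact: nvM.
  by rewrite mulrA e -mulrA e1 exprSr mulrA.
case: (claim n0.+1) => // -[s [g [ns Ag e]]].
have : s0' * s = tpar * (g * ev p (- q) * s0).
  apply: (mulfI (expf_neq0 n0 tpar_neq0)).
  rewrite [LHS]mulrA -e0 -ev_conj [RHS]mulrA -exprSr.
  rewrite [LHS](_ : _ = (ev p q * s) * ev p (- q) * s0); last by ring.
  by rewrite e; ring.
move=> e1; case: (@nv_zv (s0' * s)); first exact: nvM.
rewrite e1; apply: zvM zv_tpar; apply: inAM; last exact: nv_inA.
by apply: inAM => //; do 2!eexists.
Qed.

Lemma frac_param f : f != 0 -> exists (n : int) s s',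
  [/\ nv s, nv s' & f = s' / s * tpar ^ n].
Proof.
have [p [q [r [r0 ->]]]] := ev_gen f; rewrite -cp_eq0 in r0 *.
move=> f0; have e0 : ev p q != 0 by apply: contraNneq f0 => ->; rewrite mul0r.
have [n [s [s' [ns ns' e]]]] : exists n s s', _ := ev_param (ex_intro _ p (ex_intro _ q erefl)) e0.
have [n1 [s1 [s1' [ns1 ns1' e1]]]] := ev_param (inA_cp r) r0.
exists (n%:Z - n1%:Z), (s * s1'), (s' * s1); split; try exact: nvM.
rewrite expfzDr ?tpar_neq0 // -exprnN -!exprnP.
have -> : ev p q = tpar ^+ n * s' / s by rewrite -e mulfK ?nv_neq0.
have -> : cp r = tpar ^+ n1 * s1' / s1 by rewrite -e1 mulfK ?nv_neq0.
have := tpar_neq0; have := nv_neq0 ns; have := nv_neq0 ns1; have := nv_neq0 ns1'.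
by move=> h1 h2 h3 h4; field; rewrite h1 h2 h3 expf_neq0 // h4.
Qed.

Definition over (P : point X) : Prop :=
  [/\ regular_at P x, van P (x - C a) & van P (y - C b)].

Section Over.
Variable P : point X.
Hypothesis oP : over P.

Lemma over_van p q : van P (ev p q - C (p.[a] + q.[a] * b)).
Proof.
case: oP => Ox vx vy.
have vp r : van P (cp r - C r.[a]).
  rewrite -cpC -rmorphB /=.
  have /factor_theorem [r' ->] : root (r - (r.[a])%:P) a by rewrite /root !hornerE subrr.
  by rewrite rmorphM /= cpXa; apply: vanM => //; exact: reg_cp.
have -> : ev p q - C (p.[a] + q.[a] * b) =
   (cp p - C p.[a]) + (cp q * (y - C b) + C b * (cp q - C q.[a])).
  by rewrite /ev rmorphD rmorphM; ring.
apply: vanD => //; apply: vanD; apply: vanM => //; [exact: reg_cp | exact: regC].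
Qed.

Lemma over_unit s : nv s -> unit_at P s.
Proof.
move=> [p [q [-> h]]]; rewrite -(subrK (C (p.[a] + q.[a] * b)) (ev p q)) addrC.
by apply: unitD; [exact: unitC | exact: over_van].
Qed.

Lemma over_zv s : zv s -> van P s.
Proof.
by move=> [p [q [-> h]]]; have := over_van p q; rewrite h rmorph0 subr0.
Qed.

End Over.

Definition local_ring : set K := [set f | exists F s, [/\ inA F, nv s & f = F / s]].

Lemma local_ring_place : is_place local_ring.
Proof.
split.
- by move=> c; exists (C c), 1; rewrite divr1; split; [exact: inA_C|exact: nv1|].
- move=> _ _ [F [s [AF ns ->]]] [G [s' [AG ns' ->]]]; split.
    exists (F * s' - G * s), (s * s'); split; last 1 first.
    + by field; rewrite !nv_neq0.
    + by apply: inAB; apply: inAM => //; exact: nv_inA.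
    + exact: nvM.
  exists (F * G), (s * s'); split; [exact: inAM|exact: nvM|].
  by field; rewrite !nv_neq0.
- move=> f; have [->|f0] := eqVneq f 0.
    left; exists (C 0), 1; rewrite divr1 rmorph0; split=> //; last exact: nv1.
    by rewrite -(rmorph0 C); exact: inA_C.
  have At : inA tpar by apply: zv_inA; exact: zv_tpar.
  have AtX n : inA (tpar ^+ n).
    by elim: n => [|n IH]; [rewrite expr0 -(rmorph1 C); exact: inA_C|rewrite exprS; exact: inAM].
  have [[n|n] [s [s' [ns ns' ->]]]] := frac_param f0.
    left; exists (s' * tpar ^+ n), s; split=> //; first by apply: inAM => //; exact: nv_inA.
    by rewrite mulrAC.
  right; exists (s * tpar ^+ n.+1), s'; split=> //; first by apply: inAM => //; exact: nv_inA.
  by rewrite NegzE -exprnN invfM invf_div invrK mulrAC.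
- exists tpar^-1 => -[F [s [AF ns e]]]; apply: (nv_zv ns).
  have -> : s = tpar * F; last by apply: zvM => //; exact: zv_tpar.
  apply: (mulIf (invr_neq0 (nv_neq0 ns))); rewrite divff ?nv_neq0 // -mulrA -e.
  by rewrite divff ?tpar_neq0.
Qed.

Lemma local_ring_placeb : `[< is_place local_ring >].
Proof. by apply/asboolP; exact: local_ring_place. Qed.

Definition affine_point : point X := exist _ local_ring local_ring_placeb.

Lemma affine_point_zv f : zv f -> van affine_point f.
Proof.
move=> zf; have [->|f0] := eqVneq f 0; first by left.
right=> -[F [s [AF ns e]]]; apply: (nv_zv ns).
have -> : s = f * F; last by apply: zvM.
apply: (mulIf (invr_neq0 (nv_neq0 ns))); rewrite divff ?nv_neq0 // -mulrA -e.
by rewrite divff.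
Qed.

Lemma affine_point_over : over affine_point.
Proof.
split.
- by exists x, 1; split; rewrite ?divr1 -?cpX; [exact: inA_cp|exact: nv1|].
- apply: affine_point_zv; exists ('X - a%:P), 0.
  by rewrite ev_poly cpXa hornerXsubC subrr horner0 mul0r addr0.
- apply: affine_point_zv; exists (- b%:P), 1.
  split; first by rewrite /ev rmorphN rmorph1 /= cpC mul1r addrC.
  by rewrite !hornerE addNr.
Qed.

End AffinePoint.

(** If no x - a vanished at P, all polynomials in x would be units and every
    function would be regular at P. *)
Lemma affine_coords P : regular_at P x -> exists a b, b ^+ 2 = wpol.[a] /\ over a b P.
Proof.
move=> Ox; have Oy := reg_y Ox.
have [a va] : exists a, van P (x - C a).
  apply: contrapT => /forallNP h.
  have ucp p : p != 0 -> unit_at P (cp p).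
    move=> p0; have [rs ->] := closed_field_poly_normal p.
    rewrite -mul_polyC rmorphM /= cpC; apply: unitM.
      by apply: unitC; rewrite lead_coef_eq0.
    elim: rs => [|z rs IH]; first by rewrite big_nil rmorph1; exact: unit1.
    rewrite big_cons rmorphM /=; apply: unitM => //; rewrite cpXa.
    by apply: van_unit (h z); apply: regB => //; exact: regC.
  have [_ _ _ [f]] := reg_place P; apply.
  have [p [q [r [r0 ->]]]] := ev_gen f.
  by apply: regM; [exact: reg_ev | case: (ucp _ r0)].
have [b eb] := curve_sqrt a.
have : van P ((y - C b) * (y + C b)).
  by have [c ->] := y_factor eb; apply: vanM => //; exact: reg_cp.
have Ob := regC P b; case/van_mul; [exact: regB|exact: regD| |] => vy.
  by exists a, b.
exists a, (- b); split; first by rewrite sqrrN.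
by split=> //; rewrite rmorphN opprK.
Qed.

(** * The place at infinity *)

(** An element (p + q y)/r whose poles at infinity are absorbed by r: y has
    a pole of order 3 there and x one of order 2. *)
Definition inf_ring : set K := [set f | exists p q r : {poly k}, [/\ r != 0,
  (size p <= size r)%N, (size q <= (size r).-2)%N & f = ev p q / cp r]].

Lemma ev_fracE p q r p' q' r' : r != 0 -> r' != 0 ->
  ev p q / cp r = ev p' q' / cp r' -> p * r' = p' * r /\ q * r' = q' * r.
Proof.
rewrite -!cp_eq0 => r0 r0' /eqP.
rewrite eqr_div // => /eqP; rewrite -!ev_poly !evM !mulr0 !mul0r !addr0 !add0r.
exact: ev_inj.
Qed.

Lemma size_X2 (q : {poly k}) n : (size q <= n.-2)%N = (size ('X^2 * q)%R <= n)%N.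
Proof.
have [->|q0] := eqVneq q 0; first by rewrite mulr0 size_poly0.
by rewrite mulrC size_mulXn //; have := size_gt0 q0; move=> ?; apply/idP/idP; lia.
Qed.

Lemma x_notin_inf : ~ inf_ring x.
Proof.
move=> -[p [q [r [r0 sp sq]]]].
have -> : x = ev 'X 0 / cp 1 by rewrite ev_poly cpX rmorph1 divr1.
move/ev_fracE => /(_ (oner_neq0 _) r0) [e _].
by move: sp; rewrite -[p]mulr1 -e mulrC size_mulX // ltnn.
Qed.

Lemma inf_ring_place : is_place inf_ring.
Proof.
split.
- move=> c; exists c%:P, 0, 1; rewrite rmorph1 divr1 ev_cst oner_neq0 size_poly0.
  by rewrite size_poly1 (leq_trans (size_polyC_leq1 c)).
- move=> _ _ [p [q [r [r0 sp + ->]]]] [p' [q' [r' [r0' sp' + ->]]]].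
  rewrite !size_X2 => sq sq'.
  have szM (u v : {poly k}) : (size u <= size r)%N -> (size v <= size r')%N ->
      (size (u * v)%R <= size (r * r')%R)%N.
    by move=> h1 h2; rewrite [X in (_ <= X)%N]size_mul //; apply: leq_trans (size_polyMleq _ _) _; rewrite -!subn1 leq_sub2r // leq_add.
  have szD (u v : {poly k}) n : (size u <= n)%N -> (size v <= n)%N -> (size (u + v)%R <= n)%N.
    by move=> h1 h2; apply: leq_trans (size_polyD _ _) _; rewrite geq_max h1.
  have rr0 : r * r' != 0 by rewrite mulf_neq0.
  have cr := r0; have cr' := r0'; rewrite -cp_eq0 in cr; rewrite -cp_eq0 in cr'.
  split.
    exists (p * r' - r * p'), (q * r' - r * q'), (r * r'); split=> //.
    + by apply: szD; rewrite ?size_polyN; apply: szM.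
    + rewrite size_X2 mulrBr; apply: szD; [rewrite mulrA|rewrite size_polyN mulrCA]; exact: szM.
    + rewrite rmorphM /= /ev !rmorphB !rmorphM /=; by field; rewrite cr cr'.
  exists (p * p' + q * q' * wpol), (p * q' + q * p'), (r * r'); split=> //.
  + apply: szD; first exact: szM.
    have [->|n0] := eqVneq (q * q') 0; first by rewrite mul0r size_poly0.
    have := szM _ _ sq sq'; rewrite mulrACA -exprD mulrC size_mulXn //.
    by rewrite (size_mul n0 wpol_neq0) size_wpol addn4; apply: leq_trans; exact: leqnSn.
  + by rewrite size_X2 mulrDr; apply: szD; [rewrite mulrCA|rewrite mulrA]; exact: szM.
  + by rewrite -evM rmorphM /=; field; rewrite cr cr'.
- move=> f; have [p [q [r [r0 ->]]]] := ev_gen f.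
  have [h|h] := boolP ((size p <= size r) && (size q <= (size r).-2))%N.
    by left; exists p, q, r; case/andP: h.
  right; have r1 := size_gt0 r0.
  have pq0 : ~~ ((p == 0) && (q == 0)).
    by apply: contra h => /andP[/eqP -> /eqP ->]; rewrite size_poly0.
  move: h; rewrite size_X2 negb_and -!ltnNge => h.
  have cr := r0; rewrite -cp_eq0 in cr; have n0 := norm_neq0 pq0.
  have sN : size (p ^+ 2 - q ^+ 2 * wpol) = maxn (2 * size p).-1 (2 * size ('X^2 * q)%R).-2.
    have [q0|q0] := eqVneq q 0; last by rewrite norm_size // mulrC size_mulXn //; lia.
    rewrite q0 mulr0 size_poly0 muln0 maxn0 expr0n mul0r subr0 expr2.
    by rewrite size_mul ?mul2n ?addnn //; move: pq0; rewrite q0 eqxx andbT.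
  exists (r * p), (- (r * q)), (p ^+ 2 - q ^+ 2 * wpol); split=> //; last first.
  + have e0 := pq0; rewrite -ev_eq0 in e0; have cn := n0; rewrite -cp_eq0 -ev_conj in cn.
    rewrite -ev_conj invf_div; have /= e0' : ev p (- q) != 0.
      by move: cn; rewrite mulf_eq0 negb_or => /andP[].
    have -> : ev (r * p) (- (r * q)) = cp r * ev p (- q).
      by rewrite /ev !rmorphN !rmorphM /=; ring.
    by field; rewrite e0 e0'.
  + rewrite size_X2 mulrN size_polyN mulrCA sN; apply: leq_trans (size_polyMleq _ _) _.
    by move: h r1; move: (size p) (size r) (size ('X^2 * q)%R) => u v w /orP[]; lia.
  + by rewrite sN; apply: leq_trans (size_polyMleq _ _) _; case/orP: h; lia.
- by exists x; exact: x_notin_inf.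
Qed.

Lemma inf_ring_placeb : `[< is_place inf_ring >].
Proof. by apply/asboolP; exact: inf_ring_place. Qed.

Definition pinf : point X := exist _ inf_ring inf_ring_placeb.

Lemma x_inf : ~ regular_at pinf x. Proof. exact: x_notin_inf. Qed.

Lemma x_neq0 : x != 0. Proof. by rewrite -cpX cp_eq0 polyX_eq0. Qed.

(** A local parameter at infinity, where x and y have poles of order 2 and 3. *)
Definition tinf : K := x / y.

Lemma tinf_neq0 : tinf != 0.
Proof. by rewrite mulf_neq0 ?invr_eq0 ?x_neq0 ?y_neq0. Qed.

Section Pole.
Variable P : point X.
Hypothesis Px : ~ regular_at P x.

Lemma van_xV : van P x^-1. Proof. by right; rewrite invrK. Qed.

Lemma cp_lead p : p != 0 -> exists u, unit_at P u /\ cp p = u * x ^+ (size p).-1.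
Proof.
have x0 := x_neq0.
elim/poly_ind: p => [|p c IH]; first by rewrite eqxx.
have [->|p0] := eqVneq p 0.
  rewrite mul0r add0r => c0; exists (C c); rewrite cpC size_polyC.
  rewrite polyC_eq0 in c0; rewrite c0 expr0 mulr1; split=> //; exact: unitC.
move=> _; have [u [uu e]] := IH p0.
have s0 := size_gt0 p0.
exists (u + C c * (x^-1) ^+ (size p)); split.
  apply: unitD => //; apply: vanM; first exact: regC.
  by apply: vanXn => //; exact: van_xV.
rewrite rmorphD rmorphM /= cpX cpC e size_MXaddC (negPf p0) /= mulrDl.
rewrite exprVn -(mulrA (C c)) mulVf ?expf_neq0 // mulr1 -mulrA -exprSr.
by rewrite prednK.
Qed.

Lemma x_tinf : exists u, unit_at P u /\ x = u * tinf ^- 2.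
Proof.
have x0 := x_neq0; have y0 := y_neq0.
have [u [uu e]] := cp_lead wpol_neq0.
exists u^-1; split; first exact: unitV.
move: e; rewrite cp_wpol size_wpol /tinf expr_div_n /= => ->.
by rewrite invf_div mulrA mulKf ?(unit_neq0 uu) // exprS mulfK ?expf_neq0.
Qed.

Lemma van_tinf : van P tinf.
Proof.
have [u [uu e]] := x_tinf; apply: contrapT => nv.
have t0 := tinf_neq0.
apply: Px; rewrite e; apply: regM; first exact: unit_reg.
rewrite -exprVn; apply: regX.
have [Ot|//] := reg_or P tinf.
by have [] := van_unit Ot nv.
Qed.

Lemma cp_tinf p : p != 0 ->
  exists u, unit_at P u /\ cp p = u * tinf ^ (- (2 * (size p).-1)%:Z).
Proof.
move=> p0; have [u [uu ->]] := cp_lead p0; have [v [vu e]] := x_tinf.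
exists (u * v ^+ (size p).-1); split; first by apply: unitM => //; exact: unitX.
by rewrite {1}e exprMn mulrA exprVn -exprM exprnN.
Qed.

Lemma y_tinf : exists u, unit_at P u /\ y = u * tinf ^ (- 3).
Proof.
have [v [vu e]] := x_tinf; exists v; split=> //.
have -> : y = x / tinf by rewrite /tinf invf_div mulrCA divff ?x_neq0 ?mulr1.
by rewrite {1}e -mulrA -[X in _ / X]expr1 -invfM -exprD exprnN.
Qed.

(** The two summands have poles of different parity, so none cancels. *)
Lemma ev_tinf p q : ~~ ((p == 0) && (q == 0)) -> exists u, unit_at P u /\
  ev p q = u * tinf ^ (- (maxn (2 * (size p).-1) (if q == 0 then 0 else 2 * (size q).-1 + 3))%:Z).
Proof.
have [->|q0] := eqVneq q 0.
  by rewrite andbT maxn0 ev_poly; exact: cp_tinf.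
move=> _; have [u [uu eu]] := cp_tinf q0; have [v [vu ey]] := y_tinf.
have t0 := tinf_neq0.
have e2 : cp q * y = u * v * tinf ^ (- (2 * (size q).-1 + 3)%:Z).
  rewrite eu ey mulrACA -expfzDr //; congr (_ * _ ^ _); lia.
have [->|p0] := eqVneq p 0.
  rewrite size_poly0 muln0 max0n /ev rmorph0 add0r.
  by exists (u * v); split=> //; exact: unitM.
have [w [wu ew]] := cp_tinf p0.
have comb a b m n : unit_at P a -> unit_at P b -> (m < n)%N ->
    exists u0, unit_at P u0 /\ a * tinf ^ (- n%:Z) + b * tinf ^ (- m%:Z) = u0 * tinf ^ (- n%:Z).
  move=> ua ub mn; exists (a + b * tinf ^+ (n - m)); split.
    apply: unitD => //; apply: vanM; first exact: unit_reg.
    by apply: vanXn; [exact: van_tinf | rewrite subn_gt0].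
  rewrite mulrDl -mulrA [tinf ^+ _]exprnP -expfzDr //; congr (_ + _ * _ ^ _).
  by rewrite -subzn ?(ltnW mn) //; ring.
rewrite /ev ew e2; case: (ltngtP (2 * (size p).-1) (2 * (size q).-1 + 3)) => h; last by lia.
  by rewrite addrC; apply: comb => //; exact: unitM.
by apply: comb => //; exact: unitM.
Qed.

End Pole.

Lemma inf_param f : f != 0 -> exists n : int, forall P, ~ regular_at P x ->
  exists u, unit_at P u /\ f = u * tinf ^ n.
Proof.
have [p [q [r [r0 ->]]]] := ev_gen f => f0.
have pq0 : ~~ ((p == 0) && (q == 0)).
  by rewrite -ev_eq0; apply: contra f0 => /eqP ->; rewrite mul0r.
eexists => P Px; have [u [uu ->]] := ev_tinf Px pq0; have [v [vu ->]] := cp_tinf Px r0.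
exists (u / v); split; first by apply: unitM => //; exact: unitV.
have t0 := tinf_neq0.
by rewrite invfM mulrACA invr_expz -expfzDr.
Qed.

(** * Discreteness, residue fields and orders *)

(** The sign of n decides whether f is regular. *)
Lemma place_uniq t (Z : set (point X)) : t != 0 -> (forall P, Z P -> van P t) ->
  (forall f, f != 0 -> exists n : int, forall P, Z P -> exists u, unit_at P u /\ f = u * t ^ n) ->
  forall P Q, Z P -> Z Q -> P = Q.
Proof.
move=> t0 vt h P Q ZP ZQ; apply: val_inj; apply/predeqP => f.
change (regular_at P f <-> regular_at Q f).
have [->|f0] := eqVneq f 0; first by split=> _; exact: reg0.
have [n hn] := h f f0.
have [u [uu e]] := hn _ ZP; have [v [vu e']] := hn _ ZQ.
by rewrite {1}e (reg_expz _ t0 (vt _ ZP) uu) e' (reg_expz _ t0 (vt _ ZQ) vu).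
Qed.

Lemma affine_param a b f : b ^+ 2 = wpol.[a] -> f != 0 ->
  exists n : int, forall P, over a b P -> exists u, unit_at P u /\ f = u * tpar a b ^ n.
Proof.
move=> cab f0; have [n [s [s' [ns ns' ->]]]] := frac_param cab f0; exists n => P oP.
exists (s' / s); split=> //; apply: unitM; first exact: (over_unit oP).
apply: unitV; exact: (over_unit oP).
Qed.

Lemma over_uniq a b P Q : b ^+ 2 = wpol.[a] -> over a b P -> over a b Q -> P = Q.
Proof.
move=> cab; apply: (@place_uniq (tpar a b)); first exact: tpar_neq0.
- by move=> R oR; apply: (over_zv oR); exact: zv_tpar.
- by move=> f f0; apply: affine_param.
Qed.

Lemma inf_uniq P : ~ regular_at P x -> P = pinf.
Proof.
move=> h; apply: (@place_uniq tinf (fun P => ~ regular_at P x)) => //.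
- exact: tinf_neq0.
- by move=> Q; exact: van_tinf.
- exact: inf_param.
- exact: x_inf.
Qed.

Lemma affine_reg P : P <> pinf -> regular_at P x.
Proof. by move=> h; apply: contrapT => /inf_uniq. Qed.

Lemma affineP P : P <> pinf -> exists a b, b ^+ 2 = wpol.[a] /\ over a b P.
Proof. by move=> /affine_reg /affine_coords. Qed.

Lemma place_dvr P : exists t, [/\ t != 0, van P t &
  forall f, f != 0 -> exists (n : int) u, unit_at P u /\ f = u * t ^ n].
Proof.
have [e|h] := pselect (P = pinf).
  exists tinf; split; [exact: tinf_neq0|by rewrite e; apply: van_tinf; exact: x_inf|].
  move=> f /inf_param [n hn]; have [u hu] := hn pinf x_inf.
  by exists n, u; rewrite e.
have [a [b [cab oP]]] := affineP h; exists (tpar a b); split.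
- exact: tpar_neq0.
- by apply: (over_zv oP); exact: zv_tpar.
- move=> f /(affine_param cab) [n hn]; have [u hu] := hn _ oP; by exists n, u.
Qed.

Definition tau (P : point X) : K := projT1 (cid (place_dvr P)).

Lemma tau_neq0 P : tau P != 0.
Proof. by rewrite /tau; case: cid => t []. Qed.

Lemma van_tau P : van P (tau P).
Proof. by rewrite /tau; case: cid => t []. Qed.

Lemma tauP P f : f != 0 -> exists (n : int) u, unit_at P u /\ f = u * tau P ^ n.
Proof. by rewrite /tau; case: cid => t [t0 vt h]; exact: h. Qed.

Lemma uniformizer_tau P : uniformizer P (tau P).
Proof.
split; [exact: tau_neq0|by apply: van_reg; exact: van_tau| |].
  by move=> /unit_nvan; apply; exact: van_tau.
move=> f Of nuf; have [->|f0] := eqVneq f 0.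
  by exists 0; [exact: reg0 | rewrite mulr0].
have [n [u [uu e]]] := tauP P f0.
have : 0 <= n by apply/(reg_expz n (tau_neq0 P) (van_tau P) uu); rewrite -e.
case: n e => // -[|n] e _; first by case: nuf; rewrite e expr0z mulr1.
exists (u * tau P ^+ n); last by rewrite e -exprnP exprS mulrCA.
by apply: regM; [exact: unit_reg | apply: regX; apply: van_reg; exact: van_tau].
Qed.

Section Order.
Variable P : point X.
Local Notation t := (tau P).
Local Notation O := (regular_at P).

Lemma ord_tauE (n : int) u : unit_at P u -> ord P (u * t ^ n) = n.
Proof.
move=> uu; have t0 := tau_neq0 P; rewrite /ord; case: xgetP => [m _ [s [v [us uv e]]]|]; last first.
  by move/(_ n) => []; exists t, u; split=> //; exact: uniformizer_tau.
have [g [ug eg]] : exists g, unit_at P g /\ s = g * t.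
  have [s0 Os nus hs] := us.
  have [_ _ nut ht] := uniformizer_tau P.
  have [g Og eg] := ht _ Os nus.
  have [h Oh eh] := hs _ (van_reg (van_tau P)) nut.
  exists g; split; last by rewrite mulrC.
  split=> //; first by apply: contraNneq s0; rewrite eg => ->; rewrite mulr0.
  have e1 : g * h = 1.
    by apply: (mulfI t0); rewrite mulr1 mulrA -eg -eh.
  have g0 : g != 0 by apply: contraPneq e1 => ->; rewrite mul0r => /esym/eqP; rewrite oner_eq0.
  by rewrite -[g^-1]mulr1 -e1 mulKf.
have h : unit_at P (t ^ (n - m)).
  have -> : t ^ (n - m) = u^-1 * (v * g ^ m).
    apply: (mulfI (unit_neq0 uu)); rewrite mulrA divff ?(unit_neq0 uu) // mul1r.
    apply: (mulIf (expfz_neq0 m t0)); rewrite -mulrA -expfzDr // subrK e eg.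
    by rewrite exprzMl ?unitfE ?(unit_neq0 ug) // mulrA.
  apply: unitM; first exact: unitV.
  by apply: unitM => //; exact: unitXz.
by have /eqP := van_expz (van_tau P) h; rewrite subr_eq0 => /eqP.
Qed.

Lemma ord_unit u : unit_at P u -> ord P u = 0.
Proof. by move=> uu; have := ord_tauE 0 uu; rewrite expr0z mulr1. Qed.

Lemma ord_tau : ord P t = 1.
Proof. by have := ord_tauE 1 (unit1 P); rewrite expr1z mul1r. Qed.

Lemma ordM f g : f != 0 -> g != 0 -> ord P (f * g) = ord P f + ord P g.
Proof.
move=> /(tauP P) [n [u [uu ->]]] /(tauP P) [m [v [uv ->]]].
rewrite mulrACA -expfzDr ?tau_neq0 // !ord_tauE //; exact: unitM.
Qed.

Lemma ordV f : f != 0 -> ord P f^-1 = - ord P f.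
Proof.
move=> /(tauP P) [n [u [uu ->]]]; rewrite invfM invr_expz !ord_tauE //; exact: unitV.
Qed.

Lemma ord_ge0 f : f != 0 -> (0 <= ord P f) <-> O f.
Proof.
move=> /(tauP P) [n [u [uu ->]]]; rewrite ord_tauE //.
by rewrite (reg_expz n (tau_neq0 P) (van_tau P) uu).
Qed.

Lemma ord_decomp f : f != 0 -> exists u, unit_at P u /\ f = u * t ^ ord P f.
Proof.
by move=> /(tauP P) [n [u [uu ->]]]; exists u; rewrite ord_tauE.
Qed.

Lemma ordXz f (n : int) : f != 0 -> ord P (f ^ n) = n * ord P f.
Proof.
move=> /ord_decomp [u [uu e]]; rewrite {1}e exprzMl ?unitfE ?(unit_neq0 uu) //.
  rewrite exprz_exp ord_tauE; [exact: mulrC | exact: unitXz].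
by apply: expfz_neq0; exact: tau_neq0.
Qed.

Lemma ord_param s : s != 0 -> van P s ->
  (forall f, f != 0 -> exists (n : int) u, unit_at P u /\ f = u * s ^ n) -> ord P s = 1.
Proof.
move=> s0 vs hs; have [n [u [uu e]]] := hs _ (tau_neq0 P).
have e1 : 1 = n * ord P s.
  rewrite -ord_tau e ordM ?(unit_neq0 uu) ?expfz_neq0 // ord_unit // add0r.
  by rewrite ordXz.
have : 0 <= ord P s by apply/ord_ge0 => //; exact: van_reg.
move: e1 => /(congr1 absz); rewrite abszM => /esym/eqP; rewrite muln_eq1.
by move=> /andP[_ /eqP o1] /gez0_abs <-; rewrite o1.
Qed.

Lemma van_factor f : van P f -> exists2 g, O g & f = t * g.
Proof.
move=> vf; have [_ _ _ h] := uniformizer_tau P; apply: h; first exact: van_reg.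
by move/unit_nvan; apply.
Qed.

Lemma reg_tauX n : O (t ^+ n).
Proof. by apply: regX; apply: van_reg; exact: van_tau. Qed.

Lemma reg_pole f : exists n0, forall n, (n0 <= n)%N -> O (t ^+ n * f).
Proof.
have [->|f0] := eqVneq f 0; first by exists 0%N => n _; rewrite mulr0; exact: reg0.
have [[m|m] [u [uu ->]]] := tauP P f0.
  exists 0%N => n _; apply: regM; first exact: reg_tauX.
  by apply: regM; [exact: unit_reg|exact: reg_tauX].
exists m.+1 => n h; rewrite mulrCA; apply: regM; first exact: unit_reg.
rewrite NegzE -exprnN -(subnK h) exprD -mulrA divff ?mulr1 ?expf_neq0 ?tau_neq0 //.
exact: reg_tauX.
Qed.

(** The residue is the value at (a, b), or the quotient of the leading
    coefficients at infinity. *)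
Lemma residue f : O f -> exists c, van P (f - C c).
Proof.
have [->|/affineP [a [b [cab oP]]]] := pselect (P = pinf).
  move=> [p [q [r [r0 sp sq ->]]]].
  pose c := p`_(size r).-1 / lead_coef r; exists c; pose p' := p - c *: r.
  have l0 : lead_coef r != 0 by rewrite lead_coef_eq0.
  have r1 := size_gt0 r0.
  have cr := r0; rewrite -cp_eq0 in cr.
  have -> : ev p q / cp r - C c = ev p' q / cp r.
    have e : cp p' = cp p - C c * cp r.
      have ecr : cp (c *: r) = C c * cp r by rewrite -mul_polyC [LHS]rmorphM /= cpC.
      by rewrite /p' rmorphB /= ecr.
    by rewrite /ev e; field.
  have sp' : (size p' < size r)%N.
    rewrite -[X in (_ < X)%N](prednK r1) ltnS; apply/leq_sizeP => j.
    rewrite leq_eqVlt => /orP[/eqP <-|h].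
      by rewrite coefB coefZ /c -/(lead_coef r) mulfVK ?subrr.
    have hj : (size r <= j)%N by rewrite -(prednK r1).
    by rewrite coefB coefZ !nth_default ?mulr0 ?subr0 ?(leq_trans sp hj).
  have [e0|e0] := eqVneq (ev p' q) 0; first by left; rewrite e0 mul0r.
  right=> -[p2 [q2 [r2 [r20 sp2 sq2]]]]; rewrite invf_div => /eqP.
  have cr2 := r20; rewrite -cp_eq0 in cr2.
  have ecp : cp r * cp r2 = ev (r * r2) 0 by rewrite ev_poly [RHS]rmorphM.
  rewrite eqr_div // ecp evM => /eqP/ev_inj [e _].
  have r21 := size_gt0 r20.
  have : (size (r * r2)%R < (size r + size r2).-1)%N.
    rewrite e; apply: leq_ltn_trans (size_polyD _ _) _; rewrite gtn_max.
    apply/andP; split.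
      rewrite -[X in (_ < X)%N]prednK; last by lia.
      by rewrite ltnS; apply: leq_trans (size_polyMleq _ _) _; lia.
    have [->|q20] := eqVneq q2 0; first by rewrite mul0r mul0r size_poly0; lia.
    have [->|q0] := eqVneq q 0; first by rewrite mulr0 mul0r size_poly0; lia.
    have h1 := size_gt0 q20.
    have h2 := size_gt0 q0.
    rewrite -[X in (_ < X)%N]prednK; last by lia.
    rewrite ltnS; apply: leq_trans (size_polyMleq _ _) _; rewrite size_wpol.
    have := size_polyMleq q2 q; move: h1 h2 sq sq2 r1 r21.
    move: (size q) (size q2) (size r) (size r2) (size (q2 * q)); lia.
  by rewrite size_mul // ltnn.
move=> /[dup] Of; have [->|f0] := eqVneq f 0.
  by exists 0; rewrite rmorph0 subrr; left.
have [n [s [s' [ns ns' e]]]] := frac_param cab f0.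
have vt : van P (tpar a b) by apply: (over_zv oP); exact: zv_tpar.
have us := over_unit oP ns; have us' := over_unit oP ns'.
rewrite e reg_expz //; [|exact: tpar_neq0|by apply: unitM => //; exact: unitV].
have At : inA (tpar a b) by apply: zv_inA; exact: zv_tpar.
case: n e => // n e _.
have [p [q eF]] : inA (s' * tpar a b ^+ n).
  apply: inAM; first exact: nv_inA ns'.
  elim: n {e} => [|n IH]; last by rewrite exprS; exact: inAM.
  by rewrite expr0 -(rmorph1 C); exact: inA_C.
have [p' [q' [es h]]] := ns.
exists ((p.[a] + q.[a] * b) / (p'.[a] + q'.[a] * b)).
set c := p.[a] + _ in eF *; set c' := p'.[a] + _ in h *.
have hc : C c' != 0 by rewrite fmorph_eq0.
have -> : s' / s * tpar a b ^ n - C (c / c') =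
    ((C c') * (s' * tpar a b ^+ n - C c) - C c * (s - C c')) * (s^-1 * (C c')^-1).
  by rewrite fmorph_div -exprnP; field; rewrite (nv_neq0 ns) hc.
rewrite mulrC; apply: vanM.
  by apply: regM; [case: us | rewrite -fmorphV; exact: regC].
apply: vanB; apply: vanM; try exact: regC.
  by rewrite eF; exact: over_van.
by rewrite es; exact: over_van.
Qed.

End Order.

Lemma nonvan_finite (p : {poly k}) : p != 0 ->
  finite_set [set P | P <> pinf /\ van P (cp p)].
Proof.
move=> p0; have [rs ep] := closed_field_poly_normal p.
have [sq sqP] := choice curve_sqrt.
have sqP' a : (- sq a) ^+ 2 = wpol.[a] by rewrite sqrrN.
pose pts := flatten [seq [:: affine_point (sqP a); affine_point (sqP' a)] | a <- rs].
apply: (@sub_finite_set _ _ [set` pts]); last exact: finite_seq.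
move=> P /= [/affineP [a [b [cab oP]]] vp].
have [Ox vx vy] := oP.
have ra : a \in rs.
  have : p.[a] = 0.
    have := over_van oP p 0; rewrite ev_poly horner0 mul0r addr0 => h.
    apply: (@vanC P); rewrite -(subKr (cp p) (C _)); exact: vanB.
  have -> : a \in rs = root (\prod_(z <- rs) ('X - z%:P)) a by rewrite root_prod_XsubC.
  rewrite ep hornerZ => /eqP; rewrite mulf_eq0 lead_coef_eq0 -size_poly_eq0.
  by rewrite size_poly_eq0 (negPf p0).
have : (b == sq a) || (b == - sq a).
  by rewrite -eqf_sqr cab sqP eqxx.
move=> hbs; apply/flattenP.
exists [:: affine_point (sqP a); affine_point (sqP' a)]; first by apply/mapP; exists a.
rewrite !inE; case/orP: hbs => /eqP eb; apply/orP; [left|right]; apply/eqP.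
  by apply: (over_uniq cab oP); rewrite eb; exact: affine_point_over.
by apply: (over_uniq cab oP); rewrite eb; exact: affine_point_over.
Qed.

Lemma nonunit_finite f : f != 0 -> finite_set [set P | ~ unit_at P f].
Proof.
have [p [q [r [r0 ->]]]] := ev_gen f => f0.
have pq0 : ~~ ((p == 0) && (q == 0)).
  by rewrite -ev_eq0; apply: contra f0 => /eqP ->; rewrite mul0r.
have n0 := norm_neq0 pq0.
apply: (@sub_finite_set _ _ ([set pinf] `|`
   ([set P | P <> pinf /\ van P (cp r)] `|`
    [set P | P <> pinf /\ van P (cp (p ^+ 2 - q ^+ 2 * wpol))]))).
  move=> P /= nu; have [|h] := pselect (P = pinf); first by left.
  right; apply: contrapT => /not_orP [/not_andP h1 /not_andP h2].
  have Ox := affine_reg h.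
  have ur : unit_at P (cp r) by apply: van_unit; [exact: reg_cp | case: h1].
  have uN : unit_at P (cp (p ^+ 2 - q ^+ 2 * wpol)).
    by apply: van_unit; [exact: reg_cp | case: h2].
  apply: nu; apply: unitM; last exact: unitV.
  apply: van_unit; first exact: reg_ev.
  move=> v; apply: (unit_nvan uN); rewrite -ev_conj mulrC.
  by apply: vanM => //; exact: reg_ev.
rewrite finite_setU; split; first exact: finite_set1.
by rewrite finite_setU; split; exact: nonvan_finite.
Qed.

(** * Functions with prescribed poles *)

(** A root a of the denominator can be cancelled: the numerator p + q y
    vanishes at (a, b) and (a, - b), so that p and q vanish at a. If b = 0
    this uses that a is a simple root of the cubic. *)
Lemma affine_regular_inA f : (forall P, P <> pinf -> regular_at P f) -> inA f.
Proof.
move=> Of; have [p [q [r [r0 ef]]]] := ev_gen f.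
have [n] := ubnP (size r); elim: n => // n IH in p q r r0 ef * => hr.
have cr := r0; rewrite -cp_eq0 in cr.
have [/size_poly1P [c c0 er]|sr] := boolP (size r == 1%N).
  exists (c^-1 *: p), (c^-1 *: q).
  rewrite ef er cpC /ev -!mul_polyC !rmorphM /= !cpC fmorphV.
  have : C c != 0 by rewrite fmorph_eq0.
  by move=> ?; field.
have /closed_rootP [a /factor_theorem [r1 er]] := sr.
have [b cab] := curve_sqrt a.
have zer b' : b' ^+ 2 = wpol.[a] -> p.[a] + q.[a] * b' = 0.
  move=> cab'; have oP := affine_point_over cab'.
  have nP : affine_point cab' <> pinf.
    by move=> e; case: oP => + _ _; rewrite e; exact: x_inf.
  apply: (@vanC (affine_point cab')).
  rewrite -(subKr (ev p q) (C _)); apply: vanB (over_van oP p q).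
  have -> : ev p q = f * cp r by rewrite ef divfK.
  apply: vanM; first exact: Of.
  rewrite er rmorphM /= cpXa; apply: vanM; first by apply: reg_cp; case: oP.
  by case: oP.
have x0 : x - C a != 0 by rewrite -cpXa cp_eq0 polyXsubC_eq0.
have r10 : r1 != 0 by apply: contraNneq r0 => e; rewrite er e mul0r.
have cr1 := r10; rewrite -cp_eq0 in cr1.
have [pa qa] : p.[a] = 0 /\ q.[a] = 0.
  have h1 := zer b cab.
  have [b0|b0] := eqVneq b 0; last first.
    have h2 : p.[a] + q.[a] * - b = 0 by apply: zer; rewrite sqrrN.
    have : q.[a] * (b + b) = 0.
      by rewrite -[RHS](subrr 0) -{1}h1 -h2; ring.
    move/eqP; rewrite mulf_eq0 (negPf (double_neq0 b0)) orbF => /eqP qa.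
    by split=> //; move: h1; rewrite qa mul0r addr0.
  have pa : p.[a] = 0 by rewrite -h1 b0 mulr0 addr0.
  split=> //; have /factor_theorem [p1 ep] : root p a by apply/eqP.
  have [c [ec c0]] := wpol_factor0 cab b0.
  have oP := affine_point_over cab; set P := affine_point cab in oP.
  have nP : P <> pinf by move=> e; case: oP => + _ _; rewrite e; exact: x_inf.
  have y0 := y_neq0.
  have vy : van P y by case: oP => _ _; rewrite b0 rmorph0 subr0.
  have Ox : regular_at P x by case: oP.
  have e : cp (q * c) = y * (f * cp r1 - cp p1).
    have ew : cp c * (x - C a) = y ^+ 2 by rewrite -cp_wpol ec rmorphM /= cpXa.
    have -> : f * cp r1 - cp p1 = cp q * y / (x - C a).
      by rewrite ef er ep /ev !rmorphM /= cpXa; field; rewrite x0 cr1.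
    have -> : cp (q * c) = cp q * cp c by rewrite [LHS]rmorphM.
    have -> : cp q * cp c = cp q * (cp c * (x - C a)) / (x - C a) by field.
    by rewrite ew; field.
  have : van P (cp (q * c)).
    rewrite e mulrC; apply: vanM => //; apply: regB; last exact: reg_cp.
    by apply: regM; [exact: Of | exact: reg_cp].
  move=> v; have : (q * c).[a] = 0.
    have := over_van oP (q * c) 0; rewrite ev_poly horner0 mul0r addr0 => h.
    apply: (@vanC P); rewrite -(subKr (cp (q * c)) (C _)); exact: vanB.
  by rewrite hornerM => /eqP; rewrite mulf_eq0 (negPf c0) orbF => /eqP.
have /factor_theorem [p1 ep] : root p a by apply/eqP.
have /factor_theorem [q1 eq] : root q a by apply/eqP.
apply: (IH p1 q1 r1) => //.
  by rewrite ef er ep eq /ev !rmorphM /= cpXa; field; rewrite x0 cr1.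
by move: hr; rewrite er size_mul ?polyXsubC_eq0 // size_XsubC addn2.
Qed.

Lemma inA_regular f P : inA f -> P <> pinf -> regular_at P f.
Proof. by move=> [p [q ->]] /affine_reg; exact: reg_ev. Qed.

(** Division by r leaves a pole of order at most one at infinity, and y / x
    has a simple pole there. *)
Lemma infA_split f : exists c o g, [/\ regular_at pinf o, inA g & f = o + g + C c * (y / x)].
Proof.
have [p [q [r [r0 ->]]]] := ev_gen f.
have cr := r0; rewrite -cp_eq0 in cr; have x0 := x_neq0.
have r1 := size_gt0 r0.
have l0 : lead_coef r != 0 by rewrite lead_coef_eq0.
pose c := (q %% r)`_(size r).-2 / lead_coef r.
exists c, (ev ((p %% r) * 'X) ((q %% r) * 'X - c *: r) / cp (r * 'X)), (ev (p %/ r) (q %/ r)).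
have ecr : cp (c *: r) = C c * cp r by rewrite -mul_polyC [LHS]rmorphM /= cpC.
split; last first.
- clearbody c; rewrite {1}(divp_eq p r) {1}(divp_eq q r) /ev rmorphB !rmorphD !rmorphM /= ecr cpX.
  by field; rewrite x0 cr.
- by do 2!eexists.
- exists ((p %% r) * 'X), ((q %% r) * 'X - c *: r), (r * 'X).
  rewrite mulf_neq0 ?polyX_eq0 // size_mulX //.
  have hm (u : {poly k}) : (size (u %% r)%R < size r)%N by rewrite ltn_modp.
  split=> //.
    by apply: leq_trans (size_polyMleq _ _) _; rewrite size_polyX addn2 /=; apply: leqW; exact: hm.
  rewrite -[X in (_ <= X)%N]/((size r).-1); apply/leq_sizeP => j.
  rewrite leq_eqVlt coefB coefMX coefZ => /orP[/eqP <-|h].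
    rewrite -/(lead_coef r) /c mulfVK //; case: ifP => [/eqP e|_]; last by rewrite subrr.
    have -> : q %% r = 0.
      apply/eqP; rewrite -size_poly_eq0 -leqn0 -ltnS; apply: leq_trans (hm q) _.
      by rewrite -(prednK r1) e.
    by rewrite coef0 subrr.
  have hj : (size r <= j)%N by rewrite -(prednK r1).
  rewrite [r`_j]nth_default // mulr0 subr0; case: ifP => // h0.
  rewrite nth_default // -ltnS; apply: leq_trans (hm q) _.
  by apply: leq_trans hj _; exact: leqSpred.
Qed.

(** The poles at infinity of elements of A have order 0, 2, 3 and so on, but
    not 1. *)
Lemma yx_inf c o g : regular_at pinf o -> inA g -> C c * (y / x) = o + g -> c = 0.
Proof.
move=> [p1 [q1 [r [r0 sp sq ->]]]] [p [q ->]].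
have cr := r0; rewrite -cp_eq0 in cr; have x0 := x_neq0.
have -> : C c * (y / x) = ev 0 c%:P / cp 'X by rewrite /ev rmorph0 add0r cpC cpX mulrA.
have -> : ev p1 q1 / cp r + ev p q = ev (p1 + p * r) (q1 + q * r) / cp r.
  by rewrite /ev !rmorphD !rmorphM /=; field.
move/ev_fracE => /(_ _ r0) [|_ e]; first by rewrite polyX_eq0.
have r1 := size_gt0 r0.
have e2 : (c%:P - q * 'X) * r = q1 * 'X by rewrite mulrBl e; ring.
have [h|h] := eqVneq (c%:P - q * 'X) 0.
  move/polyP : h => /(_ 0%N).
  by rewrite coefB coefC eqxx coefMX eqxx subr0 coef0.
have : (size ((c%:P - q * 'X) * r)%R < size r)%N.
  rewrite e2; have [->|q10] := eqVneq q1 0; first by rewrite mul0r size_poly0.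
  have := size_gt0 q10.
  rewrite size_mulX //; move: sq; move: (size q1) (size r) => a b; lia.
rewrite size_mul //; have := size_gt0 h.
by move: (size (c%:P - q * 'X)) (size r) => a b; lia.
Qed.

(** The class of a function in H^1(O) = K/(O_inf + A), which has dimension 1. *)
Definition lam f : k := projT1 (cid (infA_split f)).

Lemma lamP f : exists o g, [/\ regular_at pinf o, inA g & f = o + g + C (lam f) * (y / x)].
Proof. by rewrite /lam; case: cid => c. Qed.

Lemma lamE f c o g : regular_at pinf o -> inA g -> f = o + g + C c * (y / x) -> lam f = c.
Proof.
move=> Oo Ag e; have [ o2 [g2 [Oo2 Ag2 e2]]] := lamP f.
apply/eqP; rewrite -subr_eq0; apply/eqP.
apply: (@yx_inf _ (o - o2) (g - g2)); [exact: regB|exact: inAB|].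
have : o2 + g2 + C (lam f) * (y / x) = o + g + C c * (y / x) by rewrite -e -e2.
move/eqP; rewrite -subr_eq0 => /eqP h; rewrite rmorphB.
apply/eqP; rewrite -subr_eq0; apply/eqP; rewrite -[RHS]h; ring.
Qed.

Lemma lamD f g c : lam (C c * f + g) = c * lam f + lam g.
Proof.
have [ o [h [Oo Ah e]]] := lamP f; have [ o2 [h2 [Oo2 Ah2 e2]]] := lamP g.
apply: (@lamE _ _ (C c * o + o2) (C c * h + h2)).
- by apply: regD => //; apply: regM => //; exact: regC.
- by apply: inAD => //; apply: inAM => //; exact: inA_C.
- by rewrite {1}e {1}e2 rmorphD rmorphM /=; ring.
Qed.

Lemma lam_inf o : regular_at pinf o -> lam o = 0.
Proof.
move=> Oo; apply: (@lamE _ _ o (C 0)) => //; first exact: inA_C.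
by rewrite rmorph0 mul0r !addr0.
Qed.

Lemma lam_A g : inA g -> lam g = 0.
Proof.
move=> Ag; apply: (@lamE _ _ 0 g) => //; first exact: reg0.
by rewrite rmorph0 mul0r addr0 add0r.
Qed.

Lemma lam_yx : lam (y / x) = 1.
Proof.
apply: (@lamE _ _ 0 (C 0)); [exact: reg0|exact: inA_C|].
by rewrite rmorph0 rmorph1 mul1r !add0r.
Qed.

(** The function is (y + b) / (x - a): its only other pole is a simple one at
    infinity. *)
Lemma simple_pole P : P <> pinf -> exists u0,
  [/\ exists u, unit_at P u /\ u0 = u / tau P,
      forall Q, Q <> pinf -> Q <> P -> regular_at Q u0
    & regular_at pinf (u0 - y / x)].
Proof.
move=> nP; have [a [b [cab oP]]] := affineP nP; have [Ox vx vy] := oP.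
have x0 : x - C a != 0 by rewrite -cpXa cp_eq0 polyXsubC_eq0.
have xx0 := x_neq0; have y0 := y_neq0.
have [c e] := y_factor cab.
have ht f (f0 : f != 0) : exists (n : int) u, unit_at P u /\ f = u * tpar a b ^ n.
  by have [n hn] := affine_param cab f0; have [u hu] := hn _ oP; exists n, u.
have [u1 [uu1 e1]] : exists u, unit_at P u /\ (tpar a b)^-1 = u / tau P.
  have [u [uu e1]] := ord_decomp P (tpar_neq0 a b).
  rewrite (ord_param (tpar_neq0 a b) (over_zv oP (zv_tpar a b)) ht) expr1z in e1.
  by exists u^-1; split; [exact: unitV | rewrite {1}e1 invfM].
exists ((y + C b) / (x - C a)); split.
- move: e1; rewrite /tpar; have [b0|b0] := eqVneq b 0 => e1.
    have [c' [ec' c'0]] := wpol_factor0 cab b0.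
    have ew : cp c' * (x - C a) = y ^+ 2 by rewrite -cp_wpol ec' rmorphM /= cpXa.
    exists (cp c' * u1); split.
      by apply: unitM => //; apply: (over_unit oP); exact: nv_cp.
    rewrite -mulrA -e1 b0 rmorph0 addr0; apply: (mulIf x0); rewrite divfK //.
    by rewrite mulrAC ew expr2 mulfK.
  exists ((y + C b) * u1); split; last by rewrite -mulrA -e1.
  apply: unitM => //; apply: (over_unit oP); exists b%:P, 1; split.
    by rewrite /ev rmorph1 mul1r cpC addrC.
  by rewrite !hornerC mul1r double_neq0.
- move=> Q nQ QP; have [a' [b' [cab' oQ]]] := affineP nQ; have [Ox' vx' vy'] := oQ.
  have [eaa|naa] := eqVneq a' a; last first.
    apply: regM; first by apply: regD; [exact: reg_y | exact: regC].
    have : unit_at Q (x - C a); last by case.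
    have -> : x - C a = C (a' - a) + (x - C a') by rewrite rmorphB; ring.
    by apply: unitD => //; apply: unitC; rewrite subr_eq0.
  have : (b' == b) || (b' == - b) by rewrite -eqf_sqr cab' eaa cab eqxx.
  case/orP => /eqP ebb.
    by case: QP; subst a' b'; exact: over_uniq cab oQ oP.
  have [b0|b0] := eqVneq b 0.
    by case: QP; subst a' b'; move: oQ; rewrite b0 oppr0 -b0 => oQ; exact: over_uniq cab oQ oP.
  have uy : unit_at Q (y - C b).
    have -> : y - C b = - C (b + b) + (y - C b') by rewrite ebb rmorphD rmorphN; ring.
    by apply: unitD => //; apply: unitN; apply: unitC; exact: double_neq0.
  have -> : (y + C b) / (x - C a) = cp c / (y - C b).
    by apply/eqP; rewrite eqr_div ?(unit_neq0 uy) // mulrC e.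
  by apply: regM; [exact: reg_cp | case: uy].
- exists (b *: 'X), a%:P, ('X * ('X - a%:P)).
  have X0 : 'X * ('X - a%:P) != 0 :> {poly k} by rewrite mulf_neq0 ?polyX_eq0 ?polyXsubC_eq0.
  have sX : size ('X * ('X - a%:P) : {poly k}) = 3%N.
    by rewrite size_mul ?polyX_eq0 ?polyXsubC_eq0 // size_polyX size_XsubC.
  rewrite sX; split=> //.
  + by apply: leq_trans (size_scale_leq _ _) _; rewrite size_polyX.
  + exact: size_polyC_leq1.
  + rewrite -mul_polyC /ev !rmorphM /= !cpC cpX cpXa; by field; rewrite x0 xx0.
Qed.

(** Subtracting a multiple of the function in simple_pole would write a
    nonzero multiple of y / x as a sum that yx_inf excludes. *)
Lemma no_simple_pole P f u : unit_at P u -> regular_at P (f - u / tau P) ->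
  (forall Q, Q <> P -> regular_at Q f) -> False.
Proof.
move=> uu rP rQ.
have nreg v : unit_at P v -> ~ regular_at P (v / tau P).
  move=> uv /(regM (unit_reg (unitV uv))); rewrite mulKf ?(unit_neq0 uv) // => h.
  by case: (van_tau P) => [/eqP|//]; rewrite (negPf (tau_neq0 P)).
have [eP|nP] := pselect (P = pinf).
  have Af : inA f by apply: affine_regular_inA => Q; rewrite -eP; exact: rQ.
  have x0 := x_neq0; have y0 := y_neq0; have t0 := tau_neq0 P.
  have vt : van P tinf by rewrite eP; apply: van_tinf; exact: x_inf.
  have ot : ord P tinf = 1.
    apply: ord_param => //; first exact: tinf_neq0.
    move=> g /inf_param [n hn]; have [v hv] := hn pinf x_inf.
    by exists n, v; rewrite eP.
  have [v [uv ev0]] := ord_decomp P tinf_neq0.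
  rewrite ot expr1z in ev0.
  have eyx : y / x = v^-1 / tau P by rewrite -invfM -ev0 /tinf invf_div.
  have [c hc] := residue (unit_reg (unitM uu uv)).
  have ru : regular_at P (u / tau P - C c * (y / x)).
    have [g Og eg] := van_factor hc.
    have -> : u / tau P - C c * (y / x) = g * v^-1; last first.
      by apply: regM => //; case: uv.
    rewrite eyx; apply: (mulfI t0); rewrite [RHS]mulrA -eg; field.
    by rewrite t0 (unit_neq0 uv).
  have c0 : c = 0.
    apply: (@yx_inf _ (- (f - u / tau P) - (u / tau P - C c * (y / x))) f) => //.
      by rewrite -eP; apply: regB => //; exact: regN.
    by ring.
  by apply: (unit_nvan (unitM uu uv)); move: hc; rewrite c0 rmorph0 subr0.
have [w [[v [uv ew]] wQ winf]] := simple_pole nP.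
have t0 := tau_neq0 P.
have uuv := unitM uu (unitV uv).
have [c hc] := residue (unit_reg uuv).
have Af : inA (f - C c * w).
  apply: affine_regular_inA => Q nQ; have [->|QP] := pselect (Q = P); last first.
    by apply: regB; [exact: rQ | apply: regM; [exact: regC | exact: wQ]].
  have [g Og eg] := van_factor hc.
  have -> : f - C c * w = (f - u / tau P) + v * g.
    rewrite ew; have -> : g = (u / v - C c) / tau P by rewrite eg mulrC mulKf.
    by field; rewrite t0 (unit_neq0 uv).
  by apply: regD => //; apply: regM => //; exact: unit_reg.
have c0 : c = 0.
  apply: (@yx_inf _ (f - C c * (w - y / x)) (- (f - C c * w))); last by ring.
  - by apply: regB; [apply: rQ => e; exact: nP | apply: regM => //; exact: regC].
  - by rewrite -sub0r; apply: inAB => //; rewrite -(rmorph0 C); exact: inA_C.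
by apply: (unit_nvan uuv); move: hc; rewrite c0 rmorph0 subr0.
Qed.

(** A pole is removed one order at a time, by powers of the function with a
    simple pole at P. *)
Lemma principal_part P f : P <> pinf -> exists g, regular_at P (g - f) /\
  forall Q, Q <> pinf -> Q <> P -> regular_at Q g.
Proof.
move=> nP; have [w [[v [uv ew]] wQ _]] := simple_pole nP; have t0 := tau_neq0 P.
have [n] : exists n, regular_at P (tau P ^+ n * f).
  by have [n0 h] := reg_pole P f; exists n0; exact: h.
elim: n f => [|n IH] f.
  rewrite expr0 mul1r => Of; exists 0; rewrite sub0r; split; first exact: regN.
  by move=> *; exact: reg0.
move=> h; have [c hc] := residue (regM (unit_reg (unitX n.+1 (unitV uv))) h).
have [g0 Og0 eg0] := van_factor hc.
have /IH [g [rg hg]] : regular_at P (tau P ^+ n * (f - C c * w ^+ n.+1)).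
  have -> : tau P ^+ n * (f - C c * w ^+ n.+1) = v ^+ n.+1 * g0; last first.
    by apply: regM => //; apply: regX; exact: unit_reg.
  have -> : g0 = (v^-1 ^+ n.+1 * (tau P ^+ n.+1 * f) - C c) / tau P by rewrite eg0 mulrC mulKf.
  by rewrite ew expr_div_n exprVn !exprS; field; rewrite t0 (unit_neq0 uv) !expf_neq0 // (unit_neq0 uv).
exists (g + C c * w ^+ n.+1); split; first by rewrite (_ : _ - f = g - (f - C c * w ^+ n.+1)) //; ring.
by move=> Q nQ QP; apply: regD; [exact: hg | apply: regM; [exact: regC | apply: regX; exact: wQ]].
Qed.

(** With D in A vanishing to order N at P and on S, the function is D g, where
    g has the principal part of f / D at P. *)
Lemma strong_approx P f (S : set (point X)) (N : nat) : P <> pinf -> finite_set S ->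
  exists g, (exists2 h, regular_at P h & g - f = tau P ^+ N * h) /\
  forall Q, Q <> pinf -> Q <> P -> regular_at Q g /\
    (S Q -> exists2 h, regular_at Q h & g = tau Q ^+ N * h).
Proof.
move=> nP fS; have [D [D0 AD hD]] : exists D, [/\ D != 0, inA D &
    forall Q, Q <> pinf -> (S Q \/ Q = P) -> exists2 h, regular_at Q h & D = tau Q ^+ N * h].
  have /finite_seqP [l el] : finite_set (S `|` [set P]).
    by rewrite finite_setU; split=> //; exact: finite_set1.
  have [D [D0 AD hD]] : exists D, [/\ D != 0, inA D & forall Q, Q <> pinf -> Q \in l ->
      exists2 h, regular_at Q h & D = tau Q ^+ N * h].
    elim: l {el} => [|Q l [D [D0 AD hD]]].
      exists 1; split=> //; first exact: oner_neq0.
      by rewrite -(rmorph1 C); exact: inA_C.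
    have [D' [D'0 AD' hD']] : exists D, [/\ D != 0, inA D & Q <> pinf ->
        exists2 h, regular_at Q h & D = tau Q ^+ N * h].
      have [eQ|/[dup] nQ /affineP [a [b [cab [Ox vx vy]]]]] := pselect (Q = pinf).
        exists 1; split=> //; first exact: oner_neq0.
        by rewrite -(rmorph1 C); exact: inA_C.
      have [h Oh eh] := van_factor vx.
      exists ((x - C a) ^+ N); split.
      - by rewrite expf_neq0 // -cpXa cp_eq0 polyXsubC_eq0.
      - by rewrite -cpXa -rmorphXn; exact: inA_cp.
      - by move=> _; exists (h ^+ N); [exact: regX | rewrite eh exprMn].
    exists (D * D'); split; [by rewrite mulf_neq0|exact: inAM|].
    move=> Q' nQ'; rewrite inE; have [eQ _|nQQ /= lQ'] := eqVneq Q' Q.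
      have [h Oh eh] := hD' (fun e => nQ' (etrans eQ e)).
      subst Q'; exists (D * h); last by rewrite {1}eh mulrCA.
      by apply: regM => //; exact: inA_regular.
    have [h Oh eh] := hD _ nQ' lQ'; exists (h * D'); last by rewrite {1}eh mulrA.
    by apply: regM => //; exact: inA_regular.
  exists D; split=> // Q nQ hQ; apply: hD => //.
  have : (S `|` [set P]) Q by case: hQ => [|->]; [left|right].
  by rewrite el.
have [g [rg hg]] := principal_part (f / D) nP.
exists (D * g); split.
  have [h Oh eh] := hD P nP (or_intror erefl).
  exists (h * (g - f / D)); first exact: regM.
  by rewrite mulrA -eh mulrBr mulrCA divff ?mulr1.
move=> Q nQ QP; split; first by apply: regM; [exact: inA_regular | exact: hg].
move=> SQ; have [h Oh eh] := hD Q nQ (or_introl SQ).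
by exists (h * g); [apply: regM => //; exact: hg | rewrite mulrA -eh].
Qed.

End Places.

(** * Integral matrices *)

Section Integral.
Implicit Types (P Q : point X).

Definition imx P m n (A : 'M[K]_(m, n)) : Prop := forall i j, regular_at P (A i j).

Section AtPoint.
Variable P : point X.
Local Notation imx := (imx P).

Lemma imxM m n p (A : 'M[K]_(m, n)) (B : 'M[K]_(n, p)) : imx A -> imx B -> imx (A *m B).
Proof.
by move=> hA hB i j; rewrite mxE; apply: reg_sum => l _; apply: regM.
Qed.
Lemma imxD m n (A B : 'M[K]_(m, n)) : imx A -> imx B -> imx (A + B).
Proof. by move=> hA hB i j; rewrite mxE; apply: regD. Qed.
Lemma imxN m n (A : 'M[K]_(m, n)) : imx A -> imx (- A).
Proof. by move=> hA i j; rewrite mxE; apply: regN. Qed.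
Lemma imxB m n (A B : 'M[K]_(m, n)) : imx A -> imx B -> imx (A - B).
Proof. by move=> hA hB; apply: imxD => //; exact: imxN. Qed.
Lemma imxZ m n c (A : 'M[K]_(m, n)) : regular_at P c -> imx A -> imx (c *: A).
Proof. by move=> hc hA i j; rewrite mxE; apply: regM. Qed.
Lemma imx0 m n : imx (0 : 'M[K]_(m, n)).
Proof. by move=> i j; rewrite mxE; exact: reg0. Qed.
Lemma imx1 n : imx (1%:M : 'M[K]_n).
Proof. by move=> i j; rewrite mxE; case: eqP => _; [exact: reg1|exact: reg0]. Qed.
Lemma imx_sum m n (I : finType) (F : I -> 'M[K]_(m, n)) : (forall i, imx (F i)) -> imx (\sum_i F i).
Proof. by move=> h i j; rewrite summxE; apply: reg_sum => l _; exact: h. Qed.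
Lemma imxT m n (A : 'M[K]_(m, n)) : imx A -> imx A^T.
Proof. by move=> hA i j; rewrite mxE. Qed.
Lemma imx_trace n (A : 'M[K]_n) : imx A -> regular_at P (\tr A).
Proof. by move=> hA; apply: reg_sum. Qed.
Lemma imx_det n (A : 'M[K]_n) : imx A -> regular_at P (\det A).
Proof.
move=> hA; apply: reg_sum => s _; apply: regM; last exact: reg_prod.
by rewrite -signr_odd; case: odd; [apply: regN|]; exact: reg1.
Qed.
Lemma imx_adj n (A : 'M[K]_n) : imx A -> imx (\adj A).
Proof.
move=> hA i j; rewrite mxE /cofactor; apply: regM.
  by rewrite -signr_odd; case: odd; [apply: regN|]; exact: reg1.
by apply: imx_det => a b; rewrite !mxE.
Qed.
Lemma imx_block m1 m2 n1 n2 (A : 'M[K]_(m1, n1)) (B : 'M[K]_(m1, n2)) (C : 'M[K]_(m2, n1)) (D : 'M[K]_(m2, n2)) :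
  imx A -> imx B -> imx C -> imx D -> imx (block_mx A B C D).
Proof.
move=> hA hB hC hD i j; rewrite mxE; case: fintype.split => a; rewrite mxE; case: fintype.split => b //.
Qed.
Lemma imx_row m n (A : 'M[K]_(m, n)) : imx A <-> forall i, imx (row i A).
Proof.
split=> h i; first by move=> a b; rewrite mxE.
by move=> j; have := h i 0 j; rewrite mxE.
Qed.
Lemma imx_row_mx m n1 n2 (A : 'M[K]_(m, n1)) (B : 'M[K]_(m, n2)) : imx (row_mx A B) <-> imx A /\ imx B.
Proof.
split=> [h|[hA hB] i j]; last by rewrite mxE; case: fintype.split.
split=> i j; first by have := h i (lshift _ j); rewrite row_mxEl.
by have := h i (rshift _ j); rewrite row_mxEr.
Qed.
Lemma imx_pole m n (A : 'M[K]_(m, n)) : exists n0, forall l, (n0 <= l)%N -> imx (tau P ^+ l *: A).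
Proof.
have [N NP] := choice (reg_pole P).
exists (\max_i \max_j N (A i j))%N => l hl i j; rewrite mxE; apply: NP.
apply: leq_trans hl; apply: leq_trans (leq_bigmax i).
exact: (@leq_bigmax _ (fun j => N (A i j)) j).
Qed.

Definition gl n (U : 'M[K]_n) : Prop := [/\ U \in unitmx, imx U & imx (invmx U)].

Lemma gl_det n (U : 'M[K]_n) : gl U -> unit_at P (\det U).
Proof.
case=> uU iU iU'; have d0 : \det U != 0 by rewrite -unitfE -unitmxE.
split=> //; first exact: imx_det.
by rewrite -det_inv; exact: imx_det.
Qed.

Lemma det_gl n (U : 'M[K]_n) : imx U -> unit_at P (\det U) -> gl U.
Proof.
move=> iU [d0 Od Od']; have uU : U \in unitmx by rewrite unitmxE unitfE.
by split=> //; rewrite /invmx uU; apply: imxZ => //; exact: imx_adj.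
Qed.

Lemma invmx_mul n (A B : 'M[K]_n) : A \in unitmx -> B \in unitmx ->
  invmx (A *m B) = invmx B *m invmx A.
Proof.
move=> uA uB; have uAB : A *m B \in unitmx by rewrite unitmx_mul uA.
apply: (can_inj (mulKmx uAB)); rewrite mulmxV // mulmxA -[A *m B *m _]mulmxA.
by rewrite mulmxV // mulmx1 mulmxV.
Qed.

Lemma glM n (U V : 'M[K]_n) : gl U -> gl V -> gl (U *m V).
Proof.
move=> [uU iU iU'] [uV iV iV']; split; first by rewrite unitmx_mul uU.
  exact: imxM.
by rewrite invmx_mul //; exact: imxM.
Qed.

Lemma glV n (U : 'M[K]_n) : gl U -> gl (invmx U).
Proof. by move=> [uU iU iU']; split; rewrite ?unitmx_inv ?invmxK. Qed.

Lemma gl1 n : gl (1%:M : 'M[K]_n).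
Proof. by apply: det_gl; [exact: imx1 | rewrite det1; exact: unit1]. Qed.

Lemma gl_tperm n (i j : 'I_n) : gl (tperm_mx i j : 'M[K]_n).
Proof.
apply: det_gl; first by move=> a b; rewrite !mxE; case: eqP => _; [exact: reg1|exact: reg0].
rewrite det_perm; apply: unitX; apply: unitN; exact: unit1.
Qed.

Lemma gl_block n (U : 'M[K]_n) : gl U -> gl (block_mx (1%:M : 'M[K]_1) 0 0 U).
Proof.
move=> gU; apply: det_gl; last by rewrite det_ublock det1 mul1r; exact: gl_det.
by apply: imx_block; [exact: imx1|exact: imx0|exact: imx0|case: gU].
Qed.

Lemma det_unitr n (U A : 'M[K]_n) : A \in unitmx -> gl U -> ord P (\det (U *m A)) = ord P (\det A).
Proof.
move=> uA gU; have d0 : \det A != 0 by rewrite -unitfE -unitmxE.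
have ud := gl_det gU.
by rewrite det_mulmx ordM ?(unit_neq0 ud) // ord_unit // add0r.
Qed.

(** Smith normal form over the valuation ring of P: an entry of least order
    serves as pivot. *)
Lemma smith n (g : 'M[K]_n) : g \in unitmx -> exists U V (d : 'I_n -> int),
  [/\ gl U, gl V, g = U *m diag_mx (\row_i tau P ^ d i) *m V
    & ord P (\det g) = \sum_i d i].
Proof.
elim: n g => [|n IH] g ug.
  exists 1%:M, 1%:M, (fun=> 0); split; [exact: gl1|exact: gl1|by apply/matrixP => -[]|].
  by rewrite det_mx00 big_ord0 ord_unit //; exact: unit1.
have dg : \det g != 0 by rewrite -unitfE -unitmxE.
have [[i0 j0] nz0] : exists ij : 'I_n.+1 * 'I_n.+1, g ij.1 ij.2 != 0.
  apply: contrapT => /forallNP h; move/eqP: dg; apply.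
  have -> : g = 0.
    by apply/matrixP => i j; rewrite mxE; have /negP := h (i, j); rewrite negbK => /eqP.
  by rewrite det0.
pose S := \sum_(ab : 'I_n.+1 * 'I_n.+1) `|ord P (g ab.1 ab.2)|.
pose N (ij : 'I_n.+1 * 'I_n.+1) := absz (ord P (g ij.1 ij.2) + S).
case: (arg_minnP (P := fun ij : 'I_n.+1 * 'I_n.+1 => g ij.1 ij.2 != 0) N nz0) => -[i j] /= nz hmin.
have ordmin a b : g a b != 0 -> ord P (g i j) <= ord P (g a b).
  move=> nzab; have := hmin (a, b) nzab; rewrite /N /=.
  have hS a' b' : 0 <= ord P (g a' b') + S.
    have : `|ord P (g a' b')| <= S.
      by rewrite /S (bigD1 (a', b')) //= lerDl; apply: sumr_ge0.
    by rewrite ler_norml => /andP[hl _]; rewrite -(addNr S) lerD2r.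
  have := hS a b; have := hS i j; clearbody S; lia.
clear N hmin S.
pose h : 'M[K]_(1 + n) := tperm_mx i 0 *m g *m tperm_mx j 0.
have hE a b : h a b = g (tperm i 0 a) (tperm j 0 b).
  by rewrite /h -xcolE -xrowE !mxE.
have e2 : g = tperm_mx i 0 *m h *m tperm_mx j 0.
  rewrite /h !mulmxA -[tperm_mx i 0 *m _]/(perm_mx _ *m perm_mx _) -perm_mxM tperm2 perm_mx1 mul1mx.
  by rewrite -mulmxA -[tperm_mx j 0 *m _]/(perm_mx _ *m perm_mx _) -perm_mxM tperm2 perm_mx1 mulmx1.
have uh : h \in unitmx by rewrite /h !unitmx_mul ug !unitmx_perm.
clearbody h; pose p := h 0 0.
have pE : p = g i j by rewrite /p hE !tpermR.
have p0 : p != 0 by rewrite pE.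
have intp a b : regular_at P (h a b / p).
  have [->|nzab] := eqVneq (h a b) 0; first by rewrite mul0r; exact: reg0.
  apply/ord_ge0; first by rewrite mulf_neq0 ?invr_eq0.
  rewrite ordM ?invr_eq0 // ordV // subr_ge0 pE hE; apply: ordmin.
  by rewrite -hE.
pose c := dlsubmx h; pose b := ursubmx h; pose s := drsubmx h - p^-1 *: (c *m b).
have hul : ulsubmx h = p%:M.
  apply/matrixP => x y; rewrite !ord1 !mxE eqxx mulr1n /p.
  by congr (h _ _); apply: val_inj.
pose L : 'M[K]_(1 + n) := block_mx 1%:M 0 (p^-1 *: c) 1%:M.
pose R : 'M[K]_(1 + n) := block_mx 1%:M (p^-1 *: b) 0 1%:M.
have hLR : h = L *m block_mx p%:M 0 0 s *m R.
  rewrite -[h]submxK hul /L /R !mulmx_block !mul1mx !mul0mx !mulmx0 !addr0 !mulmx1 !add0r.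
  rewrite -!scalemxAl -!scalemxAr mul_mx_scalar mul_scalar_mx !scalerA mulVf // !scale1r.
  by rewrite addr0 -scalemxAl scalerA divfK // /s -/b -/c [X in _ = block_mx _ _ _ X]addrC subrK.
have gL : gl L.
  apply: det_gl; last by rewrite det_lblock !det1 mulr1; exact: unit1.
  apply: imx_block; [exact: imx1|exact: imx0| |exact: imx1].
  by move=> x y; rewrite !mxE mulrC.
have gR : gl R.
  apply: det_gl; last by rewrite det_ublock !det1 mulr1; exact: unit1.
  apply: imx_block; [exact: imx1| |exact: imx0|exact: imx1].
  by move=> x y; rewrite !mxE mulrC.
have us : s \in unitmx.
  move: uh; rewrite hLR !unitmx_mul => /andP[/andP[_ +] _].
  by rewrite !unitmxE det_ublock unitrM => /andP[].
have [U [V [d [gU gV es od]]]] := IH s us.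
have [m [u [uu pm]]] := tauP P p0.
pose D : 'M[K]_(1 + n) := diag_mx (\row_l tau P ^ (if unlift 0 l is Some l' then d l' else m)).
have hD : D = block_mx (tau P ^ m)%:M 0 0 (diag_mx (\row_l tau P ^ d l)).
  apply/matrixP => x y; rewrite !mxE; case: fintype.splitP => x' ex; rewrite !mxE; case: fintype.splitP => y' ey; rewrite !mxE.
  - have -> : x = 0 by apply: ord_inj; rewrite ex ord1.
    have -> : y = 0 by apply: ord_inj; rewrite ey ord1.
    by rewrite !ord1 unlift_none !eqxx.
  - by have -> : (x == y) = false by apply/eqP => e; move: ey; rewrite -e ex ord1.
  - by have -> : (x == y) = false by apply/eqP => e; move: ex; rewrite e ey ord1.
  - have -> : x = lift 0 x' by apply: ord_inj; rewrite ex.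
    have -> : y = lift 0 y' by apply: ord_inj; rewrite ey.
    by rewrite liftK (inj_eq lift_inj).
have gu : gl (block_mx (u%:M : 'M[K]_1) 0 0 (1%:M : 'M[K]_n)).
  apply: det_gl; last by rewrite det_ublock det1 det_scalar1 mulr1.
  apply: imx_block; [|exact: imx0|exact: imx0|exact: imx1].
  by move=> x y; rewrite mxE; case: eqP => _; rewrite ?mulr1n ?mulr0n; [exact: unit_reg|exact: reg0].
exists (tperm_mx i 0 *m L *m block_mx u%:M 0 0 1%:M *m block_mx 1%:M 0 0 U),
       (block_mx 1%:M 0 0 V *m R *m tperm_mx j 0),
       (fun l => if unlift 0 l is Some l' then d l' else m).
have e1 : block_mx p%:M 0 0 s = block_mx u%:M 0 0 1%:M *m block_mx 1%:M 0 0 U *m D *m block_mx 1%:M 0 0 V.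
  rewrite hD !mulmx_block !mul1mx !mul0mx !mulmx0 !addr0 !mulmx1 !add0r -es.
  by rewrite !mul0mx -scalar_mxM -pm.
split.
- by do 3?[apply: glM]; [exact: gl_tperm|exact: gL|exact: gu|exact: gl_block].
- by do 2?[apply: glM]; [exact: gl_block|exact: gR|exact: gl_tperm].
- by rewrite {1}e2 hLR e1 -/D !mulmxA.
- rewrite big_ord_recl unlift_none (eq_bigr d); last by move=> l _; rewrite liftK.
  rewrite -od e2; have dh : \det h != 0 by rewrite -unitfE -unitmxE.
  rewrite -mulmxA det_unitr ?det_mulmx; last exact: gl_tperm.
    rewrite mulrC -det_mulmx det_unitr //; last exact: gl_tperm.
    have edh : \det h = p * \det s.
      by rewrite hLR !det_mulmx det_lblock !det_ublock !det1 !mulr1 !mul1r det_scalar1.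
    have op : ord P p = m by rewrite pm ord_tauE.
    by rewrite edh ordM // -?unitfE -?unitmxE // op.
  by rewrite unitmx_mul uh unitmx_perm.
Qed.

End AtPoint.

(** * Vector bundles as lattices *)

(** A vector bundle with generic fibre K^rk; its stalk at P is spanned over
    the local ring by the rows of gen P. *)
Record bun := Bun {
  rk : nat;
  gen : point X -> 'M[K]_rk;
  gen_unit : forall P, gen P \in unitmx;
  gen_fin : finite_set [set P | gen P <> 1%:M] }.

Implicit Types (E F G : bun).

Unset Implicit Arguments.
Definition lat E P : set 'rV[K]_(rk E) := [set v | imx P (v *m invmx (gen E P))].

Definition homL E F P : set 'M[K]_(rk E, rk F) :=
  [set A | imx P (gen E P *m A *m invmx (gen F P))].

Definition H0 E F : set 'M[K]_(rk E, rk F) := [set A | forall P, homL E F P A].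

Definition Laff E F : set 'M[K]_(rk E, rk F) :=
  [set A | forall P, P <> pinf -> homL E F P A].

Definition Linf E F : set 'M[K]_(rk E, rk F) := homL E F pinf.

Set Implicit Arguments.

Lemma homL_comp E F G P A B : homL E F P A -> homL F G P B -> homL E G P (A *m B).
Proof.
rewrite /homL /= => hA hB; have := imxM hA hB.
by rewrite !mulmxA mulmxKV ?gen_unit.
Qed.

Lemma homL_lat E F P A v : homL E F P A -> lat E P v -> lat F P (v *m A).
Proof.
rewrite /homL /lat /= => hA hv; have := imxM hv hA.
by rewrite !mulmxA mulmxKV ?gen_unit.
Qed.

Lemma lat_gen E P i : lat E P (row i (gen E P)).
Proof. by rewrite /lat /= -row_mul mulmxV ?gen_unit // => a b; rewrite mxE; exact: imx1. Qed.

Lemma lat_homL E F P A : (forall v, lat E P v -> lat F P (v *m A)) -> homL E F P A.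
Proof.
move=> h; apply/imx_row => i; rewrite row_mul row_mul; apply: h; exact: lat_gen.
Qed.

Lemma homL1 E P : homL E E P 1%:M.
Proof. by rewrite /homL /= mulmx1 mulmxV ?gen_unit //; exact: imx1. Qed.

Lemma lat_span E P v : lat E P v -> exists2 c : 'rV_(rk E), imx P c & v = c *m gen E P.
Proof. by move=> h; exists (v *m invmx (gen E P)) => //; rewrite mulmxKV ?gen_unit. Qed.

Lemma lat_reg E P c v : regular_at P c -> lat E P v -> lat E P (c *: v).
Proof. by move=> hc hv; rewrite /lat /= -scalemxAl; apply: imxZ. Qed.

Lemma latD E P u v : lat E P u -> lat E P v -> lat E P (u + v).
Proof. by move=> hu hv; rewrite /lat /= mulmxDl; apply: imxD. Qed.

Lemma lat0 E P : lat E P 0.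
Proof. by rewrite /lat /= mul0mx; exact: imx0. Qed.

Lemma latB E P u v : lat E P u -> lat E P v -> lat E P (u - v).
Proof. by move=> hu hv; rewrite /lat /= mulmxBl; apply: imxB. Qed.

Lemma lat_sum E P n (F : 'I_n -> 'rV_(rk E)) : (forall i, lat E P (F i)) -> lat E P (\sum_i F i).
Proof. by move=> h; rewrite /lat /= mulmx_suml; apply: imx_sum. Qed.

Lemma homL_reg E F P c A : regular_at P c -> homL E F P A -> homL E F P (c *: A).
Proof. by move=> hc hA; rewrite /homL /= -scalemxAr -scalemxAl; apply: imxZ. Qed.

Lemma homLD E F P A B : homL E F P A -> homL E F P B -> homL E F P (A + B).
Proof. by move=> hA hB; rewrite /homL /= mulmxDr mulmxDl; apply: imxD. Qed.

Lemma homL0 E F P : homL E F P 0.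
Proof. by rewrite /homL /= mulmx0 mul0mx; exact: imx0. Qed.

Lemma homL_sum E F P n (A : 'I_n -> 'M[K]_(rk E, rk F)) :
  (forall a, homL E F P (A a)) -> homL E F P (\sum_a A a).
Proof. by move=> h; apply: (big_ind (homL E F P)) => //; [exact: homL0|exact: homLD]. Qed.

Lemma homLN E F P A : homL E F P A -> homL E F P (- A).
Proof. by move=> hA; rewrite /homL /= mulmxN mulNmx; apply: imxN. Qed.

Lemma homLB E F P A B : homL E F P A -> homL E F P B -> homL E F P (A - B).
Proof. by move=> hA hB; apply: homLD => //; apply: homLN. Qed.

Lemma ksub_homL E F P : ksub (cst X) (homL E F P).
Proof.
split; first exact: homL0.
by move=> c u v hu hv; apply: homLD => //; apply: homL_reg => //; exact: regC.
Qed.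

Lemma ksub_H0 E F : ksub (cst X) (H0 E F).
Proof.
split; first by move=> P; exact: homL0.
by move=> c u v hu hv P; apply: (proj2 (ksub_homL E F P)).
Qed.

Lemma ksub_Laff E F : ksub (cst X) (Laff E F).
Proof.
split; first by move=> P _; exact: homL0.
by move=> c u v hu hv P nP; apply: (proj2 (ksub_homL E F P)); [exact: hu|exact: hv].
Qed.

Lemma bad_finite E F : finite_set [set P | gen E P <> 1%:M \/ gen F P <> 1%:M].
Proof.
have -> : [set P | gen E P <> 1%:M \/ gen F P <> 1%:M] =
   [set P | gen E P <> 1%:M] `|` [set P | gen F P <> 1%:M] by [].
by rewrite finite_setU; split; exact: gen_fin.
Qed.

Lemma triv_fin n : finite_set [set P : point X | (1%:M : 'M[K]_n) <> 1%:M].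
Proof. by apply: (@sub_finite_set _ _ set0) => // P /=. Qed.

Definition triv n : bun := Bun (fun _ => unitmx1 K n) (triv_fin n).

(** Away from finitely many points both bundles are trivial, so the bound can
    be chosen independently of P. *)
Lemma homL_bound E F : exists N, forall P l A, (N <= l)%N -> imx P A ->
  homL E F P (tau P ^+ l *: A).
Proof.
have /finite_seqP [s es] := bad_finite E F.
have /choice [N NP] P : exists N, forall l A, (N <= l)%N -> imx P A -> homL E F P (tau P ^+ l *: A).
  have [n1 h1] := imx_pole P (gen E P); have [n2 h2] := imx_pole P (invmx (gen F P)).
  exists (n1 + n2)%N => l A hl hA.
  rewrite /homL /=.
  have -> : gen E P *m (tau P ^+ l *: A) *m invmx (gen F P) = tau P ^+ (l - (n1 + n2)) *:
      ((tau P ^+ n1 *: gen E P) *m A *m (tau P ^+ n2 *: invmx (gen F P))).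
    rewrite -!scalemxAl -!scalemxAr -!scalemxAl !scalerA -!exprD.
    by congr (_ ^+ _ *: _); lia.
  apply: imxZ; first exact: reg_tauX.
  apply: imxM; last exact: h2.
  by apply: imxM => //; exact: h1.
exists (\max_(P <- s) N P)%N => P l A hl hA.
have [Ps|nPs] := boolP (P \in s).
  by apply: NP => //; apply: leq_trans hl; exact: leq_bigmax_seq.
have : ~ [set` s] P by move=> /= h; rewrite h in nPs.
rewrite -es /= => /not_orP [/contrapT eE /contrapT eF].
rewrite /homL /= eE eF invmx1 mul1mx mulmx1; apply: imxZ => //; exact: reg_tauX.
Qed.

Lemma homL_good E F P A : gen E P = 1%:M -> gen F P = 1%:M -> homL E F P A <-> imx P A.
Proof. by move=> eE eF; rewrite /homL /= eE eF invmx1 mul1mx mulmx1. Qed.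

Lemma approx_homL E F P (A : 'M[K]_(rk E, rk F)) N : P <> pinf ->
  exists B, (exists2 D, imx P D & B - A = tau P ^+ N *: D) /\
    forall Q, Q <> pinf -> Q <> P -> homL E F Q B.
Proof.
move=> nP; have [N0 hN0] := homL_bound E F.
pose S := [set Q | gen E Q <> 1%:M \/ gen F Q <> 1%:M].
have [g hg] := choice (fun a => strong_approx a (maxn N N0) nP (bad_finite E F)).
pose B := \matrix_(i, j) g (A i j).
have BP i j : (exists2 h, regular_at P h & B i j - A i j = tau P ^+ maxn N N0 * h) /\
  forall Q, Q <> pinf -> Q <> P -> regular_at Q (B i j) /\
  (S Q -> exists2 h, regular_at Q h & B i j = tau Q ^+ maxn N N0 * h).
  by rewrite /B mxE.
clearbody B; exists B; split.
  exists (tau P ^- N *: (B - A)); last by rewrite scalerA divff ?scale1r // expf_neq0 ?tau_neq0.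
  move=> i j; have [[h Oh e] _] := BP i j; rewrite !mxE e.
  have -> : tau P ^+ maxn N N0 = tau P ^+ N * tau P ^+ (maxn N N0 - N).
    by rewrite -exprD subnKC ?leq_maxl.
  rewrite -mulrA mulKf ?expf_neq0 ?tau_neq0 //.
  by apply: regM => //; exact: reg_tauX.
move=> Q nQ QP; have [SQ|nSQ] := pselect (S Q).
  have -> : B = tau Q ^+ maxn N N0 *: (tau Q ^- maxn N N0 *: B).
    by rewrite scalerA divff ?scale1r // expf_neq0 ?tau_neq0.
  apply: hN0; first exact: leq_maxr.
  move=> i j; have [_ /(_ Q nQ QP) [_ /(_ SQ) [h Oh e]]] := BP i j.
  by rewrite mxE e mulKf ?expf_neq0 ?tau_neq0.
move/not_orP : nSQ => [/contrapT eE /contrapT eF]; apply/homL_good => // i j.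
by have [_ /(_ Q nQ QP) []] := BP i j.
Qed.

End Integral.
Arguments lat E P _ : rename.
Arguments homL E F P _ : rename.
Arguments H0 E F _ : rename.
Arguments Laff E F _ : rename.
Arguments Linf E F _ : rename.

Local Notation ksub := (@ksub _ _ C _).
Local Notation qdim := (@qdim _ _ C _).

(** * Euler characteristics of families of lattices *)

Section RR.
Local Notation x := (coordX X).
Local Notation y := (coordY X).
Implicit Types (P Q : point X) (E F G : bun).

Lemma const_regular f : (forall P, regular_at P f) -> exists c, f = C c.
Proof.
move=> Of; have [p [q e]] : inA f by apply: (affine_regular_inA) => P _.
have [p1 [q1 [r [r0 sp sq e1]]]] := Of pinf.
have : ev p q / cp 1 = ev p1 q1 / cp r by rewrite rmorph1 divr1 -e -e1.
move/(ev_fracE (oner_neq0 _) r0); rewrite !mulr1 => -[e2 e3].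
have r1 := size_gt0 r0.
have q0 : q = 0.
  apply/eqP/negPn/negP => q0; move: sq; rewrite -e3 size_mul //.
  have := size_gt0 q0.
  by move: (size q) (size r) r1 => a b; lia.
have [c ec] : exists c, p = c%:P.
  have [->|p0] := eqVneq p 0; first by exists 0.
  have : (size p <= 1)%N.
    move: sp; rewrite -e2 size_mul //; move: (size p) (size r) r1 => a b; lia.
  by move/size1_polyC => ->; eexists.
by exists c; rewrite e q0 ec ev_cst.
Qed.

Section Families.
Variables (m n : nat).
Local Notation M := 'M[K]_(m, n).
Implicit Types (L : point X -> set M).

Definition affL L : set M := [set A | forall P, P <> pinf -> L P A].

(** H^0 is the intersection of the lattice at infinity with the matrices
    regular on the affine curve, and H^1 is the space of all matrices modulo
    their sum. *)
Definition chiL L (c : int) : Prop := exists a b : nat,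
  [/\ qdim (L pinf `&` affL L) [set 0] a,
      qdim setT (sumS (L pinf) (affL L)) b & a%:Z - b%:Z = c].

Definition ksubL L := forall P, ksub (L P).

Lemma ksub_affL L : ksubL L -> ksub (affL L).
Proof.
move=> h; split; first by move=> P _; apply: ksub0.
by move=> c u v hu hv P nP; apply: (proj2 (h P)); [exact: hu | exact: hv].
Qed.

(** By qdim_modular the dimension of V / U is the sum of the increase of the
    intersection and the decrease of the codimension of the sum. *)
Lemma chi_modular (U V T : set M) d : ksub U -> ksub V -> ksub T -> U `<=` V ->
  qdim V U d -> forall c,
  (exists a b : nat, [/\ qdim (U `&` T) [set 0] a, qdim setT (sumS U T) b & a%:Z - b%:Z = c]) <->
  (exists a b : nat, [/\ qdim (V `&` T) [set 0] a, qdim setT (sumS V T) b & a%:Z - b%:Z = c + d%:Z]).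
Proof.
move=> kU kV kT UV qd c; have [a [b [qa qb eab]]] := qdim_modular kU kV kT UV qd.
have kUT := ksubI kU kT; have kVT := ksubI kV kT.
have kU' := ksub_sumS kU kT; have kV' := ksub_sumS kV kT.
have sI : U `&` T `<=` V `&` T by move=> u [/UV].
have sS : sumS U T `<=` sumS V T by move=> _ [u [t [/UV Vu Tt ->]]]; exists u, t.
have s0 : [set 0] `<=` U `&` T by move=> _ ->; exact: (ksub0 kUT).
have k0 := ksub_set0 C M.
split=> -[a1 [b1 [h1 h2 e]]].
  have [b2 [b3 [h3 h4 e3]]] := qdim_split kV' (ksubT C M) sS (@subsetT _ _) h2.
  exists (a1 + a)%N, b3; split=> //; first exact: (qdim_add kUT kVT s0 sI).
  by have := qdim_uniq kV' qb h3; lia.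
have [a2 [a3 [h3 h4 e3]]] := qdim_split kUT kVT s0 sI h1.
exists a2, (b + b1)%N; split=> //; first exact: (qdim_add kV' (ksubT C M) sS (@subsetT _ _)).
by have := qdim_uniq kVT qa h4; lia.
Qed.

(** A change at infinity is an instance of chi_modular. A change at another
    point enlarges the affine part, by approximation in the same dimension. *)
Lemma chiL_step L L' Q d : ksubL L -> ksubL L' -> (forall P, P <> Q -> L P = L' P) ->
  L Q `<=` L' Q -> qdim (L' Q) (L Q) d ->
  (Q <> pinf -> forall A, exists B, L Q (B - A) /\
     forall P, P <> pinf -> P <> Q -> L P B) ->
  forall c, chiL L c <-> chiL L' (c + d%:Z).
Proof.
move=> kL kL' eL sL qd ap c.
have [eQ|nQ] := pselect (Q = pinf).
  have e : affL L = affL L'.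
    apply/predeqP => A; split=> h P nP; have := h P nP; rewrite eL // => e; by rewrite eQ in e.
  subst Q; have := chi_modular (kL _) (kL' _) (ksub_affL kL) sL qd c.
  by rewrite /chiL -e.
have e : L pinf = L' pinf by apply: eL => e; exact: nQ.
have sA : affL L `<=` affL L'.
  move=> A h P nP; have [->|PQ] := pselect (P = Q); first by apply/sL/h.
  by rewrite -eL //; exact: h.
have qA : qdim (affL L') (affL L) d.
  apply: (@qdim_pull _ _ _ _ _ id (affL L') (affL L) (L' Q) (L Q)) qd => //.
  - by move=> A hA; apply: hA.
  - move=> A hA; split=> [h P nP|h]; last exact: h.
    by have [->|PQ] := pselect (P = Q) => //; rewrite eL //; exact: hA.
  - move=> A hA; have [B [h1 h2]] := ap nQ A; exists B.
      move=> P nP; have [->|PQ] := pselect (P = Q); last by rewrite -eL //; exact: h2.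
      by rewrite -(subrK A B); apply: (ksubD (kL' Q)) => //; exact: sL.
    by rewrite -opprB; apply: ksubN.
have sC (U V : set M) : U `&` V = V `&` U by rewrite setIC.
have sD (U V : set M) : sumS U V = sumS V U.
  by apply/predeqP => A; split=> -[u [v [Uu Vv ->]]]; exists v, u; rewrite addrC.
have := chi_modular (ksub_affL kL) (ksub_affL kL') (kL pinf) sA qA c.
by rewrite /chiL -e ![affL _ `&` _]sC ![sumS (affL _) _]sD.
Qed.

End Families.

Section Residue.
Variable Q : point X.
Implicit Types (a c : k).

Lemma reg_tauz (z : int) : 0 <= z -> regular_at Q (tau Q ^ z).
Proof. by case: z => // n _; exact: reg_tauX. Qed.

Definition rs (f : K) : k := xget 0 [set c | van Q (f - C c)].

Lemma rsP f : regular_at Q f -> van Q (f - C (rs f)).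
Proof.
move=> /(residue) [c hc]; rewrite /rs; case: xgetP => [d _ //|/(_ c)]; by case.
Qed.

Lemma rs_uniq f c : regular_at Q f -> van Q (f - C c) -> rs f = c.
Proof.
move=> /rsP h1 h2; apply/eqP; rewrite -subr_eq0; apply/eqP; apply: (@vanC Q).
rewrite rmorphB; have := vanB h2 h1; congr (van Q _); ring.
Qed.

Lemma rs_lin a f g : regular_at Q f -> regular_at Q g -> rs (C a * f + g) = a * rs f + rs g.
Proof.
move=> Of Og; apply: rs_uniq; first by apply: regD => //; apply: regM => //; exact: regC.
have -> : C a * f + g - C (a * rs f + rs g) = C a * (f - C (rs f)) + (g - C (rs g)).
  by rewrite rmorphD rmorphM; ring.
by apply: vanD; [apply: vanM; [exact: regC|exact: rsP]|exact: rsP].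
Qed.

Lemma rs_C c : rs (C c) = c.
Proof. by apply: rs_uniq; [exact: regC | rewrite subrr; left]. Qed.

Lemma rs_eq0 f : regular_at Q f -> rs f = 0 <-> van Q f.
Proof.
move=> Of; split=> [e|v]; first by have := rsP Of; rewrite e rmorph0 subr0.
by apply: rs_uniq => //; rewrite rmorph0 subr0.
Qed.

End Residue.

Section Diagonal.
Variables (E F : bun) (Q : point X).
Variables (V : 'M[K]_(rk E)) (V' : 'M[K]_(rk F)).
Hypotheses (gV : gl Q V) (gV' : gl Q V').
Implicit Types (c : 'I_(rk E) -> 'I_(rk F) -> int).

(** In suitable coordinates the lattice at Q is diagonal and can be changed by
    one dimension at a time. *)
Definition diagL c P : set 'M[K]_(rk E, rk F) :=
  [set A | if P == Q then forall i j, regular_at Q (tau Q ^ c i j * (V *m A *m V') i j)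
           else homL E F P A].

Lemma conj_lin a (A B : 'M[K]_(rk E, rk F)) i j :
  (V *m (C a *: A + B) *m V') i j = C a * (V *m A *m V') i j + (V *m B *m V') i j.
Proof. by rewrite mulmxDr mulmxDl -scalemxAr -scalemxAl !mxE. Qed.

Lemma ksub_diagL c : ksubL (diagL c).
Proof.
move=> P; rewrite /diagL; case: (P == Q); last exact: ksub_homL.
split=> [i j|a A B hA hB i j]; first by rewrite mulmx0 mul0mx mxE mulr0; exact: reg0.
rewrite conj_lin mulrDr mulrCA.
by apply: regD; [apply: regM; [exact: regC|exact: hA]|exact: hB].
Qed.

Lemma chi_diagL1 c i0 j0 z : chiL (diagL c) z <->
  chiL (diagL (fun i j => c i j + ((i == i0) && (j == j0))%:Z)) (z + 1).
Proof.
set c' := fun i j => _.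
have t0 := tau_neq0 Q.
have [uV iV iV'] := gV; have [uV' iV1 iV1'] := gV'.
have ect i j : tau Q ^ c' i j = tau Q ^ c i j * (if (i == i0) && (j == j0) then tau Q else 1).
  rewrite /c'; case: ifP => _; last by rewrite mulr1 addr0.
  by rewrite expfzDr // expr1z.
have ec0 : tau Q ^ c' i0 j0 = tau Q ^ c i0 j0 * tau Q by rewrite ect !eqxx.
apply: (@chiL_step _ _ (diagL c) (diagL c') Q 1).
- exact: ksub_diagL.
- exact: ksub_diagL.
- by move=> P /eqP/negPf PQ; rewrite /diagL PQ.
- move=> A; rewrite /diagL eqxx => h i j.
  rewrite ect mulrAC; apply: regM; first exact: h.
  by case: ifP => _; [apply: van_reg; exact: van_tau | exact: reg1].
- exists (fun A => (rs Q (tau Q ^ c' i0 j0 * (V *m A *m V') i0 j0))%:M : 'rV[k]_1).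
  rewrite /diagL eqxx; split.
  + move=> a A B hA hB; rewrite conj_lin mulrDr mulrCA rs_lin; [|exact: hA|exact: hB].
    by rewrite raddfD /= -scale_scalar_mx.
  + move=> w; pose A := invmx V *m (tau Q ^ (- c' i0 j0) *: (C (w 0 0) *: delta_mx i0 j0)) *m invmx V'.
    have eA i j : (V *m A *m V') i j = tau Q ^ (- c' i0 j0) * (C (w 0 0) * ((i == i0) && (j == j0))%:R).
      by rewrite /A !mulmxA mulmxV // mul1mx mulmxKV // !mxE.
    exists A.
      move=> i j; rewrite eA; case: ((i == i0) && (j == j0)) / andP => [[/eqP -> /eqP ->]|_]; last first.
        by rewrite !mulr0; exact: reg0.
      by rewrite mulrA -expfzDr // subrr mul1r mulr1; exact: regC.
    rewrite eA !eqxx mulr1 mulrA -expfzDr // subrr mul1r rs_C.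
    by rewrite -mx11_scalar.
  + move=> A hA; have h00 := hA i0 j0; split=> [e|h].
      have /(rs_eq0 h00) v : rs Q (tau Q ^ c' i0 j0 * (V *m A *m V') i0 j0) = 0.
        by have := congr1 (@mxtrace _ 1) e; rewrite mxtrace_scalar mulr1n mxtrace0.
      move=> i j.
      case: (boolP ((i == i0) && (j == j0))) => [/andP[/eqP -> /eqP ->]|/negPf nij].
        have [g Og eg] := van_factor v.
        suff -> : tau Q ^ c i0 j0 * (V *m A *m V') i0 j0 = g by [].
        by apply: (mulfI t0); rewrite -eg ec0; ring.
      by have := hA i j; rewrite ect nij mulr1.
    suff -> : rs Q (tau Q ^ c' i0 j0 * (V *m A *m V') i0 j0) = 0 by rewrite raddf0.
    apply/rs_eq0 => //; rewrite ec0 mulrAC; apply: vanM; [exact: h|exact: van_tau].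
- move=> nQ A; pose N := (\max_(ij : 'I_(rk E) * 'I_(rk F)) `|c ij.1 ij.2|)%N.
  have [B [[D iD eB] hB]] := approx_homL A N nQ.
  exists B; split; last first.
    by move=> P nP PQ; have /eqP/negPf PQ' := PQ; rewrite /diagL PQ'; exact: hB.
  rewrite /diagL eqxx => i j; rewrite eB -scalemxAr -scalemxAl mxE mulrA.
  apply: regM; last by apply: imxM => //; exact: imxM.
  rewrite exprnP -expfzDr //; apply: reg_tauz.
  have : (`|c i j| <= N)%N by rewrite /N (bigD1 (i, j)) //= leq_maxl.
  lia.
Qed.

Lemma chi_diagL c z : chiL (diagL c) z <->
  chiL (diagL (fun _ _ => 0)) (z - \sum_i \sum_j c i j).
Proof.
pose S (c : 'I_(rk E) -> 'I_(rk F) -> int) := (\sum_i \sum_j `|c i j|)%N.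
have [N] := ubnP (S c); elim: N => // N IH in c z *; rewrite ltnS => hS.
have [h|/existsNP [i0 /existsNP [j0 nz]]] := pselect (forall i j, c i j = 0).
  have -> : c = (fun _ _ => 0) by apply/funext => i; apply/funext => j.
  by rewrite big1 ?subr0 // => i _; rewrite big1.
have sumD (f : 'I_(rk E) -> 'I_(rk F) -> int) (e : int) :
    \sum_i \sum_j (f i j + e * ((i == i0) && (j == j0))%:Z) = \sum_i \sum_j f i j + e.
  under eq_bigr do rewrite big_split /=.
  rewrite big_split /=; congr (_ + _).
  rewrite (bigD1 i0) //= (bigD1 j0) //= !eqxx mulr1 !big1 ?addr0 //.
    by move=> i /negPf ni; rewrite big1 // => j _; rewrite ni mulr0.
  by move=> j /negPf nj; rewrite nj andbF mulr0.
have Slt (f : 'I_(rk E) -> 'I_(rk F) -> int) : (forall i j, (i == i0) && (j == j0) = false -> f i j = c i j) ->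
    (`|f i0 j0| < `|c i0 j0|)%N -> (S f < S c)%N.
  move=> hf h0; rewrite /S (bigD1 i0) //= (bigD1 j0) //= [X in (_ < X)%N](bigD1 i0) //= [X in (_ < X + _)%N](bigD1 j0) //=.
  rewrite -!addnA -addSn leq_add // leq_eqVlt; apply/orP; left; apply/eqP.
  congr (_ + _)%N; first by apply: eq_bigr => j /negPf nj; rewrite hf // nj andbF.
  by apply: eq_bigr => i /negPf ni; apply: eq_bigr => j _; rewrite hf // ni.
have [c0|c0] := ltP 0 (c i0 j0).
  pose c1 i j := c i j + (-1) * ((i == i0) && (j == j0))%:Z.
  have -> : c = (fun i j => c1 i j + ((i == i0) && (j == j0))%:Z).
    by apply/funext => i; apply/funext => j; rewrite /c1; lia.
  rewrite -(subrK 1 z) -chi_diagL1 IH; last first.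
    by apply: leq_trans hS; apply: Slt => [i j e|]; rewrite /c1 ?e ?eqxx; lia.
  have := sumD c (-1); rewrite -/(c1 _ _) => e1.
  have := sumD c1 1; under eq_bigr do under eq_bigr do rewrite mul1r.
  set s1 := \sum_i \sum_j c1 i j => ->.
  by have -> : z - 1 + 1 - (s1 + 1) = z - 1 - s1 by ring.
pose c1 i j := c i j + 1 * ((i == i0) && (j == j0))%:Z.
rewrite (chi_diagL1 c i0 j0).
have -> : (fun i j => c i j + ((i == i0) && (j == j0))%:Z) = c1.
  by apply/funext => i; apply/funext => j; rewrite /c1 mul1r.
rewrite IH; last first.
  by apply: leq_trans hS; apply: Slt => [i j e|]; rewrite /c1 ?e ?eqxx; lia.
by rewrite /c1 sumD opprD addrACA subrr addr0.
Qed.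

End Diagonal.
(** * Riemann-Roch *)

(** Riemann-Roch is reduced to trivial bundles by making the bundles trivial
    at one point after another. *)
Definition fixb_gen E Q P : 'M[K]_(rk E) := if P == Q then 1%:M else gen E P.

Lemma fixb_unit E Q P : fixb_gen E Q P \in unitmx.
Proof. by rewrite /fixb_gen; case: ifP => _; [exact: unitmx1|exact: gen_unit]. Qed.

Lemma fixb_fin E Q : finite_set [set P | fixb_gen E Q P <> 1%:M].
Proof.
apply: sub_finite_set (gen_fin E) => P; rewrite /fixb_gen /=; by case: ifP.
Qed.

Definition fixb E Q : bun := Bun (fixb_unit E Q) (fixb_fin E Q).

Lemma chi_fix E F Q z : chiL (homL E F) z <->
  chiL (homL (fixb E Q) (fixb F Q))
    (z - ((rk F)%:Z * ord Q (\det (gen E Q)) - (rk E)%:Z * ord Q (\det (gen F Q)))).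
Proof.
have [U [V [d [gU gV eE oE]]]] := smith Q (gen_unit E Q).
have [U' [V' [d' [gU' gV' eF oF]]]] := smith Q (gen_unit F Q).
have [uU iU iU'] := gU; have [uV iV iV'] := gV.
have [uU' iU1 iU1'] := gU'; have [uV' iV1 iV1'] := gV'.
have gV'' := glV gV'.
have t0 := tau_neq0 Q.
pose c (i : 'I_(rk E)) (j : 'I_(rk F)) := d i - d' j.
have eL P : homL E F P = diagL Q V (invmx V') c P.
  rewrite /diagL; case: eqVneq => [->|//]; apply/predeqP => A.
  pose D := diag_mx (\row_i tau Q ^ d i); pose D' := diag_mx (\row_i tau Q ^ d' i).
  pose D1 := diag_mx (\row_i tau Q ^ (- d' i)).
  have eD : D' *m D1 = 1%:M.
    rewrite mulmx_diag; apply/matrixP => i j; rewrite !mxE.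
    by case: eqP => _ //=; rewrite mulr1n -expfzDr // subrr.
  have uD : D' \in unitmx by case/mulmx1_unit: eD.
  have eD1 : invmx D' = D1 by rewrite -[LHS]mulmx1 -eD mulmxA mulVmx // mul1mx.
  have e : gen E Q *m A *m invmx (gen F Q) = U *m (D *m (V *m A *m invmx V') *m D1) *m invmx U'.
    rewrite eE eF -/D -/D' !invmx_mul ?unitmx_mul ?uU' ?uD // eD1 !mulmxA //.
  have e2 i j : (D *m (V *m A *m invmx V') *m D1) i j = tau Q ^ c i j * (V *m A *m invmx V') i j.
    by rewrite mul_mx_diag mxE mul_diag_mx !mxE mulrAC -expfzDr.
  rewrite /homL /= e; split=> [h i j|h].
    rewrite -e2.
    have -> : D *m (V *m A *m invmx V') *m D1 =
        invmx U *m (U *m (D *m (V *m A *m invmx V') *m D1) *m invmx U') *m U'.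
      by rewrite -!mulmxA mulVmx // mulmx1 !mulmxA mulVmx // mul1mx.
    by apply: imxM => //; apply: imxM.
  by apply: imxM => //; apply: imxM => // i j; rewrite e2.
have eL0 P : diagL Q V (invmx V') (fun _ _ => 0) P = homL (fixb E Q) (fixb F Q) P.
  rewrite /diagL /homL /= /fixb_gen; case: eqVneq => [->|//].
  apply/predeqP => A; rewrite /= invmx1 mul1mx mulmx1; split=> [h|h i j]; last first.
    by rewrite mul1r; apply: imxM => //; exact: imxM.
  have -> : A = invmx V *m (V *m A *m invmx V') *m V'.
    by rewrite !mulmxA mulVmx // mul1mx mulmxKV.
  by apply: imxM => //; apply: imxM => // i j; have := h i j; rewrite mul1r.
have -> : homL E F = diagL Q V (invmx V') c by apply/funext.
rewrite (chi_diagL gV gV'') (funext eL0).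
suff -> : \sum_i \sum_j c i j = (rk F)%:Z * ord Q (\det (gen E Q)) - (rk E)%:Z * ord Q (\det (gen F Q)) by [].
under eq_bigr do rewrite big_split /= sumr_const card_ord.
rewrite big_split /= sumr_const card_ord sumrN -oF sumrMnl -oE.
have muln (v : int) n : v *+ n = n%:Z * v by rewrite -mulr_natl natz.
by rewrite !muln mulrN.
Qed.

(** The larger the order of the determinant, the smaller the lattice, whence
    the sign. *)
Definition deg E : int := - \sum_(P \in [set: point X]) ord P (\det (gen E P)).

Lemma fsum_seq (f : point X -> int) (s : seq (point X)) : uniq s ->
  (forall P, f P != 0 -> P \in s) -> \sum_(P \in [set: point X]) f P = \sum_(P <- s) f P.
Proof.
move=> us hs; rewrite [RHS]fsbig_seq //; apply: esym; apply: (@fsbig_widen _ _ _ _ [set` s] setT f) => // P /= [_ nP].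
by apply/eqP; apply: contra_notT nP; exact: hs.
Qed.

Lemma deg_seq E (s : seq (point X)) : uniq s -> (forall P, gen E P <> 1%:M -> P \in s) ->
  deg E = - \sum_(P <- s) ord P (\det (gen E P)).
Proof.
move=> us hs; rewrite /deg (fsum_seq us) // => P h; apply: hs => e.
by move: h; rewrite e det1 ord_unit ?eqxx //; exact: unit1.
Qed.

Lemma deg_triv E : (forall P, gen E P = 1%:M) -> deg E = 0.
Proof. by move=> h; rewrite (deg_seq (s := [::])) ?big_nil ?oppr0. Qed.

(** H^0 consists of the constant matrices, and H^1 of the constant multiples
    of y / x. *)
Lemma chi_trivial E F : (forall P, gen E P = 1%:M) -> (forall P, gen F P = 1%:M) ->
  chiL (homL E F) 0.
Proof.
move=> hE hF.
have hL P A : homL E F P A <-> imx P A by apply: homL_good.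
exists (rk E * rk F)%N, (rk E * rk F)%N; split; last by rewrite subrr.
- have /choice [cf cfP] f : exists c, (forall P, regular_at P f) -> f = C c.
    by have [/const_regular [c ->]|h] := pselect (forall P, regular_at P f); [exists c|exists 0].
  have hI A : (homL E F pinf `&` affL (homL E F)) A <-> forall i j P, regular_at P (A i j).
    split=> [[h1 h2] i j P|h].
      by have [->|nP] := pselect (P = pinf); [by have /hL := h1; apply|by have /hL := h2 P nP; apply].
    by split=> [|P _]; apply/hL => i j; exact: h.
  exists (fun A => mxvec (map_mx cf A)); split.
  + move=> c A B /hI hA /hI hB; rewrite -linearP; congr mxvec.
    apply/matrixP => i j; rewrite !mxE; apply: (fmorph_inj C).
    rewrite -cfP; first by rewrite rmorphD rmorphM -!cfP.
    by move=> P; apply: regD => //; apply: regM => //; exact: regC.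
  + move=> w; exists (map_mx C (vec_mx w)).
      by apply/hI => i j P; rewrite mxE; exact: regC.
    rewrite -[RHS]vec_mxK; congr mxvec; apply/matrixP => i j; rewrite !mxE.
    by apply: (fmorph_inj C); rewrite -cfP // => P; exact: regC.
  + move=> A /hI hA; split=> [|->].
      rewrite -(linear0 mxvec) => /(can_inj mxvecK)/matrixP h.
      apply/matrixP => i j; have := h i j; rewrite !mxE => e.
      by rewrite [LHS](cfP _ (hA i j)) e rmorph0.
    rewrite -(linear0 mxvec); congr mxvec; apply/matrixP => i j; rewrite !mxE.
    by apply: (fmorph_inj C); rewrite -cfP ?rmorph0 // => P; exact: reg0.
- exists (fun A => mxvec (map_mx (lam) A)); split.
  + move=> c A B _ _; rewrite -linearP; congr mxvec.
    by apply/matrixP => i j; rewrite !mxE lamD.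
  + move=> w; exists ((y / x) *: map_mx C (vec_mx w)) => //.
    rewrite -[RHS]vec_mxK; congr mxvec; apply/matrixP => i j; rewrite !mxE mulrC.
    have := lamD (y / x) 0 (vec_mx w i j); rewrite !mxE addr0 lam_yx mulr1 => ->.
    by rewrite lam_inf ?addr0 //; exact: reg0.
  + move=> A _; split=> [|[B [D [hB hD ->]]]].
      rewrite -(linear0 mxvec) => /(can_inj mxvecK)/matrixP h.
      have /choice [og ogP] (ij : 'I__ * 'I__) : exists og,
          [/\ regular_at pinf og.1, inA og.2 & A ij.1 ij.2 = og.1 + og.2].
        have [ o1 [g [Oo Ag e]]] := lamP (A ij.1 ij.2); exists (o1, g); split=> //.
        by rewrite e; have := h ij.1 ij.2; rewrite !mxE => ->; rewrite rmorph0 mul0r addr0.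
      exists (\matrix_(i, j) (og (i, j)).1), (\matrix_(i, j) (og (i, j)).2); split.
      - by apply/hL => i j; rewrite mxE; case: (ogP (i, j)).
      - by move=> P nP; apply/hL => i j; rewrite mxE; apply: inA_regular nP; case: (ogP (i, j)).
      - by apply/matrixP => i j; rewrite !mxE; case: (ogP (i, j)).
    rewrite -(linear0 mxvec); congr mxvec; apply/matrixP => i j; rewrite !mxE.
    have := lamD (B i j) (D i j) 1; rewrite rmorph1 !mul1r => ->.
    rewrite lam_inf ?lam_A ?addr0 //; last by move/hL: hB.
    by apply: (affine_regular_inA) => P nP; have /hL := hD P nP.
Qed.

Theorem riemann_roch E F : chiL (homL E F) ((rk E)%:Z * deg F - (rk F)%:Z * deg E).
Proof.
have /finite_seqP [s es] := bad_finite E F.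
have : forall P, gen E P <> 1%:M \/ gen F P <> 1%:M -> P \in undup s.
  move=> P h; rewrite mem_undup; have : [set` s] P by rewrite -es.
  by [].
have := undup_uniq s; move: (undup s) => {es}{}s; elim: s E F => [|Q s IH] E F.
  move=> _ h; have hE P : gen E P = 1%:M by apply: contrapT => e; have := h P (or_introl e).
  have hF P : gen F P = 1%:M by apply: contrapT => e; have := h P (or_intror e).
  by have := chi_trivial hE hF; rewrite !deg_triv // !mulr0 subr0.
move=> /= /andP[Qs us] h; apply/(chi_fix E F Q).
have hf G P : fixb_gen G Q P <> 1%:M -> P <> Q /\ gen G P <> 1%:M.
  by rewrite /fixb_gen; case: eqVneq => // /eqP.
have hs P : P <> Q -> P \in Q :: s -> P \in s by rewrite inE => /eqP/negPf ->.
have := IH (fixb E Q) (fixb F Q) us.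
rewrite (@deg_seq E (Q :: s)) //=; [|by rewrite Qs|by move=> P e; apply: h; left].
rewrite (@deg_seq F (Q :: s)) //=; [|by rewrite Qs|by move=> P e; apply: h; right].
rewrite (@deg_seq (fixb E Q) s) //=; last first.
  by move=> P /hf [PQ e]; apply: hs => //; apply: h; left.
rewrite (@deg_seq (fixb F Q) s) //=; last first.
  by move=> P /hf [PQ e]; apply: hs => //; apply: h; right.
have esum G : \sum_(P <- s) ord P (\det (fixb_gen G Q P)) = \sum_(P <- s) ord P (\det (gen G P)).
  rewrite big_seq [RHS]big_seq; apply: eq_bigr => P Ps; rewrite /fixb_gen.
  by case: eqVneq => // e; rewrite -e Ps in Qs.
have hh P : fixb_gen E Q P <> 1%:M \/ fixb_gen F Q P <> 1%:M -> P \in s.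
  by move=> [/hf|/hf] [PQ e]; apply: hs => //; apply: h; [left|right].
move=> /(_ hh); rewrite !big_cons !esum.
set a := \sum_(P <- s) _; set b := \sum_(P <- s) _.
have -> : (rk E)%:Z * - (ord Q (\det (gen F Q)) + a) - (rk F)%:Z * - (ord Q (\det (gen E Q)) + b) -
   ((rk F)%:Z * ord Q (\det (gen E Q)) - (rk E)%:Z * ord Q (\det (gen F Q))) =
   (rk E)%:Z * - a - (rk F)%:Z * - b by ring.
by [].
Qed.

(** * Serre duality *)

Definition h0 E F n := qdim (H0 E F) [set 0] n.
Definition h1 E F n := qdim setT (sumS (Linf E F) (Laff E F)) n.

Lemma H0E E F : H0 E F = Linf E F `&` Laff E F.
Proof.
apply/predeqP => A; split=> [h|[h1 h2] P]; first by split=> [|P _]; exact: h.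
by have [->|nP] := pselect (P = pinf) => //; exact: h2.
Qed.

Lemma h0_h1 E F : exists a b : nat,
  [/\ h0 E F a, h1 E F b & a%:Z - b%:Z = (rk E)%:Z * deg F - (rk F)%:Z * deg E].
Proof.
have [a [b [ha hb e]]] := riemann_roch E F; exists a, b; split=> //.
by rewrite /h0 H0E.
Qed.

Lemma lam0 : lam (0 : K) = 0.
Proof. by apply: lam_inf; exact: reg0. Qed.

Lemma lamB (f g : K) : lam (f + g) = lam f + lam g.
Proof. by have := lamD f g 1; rewrite rmorph1 !mul1r. Qed.

Lemma lamZ c (f : K) : lam (C c * f) = c * lam f.
Proof. by have := lamD f 0 c; rewrite lam0 !addr0. Qed.

Lemma lam_sum n (f : 'I_n -> K) : lam (\sum_i f i) = \sum_i lam (f i).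
Proof. exact: (big_morph _ lamB lam0). Qed.

Lemma homL_tr E F P A B : homL E F P A -> homL F E P B -> regular_at P (\tr (A *m B)).
Proof.
move=> hA hB; have := homL_comp hA hB; rewrite /homL /= => /imx_trace.
by rewrite mxtrace_mulC mulKmx ?gen_unit.
Qed.

Lemma lam_tr0 E F A B : sumS (Linf E F) (Laff E F) A -> H0 F E B -> lam (\tr (A *m B)) = 0.
Proof.
move=> [A1 [A2 [h1 h2 ->]]] hB; rewrite mulmxDl raddfD /= lamB.
rewrite lam_inf; last exact: homL_tr (hB _).
rewrite lam_A ?addr0 //; apply: (affine_regular_inA) => P nP.
exact: homL_tr (h2 P nP) (hB P).
Qed.

Lemma lam_tr_nondeg m n (B : 'M[K]_(n, m)) : (forall A : 'M[K]_(m, n), lam (\tr (A *m B)) = 0) -> B = 0.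
Proof.
move=> h; apply/matrixP => i j; rewrite mxE; apply/eqP/negPn/negP => b0.
have := h ((y / x / B i j) *: delta_mx j i).
rewrite -scalemxAl mxtraceZ /mxtrace (bigD1 j) //= big1 ?addr0; last first.
  move=> l /negPf lj; rewrite mxE big1 // => a _; rewrite mxE lj mul0r //.
rewrite mxE (bigD1 i) //= big1 ?addr0; last first.
  by move=> a /negPf ai; rewrite mxE eqxx ai mul0r.
by rewrite mxE !eqxx mul1r divfK // lam_yx => /eqP; rewrite oner_eq0.
Qed.

(** The pairing of H1(E, F) with H0(F, E) in coordinates. It is injective on
    the side of H0(F, E), where a matrix can be multiplied by arbitrary
    functions. *)
Lemma pairing_matrix E F a b : h0 F E a -> h1 E F b ->
  exists phi : 'M[K]_(rk E, rk F) -> 'rV[k]_b, exists B : 'I_a -> 'M[K]_(rk F, rk E),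
  exists M : 'M[k]_(b, a),
  [/\ forall A, phi A = 0 <-> sumS (Linf E F) (Laff E F) A,
      forall i, H0 F E (B i),
      row_free M^T & forall A i, (phi A *m M) 0 i = lam (\tr (A *m B i))].
Proof.
move=> ha [phi cphi]; have [B [hB bas]] := qdim_set0 ha (ksub_H0 F E).
have [f [_ [fk fS]]] := coords_section (ksubT C _) cphi.
pose M := \matrix_(j, i) lam (\tr (f j *m B i)) : 'M[k]_(b, a).
have lamk (c : 'rV[k]_b) D : lam (\tr (klin C c f *m D)) = \sum_j c 0 j * lam (\tr (f j *m D)).
  rewrite /klin mulmx_suml raddf_sum lam_sum; apply: eq_bigr => j _.
  by rewrite -scalemxAl /= mxtraceZ lamZ.
have e A D : H0 F E D -> lam (\tr (A *m D)) = \sum_j phi A 0 j * lam (\tr (f j *m D)).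
  move=> hD; rewrite -lamk -[A in LHS](subrK (klin C (phi A) f)) mulmxDl raddfD /= lamB.
  by rewrite (lam_tr0 (fS A I) hD) add0r.
exists phi, B, M; split=> //.
- by have [_ _ h] := cphi; move=> A; exact: h.
- rewrite -kermx_eq0; apply/rowV0P => c /sub_kermxP hc.
  have hD : H0 F E (klin C c B) by apply: ksub_klin => //; exact: ksub_H0.
  have h0' : klin C c B = 0.
    apply: lam_tr_nondeg => A; rewrite e //; apply: big1 => j _.
    have -> : lam (\tr (f j *m klin C c B)) = (c *m M^T) 0 j.
      rewrite /klin mulmx_sumr raddf_sum lam_sum mxE; apply: eq_bigr => l _.
      by rewrite -scalemxAr /= mxtraceZ lamZ !mxE.
    by rewrite hc mxE mulr0.
  have [c' [_ u]] := bas _ hD.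
  by rewrite -(u c erefl) (u 0) // h0' klin0.
- move=> A i; rewrite e // mxE; apply: eq_bigr => j _; by rewrite mxE.
Qed.

Lemma h0_uniq E F a b : h0 E F a -> h0 E F b -> a = b.
Proof. exact: qdim_uniq (ksub_H0 E F). Qed.

Lemma h1_uniq E F a b : h1 E F a -> h1 E F b -> a = b.
Proof. exact: qdim_uniq (ksubT C _). Qed.

Lemma h0_exists E F : exists n, h0 E F n.
Proof. by have [a [_ [h _ _]]] := h0_h1 E F; exists a. Qed.

(** Riemann-Roch is antisymmetric, so the two injective pairings have the same
    size and are perfect. *)
Lemma serre_dim E F a b : h0 F E a -> h1 E F b -> a = b.
Proof.
have le E' F' a' b' : h0 F' E' a' -> h1 E' F' b' -> (a' <= b')%N.
  move=> ha hb; have [_ [_ [M [_ _ fM _]]]] := pairing_matrix ha hb.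
  by rewrite -(eqP fM) rank_leq_col.
move=> ha hb; have [a1 [b1 [ha1 hb1 e1]]] := h0_h1 F E; have [a2 [b2 [ha2 hb2 e2]]] := h0_h1 E F.
have := le _ _ _ _ ha1 hb2; have := le _ _ _ _ ha2 hb1.
by rewrite (h0_uniq ha ha1) (h1_uniq hb hb2); lia.
Qed.

Lemma serre E F n : h0 F E n <-> h1 E F n.
Proof.
have [a [_ [ha _ _]]] := h0_h1 F E; have [_ [b [_ hb _]]] := h0_h1 E F.
have e := serre_dim ha hb; split=> h.
  by rewrite (h0_uniq h ha) e.
by rewrite (h1_uniq h hb) -e.
Qed.

Lemma h0_chi E F a b : h0 E F a -> h0 F E b ->
  a%:Z - b%:Z = (rk E)%:Z * deg F - (rk F)%:Z * deg E.
Proof.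
move=> ha /(serre) hb; have [a' [b' [ha' hb' <-]]] := h0_h1 E F.
by rewrite (h0_uniq ha ha') (h1_uniq hb hb').
Qed.

Theorem serre_duality E F A : (forall B, H0 F E B -> lam (\tr (A *m B)) = 0) ->
  exists A1 A2, [/\ Linf E F A1, Laff E F A2 & A = A1 + A2].
Proof.
move=> h; have [a [_ [ha _ _]]] := h0_h1 F E; have hb := (serre E F a).1 ha.
have [phi [B [M [hphi hB fM e]]]] := pairing_matrix ha hb.
apply/hphi; have /row_free_inj inj : row_free M.
  by rewrite /row_free -mxrank_tr.
apply: inj; rewrite mul0mx; apply/rowP => i; rewrite e mxE; exact: h.
Qed.

End RR.

Section Lattices.
Implicit Types (P Q : point X) (E F G : bun).

(** * Lattices and the bundles they define *)

Definition is_lattice P n (S : set 'rV[K]_n) : Prop :=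
  [/\ forall u v, S u -> S v -> S (u + v),
      forall c v, regular_at P c -> S v -> S (c *: v),
      exists N, forall v, S v -> imx P (tau P ^+ N *: v)
    & exists N, forall v, imx P v -> S (tau P ^+ N *: v)].

Definition set_row n (G : 'M[K]_n) i (v : 'rV[K]_n) : 'M[K]_n :=
  \matrix_(a, b) if a == i then v 0 b else G a b.

Lemma det_set_row n (G : 'M[K]_n) i v : \det (set_row G i v) = (v *m \adj G) 0 i.
Proof.
rewrite (expand_det_row _ i) mxE; apply: eq_bigr => l _; rewrite [in RHS]mxE.
rewrite mxE eqxx; congr (_ * _); rewrite /cofactor; congr (_ * \det _).
by apply/matrixP => a b; rewrite !mxE eq_sym (negPf (neq_lift _ _)).
Qed.

(** A basis of the lattice is a choice of n elements whose determinant has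
    least order. *)
Lemma lattice_free P n (S : set 'rV[K]_n) : is_lattice P S ->
  exists2 g : 'M[K]_n, g \in unitmx & forall v, S v <-> imx P (v *m invmx g).
Proof.
move=> [SD SZ [N hN] [N' hN']]; have t0 := tau_neq0 P.
pose ok (G : 'M[K]_n) : Prop := G \in unitmx /\ forall i, S (row i G).
pose val (G : 'M[K]_n) := ord P (\det G) + (n * N)%:Z.
have val0 (G : 'M[K]_n) : ok G -> 0 <= val G.
  move=> [uG hG]; have d0 : \det G != 0 by rewrite -unitfE -unitmxE.
  have : regular_at P (\det (tau P ^+ N *: G)).
    by apply: imx_det => i j; have := hN _ (hG i) 0 j; rewrite !mxE.
  have t1 : tau P ^+ N ^+ n != 0 by rewrite !expf_neq0.
  rewrite detZ => /(ord_ge0 P (mulf_neq0 t1 d0)); rewrite ordM // -exprM.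
  have := ord_tauE (P := P) (N * n)%:Z (unit1 P); rewrite mul1r => ->.
  by rewrite /val addrC mulnC.
have ex0 : exists r : nat, `[< exists G : 'M[K]_n, ok G /\ absz (val G) = r >].
  exists (absz (val (tau P ^+ N' *: 1%:M))); apply/asboolP; eexists; split=> //.
  split; first by rewrite unitmxZ ?unitmx1 // unitfE expf_neq0.
  by move=> i; rewrite linearZ /=; apply: hN' => a b; rewrite mxE; exact: imx1.
case: (ex_minnP ex0) => r /asboolP[G [okG eG]] rmin.
have [uG hG] := okG; have d0 : \det G != 0 by rewrite -unitfE -unitmxE.
exists G => // v; split=> [Sv i j|h].
  rewrite !ord1 {i}; set c := v *m invmx G.
  have ec : c 0 j = \det (set_row G j v) / \det G.
    by rewrite det_set_row /c /invmx uG -scalemxAr mxE mulrC.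
  have [->|c0] := eqVneq (c 0 j) 0; first exact: reg0.
  have dG0 : \det (set_row G j v) != 0.
    by apply: contraNneq c0; rewrite ec => ->; rewrite mul0r.
  have okG' : ok (set_row G j v).
    split; first by rewrite unitmxE unitfE.
    move=> i; case: (eqVneq i j) => [->|/negPf ij].
      by have -> : row j (set_row G j v) = v by apply/rowP => b; rewrite !mxE eqxx.
    have -> : row i (set_row G j v) = row i G by apply/rowP => b; rewrite !mxE ij.
    exact: hG.
  apply/(ord_ge0 P c0); rewrite ec ordM ?invr_eq0 // ordV // subr_ge0.
  have : (absz (val G) <= absz (val (set_row G j v)))%N.
    by rewrite eG; apply: rmin; apply/asboolP; exists (set_row G j v).
  have := val0 _ okG; have := val0 _ okG'; rewrite /val.
  move: (ord P _) (ord P _) (n * N)%N => a b c'; lia.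
have -> : v = \sum_i (v *m invmx G) 0 i *: row i G.
  by rewrite -mulmx_sum_row mulmxKV.
have S0 : S 0.
  have [n0|n0] := posnP n.
    have := hN' 0 (@imx0 P _ _); rewrite scaler0; exact.
  by have := SZ 0 _ (reg0 P) (hG (Ordinal n0)); rewrite scale0r.
elim/big_rec: _ => // i u _ Su; apply: SD => //; apply: SZ => //; exact: h.
Qed.

Lemma bundle_of_lattices n (L : point X -> set 'rV[K]_n) :
  (forall P, is_lattice P (L P)) ->
  finite_set [set P | ~ forall v, L P v <-> imx P v] ->
  exists (g : point X -> 'M[K]_n) (gU : forall P, g P \in unitmx)
    (gf : finite_set [set P | g P <> 1%:M]),
    forall P v, L P v <-> lat (Bun gU gf) P v.
Proof.
move=> hL fL; have /choice [g gP] P : exists g : 'M[K]_n, [/\ g \in unitmx,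
    forall v, L P v <-> imx P (v *m invmx g) & (forall v, L P v <-> imx P v) -> g = 1%:M].
  have [hs|hs] := pselect (forall v, L P v <-> imx P v).
    by exists 1%:M; split=> // [|v]; [exact: unitmx1 | rewrite invmx1 mulmx1].
  by have [g ug hg] := lattice_free (hL P); exists g.
have gU P : g P \in unitmx by case: (gP P).
have gf : finite_set [set P | g P <> 1%:M].
  by apply: sub_finite_set fL => P /= + hs; case: (gP P) => _ _ /(_ hs).
by exists g, gU, gf => P v; case: (gP P).
Qed.

Lemma pole_finite m n (A : 'M[K]_(m, n)) : finite_set [set P | ~ imx P A].
Proof.
apply: (@sub_finite_set _ _ (\bigcup_(ij in [set: 'I_m * 'I_n])
    [set P | A ij.1 ij.2 != 0 /\ ~ unit_at P (A ij.1 ij.2)])).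
  move=> P /= /existsNP [i /existsNP [j h]]; exists (i, j) => //=.
  split; first by apply: contra_notN h => /eqP ->; exact: reg0.
  by move=> /unit_reg.
apply: bigcup_finite; first exact: finite_finset.
move=> ij _; have [e|n0] := eqVneq (A ij.1 ij.2) 0.
  by apply: (@sub_finite_set _ _ set0) => // P [].
apply: sub_finite_set (nonunit_finite n0) => P /= [_]; exact.
Qed.

(** The line bundle of f is isomorphic to the trivial one, so by Riemann-Roch
    it has degree zero. *)
Lemma product_formula (f1 : K) : f1 != 0 -> \sum_(P \in [set: point X]) ord P f1 = 0.
Proof.
move=> n1.
pose g f P : 'M[K]_1 := if `[< unit_at P f >] then 1%:M else f%:M.
have gE f P : f != 0 -> exists u, unit_at P u /\ g f P = (u * f)%:M.
  move=> f0; rewrite /g; case: asboolP => h; last by exists 1; rewrite mul1r; split=> //; exact: unit1.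
  by exists f^-1; rewrite mulVf //; split=> //; exact: unitV.
have gU f : f != 0 -> forall P, g f P \in unitmx.
  move=> f0 P; have [u [uu ->]] := gE f P f0.
  by rewrite unitmxE det_scalar1 unitfE mulf_neq0 // (unit_neq0 uu).
have gf f : f != 0 -> finite_set [set P | g f P <> 1%:M].
  by move=> f0; apply: sub_finite_set (nonunit_finite f0) => P /=; rewrite /g; case: asboolP.
pose L f f0 := Bun (gU f f0) (gf f f0).
have LP f f0 h h0 P A : homL (L f f0) (L h h0) P A <-> regular_at P (f * A 0 0 / h).
  have [u [uu eu]] := gE f P f0; have [v [uv ev]] := gE h P h0.
  have e : g f P *m A *m invmx (g h P) = (u / v * (f * A 0 0 / h))%:M.
    rewrite eu ev invmx_scalar [A]mx11_scalar -!scalar_mxM mxE eqxx mulr1n; congr _%:M.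
    by field; rewrite h0 (unit_neq0 uv).
  have w : unit_at P (u / v) by apply: unitM => //; exact: unitV.
  rewrite /homL /= e; split=> [/(_ 0 0)|r i j].
    rewrite mxE eqxx mulr1n => r; rewrite -(mulKf (unit_neq0 w) (f * _ / h)).
    apply: regM r; exact: unit_reg (unitV w).
  by rewrite !ord1 mxE eqxx mulr1n; apply: regM r; exact: unit_reg.
have d1 f f0 h (hn : h != 0) : h0 (L f f0) (L h hn) 1.
  apply: (@qdim_of_basis _ _ C _ 1 _ (fun=> (h / f)%:M)) => [|_ P|A hA]; first exact: ksub_H0.
    by apply/LP; rewrite mxE eqxx mulrCA divff // mulr1 divff //; exact: reg1.
  have [c ec] : exists c, f * A 0 0 / h = C c by apply: const_regular => P; exact: (LP f f0 h hn P A).1.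
  have eA : A = (C c * (h / f))%:M.
    by rewrite -ec {1}[A]mx11_scalar; congr _%:M; field; rewrite f0 hn.
  exists c%:M; split=> [|d]; rewrite /klin big_ord1 scale_scalar_mx; first by rewrite mxE eqxx mulr1n.
  have hf : h / f != 0 by rewrite mulf_neq0 ?invr_eq0.
  rewrite eA => /matrixP /(_ 0 0); rewrite !mxE eqxx !mulr1n => /(mulIf hf) /fmorph_inj ->.
  by rewrite -mx11_scalar.
have dL f f0 : deg (L f f0) = - \sum_(P \in [set: point X]) ord P f.
  rewrite /deg; congr (- _); apply: eq_fsbigr => P _; rewrite /= /g.
  case: asboolP => [u|_]; last by rewrite det_scalar1.
  by rewrite det1 !ord_unit //; exact: unit1.
have dO : deg (L 1 (oner_neq0 _)) = 0.
  by apply: deg_triv => P /=; rewrite /g; case: ifP.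
have := h0_chi (d1 1 (oner_neq0 _) f1 n1) (d1 f1 n1 1 (oner_neq0 _)).
by rewrite dO dL subrr mulr0 subr0 mul1r => /esym/eqP; rewrite oppr_eq0 => /eqP.
Qed.

Lemma sum_ord_div (f : K) (h : point X -> int) (E : bun) : f != 0 ->
  (forall P, h P = ord P f - ord P (\det (gen E P))) -> \sum_(P \in [set: point X]) h P = deg E.
Proof.
move=> f0 hE.
have fin : finite_set ([set P | gen E P <> 1%:M] `|` [set P | ~ unit_at P f]).
  by rewrite finite_setU; split; [exact: gen_fin|exact: (nonunit_finite)].
have /finite_seqP [s es] := fin; have us := undup_uniq s.
have hs P : (gen E P <> 1%:M \/ ~ unit_at P f) -> P \in undup s.
  by move=> h1; have : [set` s] P; [rewrite -es|rewrite /= mem_undup].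
have hf P : ord P f != 0 -> P \in undup s.
  by move=> h1; apply: hs; right=> u; move: h1; rewrite (ord_unit u) eqxx.
rewrite (deg_seq us) => [|P h1]; last by apply: hs; left.
rewrite (fsum_seq us) => [|P]; last first.
  rewrite hE; have [e1|n1] := pselect (gen E P = 1%:M); last by move=> _; apply: hs; left.
  by rewrite e1 det1 (ord_unit (unit1 P)) subr0; exact: hf.
rewrite (eq_bigr _ (fun P _ => hE P)) sumrB -[X in X - _](fsum_seq us) //.
by rewrite product_formula // sub0r.
Qed.

End Lattices.

Section Exact.
Implicit Types (P Q : point X) (E F G I J : bun).

(** * Exact sequences of bundles *)

Definition onto E F (A : 'M[K]_(rk E, rk F)) : Prop :=
  forall P v, lat F P v -> exists2 u, lat E P u & v = u *m A.

(** The condition on lattices says that J is saturated in E. *)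
Definition exact_seq J E F (B : 'M[K]_(rk J, rk E)) (A : 'M[K]_(rk E, rk F)) : Prop :=
  [/\ row_free B, forall v : 'rV_(rk E), v *m A = 0 <-> exists w, v = w *m B,
      H0 E F A, onto A & forall P w, lat J P w <-> lat E P (w *m B)].

Lemma lat_good E P v : gen E P = 1%:M -> lat E P v <-> imx P v.
Proof. by move=> e; rewrite /lat /= e invmx1 mulmx1. Qed.

Lemma sub_lattice E n (B : 'M[K]_(n, rk E)) : row_free B ->
  exists (g : point X -> 'M[K]_n) (gU : forall P, g P \in unitmx)
    (gf : finite_set [set P | g P <> 1%:M]),
    forall P w, lat E P (w *m B) <-> lat (Bun gU gf) P w.
Proof.
move=> fB; have fB1 : B *m pinvmx B = 1%:M by exact: mulmxVp.
pose L P : set 'rV[K]_n := [set w | lat E P (w *m B)].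
have hL P : is_lattice P (L P).
  split=> [u v hu hv|c v hc hv||]; rewrite /=.
  - by rewrite /L /= mulmxDl; exact: latD.
  - by rewrite /L /= -scalemxAl; exact: lat_reg.
  - have [N hN] := imx_pole P (gen E P *m pinvmx B); exists N => w /= /lat_span [c ic ew].
    have -> : w = c *m (gen E P *m pinvmx B) by rewrite mulmxA -ew -mulmxA fB1 mulmx1.
    by rewrite scalemxAr; apply: imxM => //; exact: hN.
  - have [N hN] := imx_pole P (B *m invmx (gen E P)); exists N => w iw /=.
    by rewrite /L /lat /= -scalemxAl -scalemxAl -mulmxA scalemxAr; apply: imxM => //; exact: hN.
suff fL : finite_set [set P | ~ forall v, L P v <-> imx P v].
  by have [g [gU [gf h]]] := bundle_of_lattices hL fL; exists g, gU, gf.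
apply: (@sub_finite_set _ _ ([set P | gen E P <> 1%:M] `|` ([set P | ~ imx P B] `|`
   [set P | ~ imx P (pinvmx B)]))); last first.
  rewrite !finite_setU; split; first exact: gen_fin.
  by split; exact: pole_finite.
move=> P /= h; apply: contrapT => /not_orP [/contrapT e /not_orP [/contrapT iB /contrapT iB']].
apply: h => v; rewrite /L /= lat_good //; split=> h; last exact: imxM.
by rewrite -(mulmx1 v) -fB1 mulmxA; exact: imxM.
Qed.

Lemma kernel_bundle E F (A : 'M[K]_(rk E, rk F)) : H0 E F A -> onto A ->
  exists J B, @exact_seq J E F B A.
Proof.
move=> hA oA; have fB : row_free (row_base (kermx A)) by exact: row_base_free.
have [g [gU [gf hg]]] := sub_lattice fB; exists (Bun gU gf), (row_base (kermx A)).
split=> // [v|P w]; last by rewrite -hg.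
split=> [/eqP h|[w ->]].
  have /submxP [D ->] : (v <= row_base (kermx A))%MS by rewrite eq_row_base; apply/sub_kermxP/eqP.
  by exists D.
by apply/sub_kermxP; rewrite (submx_trans (submxMl _ _)) // eq_row_base.
Qed.

(** The image of a homomorphism, with generic fibre the row space. *)
Lemma image_bundle E F (A : 'M[K]_(rk E, rk F)) : H0 E F A ->
  exists I (A1 : 'M[K]_(rk E, rk I)) (A2 : 'M[K]_(rk I, rk F)),
    [/\ A = A1 *m A2, row_free A2, H0 E I A1, onto A1 & H0 I F A2].
Proof.
move=> hA; pose r := \rank A; pose A1 : 'M[K]_(_, r) := col_base A.
have eA : A1 *m row_base A = A by exact: mulmx_base.
have f1 : row_full A1 by exact: col_base_full.
pose S := pinvmx A1; have S1 : S *m A1 = 1%:M by exact: mulVpmx.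
have [g [gU [gf hg]]] : exists (g : point X -> 'M[K]_r) (gU : forall P, g P \in unitmx)
    (gf : finite_set [set P | g P <> 1%:M]),
    forall P v, (exists2 u, lat E P u & v = u *m A1) <-> lat (Bun gU gf) P v.
  pose L P : set 'rV[K]_r := [set v | exists2 u, lat E P u & v = u *m A1].
  have hL P : is_lattice P (L P).
    split=> [_ _ [u hu ->] [v hv ->]|c _ hc [u hu ->]||].
    - by exists (u + v); [exact: latD|rewrite mulmxDl].
    - by exists (c *: u); [exact: lat_reg|rewrite scalemxAl].
    - have [N hN] := imx_pole P (gen E P *m A1); exists N => _ [u /lat_span [c ic ->] ->].
      by rewrite -mulmxA scalemxAr; apply: imxM => //; exact: hN.
    - have [N hN] := imx_pole P (S *m invmx (gen E P)); exists N => v iv /=.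
      exists (tau P ^+ N *: (v *m S)); last by rewrite -scalemxAl -mulmxA S1 mulmx1.
      by rewrite /lat /= -scalemxAl -mulmxA scalemxAr; apply: imxM => //; exact: hN.
  suff fL : finite_set [set P | ~ forall v, L P v <-> imx P v].
    by have [g [gU [gf h]]] := bundle_of_lattices hL fL; exists g, gU, gf.
  apply: (@sub_finite_set _ _ ([set P | gen E P <> 1%:M] `|` ([set P | ~ imx P A1] `|`
     [set P | ~ imx P S]))); last first.
    rewrite !finite_setU; split; first exact: gen_fin.
    by split; exact: pole_finite.
  move=> P /= h; apply: contrapT => /not_orP [/contrapT e /not_orP [/contrapT iB /contrapT iB']].
  apply: h => v; split=> [[u hu ->]|iv].
    by apply: imxM => //; apply/(lat_good _ e).
  exists (v *m S); first by apply/(lat_good _ e); exact: imxM.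
  by rewrite -mulmxA S1 mulmx1.
pose I := Bun gU gf; exists I, A1, (row_base A).
split=> //; first exact: row_base_free.
- by move=> P; apply: lat_homL => v hv; apply/hg; exists v.
- by move=> P v /hg.
- move=> P; apply: lat_homL => _ /hg [u hu ->]; rewrite -mulmxA eA; exact: homL_lat (hA P) hu.
Qed.

Section Sections.
Variables (J E F : bun) (B : 'M[K]_(rk J, rk E)) (A : 'M[K]_(rk E, rk F)).
Hypothesis ex : exact_seq B A.

Lemma exact_H0 : H0 J E B.
Proof. by case: ex => _ _ _ _ h P; apply: lat_homL => w /h. Qed.

Lemma exact_kill m (D : 'M[K]_(m, rk E)) : D *m A = 0 -> exists D', D = D' *m B.
Proof.
case: ex => fB h _ _ _ e; exists (D *m pinvmx B); rewrite mulmxKpV //; apply/row_subP => i.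
have : row i D *m A = 0 by rewrite -row_mul e row0.
by move=> /h [w ->]; exact: submxMl.
Qed.

Lemma exact_comp0 : B *m A = 0.
Proof.
by apply/row_matrixP => i; rewrite row_mul row0; case: ex => _ h _ _ _; apply/h; exists (delta_mx 0 i); rewrite rowE.
Qed.

Lemma local_section P : exists2 S, homL F E P S & S *m A = 1%:M.
Proof.
case: ex => _ _ _ oA _.
have /choice [u hu] i : exists u, lat E P u /\ row i (gen F P) = u *m A.
  by have [u hu e] := oA P _ (lat_gen P i); exists u.
pose U : 'M[K]_(_, _) := \matrix_i u i.
have UA : U *m A = gen F P.
  by apply/row_matrixP => i; rewrite row_mul rowK; case: (hu i).
exists (invmx (gen F P) *m U); last by rewrite -mulmxA UA mulVmx ?gen_unit.
rewrite /homL /= mulmxA mulmxV ?gen_unit // mul1mx.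
by apply/imx_row => i; rewrite row_mul rowK; case: (hu i).
Qed.

(** A section over the whole affine curve: the poles of any rational section
    are removed one at a time, by strong approximation in Hom(F, J). *)
Lemma affine_section : exists2 S, Laff F E S & S *m A = 1%:M.
Proof.
have [S0 _ S0A] := local_section pinf.
have fin : finite_set [set P | ~ homL F E P S0].
  apply: (@sub_finite_set _ _ ([set P | gen F P <> 1%:M \/ gen E P <> 1%:M] `|` [set P | ~ imx P S0])).
    move=> P /= h; apply: contrapT => /not_orP [/not_orP [/contrapT e1 /contrapT e2] /contrapT i].
    by apply: h; apply/homL_good.
  by rewrite finite_setU; split; [exact: bad_finite|exact: pole_finite].
have /finite_seqP [s es] := fin.
have : forall P, P <> pinf -> ~ homL F E P S0 -> P \in s.
  by move=> P _ h; have : [set P | ~ homL F E P S0] P by []; rewrite es.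
elim: s {es fin} S0 S0A => [|P s IH] S0 S0A hs.
  by exists S0 => // P nP; apply: contrapT => /(hs _ nP).
have [eP|nP] := pselect (P = pinf).
  apply: (IH S0) => // Q nQ /(hs _ nQ); rewrite inE => /orP [/eqP e|//].
  by case: nQ; rewrite e.
have [S hS SA] := local_section P.
have [T eT] : exists T, S - S0 = T *m B.
  by apply: exact_kill; rewrite mulmxBl SA S0A subrr.
have [N hN] := homL_bound F J.
have [T' [[D iD eD] hT']] := approx_homL (E := F) (F := J) T N nP.
apply: (IH (S0 + T' *m B)).
  by rewrite mulmxDl S0A -mulmxA exact_comp0 mulmx0 addr0.
move=> Q nQ hQ.
have QP : Q <> P.
  move=> e; subst Q; apply: hQ.
  have -> : S0 + T' *m B = S + (T' - T) *m B.
    by rewrite mulmxBl -eT opprB addrCA [S + _]addrC subrK addrC.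
  apply: homLD => //; rewrite eD; apply: homL_comp (exact_H0 P).
  exact: hN.
have : Q \in P :: s.
  apply: hs => // h; apply: hQ; apply: homLD => //.
  exact: homL_comp (hT' Q nQ QP) (exact_H0 Q).
by rewrite inE => /orP [/eqP|].
Qed.

Lemma exact_rk : rk E = (rk J + rk F)%N.
Proof.
have [S _ SA] := local_section pinf; have [fB h _ _ _] := ex.
have fA : \rank A = rk F.
  apply/eqP; rewrite -[_ == _]/(row_full A); apply/row_fullP; by exists S.
have rB : (B :=: kermx A)%MS.
  apply/eqmxP/andP; split; first by apply/sub_kermxP; exact: exact_comp0.
  by have [D ->] := exact_kill (mulmx_ker A); exact: submxMl.
have := mxrank_ker A; rewrite -rB fA (eqP fB) => ->; rewrite subnK // -fA; exact: rank_leq_row.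
Qed.

End Sections.

(** A local section turns frames of J and F into a frame of E, which is block
    triangular in a fixed basis M0 of the generic fibre. So the degrees differ
    by the sum of the orders of det M0, which is zero. *)
Lemma exact_deg J E F (B : 'M[K]_(rk J, rk E)) (A : 'M[K]_(rk E, rk F)) :
  exact_seq B A -> deg E = deg J + deg F.
Proof.
move=> ex; have e := exact_rk ex; case: E B A ex e => n g gU gf B A ex /= e; subst n.
set E := Bun gU gf in B A ex *.
have [fB kA hA oA lJ] := ex; have fB1 : B *m pinvmx B = 1%:M by exact: mulmxVp.
have [S0 _ S0A] := local_section ex pinf.
pose M0 : 'M[K]_(rk J + rk F) := col_mx B S0.
have d0 : \det M0 != 0.
  have : M0 *m row_mx (pinvmx B) A = block_mx 1%:M 0 (S0 *m pinvmx B) 1%:M.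
    by rewrite mul_col_row fB1 (exact_comp0 ex) S0A.
  move=> /(congr1 determinant); rewrite det_mulmx det_lblock !det1 mulr1 => h.
  by apply: contra_eq_neq h => ->; rewrite mul0r eq_sym oner_eq0.
have ordE P : ord P (\det (g P)) = ord P (\det (gen J P)) + ord P (\det (gen F P)) + ord P (\det M0).
  have [S hS SA] := local_section ex P.
  have [T eT] : exists T, S - S0 = T *m B.
    by apply: (exact_kill ex); rewrite mulmxBl SA S0A subrr.
  pose G : 'M[K]_(rk J + rk F) := col_mx (gen J P *m B) (gen F P *m S).
  have eG : G = block_mx (gen J P) 0 (gen F P *m T) (gen F P) *m M0.
    rewrite mul_block_col mul0mx addr0 -mulmxA -eT -mulmxDr; congr (col_mx _ (_ *m _)).
    by rewrite subrK.
  have dJ : \det (gen J P) != 0 by rewrite -unitfE -unitmxE gen_unit.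
  have dF : \det (gen F P) != 0 by rewrite -unitfE -unitmxE gen_unit.
  have dG : \det G = \det (gen J P) * \det (gen F P) * \det M0 by rewrite eG det_mulmx det_lblock.
  have uG : G \in unitmx by rewrite unitmxE unitfE dG !mulf_neq0.
  have gU' : gl P (G *m invmx (g P)).
    split; first by rewrite unitmx_mul uG unitmx_inv gU.
      rewrite mul_col_mx => i j; rewrite mxE; case: fintype.split => a.
        have : lat E P (row a (gen J P) *m B) by apply/lJ; exact: lat_gen.
        by move=> /(_ 0 j); rewrite -row_mul /= -row_mul mxE.
      have : lat E P (row a (gen F P) *m S) by apply: homL_lat hS _; exact: lat_gen.
      by move=> /(_ 0 j); rewrite -row_mul /= -row_mul mxE.
    rewrite invmx_mul ?unitmx_inv // invmxK; apply/imx_row => i; rewrite row_mul.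
    have li : lat E P (row i (g P)) := lat_gen (E := E) P i.
    move: (row i (g P)) li => v li.
    have [c2 ic2 e2] := lat_span (homL_lat (hA P) li).
    have /kA [w ew] : (v - c2 *m gen F P *m S) *m A = 0.
      by rewrite mulmxBl -[X in _ - X]mulmxA SA mulmx1 e2 subrr.
    have : lat E P (w *m B).
      rewrite -ew; apply: latB => //; apply: homL_lat hS _.
      by rewrite /lat /= mulmxK ?gen_unit.
    move=> /lJ /lat_span [c1 ic1 e1].
    have -> : v = row_mx c1 c2 *m G.
      by rewrite mul_row_col !mulmxA -e1 -ew subrK.
    by rewrite mulmxK //; apply/imx_row_mx.
  have -> : ord P (\det (g P)) = ord P (\det (G *m invmx (g P) *m g P)) by rewrite det_unitr.
  by rewrite mulmxKV // dG !ordM // mulf_neq0.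
have fin : finite_set ([set P | gen E P <> 1%:M] `|` ([set P | gen J P <> 1%:M] `|`
   ([set P | gen F P <> 1%:M] `|` [set P | ~ unit_at P (\det M0)]))).
  rewrite !finite_setU; do !split; try exact: gen_fin; exact: (nonunit_finite).
have /finite_seqP [s es] := fin.
have hs P : (gen E P <> 1%:M \/ gen J P <> 1%:M \/ gen F P <> 1%:M \/ ~ unit_at P (\det M0)) -> P \in undup s.
  move=> h; have : [set` s] P by rewrite -es.
  by rewrite /= mem_undup.
have us := undup_uniq s.
rewrite !(deg_seq us); try by move=> P h; apply: hs; tauto.
have := product_formula d0; rewrite (fsum_seq us); last first.
  move=> P h; apply: hs; do 3 right; move=> u; move: h.
  by rewrite ord_unit // eqxx.
rewrite (eq_bigr _ (fun P _ => ordE P)) !big_split /= => ->; rewrite addr0 opprD; congr (- _ - _); exact: eq_bigr.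
Qed.

(** * Direct sums *)

Definition biproduct E F S (i1 : 'M[K]_(rk E, rk S)) (p1 : 'M[K]_(rk S, rk E))
    (i2 : 'M[K]_(rk F, rk S)) (p2 : 'M[K]_(rk S, rk F)) : Prop :=
  [/\ [/\ H0 E S i1, H0 S E p1, H0 F S i2 & H0 S F p2],
      [/\ i1 *m p1 = 1%:M, i2 *m p2 = 1%:M, i1 *m p2 = 0 & i2 *m p1 = 0]
    & p1 *m i1 + p2 *m i2 = 1%:M].

Lemma biproduct_exact E F S i1 p1 i2 p2 : @biproduct E F S i1 p1 i2 p2 -> exact_seq i1 p2.
Proof.
move=> [[h1 h2 h3 h4] [e1 e2 e3 e4] e]; split=> // [|v|P v hv|P w].
- by apply/row_freeP; exists p1.
- split=> [v0|[w ->]]; last by rewrite -mulmxA e3 mulmx0.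
  by exists (v *m p1); rewrite -[LHS]mulmx1 -e mulmxDr !mulmxA v0 mul0mx addr0.
- by exists (v *m i2); [exact: homL_lat (h3 P) hv|rewrite -mulmxA e2 mulmx1].
- split=> h; first exact: homL_lat (h1 P) h.
  by have := homL_lat (h2 P) h; rewrite -mulmxA e1 mulmx1.
Qed.

Lemma biproduct_exists E F : exists S i1 p1 i2 p2, @biproduct E F S i1 p1 i2 p2.
Proof.
pose g P : 'M[K]_(rk E + rk F) := block_mx (gen E P) 0 0 (gen F P).
have gU P : g P \in unitmx.
  by rewrite unitmxE det_ublock unitrM -!unitmxE !gen_unit.
have gf : finite_set [set P | g P <> 1%:M].
  apply: sub_finite_set (bad_finite E F) => P /= h; apply: contrapT => /not_orP [/contrapT e1 /contrapT e2].
  by apply: h; rewrite /g e1 e2 -scalar_mx_block.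
pose S := Bun gU gf.
exists S, (row_mx 1%:M 0), (col_mx 1%:M 0), (row_mx 0 1%:M), (col_mx 0 1%:M).
have iu P (n m : nat) (A : 'M[K]_(n, m)) : imx P A -> imx P A by [].
split; first split=> P; rewrite /homL /=.
- have -> : gen E P *m row_mx 1%:M 0 = row_mx 1%:M 0 *m g P.
    by rewrite mul_mx_row mul_row_block !mul1mx !mulmx1 !mulmx0 !mul0mx !addr0.
  by rewrite mulmxK ?gU //; apply/imx_row_mx; split; [exact: imx1|exact: imx0].
- rewrite mul_block_col mulmx1 !mulmx0 mul0mx !addr0 mul_col_mx mulmxV ?gen_unit // mul0mx.
  by move=> i j; rewrite mxE; case: fintype.split => a; [exact: imx1|exact: imx0].
- have -> : gen F P *m row_mx 0 1%:M = row_mx 0 1%:M *m g P.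
    by rewrite mul_mx_row mul_row_block !mul1mx !mulmx1 !mulmx0 !mul0mx !add0r.
  by rewrite mulmxK ?gU //; apply/imx_row_mx; split; [exact: imx0|exact: imx1].
- rewrite mul_block_col !mulmx1 !mulmx0 !add0r mul_col_mx mulmxV ?gen_unit // mul0mx.
  by move=> i j; rewrite mxE; case: fintype.split => a; [exact: imx0|exact: imx1].
- by split; rewrite mul_row_col ?mul0mx ?mulmx0 ?mul1mx ?addr0 ?add0r.
- rewrite !mul_col_mx !mul1mx !mul0mx add_col_mx addr0 add0r.
  by rewrite /S /= [RHS]scalar_mx_block.
Qed.

Definition power E n S (i : 'I_n -> 'M[K]_(rk E, rk S)) (p : 'I_n -> 'M[K]_(rk S, rk E)) : Prop :=
  [/\ forall a, H0 E S (i a), forall a, H0 S E (p a),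
      forall a b, i a *m p b = (a == b)%:R%:M & \sum_a p a *m i a = 1%:M].

Lemma power_exists E n : exists S (i : 'I_n -> 'M[K]_(rk E, rk S)) p,
  [/\ power i p, rk S = (n * rk E)%N & deg S = n%:Z * deg E].
Proof.
elim: n => [|n [S [i [p [[hi hp e1 e2] rS dS]]]]].
  exists (triv 0), (fun=> 0), (fun=> 0); split=> //; first split=> //; try by case.
    by apply/matrixP => [[]].
  by rewrite deg_triv // mul0r.
have [T [i1 [p1 [i2 [p2 bp]]]]] := biproduct_exists E S.
have ex := biproduct_exact bp; have [[h1 h2 h3 h4] [f1 f2 f3 f4] f] := bp.
pose I a := if unlift ord0 a is Some b then i b *m i2 else i1.
pose Q a := if unlift ord0 a is Some b then p2 *m p b else p1.
exists T, I, Q; split; last first.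
- by rewrite (exact_deg ex) dS; lia.
- by rewrite (exact_rk ex) rS mulSn.
split.
- by move=> a P; rewrite /I; case: unliftP => [b _|_]; [apply: homL_comp (hi b P) (h3 P)|].
- by move=> a P; rewrite /Q; case: unliftP => [b _|_]; [apply: homL_comp (h4 P) (hp b P)|].
- move=> a b; rewrite /I /Q; case: unliftP => [a' ->|->]; case: unliftP => [b' ->|->].
  + by rewrite mulmxA -(mulmxA (i a')) f2 mulmx1 e1 (inj_eq lift_inj).
  + by rewrite -mulmxA f4 mulmx0 raddf0.
  + by rewrite mulmxA f3 mul0mx raddf0.
  + by rewrite f1 eqxx.
rewrite big_ord_recl {1}/I {1}/Q unlift_none -f; congr (_ + _).
rewrite (eq_bigr (fun a => p2 *m (p a *m i a) *m i2)) => [|a _].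
  by rewrite -mulmx_suml -mulmx_sumr e2 mulmx1.
by rewrite /I /Q liftK !mulmxA.
Qed.

Section Power.
Variables (E S : bun) (n : nat) (i : 'I_n -> 'M[K]_(rk E, rk S)) (p : 'I_n -> 'M[K]_(rk S, rk E)).
Hypothesis pw : power i p.

Lemma power_ip m (f : 'I_n -> 'M[K]_(rk E, m)) a : i a *m (\sum_b p b *m f b) = f a.
Proof.
have [_ _ e _] := pw.
rewrite mulmx_sumr (bigD1 a) //= mulmxA e eqxx mul1mx big1 ?addr0 // => b ne.
by rewrite mulmxA e eq_sym (negPf ne) raddf0 mul0mx.
Qed.

Lemma power_tp m (t : 'I_n -> 'M[K]_(m, rk E)) b : (\sum_a t a *m i a) *m p b = t b.
Proof.
have [_ _ e _] := pw.
rewrite mulmx_suml (bigD1 b) //= -mulmxA e eqxx mulmx1 big1 ?addr0 // => a ne.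
by rewrite -mulmxA e (negPf ne) raddf0 mulmx0.
Qed.

Lemma power_vi m (v : 'M[K]_(m, rk S)) : \sum_a (v *m p a) *m i a = v.
Proof.
have [_ _ _ e] := pw; rewrite -[RHS]mulmx1 -e mulmx_sumr.
by apply: eq_bigr => a _; rewrite mulmxA.
Qed.

Lemma power_iD m (D : 'M[K]_(rk S, m)) : \sum_a p a *m (i a *m D) = D.
Proof.
have [_ _ _ e] := pw; rewrite -[RHS]mul1mx -e mulmx_suml.
by apply: eq_bigr => a _; rewrite mulmxA.
Qed.

End Power.

(** * Simple bundles *)

Definition simple E : Prop :=
  (0 < rk E)%N /\ forall A, H0 E E A -> exists c, A = (C c)%:M.

Lemma h0_0P E F : h0 E F 0 <-> forall A, H0 E F A -> A = 0.
Proof.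
split=> [[phi [_ _ h]] A hA|h]; first by apply/(h A hA)/rowP => [[]].
exists (fun=> 0); split=> [c u v _ _|w|v /h ->]; first by rewrite scaler0 addr0.
  by exists 0; [exact: (ksub0 (ksub_H0 E F))|apply/rowP => [[]]].
by [].
Qed.

Lemma h0_basis E F n : h0 E F n -> exists f : 'I_n -> 'M[K]_(rk E, rk F), basis C (H0 E F) f.
Proof. by move=> h; exact: qdim_set0 h (ksub_H0 E F). Qed.

Lemma simple_h0 E : simple E -> h0 E E 1.
Proof.
move=> [r0 h]; apply: (@qdim_of_basis _ _ C _ 1 _ (fun=> 1%:M)) => [||A /h [c ->]].
- exact: ksub_H0.
- by move=> _ P; exact: homL1.
exists c%:M; split.
  by rewrite /klin big_ord1 mxE eqxx mulr1n scalemx1.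
move=> d; rewrite /klin big_ord1 scalemx1 => /matrixP /(_ (Ordinal r0) (Ordinal r0)).
by rewrite !mxE eqxx !mulr1n => /fmorph_inj ->; rewrite -mx11_scalar.
Qed.

Lemma h0_simple E : (0 < rk E)%N -> h0 E E 1 -> simple E.
Proof.
move=> r0 h; split=> // A hA; have [f [hf fb]] := h0_basis h.
have hI : H0 E E 1%:M by move=> P; exact: homL1.
have [c [ec _]] := fb _ hI; have [a [ea _]] := fb _ hA.
rewrite /klin big_ord1 in ec; rewrite /klin big_ord1 in ea.
have c0 : c 0 0 != 0.
  apply/eqP => c0; move: ec; rewrite c0 rmorph0 scale0r => /matrixP /(_ (Ordinal r0) (Ordinal r0)).
  by rewrite !mxE eqxx => /eqP; rewrite oner_eq0.
exists (a 0 0 / c 0 0).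
rewrite -scalemx1 ec scalerA -rmorphM divfK //.
Qed.

(** * Mutations *)

(** Exactness of 0 -> G -> E^n -> F -> 0 is required on generic fibres and on
    lattices. *)
Definition mutates E F G n (f : 'I_n -> 'M[K]_(rk E, rk F)) (g : 'I_n -> 'M[K]_(rk G, rk E)) : Prop :=
  [/\ basis C (H0 E F) f,
      forall P v, lat F P v -> exists2 t : 'I_n -> 'rV[K]_(rk E),
        (forall i, lat E P (t i)) & v = \sum_i t i *m f i,
      forall t : 'I_n -> 'rV[K]_(rk E), \sum_i t i *m f i = 0 <->
        exists s, forall i, t i = s *m g i,
      forall s : 'rV[K]_(rk G), (forall i, s *m g i = 0) -> s = 0
    & forall P s, lat G P s <-> forall i, lat E P (s *m g i)].

Section Mutation.
Variables (E F : bun) (n : nat).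
Hypotheses (sE : simple E) (sF : simple F) (hFE : h0 F E 0) (hEF : h0 E F n)
  (rEF : (rk F < n * rk E)%N).
Variables (f : 'I_n -> 'M[K]_(rk E, rk F)).
Hypothesis (fb : basis C (H0 E F) f).
Variables (S : bun) (i : 'I_n -> 'M[K]_(rk E, rk S)) (p : 'I_n -> 'M[K]_(rk S, rk E)).
Hypotheses (pw : power i p) (rS : rk S = (n * rk E)%N).

Let A : 'M[K]_(rk S, rk F) := \sum_a p a *m f a.

Lemma ev_H0 : H0 S F A.
Proof.
have [_ hp _ _] := pw; have [hf _] := fb.
by move=> P; apply: homL_sum => a; exact: homL_comp (hp a P) (hf a P).
Qed.

Lemma i_ev a : i a *m A = f a. Proof. exact: power_ip. Qed.

(** As E is simple, the endomorphisms of E^n are the matrices over k. *)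
Definition smat (c : 'M[k]_n) : 'M[K]_(rk S) := \sum_a \sum_b C (c a b) *: (p a *m i b).

Lemma smat_ev c : smat c *m A = \sum_a p a *m klin C (row a c) f.
Proof.
rewrite mulmx_suml; apply: eq_bigr => a _; rewrite mulmx_suml mulmx_sumr.
by apply: eq_bigr => b _; rewrite -scalemxAl -mulmxA i_ev mxE scalemxAr.
Qed.

Lemma smat_H0 c : H0 S S (smat c).
Proof.
have [hi hp _ _] := pw => P; apply: homL_sum => a; apply: homL_sum => b.
by apply: homL_reg; [exact: regC|exact: homL_comp (hp a P) (hi b P)].
Qed.

Lemma H0_ev D : H0 S F D -> exists c, D = smat c *m A.
Proof.
have [hi hp _ _] := pw; have [hf hb] := fb => hD.
have /choice [c hc] a : exists c : 'rV[k]_n, i a *m D = klin C c f.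
  have /hb [c [e _]] : H0 E F (i a *m D) by move=> P; exact: homL_comp (hi a P) (hD P).
  by exists c.
exists (\matrix_a c a); rewrite smat_ev -{1}(power_iD pw D).
by apply: eq_bigr => a _; rewrite rowK hc.
Qed.

Lemma smat_end D : H0 S S D -> exists c, D = smat c.
Proof.
have [hi hp _ _] := pw => hD.
have /choice [c hc] (ab : 'I_n * 'I_n) : exists c, i ab.1 *m D *m p ab.2 = (C c)%:M.
  by apply: (proj2 sE) => P; exact: homL_comp (homL_comp (hi _ P) (hD P)) (hp _ P).
exists (\matrix_(a, b) c (a, b)); rewrite /smat -{1}(power_iD pw D).
apply: eq_bigr => a _; rewrite -{1}(power_vi pw (i a *m D)) mulmx_sumr.
by apply: eq_bigr => b _; rewrite mxE (hc (a, b)) mul_scalar_mx scalemxAr.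
Qed.

Lemma smat_inj c c' : smat c *m A = smat c' *m A -> c = c'.
Proof.
move=> h; apply/row_matrixP => a.
have : klin C (row a c) f = klin C (row a c') f.
  have ip (d : 'M[k]_n) : i a *m (smat d *m A) = klin C (row a d) f.
    by rewrite smat_ev (power_ip pw).
  by rewrite -!ip h.
move=> /eqP; rewrite -subr_eq0 -sumrB => /eqP h0.
suff /eqP : row a c - row a c' = 0 by rewrite subr_eq0 => /eqP.
apply: (basis_free (ksub_H0 E F) fb); rewrite -[RHS]h0; apply: eq_bigr => b _.
by rewrite !mxE rmorphB scalerBl.
Qed.

Lemma smat1 : smat 1%:M = 1%:M.
Proof.
have [_ _ _ <-] := pw; apply: eq_bigr => a _.
rewrite (bigD1 a) //= mxE eqxx rmorph1 scale1r big1 ?addr0 // => b ne.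
by rewrite mxE eq_sym (negPf ne) rmorph0 scale0r.
Qed.

(** Surjectivity of the evaluation map.  The extension of its image I by its
    kernel is given by the difference of a section at infinity and a section
    over the affine curve; it pairs to zero with Hom(E^n, F), because every
    homomorphism E^n -> F is a k-linear combination of the coordinates of the
    evaluation map.  By duality this yields a homomorphism F -> I, which is
    not zero as otherwise I would be a direct summand of E^n. *)
Lemma ev_onto : onto A.
Proof.
have [I [A1 [A2 [eA fA2 hA1 oA1 hA2]]]] := image_bundle ev_H0.
have [J [B ex]] := kernel_bundle hA1 oA1.
have [Ci hCi eCi] := local_section ex pinf.
have [Ca hCa eCa] := affine_section ex.
have A2V : A2 *m pinvmx A2 = 1%:M by exact: mulmxVp.
have lam0 D : H0 S F D -> lam (\tr (pinvmx A2 *m (Ci - Ca) *m D)) = 0.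
  move=> /H0_ev [c ->]; set T := smat c.
  have -> : \tr (pinvmx A2 *m (Ci - Ca) *m (T *m A)) = \tr (Ci *m (T *m A1)) - \tr (Ca *m (T *m A1)).
    rewrite eA -mulmxA mxtrace_mulC -raddfB /= -mulmxBl.
    by congr (\tr _); rewrite -!mulmxA A2V mulmx1.
  rewrite lamB lam_inf; last first.
    apply: homL_tr hCi _; exact: homL_comp (smat_H0 c _) (hA1 _).
  rewrite -raddfN /= -mulNmx lam_A ?addr0 //; apply: (affine_regular_inA) => P nP.
  apply: homL_tr (homLN (hCa P nP)) _; exact: homL_comp (smat_H0 c _) (hA1 _).
have [w1 [w2 [hw1 hw2 ew]]] := serre_duality lam0.
have ee : w1 *m A1 = - (w2 *m A1).
  apply/eqP; rewrite -subr_eq0 opprK -mulmxDl -ew -mulmxA mulmxBl eCi eCa subrr mulmx0 //.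
have he : H0 F I (w1 *m A1).
  move=> P; have [->|nP] := pselect (P = pinf); first exact: homL_comp hw1 (hA1 _).
  rewrite ee; apply: homLN; exact: homL_comp (hw2 P nP) (hA1 _).
have hee : H0 F F (w1 *m A1 *m A2) by move=> P; exact: homL_comp (he P) (hA2 P).
have [c ec] := proj2 sF _ hee.
have c0 : c != 0.
  apply/eqP => c0; have e0 : w1 *m A1 = 0.
    by rewrite -[LHS]mulmx1 -A2V mulmxA ec c0 rmorph0 raddf0 mul0mx.
  have eC : Ci - A2 *m w1 = Ca + A2 *m w2.
    apply/eqP; rewrite subr_eq -addrA -mulmxDr [w2 + w1]addrC -ew mulmxA A2V mul1mx.
    by rewrite addrC subrK.
  pose C' := Ci - A2 *m w1.
  have hC' : H0 I S C'.
    move=> P; have [->|nP] := pselect (P = pinf).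
      by apply: homLB => //; exact: homL_comp (hA2 _) hw1.
    rewrite /C' eC; apply: homLD; first exact: hCa.
    exact: homL_comp (hA2 _) (hw2 P nP).
  have C'A : C' *m A1 = 1%:M by rewrite mulmxBl eCi -mulmxA e0 mulmx0 subr0.
  have [d ed] : exists d, A1 *m C' = smat d.
    by apply: smat_end => P; exact: homL_comp (hA1 P) (hC' P).
  have d1 : d = 1%:M.
    apply: smat_inj; rewrite smat1 mul1mx -ed {1}eA -mulmxA [C' *m _]mulmxA C'A mul1mx //.
  have : (\rank (1%:M : 'M[K]_(rk S)) <= rk F)%N.
    rewrite -smat1 -d1 -ed; apply: leq_trans (mulmx_max_rank _ _) _.
    by rewrite -(eqP fA2) rank_leq_col.
  by rewrite mxrank1 rS leqNgt rEF.
have c0' : C c != 0 by rewrite fmorph_eq0.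
move=> P v hv.
have [u hu eu] := oA1 P _ (homL_lat (he P) (lat_reg (regC P c^-1) hv)).
exists u => //; rewrite eA mulmxA -eu -mulmxA ec mul_mx_scalar scalerA.
by rewrite -rmorphM mulfV // rmorph1 scale1r.
Qed.

Section Kernel.
Variables (G : bun) (B : 'M[K]_(rk G, rk S)).
Hypothesis ex : exact_seq B A.
Let g a : 'M[K]_(rk G, rk E) := B *m p a.

Lemma kernel_g a : H0 G E (g a).
Proof. by have [_ hp _ _] := pw => P; exact: homL_comp (exact_H0 ex P) (hp a P). Qed.

Lemma kernel_mutates : mutates f g.
Proof.
have [hi hp e1 e2] := pw; have [fB kA hA oA lJ] := ex.
have tA (t : 'I_n -> 'rV[K]_(rk E)) : \sum_a t a *m f a = (\sum_a t a *m i a) *m A.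
  by rewrite mulmx_suml; apply: eq_bigr => a _; rewrite -mulmxA i_ev.
have vi (v : 'rV[K]_(rk S)) := power_vi pw v.
split=> //.
- move=> P v /oA [u hu ->]; exists (fun a => u *m p a); last by rewrite tA vi.
  by move=> a; exact: homL_lat (hp a P) hu.
- move=> t; rewrite tA kA; split=> [[w ew]|[s es]]; [exists w => a | exists s].
    by rewrite /g mulmxA -ew (power_tp pw).
  by rewrite -[RHS]vi; apply: eq_bigr => a _; rewrite es mulmxA.
- move=> s hs; have : s *m B = 0.
    by rewrite -[LHS]vi big1 // => a _; rewrite -(mulmxA s) hs mul0mx.
  by move=> /(congr1 (mulmx^~ (pinvmx B))); rewrite /= -mulmxA mulmxVp // mulmx1 mul0mx.
- move=> P s; split=> [hs a|h]; first exact: homL_lat (kernel_g a P) hs.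
  apply/lJ; rewrite -[_ *m B]vi; apply: lat_sum => a; apply: homL_lat (hi a P) _.
  by rewrite -mulmxA; exact: h.
Qed.

(** The components E -> G -> E are scalars c with klin c f = 0, and f is a
    basis. *)
Lemma kernel_hom0 : h0 E G 0.
Proof.
have [hi hp e1 e2] := pw; apply/h0_0P => D hD.
have /choice [c' hc] a : exists c, D *m g a = (C c)%:M.
  by apply: (proj2 sE) => P; exact: homL_comp (hD P) (kernel_g a P).
pose c : 'rV[k]_n := \row_a c' a.
have DB : D *m B = \sum_a C (c 0 a) *: i a.
  rewrite -(power_vi pw (D *m B)); apply: eq_bigr => a _.
  by rewrite -(mulmxA D) hc mul_scalar_mx mxE.
have c0 : c = 0.
  apply: (basis_free (ksub_H0 E F) fb).
  have : D *m B *m A = 0 by rewrite -mulmxA (exact_comp0 ex) mulmx0.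
  rewrite DB mulmx_suml => h0; rewrite -[RHS]h0; apply: eq_bigr => a _.
  by rewrite -scalemxAl i_ev.
have : D *m B = 0 by rewrite DB big1 // => a _; rewrite c0 mxE rmorph0 scale0r.
have [fB _ _ _ _] := ex.
by move=> /(congr1 (mulmx^~ (pinvmx B))); rewrite /= -mulmxA mulmxVp // mulmx1 mul0mx.
Qed.

(** A combination of the projections E^n -> E that vanishes on G factors
    through F, and Hom(F, E) = 0. *)
Lemma kernel_free (c : 'rV[k]_n) : klin C c g = 0 -> c = 0.
Proof.
have [hi hp e1 e2] := pw; rewrite /klin => h.
pose Q := \sum_a C (c 0 a) *: p a.
have BQ : B *m Q = 0.
  by rewrite mulmx_sumr -[RHS]h; apply: eq_bigr => a _; rewrite -scalemxAr.
have hQ : H0 S E Q.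
  by move=> P; apply: homL_sum => a; apply: homL_reg; [exact: regC|exact: hp].
have [S0 _ S0A] := local_section ex pinf.
have [T eT] : exists T, 1%:M - A *m S0 = T *m B.
  by apply: (exact_kill ex); rewrite mulmxBl mul1mx -mulmxA S0A mulmx1 subrr.
have eQ : Q = A *m (S0 *m Q).
  apply/eqP; rewrite mulmxA -subr_eq0 -{1}[Q]mul1mx -mulmxBl eT -mulmxA BQ mulmx0 //.
have : H0 F E (S0 *m Q).
  have [_ _ _ oA _] := ex; move=> P; apply: lat_homL => v /oA [u hu ->].
  by rewrite -mulmxA -eQ; exact: homL_lat (hQ P) hu.
move=> /(h0_0P F E).1 -/(_ hFE) Q0.
have {}Q0 : Q = 0 by rewrite eQ Q0 mulmx0.
apply/rowP => a; rewrite mxE.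
have : i a *m Q = (C (c 0 a))%:M.
  rewrite mulmx_sumr (bigD1 a) //= -scalemxAr e1 eqxx scalemx1 big1 ?addr0 // => b ne.
  by rewrite -scalemxAr e1 eq_sym (negPf ne) raddf0 scaler0.
rewrite Q0 mulmx0 => /matrixP /(_ (Ordinal (proj1 sE)) (Ordinal (proj1 sE))).
by rewrite !mxE eqxx mulr1n => /esym/eqP; rewrite fmorph_eq0 => /eqP.
Qed.

Lemma kernel_rk : (rk G + rk F = n * rk E)%N.
Proof. by rewrite -rS (exact_rk ex). Qed.

Lemma kernel_h0 : deg S = n%:Z * deg E -> h0 G E n.
Proof.
move=> dS; have [m hm] := h0_exists G E.
suff e : m = n by rewrite -e.
have := h0_chi hm kernel_hom0; have := h0_chi hEF hFE; have := kernel_rk.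
have := exact_deg ex; rewrite dS.
move: (deg G) (deg E) (deg F) (rk G) (rk E) (rk F) => dG dE dF rG rE rF e1 e2 e3 e4.
have : m%:Z = n%:Z by move: e4; nia.
by case.
Qed.

(** The g_a form a basis of Hom(G, E), so an endomorphism of G extends to E^n
    and induces one of F. The latter is a scalar, and f being a basis, so is
    the endomorphism of E^n. *)
Lemma kernel_simple : h0 G E n -> simple G.
Proof.
move=> hGE; have gb : basis C (H0 G E) g.
  apply: basis_of_free => //; [exact: ksub_H0|exact: kernel_g|exact: kernel_free].
have [hi hp e1 e2] := pw; have [fB _ _ oA _] := ex.
split=> [|D hD]; first by have := kernel_rk; move: rEF; lia.
have /choice [d hd] a : exists c : 'rV[k]_n, D *m g a = klin C c g.
  have /(proj2 gb) [c [e _]] : H0 G E (D *m g a) by move=> P; exact: homL_comp (hD P) (kernel_g a P).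
  by exists c.
pose c : 'M[k]_n := \matrix_(b, a) d a 0 b.
have DB : D *m B = B *m smat c.
  rewrite -(power_vi pw (D *m B)).
  transitivity (\sum_a \sum_b C (c b a) *: (B *m (p b *m i a))).
    apply: eq_bigr => a _; rewrite -(mulmxA D) hd mulmx_suml.
    by apply: eq_bigr => b _; rewrite -scalemxAl mulmxA mxE.
  rewrite exchange_big mulmx_sumr; apply: eq_bigr => b _; rewrite mulmx_sumr.
  by apply: eq_bigr => a _; rewrite -scalemxAr.
have [S0 _ S0A] := local_section ex pinf.
have [T eT] : exists T, 1%:M - A *m S0 = T *m B.
  by apply: (exact_kill ex); rewrite mulmxBl mul1mx -mulmxA S0A mulmx1 subrr.
pose psi := S0 *m smat c *m A.
have epsi : smat c *m A = A *m psi.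
  apply/eqP; rewrite -subr_eq0 -[smat c *m A]mul1mx /psi -(mulmxA S0).
  have -> : 1%:M *m (smat c *m A) - A *m (S0 *m (smat c *m A)) = T *m (B *m smat c) *m A.
    by rewrite (mulmxA A) -mulmxBl eT -!mulmxA.
  by rewrite -DB -!mulmxA (exact_comp0 ex) !mulmx0.
have : H0 F F psi.
  move=> P; apply: lat_homL => v /oA [u hu ->]; rewrite -mulmxA -epsi mulmxA.
  exact: homL_lat (ev_H0 P) (homL_lat (smat_H0 c P) hu).
move=> /(proj2 sF) [a ea].
have ec : c = a%:M.
  apply: smat_inj; rewrite epsi ea mul_mx_scalar smat_ev /A scaler_sumr.
  apply: eq_bigr => b _; rewrite scalemxAr; congr (_ *m _).
  rewrite /klin (bigD1 b) //= !mxE eqxx mulr1n big1 ?addr0 // => b' ne.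
  by rewrite !mxE eq_sym (negPf ne) mulr0n rmorph0 scale0r.
have es : smat c = (C a)%:M.
  rewrite ec -[RHS]mulmx1 -smat1 mul_scalar_mx scaler_sumr; apply: eq_bigr => b _.
  rewrite scaler_sumr; apply: eq_bigr => b' _; rewrite scalerA -rmorphM; congr (C _ *: _).
  by rewrite !mxE; case: eqP; rewrite ?mulr1 ?mulr0.
exists a; rewrite -[D]mulmx1 -(mulmxVp fB) mulmxA DB es mul_mx_scalar -scalemxAl (mulmxVp fB).
by rewrite scalemx1.
Qed.

End Kernel.
End Mutation.

Lemma mutation E F n (f : 'I_n -> 'M[K]_(rk E, rk F)) : simple E -> simple F ->
  h0 F E 0 -> h0 E F n -> (rk F < n * rk E)%N -> basis C (H0 E F) f ->
  exists G (g : 'I_n -> 'M[K]_(rk G, rk E)),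
   [/\ mutates f g, simple G, h0 E G 0, h0 G E n & basis C (H0 G E) g] /\
   (rk G + rk F = n * rk E)%N /\ deg G = n%:Z * deg E - deg F.
Proof.
move=> sE sF hFE hEF rEF fb.
have [S [i [p [pw rS dS]]]] := power_exists E n.
have oA := ev_onto sE sF rEF fb pw rS.
have [G [B ex]] := kernel_bundle (ev_H0 fb pw) oA.
have hGE : h0 G E n by eapply kernel_h0; eassumption.
exists G, (fun a => B *m p a); split; last split.
- split.
  + eapply kernel_mutates; eassumption.
  + have hh := kernel_simple sE sF hFE rEF fb pw rS ex hGE. exact: hh.
  + eapply kernel_hom0; eassumption.
  + exact: hGE.
  + apply: basis_of_free => //; [exact: ksub_H0|move=> a; eapply kernel_g; eassumption|].
    move=> c; eapply kernel_free; eassumption.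
- eapply kernel_rk; eassumption.
- by have := exact_deg ex; rewrite dS; lia.
Qed.

End Exact.

Section Helices.
Implicit Types (P Q : point X) (E F G L : bun).

(** * Duality *)

Lemma trmx_unit n (A : 'M[K]_n) : A \in unitmx -> (invmx A)^T \in unitmx.
Proof. by rewrite unitmx_tr unitmx_inv. Qed.

Lemma dual_fin E : finite_set [set P | (invmx (gen E P))^T <> 1%:M].
Proof.
apply: sub_finite_set (gen_fin E) => P /= h e; apply: h.
by rewrite e invmx1 trmx1.
Qed.

Definition dual E : bun :=
  Bun (fun P => trmx_unit (gen_unit E P)) (dual_fin E).

Lemma bun_eq n (g h : point X -> 'M[K]_n) gU gf hU hf : g = h ->
  Bun (gen := g) gU gf = Bun (gen := h) hU hf.
Proof.
by move=> e; subst h; rewrite (Prop_irrelevance gU hU) (Prop_irrelevance gf hf).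
Qed.

Lemma dualK E : dual (dual E) = E.
Proof.
case: E => n g gU gf; apply: bun_eq; apply/funext => P /=.
by rewrite trmx_inv trmxK invmxK.
Qed.

Lemma homL_dual E F P A : homL (dual F) (dual E) P A^T <-> homL E F P A.
Proof.
rewrite /homL /= [X in imx P X <-> _](_ : _ = (gen E P *m A *m invmx (gen F P))^T).
  by split=> h; [rewrite -[X in imx P X]trmxK|]; exact: imxT.
by rewrite !trmx_mul !trmx_inv invmxK mulmxA.
Qed.

Lemma H0_dual E F A : H0 (dual F) (dual E) A^T <-> H0 E F A.
Proof. by split=> h P; apply/homL_dual. Qed.

Lemma simple_dual E : simple E -> simple (dual E).
Proof.
move=> [r0 h]; split=> // A hA; have /h [c ec] : H0 E E A^T by apply/H0_dual; rewrite trmxK.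
by exists c; rewrite -[A]trmxK ec tr_scalar_mx.
Qed.

Lemma h0_dual0 E F : h0 E F 0 -> h0 (dual F) (dual E) 0.
Proof.
move=> /h0_0P h; apply/h0_0P => A hA; rewrite -[A]trmxK (h A^T) ?trmx0 //.
by apply/H0_dual; rewrite trmxK.
Qed.

Lemma klin_trmx m n l (c : 'rV[k]_l) (f : 'I_l -> 'M[K]_(m, n)) :
  (klin C c f)^T = klin C c (fun i => (f i)^T).
Proof. by rewrite /klin raddf_sum; apply: eq_bigr => i _; apply/matrixP => a b; rewrite !mxE. Qed.

Lemma basis_dual E F n (f : 'I_n -> 'M[K]_(rk E, rk F)) : basis C (H0 E F) f ->
  basis C (H0 (dual F) (dual E)) (fun i => (f i)^T).
Proof.
move=> [hf fb]; split=> [i|A hA]; first by apply/H0_dual.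
have /fb [c [ec uc]] : H0 E F A^T by apply/H0_dual; rewrite trmxK.
exists c; split=> [|c' e]; first by rewrite -klin_trmx -ec trmxK.
by apply: uc; rewrite e -klin_trmx trmxK.
Qed.

Lemma det_dual E P : ord P (\det (gen (dual E) P)) = - ord P (\det (gen E P)).
Proof. by rewrite /= det_tr det_inv ordV // -unitfE -unitmxE gen_unit. Qed.

Lemma deg_dual E : deg (dual E) = - deg E.
Proof.
rewrite [LHS]/deg (sum_ord_div (E := E) (oner_neq0 _)) // => P.
by rewrite det_dual (ord_unit (unit1 P)) sub0r.
Qed.

(** * Properties of mutations *)

Section Split.
Variables (E F G : bun) (n : nat).
Variables (f : 'I_n -> 'M[K]_(rk E, rk F)) (g : 'I_n -> 'M[K]_(rk G, rk E)).
Hypothesis (mu : mutates f g).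

Lemma mutates_H0f a : H0 E F (f a).
Proof. by case: mu => -[]. Qed.

Lemma mutates_H0g a : H0 G E (g a).
Proof. by case: mu => _ _ _ _ h P; apply: lat_homL => v /h. Qed.

Lemma mutates_inj m (D : 'M[K]_(m, rk G)) : (forall a, D *m g a = 0) -> D = 0.
Proof.
case: mu => _ _ _ h _ e; apply/row_matrixP => i; rewrite row0; apply: h => a.
by rewrite -row_mul e row0.
Qed.

Lemma mutates_comp : \sum_a g a *m f a = 0.
Proof.
case: mu => _ _ h _ _; apply/row_matrixP => i; rewrite row0 raddf_sum /=.
rewrite (eq_bigr (fun a => row i (g a) *m f a)) => [|a _]; last by rewrite row_mul.
by apply/h; exists (delta_mx 0 i) => a; rewrite rowE.
Qed.

Lemma mutates_lift G' P (t : 'I_n -> 'M[K]_(rk G', rk E)) : (forall a, homL G' E P (t a)) ->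
  \sum_a t a *m f a = 0 -> exists2 D, homL G' G P D & forall a, t a = D *m g a.
Proof.
case: mu => _ _ h _ hl ht e.
have /choice [s hs] i : exists s : 'rV_(rk G), forall a, row i (t a) = s *m g a.
  apply/h; transitivity (row i (\sum_a t a *m f a)); last by rewrite e row0.
  rewrite raddf_sum /=.
  by apply: eq_bigr => a _; rewrite row_mul.
pose D := \matrix_i s i.
have eD a : t a = D *m g a by apply/row_matrixP => i; rewrite row_mul rowK.
exists D => //; apply: lat_homL => v hv; apply/hl => a.
by rewrite -mulmxA -eD; exact: homL_lat (ht a) hv.
Qed.

Lemma mutates_split P : exists (S : 'I_n -> 'M[K]_(rk F, rk E)) (R : 'I_n -> 'M[K]_(rk E, rk G)),
  [/\ forall a, homL F E P (S a), forall a, homL E G P (R a),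
      \sum_a S a *m f a = 1%:M, \sum_a g a *m R a = 1%:M
    & forall a b, (a == b)%:R%:M - f a *m S b = R a *m g b].
Proof.
have [_ sf _ _ _] := mu.
have /choice [t ht] i : exists t : 'I_n -> 'rV[K]_(rk E),
    (forall a, lat E P (t a)) /\ row i (gen F P) = \sum_a t a *m f a.
  by have [t ? ?] := sf P _ (lat_gen P i); exists t.
pose U a : 'M[K]_(_, _) := \matrix_i t i a.
pose S a := invmx (gen F P) *m U a.
have hS a : homL F E P (S a).
  rewrite /homL /= mulmxA mulmxV ?gen_unit // mul1mx.
  by apply/imx_row => i; rewrite row_mul rowK; apply: (ht i).1.
have e1 : \sum_a S a *m f a = 1%:M.
  rewrite -(mulVmx (gen_unit F P)) /S.
  rewrite (eq_bigr (fun a => invmx (gen F P) *m (U a *m f a))) => [|a _]; last by rewrite mulmxA.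
  rewrite -mulmx_sumr; congr (_ *m _); apply/row_matrixP => i.
  by rewrite (ht i).2 raddf_sum; apply: eq_bigr => a _ /=; rewrite row_mul rowK.
have hR a : exists2 D, homL E G P D & forall b, (a == b)%:R%:M - f a *m S b = D *m g b.
  apply: mutates_lift => [b|].
    apply: homLB; last exact: homL_comp (mutates_H0f a P) (hS b).
    by case: (a == b); [exact: homL1|rewrite raddf0; exact: homL0].
  rewrite (eq_bigr (fun b => (a == b)%:R%:M *m f b - f a *m (S b *m f b))) => [|b _]; last first.
    by rewrite mulmxBl -(mulmxA (f a)).
  rewrite sumrB -mulmx_sumr e1 mulmx1 (bigD1 a) //= eqxx mul1mx big1 ?addr0 ?subrr // => b ne.
  by rewrite eq_sym (negPf ne) raddf0 mul0mx.
have /choice [R RP] a : exists D, homL E G P D /\ forall b, (a == b)%:R%:M - f a *m S b = D *m g b.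
  by have [D ? ?] := hR a; exists D.
exists S, R; split=> // [a||a b]; [by case: (RP a)| |by case: (RP a)].
apply/eqP; rewrite -subr_eq0; apply/eqP/mutates_inj => b.
rewrite mulmxBl mul1mx mulmx_suml (eq_bigr (fun a => (a == b)%:R *: g a - g a *m f a *m S b)).
  rewrite sumrB -mulmx_suml mutates_comp mul0mx subr0 (bigD1 b) //= eqxx scale1r.
  by rewrite big1 ?addr0 ?subrr // => a /negPf ->; rewrite scale0r.
move=> a _; rewrite -(mulmxA (g a) (R a)) -(proj2 (RP a)).
by rewrite mulmxBr mul_mx_scalar mulmxA.
Qed.

(** Exact sequences of bundles split locally, so that they can be transposed. *)
Lemma mutates_dual : basis C (H0 G E) g ->
  @mutates (dual E) (dual G) (dual F) n (fun a => (g a)^T) (fun a => (f a)^T).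
Proof.
move=> gb; have [_ sf kf ig lg] := mu; split.
- exact: basis_dual.
- move=> P v hv; have [S [R [hS hR eS eR eSR]]] := mutates_split P.
  exists (fun a => v *m (R a)^T) => [a|].
    by apply: homL_lat hv; apply/homL_dual.
  rewrite -{1}[v]mulmx1 -trmx1 -eR raddf_sum mulmx_sumr.
  by apply: eq_bigr => a _; rewrite /= trmx_mul mulmxA.
- have [S [R [hS hR eS eR eSR]]] := mutates_split pinf.
  move=> t; split=> [h|[s es]].
    exists (\sum_b t b *m (S b)^T) => a; rewrite mulmx_suml.
    have -> : t a = \sum_b t b *m ((a == b)%:R%:M)^T.
      rewrite (bigD1 a) //= eqxx trmx1 mulmx1 big1 ?addr0 // => b ne.
      by rewrite eq_sym (negPf ne) raddf0 trmx0 mulmx0.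
    rewrite [RHS](_ : _ = \sum_b t b *m ((a == b)%:R%:M)^T - \sum_b t b *m (g b)^T *m (R a)^T).
      by rewrite -mulmx_suml h mul0mx subr0.
    rewrite -sumrB; apply: eq_bigr => b _.
    by rewrite -!mulmxA -!trmx_mul -eSR linearB /= mulmxBr opprB addrC subrK.
  rewrite (eq_bigr (fun a => s *m (g a *m f a)^T)) => [|a _]; last by rewrite es trmx_mul mulmxA.
  by rewrite -mulmx_sumr -[X in _ *m X]raddf_sum /= mutates_comp trmx0 mulmx0.
- move=> s hs; have [S [R [hS hR eS eR eSR]]] := mutates_split pinf.
  rewrite -[s]mulmx1 -trmx1 -eS raddf_sum mulmx_sumr big1 // => a _.
  by rewrite /= trmx_mul mulmxA hs mul0mx.
- move=> P s; split=> [hs a|h]; first by apply: homL_lat hs; apply/homL_dual; exact: mutates_H0f.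
  have [S [R [hS hR eS eR eSR]]] := mutates_split P.
  rewrite -[s]mulmx1 -trmx1 -eS raddf_sum mulmx_sumr; apply: lat_sum => a.
  by rewrite /= trmx_mul mulmxA; apply: homL_lat (h a); apply/homL_dual.
Qed.

(** Hom(H, G) embeds in Hom(H, E)^n. *)
Lemma mutates_hom0 H : h0 H E 0 -> h0 H G 0.
Proof.
move=> /h0_0P h; apply/h0_0P => A hA; apply: mutates_inj => a; apply: h => P.
exact: homL_comp (hA P) (mutates_H0g a P).
Qed.

End Split.

(** * Line bundles of given degree *)

Definition line_gen (z : int) P : 'M[K]_1 :=
  if P == pinf then (tau pinf ^ (- z))%:M else 1%:M.

Lemma line_unit z P : line_gen z P \in unitmx.
Proof.
rewrite /line_gen; case: eqP => _; last exact: unitmx1.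
by rewrite unitmxE det_scalar1 unitfE expfz_neq0 // tau_neq0.
Qed.

Lemma line_fin z : finite_set [set P | line_gen z P <> 1%:M].
Proof.
apply: (@sub_finite_set _ _ [set pinf]); last exact: finite_set1.
by move=> P /=; rewrite /line_gen; case: eqP.
Qed.

Definition line z : bun := Bun (line_unit z) (line_fin z).

Lemma deg_line z : deg (line z) = z.
Proof.
rewrite (deg_seq (s := [:: pinf])) //= => [|P]; last first.
  by rewrite /line_gen inE; case: eqP.
rewrite big_seq1 /line_gen eqxx det_scalar1.
have := ord_tauE (- z) (unit1 pinf); rewrite mul1r => ->; lia.
Qed.

Lemma homL_line a b P A : homL (line a) (line b) P A <->
  regular_at P (if P == pinf then tau P ^ (b - a) * A 0 0 else A 0 0).
Proof.
rewrite /homL /= /line_gen; case: eqP => [->|_].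
  rewrite invmx_scalar mul_mx_scalar mul_scalar_mx scalerA invr_expz opprK -expfzDr ?tau_neq0 //; split=> [/(_ 0 0)|h i j]; by rewrite ?ord1 mxE.
rewrite invmx1 mulmx1 mul1mx; split=> [/(_ 0 0)//|h i j]; by rewrite !ord1.
Qed.

Lemma simple_line z : simple (line z).
Proof.
split=> // A hA; have [c ec] : exists c, A 0 0 = C c.
  apply: const_regular => // P; have := hA P; rewrite homL_line subrr expr0z mul1r.
  by case: ifP.
by exists c; rewrite [A]mx11_scalar ec.
Qed.

Lemma line_hom0 a b : b < a -> h0 (line a) (line b) 0.
Proof.
move=> ab; apply/h0_0P => A hA; have t0 := tau_neq0 pinf.
have e : a - b = (absz (a - b)).-1.+1%:Z by move: ab; lia.
have hinf : exists2 g, regular_at pinf g & A 0 0 = tau pinf * g.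
  have := hA pinf; rewrite homL_line eqxx => h.
  exists (tau pinf ^ (a - b - 1) * (tau pinf ^ (b - a) * A 0 0)).
    by apply: regM => //; rewrite e -addn1 PoszD addrK; apply: reg_tauX.
  have e1 : tau pinf * tau pinf ^ (a - b - 1) = tau pinf ^ (a - b).
    by rewrite -{1}[tau _]expr1z -expfzDr //; congr (_ ^ _); ring.
  rewrite !mulrA e1 -expfzDr // (_ : a - b + _ = 0) ?expr0z ?mul1r //; ring.
have [c ec] : exists c, A 0 0 = C c.
  apply: const_regular => // P; have := hA P; rewrite homL_line.
  case: eqP => // -> _; have [g Og ->] := hinf; apply: regM => //; exact: van_reg (van_tau _).
have vA : van pinf (A 0 0) by have [g Og ->] := hinf; rewrite mulrC; apply: vanM => //; exact: van_tau.
by rewrite [A]mx11_scalar ec; rewrite ec in vA; rewrite (vanC vA) rmorph0 raddf0.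
Qed.

Lemma line_h0 a b n : b - a = n%:Z -> (0 < n)%N -> h0 (line a) (line b) n.
Proof.
move=> ab n0; have [m hm] := h0_exists (line a) (line b).
have hz : h0 (line b) (line a) 0 by apply: line_hom0; move: ab n0; lia.
have := h0_chi hm hz; rewrite !deg_line /= subr0 !mul1r ab => /eqP.
by rewrite eqz_nat => /eqP <-.
Qed.

(** * Helices of bundles *)

(** The last condition says quad n (rk E) (rk F) = N. It passes from (E, F) to
    the pair formed by the mutation and E, and keeps the rank of the mutation
    positive. *)
Definition helix_pair (n N : nat) E F : Prop :=
  [/\ simple E, simple F, h0 F E 0, h0 E F n &
     (0 < N)%N /\ (n * rk E * rk F = N + rk E ^ 2 + rk F ^ 2)%N].

Lemma pair_rank n N E F : helix_pair n N E F -> (rk F < n * rk E)%N.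
Proof.
move=> [[rE _] [rF _] _ _ [N0 e]]; rewrite ltnNge; apply/negP => h.
have : (n * rk E * rk F <= rk F * rk F)%N by rewrite leq_mul2r h orbT.
by rewrite e -mulnn; nia.
Qed.

Definition mut_step n N (EF GE : bun * bun) : Prop :=
  [/\ helix_pair n N GE.1 GE.2, GE.2 = EF.1, deg GE.1 = n%:Z * deg EF.1 - deg EF.2 &
   exists f g, @mutates EF.1 EF.2 GE.1 n f g /\ basis C (H0 GE.1 EF.1) g].

Lemma helix_step n N EF : helix_pair n N EF.1 EF.2 -> exists GE, mut_step n N EF GE.
Proof.
case: EF => E F /= hp; have r := pair_rank hp; have [sE sF h1 h2 [N0 eN]] := hp.
have [f fb] := h0_basis h2.
have [G [g [[mu sG hEG hGE gb] [er ed]]]] := mutation sE sF h1 h2 r fb.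
exists (G, E); split=> //=; last by exists f, g.
split=> //; split=> //; move: er eN.
by move: (rk G) (rk E) (rk F) => a b c; nia.
Qed.

Definition mut_seq n N E F (i : nat) : bun * bun :=
  iter i (fun p => if pselect (exists p', mut_step n N p p') is left h
    then projT1 (cid h) else p) (E, F).

Lemma mut_seqP n N E F : helix_pair n N E F -> forall i,
  helix_pair n N (mut_seq n N E F i).1 (mut_seq n N E F i).2 /\
  mut_step n N (mut_seq n N E F i) (mut_seq n N E F i.+1).
Proof.
move=> hp; pose nx (p : bun * bun) := if pselect (exists p', mut_step n N p p') is left h
    then projT1 (cid h) else p.
have step p : helix_pair n N p.1 p.2 -> mut_step n N p (nx p).
  by move=> /helix_step h; rewrite /nx; case: pselect => // h'; case: cid.
have h i : helix_pair n N (mut_seq n N E F i).1 (mut_seq n N E F i).2.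
  by elim: i => // i /step [].
by move=> i; split=> //; exact: step.
Qed.

Definition bun_helix n (E : int -> bun) : Prop :=
  [/\ forall i, simple (E i), forall i, h0 (E i) (E (i - 1)) 0 &
     forall i, exists f g, @mutates (E (i - 1)) (E i) (E (i - 2)) n f g /\
       basis C (H0 (E (i - 2)) (E (i - 1))) g].

Lemma bun_helix_dual n (E : int -> bun) : bun_helix n E -> bun_helix n (fun i => dual (E (- i))).
Proof.
move=> [h1 h2 h3]; split=> [i|i|i]; first exact: simple_dual.
  by apply: h0_dual0; have := h2 (- (i - 1)); rewrite (_ : - (i - 1) - 1 = - i) //; ring.
have [f [g [mu gb]]] := h3 (- i + 2).
have e1 : - i + 2 - 2 = - i by ring. have e2 : - i + 2 - 1 = - (i - 1) by ring.
have e3 : - i + 2 = - (i - 2) by ring.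
rewrite e1 e2 in f g mu gb *; rewrite e3 in f mu *.
exists (fun a => (g a)^T), (fun a => (f a)^T); split; first exact: mutates_dual.
by apply: basis_dual; case: mu.
Qed.

Lemma helix_pair_dual n N E F : helix_pair n N E F -> helix_pair n N (dual F) (dual E).
Proof.
move=> [sE sF h1 h2 [N0 e]]; split; [exact: simple_dual|exact: simple_dual|exact: h0_dual0| |].
  have [m hm] := h0_exists (dual F) (dual E).
  have hz : h0 (dual E) (dual F) 0 by exact: h0_dual0.
  have := h0_chi hm hz; have := h0_chi h2 h1; rewrite !deg_dual /=.
  suff : m%:Z = n%:Z -> h0 (dual F) (dual E) n.
    by move=> s e1 e2; apply: s; move: e1 e2; move: (deg _) (deg _) => x y; nia.
  by case=> <-.
by split=> //=; move: e; move: (rk E) (rk F) => a b; nia.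
Qed.

(** The helix through a pair: its left half is obtained by mutation, its right
    half by mutation of the dual pair. *)
Lemma pair_helix n N E F : helix_pair n N E F ->
  exists H, [/\ bun_helix n H, H 0 = F & H (-1) = E].
Proof.
move=> hp; have hp' := helix_pair_dual hp.
pose l := mut_seq n N E F; pose r := mut_seq n N (dual F) (dual E).
have hl := mut_seqP hp; have hr := mut_seqP hp'.
pose H (i : int) := if i is Posz m then dual (r m).1 else (l (absz i)).2.
have H0 : H 0 = F by rewrite /H /r /= dualK.
have HP m : H (m%:Z - 1) = dual (r m).2.
  case: m => [|m]; first by rewrite /= /r /= dualK; have [_ [_ -> _ _]] := hl 0%N.
  rewrite (_ : m.+1%:Z - 1 = m%:Z); last by lia.
  by rewrite /=; have [_ [_ <- _ _]] := hr m.
have HN m : H (- m%:Z) = (l m).2.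
  by case: m => [|m]; [exact: H0|rewrite -NegzE].
have HN1 m : H (- m%:Z - 1) = (l m).1.
  rewrite (_ : - m%:Z - 1 = - (m.+1)%:Z); last by lia.
  by rewrite HN; have [_ [_ -> _ _]] := hl m.
exists H; split=> //; last by rewrite (_ : -1 = - 0%:Z - 1) // HN1.
split.
- case=> m; first by rewrite /=; apply: simple_dual; have [[]] := hr m.
  by rewrite NegzE HN; have [[]] := hl m.+1.
- case=> m; last first.
    by rewrite NegzE HN HN1; have [[]] := hl m.+1.
  by rewrite HP /=; apply: h0_dual0; have [[]] := hr m.
case=> [[|m]|m]; last 1 first.
- rewrite NegzE HN HN1 (_ : - m.+1%:Z - 2 = - m.+2%:Z - 1); last by lia.
  by rewrite HN1; have [_ [_ _ _ h]] := hl m.+1.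
- have -> : (0%:Z - 1 : int) = - 0%:Z - 1 by []. have -> : (0%:Z - 2 : int) = - 1%:Z - 1 by [].
  have -> : Posz 0 = - 0%:Z by []. rewrite HN !HN1.
  by have [_ [_ _ _ h]] := hl 0%N.
have -> : m.+1%:Z - 1 = m%:Z by lia.
have -> : m.+1%:Z - 2 = m%:Z - 1 by lia.
rewrite HP /=; have [hpm [_ e2 _ [f [g [mu gb]]]]] := hr m.
exists (fun a => (g a)^T), (fun a => (f a)^T); split; first exact: mutates_dual.
by apply: basis_dual; case: mu.
Qed.

Lemma bun_helix_h0 n (E : int -> bun) : bun_helix n E -> forall i j, i < j -> h0 (E j) (E i) 0.
Proof.
move=> [h1 h2 h3] i j ij.
have e : i = j - (absz (j - i)).-1.+1%:Z by move: ij; lia.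
rewrite e; elim: (absz _).-1 => [|m IH]; first exact: h2.
have [f [g [mu gb]]] := h3 (j - m%:Z).
have -> : j - m.+2%:Z = j - m%:Z - 2 by lia.
apply: (mutates_hom0 mu); have -> // : j - m%:Z - 1 = j - m.+1%:Z by lia.
Qed.

(** M is the kernel of the evaluation map O(b)^n -> O(b + n). *)
Lemma start_pair (a b : int) (n d : nat) : (2 <= n)%N -> 0 < a ->
  d%:Z = (n.-1)%:Z * a + n%:Z -> (d * n.-1 > n.-1 ^ 2 + 1)%N ->
  exists M, helix_pair d (d * n.-1 - (n.-1 ^ 2 + 1)) M (line (b + a)) /\
    rk M = n.-1 /\ deg M = (n.-1)%:Z * b - n%:Z.
Proof.
move=> n2 a0 ed hN.
have h1 : h0 (line (b + n%:Z)) (line b) 0 by apply: line_hom0; lia.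
have h2 : h0 (line b) (line (b + n%:Z)) n by apply: line_h0; lia.
have [f fb] := h0_basis h2.
have r1 : (rk (line (b + n%:Z)) < n * rk (line b))%N by rewrite /= muln1.
have [M [g [[mu sM _ _ _] [er ed']]]] :=
  mutation (simple_line _) (simple_line _) h1 h2 r1 fb.
rewrite /= !deg_line in er ed'.
have rM : rk M = n.-1 by move: er; lia.
exists M; split; last by split=> //; rewrite ed'; lia.
have hz : h0 (line (b + a)) M 0 by apply: (mutates_hom0 mu); apply: line_hom0; lia.
split=> //; first exact: simple_line.
  have [m hm] := h0_exists M (line (b + a)).
  have := h0_chi hm hz; rewrite deg_line rM ed' /= subr0 => e.
  suff -> : d = m by [].
  by apply/eqP; rewrite -eqz_nat ed e; apply/eqP; move: n2; nia.
rewrite /= rM muln1; split; first by rewrite subn_gt0.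
by rewrite -addnA exp1n subnK // ltnW.
Qed.

End Helices.

Section Sheaves.
Implicit Types (P Q : point X) (U V W : opens X) (F G H : module_sheaf X).

(** * Open sets *)

Definition capO U V : opens X.
Proof.
exists (open_set U `&` open_set V).
rewrite setCI finite_setU; split; exact: open_cofinite.
Defined.

Definition remO U (A : set (point X)) (fA : finite_set A) : opens X.
Proof.
exists (open_set U `\` A).
rewrite setDE setCI setCK finite_setU; split=> //; exact: open_cofinite.
Defined.

Lemma capOl U V : capO U V `<=` U. Proof. by move=> P []. Qed.
Lemma capOr U V : capO U V `<=` V. Proof. by move=> P []. Qed.
Lemma capOS U V W : W `<=` U -> W `<=` V -> W `<=` capO U V.
Proof. by move=> h1 h2 P WP; split; [exact: h1|exact: h2]. Qed.

Lemma regular_sub (A B : set (point X)) (f : K) : B `<=` A -> regular A f -> regular B f.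
Proof. by move=> h r P /h; exact: r. Qed.

Lemma regular1 (A : set (point X)) : regular A (1 : K).
Proof. by move=> P _; exact: reg1. Qed.
Lemma regular0 (A : set (point X)) : regular A (0 : K).
Proof. by move=> P _; exact: reg0. Qed.
Lemma regularD (A : set (point X)) (f g : K) : regular A f -> regular A g -> regular A (f + g).
Proof. by move=> hf hg P AP; apply: regD; [exact: hf|exact: hg]. Qed.
Lemma regularN (A : set (point X)) (f : K) : regular A f -> regular A (- f).
Proof. by move=> hf P AP; apply: regN; exact: hf. Qed.
Lemma regularM (A : set (point X)) (f g : K) : regular A f -> regular A g -> regular A (f * g).
Proof. by move=> hf hg P AP; apply: regM; [exact: hf|exact: hg]. Qed.
Lemma regular_sum (A : set (point X)) (I : finType) (f : I -> K) :
  (forall i, regular A (f i)) -> regular A (\sum_i f i).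
Proof. by move=> hf P AP; apply: reg_sum => i _; exact: hf. Qed.

Lemma shrink U P (A : set (point X)) : finite_set A -> open_set U P -> ~ A P ->
  exists V, [/\ V `<=` U, open_set V P & forall Q, open_set V Q -> ~ A Q].
Proof.
move=> fA UP nP; exists (remO U fA); split=> [Q []//||Q []//]; by split.
Qed.

Lemma finite_family n (A : 'I_n -> set (point X)) : (forall i, finite_set (A i)) ->
  finite_set (\bigcup_(i in [set: 'I_n]) A i).
Proof. by move=> h; apply: bigcup_finite => [|i _]; [exact: finite_finset|exact: h]. Qed.

Lemma shrink_family U P n (A : 'I_n -> set (point X)) : (forall i, finite_set (A i)) ->
  open_set U P -> (forall i, ~ A i P) ->
  exists V, [/\ V `<=` U, open_set V P & forall i Q, open_set V Q -> ~ A i Q].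
Proof.
move=> fA UP nA; have [|V [VU VP h]] := shrink (finite_family fA) UP; first by case=> i _; exact: nA.
by exists V; split=> // i Q VQ AQ; apply: (h Q VQ); exists i.
Qed.

Lemma regular_finite (f : K) : finite_set [set P | ~ regular_at P f].
Proof.
have [->|f0] := eqVneq f 0.
  by apply: (@sub_finite_set _ _ set0) => // P /= h; apply: h; exact: reg0.
apply: sub_finite_set (nonunit_finite f0) => P /= h u; apply: h; exact: unit_reg.
Qed.

Lemma regular_nbhd n (f : 'I_n -> K) U P : open_set U P ->
  (forall i, regular_at P (f i)) -> exists V, [/\ V `<=` U, open_set V P & forall i, regular V (f i)].
Proof.
move=> UP hf; have [|V [VU VP h]] := shrink_family (fun i => regular_finite (f i)) UP.
  by move=> i; apply.
by exists V; split=> // i Q /(h i) /contrapT.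
Qed.

(** There is a point over every value of x, and k is infinite. *)
Lemma open_point U : exists P, open_set U P.
Proof.
have [sq sqP] := choice curve_sqrt; pose f (n : nat) := affine_point (sqP n%:R).
have fv n : van (f n) (coordX X - C n%:R) by case: (affine_point_over (sqP n%:R)).
have fi : injective f.
  move=> m n e; have := fv m; rewrite e => h1; have h2 := fv n.
  have : van (f n) (C (m%:R - n%:R)).
    have := vanB h2 h1; congr (van (f n) _); rewrite rmorphB; ring.
  move=> /vanC /eqP; wlog le : m n {e h1 h2} / (n <= m)%N.
    by move=> h; case: (leqP n m) => [|/ltnW] le; [exact: h|rewrite subr_eq0 eq_sym -subr_eq0 => /(h _ _ le)].
  by rewrite -natrB // (proj1 (GRing.pcharf0P _) char_k) subn_eq0 => le'; apply/eqP; rewrite eqn_leq le le'.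
apply: contrapT => /forallNP h; apply: infinite_nat.
have -> : [set: nat] = f @^-1` (~` open_set U) by apply/seteqP; split=> // n _ /=; exact: h.
by apply: finite_preimage; [move=> ? ? _ _; exact: fi|exact: open_cofinite].
Qed.

(** * Sections of sheaves *)

Lemma res0 F U V : V `<=` U -> res V (0 : F U) = 0.
Proof. by move=> VU; apply: (addIr (res V (0 : F U))); rewrite -resD // !add0r. Qed.

Lemma resN F U V (s : F U) : V `<=` U -> res V (- s) = - res V s.
Proof. by move=> VU; apply: (addIr (res V s)); rewrite -resD // !addNr res0. Qed.

Lemma resB F U V (s t : F U) : V `<=` U -> res V (s - t) = res V s - res V t.
Proof. by move=> VU; rewrite resD // resN. Qed.

Lemma res_sum F U V n (s : 'I_n -> F U) : V `<=` U ->
  res V (\sum_i s i) = \sum_i res V (s i).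
Proof.
move=> VU; elim/big_rec2: _ => [|i y1 y2 _ <-]; first exact: res0.
exact: resD.
Qed.

Lemma act0r F U f : regular U f -> act f (0 : F U) = 0.
Proof. by move=> rf; apply: (addIr (act f (0 : F U))); rewrite -actDr // !add0r. Qed.

Lemma act0l F U (s : F U) : act 0 s = 0.
Proof. by apply: (addIr (act 0 s)); rewrite -actDl ?addr0 ?add0r //; exact: regular0. Qed.

Lemma actNr F U f (s : F U) : regular U f -> act f (- s) = - act f s.
Proof. by move=> rf; apply: (addIr (act f s)); rewrite -actDr // !addNr act0r. Qed.

Lemma actNl F U f (s : F U) : regular U f -> act (- f) s = - act f s.
Proof.
move=> rf; apply: (addIr (act f s)); rewrite -actDl ?addNr ?act0l //; exact: regularN.
Qed.

Lemma act_sumr F U n f (s : 'I_n -> F U) : regular U f ->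
  act f (\sum_i s i) = \sum_i act f (s i).
Proof.
move=> rf; elim/big_rec2: _ => [|i y1 y2 _ <-]; first exact: act0r.
exact: actDr.
Qed.

Lemma act_suml F U n (f : 'I_n -> K) (s : F U) : (forall i, regular U (f i)) ->
  act (\sum_i f i) s = \sum_i act (f i) s.
Proof.
move=> rf; elim: n f rf => [|n IH] f rf; first by rewrite !big_ord0 act0l.
rewrite !big_ord_recl actDl ?IH //; exact: regular_sum.
Qed.

Lemma separated F U (s t : F U) :
  (forall P, open_set U P -> exists V, [/\ V `<=` U, open_set V P & res V s = res V t]) -> s = t.
Proof.
move=> h; pose D V := V `<=` U /\ res V s = res V t.
have [|P UP|V V' W [VU _] [VU' _] WV WV'|t' [_ ut]] := @glue _ _ F U D _ _ (fun V => res V s).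
- by move=> V [].
- by have [V [VU VP e]] := h P UP; exists V.
- by rewrite !res_comp.
by rewrite -(ut s) // (ut t) // => V [VU e]; exact: esym.
Qed.

Lemma hom0 F G (h : hom F G) U : h U 0 = 0.
Proof. by apply: (addIr (h U 0)); rewrite -homD !add0r. Qed.

Lemma homN F G (h : hom F G) U s : h U (- s) = - h U s.
Proof. by apply: (addIr (h U s)); rewrite -homD !addNr hom0. Qed.

Lemma homB F G (h : hom F G) U s t : h U (s - t) = h U s - h U t.
Proof. by rewrite homD homN. Qed.

Lemma hom_sum F G (h : hom F G) U n (s : 'I_n -> F U) :
  h U (\sum_i s i) = \sum_i h U (s i).
Proof.
elim/big_rec2: _ => [|i y1 y2 _ <-]; first exact: hom0.
exact: homD.
Qed.

(** * Homomorphisms *)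

(** The value on a section is glued from the values that the relation
    prescribes locally. *)
Section HomOfRel.
Variables (F G : module_sheaf X) (R : forall U, F U -> G U -> Prop).
Hypothesis R_fun : forall U s t t', R s t -> R (U := U) s t' -> t = t'.
Hypothesis R_add : forall U s t s' t', R s t -> R (U := U) s' t' -> R (s + s') (t + t').
Hypothesis R_act : forall U f s t, regular U f -> R (U := U) s t -> R (act f s) (act f t).
Hypothesis R_res : forall U V s t, V `<=` U -> R (U := U) s t -> R (res V s) (res V t).
Hypothesis R_tot : forall U (s : F U) P, open_set U P ->
  exists V, [/\ V `<=` U, open_set V P & exists t, R (res V s) t].

Definition locR U (s : F U) (t : G U) : Prop := forall P, open_set U P ->
  exists V, [/\ V `<=` U, open_set V P & R (res V s) (res V t)].

Lemma locR_sub U V (s : F U) t : V `<=` U -> locR s t -> locR (res V s) (res V t).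
Proof.
move=> VU h P VP; have [W [WU WP r]] := h P (VU P VP).
exists (capO V W); split=> //; first exact: capOl.
have := R_res (@capOr V W) r.
by rewrite !res_comp //; try exact: capOr; exact: capOl.
Qed.

Lemma locR_fun U (s : F U) t t' : locR s t -> locR s t' -> t = t'.
Proof.
move=> h h'; apply: separated => P UP.
have [V [VU VP r]] := h P UP; have [V' [VU' VP' r']] := h' P UP.
exists (capO V V'); split=> //; first by move=> Q [/VU].
have e := R_res (@capOl V V') r; have e' := R_res (@capOr V V') r'.
rewrite !res_comp // in e e'; try exact: capOl; try exact: capOr.
exact: R_fun e e'.
Qed.

Lemma locR_ex U (s : F U) : exists t, locR s t.
Proof.
have ht V : exists t, (V `<=` U /\ exists t', R (res V s) t') -> R (res V s) t.
  have [[_ [t' r]]|n] := pselect (V `<=` U /\ exists t', R (res V s) t'); first by exists t'.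
  by exists 0.
pose D V := V `<=` U /\ exists t', R (res V s) t'.
pose T V := projT1 (cid (ht V)).
have TP V : D V -> R (res V s) (T V) by rewrite /T; case: cid.
have [|P UP|V V' W DV DV' WV WV'|t [ht' _]] := @glue _ _ G U D _ _ T.
- by move=> V [].
- by have [V [VU VP e]] := R_tot s UP; exists V.
- have := R_res WV' (TP _ DV'); have := R_res WV (TP _ DV).
  have [[VU _] [VU' _]] := (DV, DV').
  by rewrite !res_comp //; exact: R_fun.
exists t => P UP; have [V [VU VP e]] := R_tot s UP.
by exists V; split=> //; rewrite ht' //; exact: TP.
Qed.

Lemma hom_of_rel : exists h : hom F G, (forall U s t, R s t -> h U s = t) /\
  forall U s, locR s (h U s).
Proof.
pose h U (s : F U) := projT1 (cid (locR_ex s)).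
have hP U (s : F U) : locR s (h U s) by rewrite /h; case: cid.
have hu U (s : F U) t : locR s t -> h U s = t by apply: locR_fun; exact: hP.
have hD U (s t : F U) : h U (s + t) = h U s + h U t.
  apply: hu => P UP; have [V [VU VP r]] := hP U s P UP; have [V' [VU' VP' r']] := hP U t P UP.
  have VVU : capO V V' `<=` U by move=> Q [/VU].
  exists (capO V V'); split=> //; rewrite !resD //; apply: R_add.
    by have := R_res (@capOl V V') r; rewrite !res_comp //; exact: capOl.
  by have := R_res (@capOr V V') r'; rewrite !res_comp //; exact: capOr.
have hZ U f (s : F U) : regular U f -> h U (act f s) = act f (h U s).
  move=> rf; apply: hu => P UP; have [V [VU VP r]] := hP U s P UP.
  exists V; split=> //; rewrite !res_act //; apply: R_act => //; exact: regular_sub rf.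
have hr U V : V `<=` U -> forall s : F U, h V (res V s) = res V (h U s).
  by move=> VU s; apply: hu; apply: locR_sub => //; exact: hP.
exists (Hom hD hZ hr); split=> [U s t r|U s]; last exact: hP.
by apply: hu => P UP; exists U; split=> //; exact: R_res.
Qed.

End HomOfRel.

Lemma hom_glue F G (V : point X -> opens X) (h : forall P W, F W -> G W) :
  (forall P, open_set (V P) P) ->
  (forall P W s t, W `<=` V P -> h P W (s + t) = h P W s + h P W t) ->
  (forall P W f s, W `<=` V P -> regular W f -> h P W (act f s) = act f (h P W s)) ->
  (forall P W W' s, W `<=` V P -> W' `<=` W -> h P W' (res W' s) = res W' (h P W s)) ->
  (forall P Q W s, W `<=` V P -> W `<=` V Q -> h P W s = h Q W s) ->
  exists H : hom F G, forall P W s, W `<=` V P -> H W s = h P W s.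
Proof.
move=> VP hD hZ hr hPQ.
pose R W (s : F W) (t : G W) := exists P, W `<=` V P /\ t = h P W s.
have [|||||H [hH _]] := @hom_of_rel F G R.
- by move=> W s t t' [P [WP ->]] [Q [WQ ->]]; exact: hPQ.
- move=> W s t s' t' [P [WP ->]] [Q [WQ ->]]; exists P; split=> //.
  by rewrite hD // (hPQ Q P).
- by move=> W f s t rf [P [WP ->]]; exists P; rewrite hZ.
- move=> W W' s t WW [P [WP ->]]; exists P; split; first exact: subset_trans WP.
  by rewrite hr.
- move=> W s P WP; exists (capO W (V P)); split=> //; first exact: capOl.
  by eexists; exists P; split; first exact: capOr.
by exists H => P W s WP; apply: hH; exists P.
Qed.

Definition loc_surj F G (p : hom F G) : Prop := forall U (s : G U) P, open_set U P ->
  exists V, [/\ V `<=` U, open_set V P & exists t, p V t = res V s].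

Lemma hom_descend F G H (p : hom F G) (m : hom F H) : loc_surj p ->
  (forall U s, p U s = 0 -> m U s = 0) -> exists f : hom G H, forall U s, f U (p U s) = m U s.
Proof.
move=> sp hm; pose R U (a : G U) (b : H U) := exists t, p U t = a /\ m U t = b.
have [|||||f [hf _]] := @hom_of_rel G H R.
- move=> U s t t' [a [ea <-]] [b [eb <-]]; apply/eqP; rewrite -subr_eq0 -homB; apply/eqP/hm.
  by rewrite homB ea eb subrr.
- by move=> U s t s' t' [a [<- <-]] [b [<- <-]]; exists (a + b); rewrite !homD.
- by move=> U f s t rf [a [<- <-]]; exists (act f a); rewrite !homZ.
- by move=> U V s t VU [a [<- <-]]; exists (res V a); rewrite !hom_res.
- move=> U s P UP; have [V [VU VP [t et]]] := sp U s P UP.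
  by exists V; split=> //; exists (m V t), t.
by exists f => U s; apply: hf; exists s.
Qed.

Lemma hom_lift F G H (j : hom G H) (m : hom F H) : (forall U s t, j U s = j U t -> s = t) ->
  (forall U s, exists t, j U t = m U s) -> exists f : hom F G, forall U s, j U (f U s) = m U s.
Proof.
move=> ij jm.
have [|||||f [hf _]] := @hom_of_rel F G (fun U s t => j U t = m U s).
- by move=> U s t t' e1 e2; apply: (ij U); rewrite e1 e2.
- by move=> U s t s' t' e1 e2; rewrite !homD e1 e2.
- by move=> U f s t rf e1; rewrite !homZ // e1.
- by move=> U V s t VU e1; rewrite !hom_res // e1.
- move=> U s P UP; have [t et] := jm U s.
  by exists U; split=> //; exists t; rewrite et res_id.
by exists f => U s; have [t et] := jm U s; rewrite (hf _ _ _ et).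
Qed.

Definition iso F G (f : hom F G) (g : hom G F) : Prop :=
  (forall U s, g U (f U s) = s) /\ forall U s, f U (g U s) = s.

Definition hom_comp F G H (f : hom F G) (g : hom G H) : hom F H.
Proof.
exists (fun U s => g U (f U s)).
- by move=> U s t; rewrite !homD.
- by move=> U a s ra; rewrite !homZ.
- by move=> U V VU s; rewrite !hom_res.
Defined.

Lemma hom_compE F G H (f : hom F G) (g : hom G H) U s : hom_comp f g U s = g U (f U s).
Proof. by []. Qed.

Definition hom_add F G (f g : hom F G) : hom F G.
Proof.
exists (fun U s => f U s + g U s).
- by move=> U s t; rewrite !homD addrACA.
- by move=> U a s ra; rewrite !homZ // actDr.
- by move=> U V VU s; rewrite !hom_res // resD.
Defined.

Definition hom_opp F G (f : hom F G) : hom F G.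
Proof.
exists (fun U s => - f U s).
- by move=> U s t; rewrite !homD opprD.
- by move=> U a s ra; rewrite !homZ // actNr.
- by move=> U V VU s; rewrite !hom_res // resN.
Defined.

Definition hom_null F G : hom F G.
Proof.
exists (fun U s => 0).
- by move=> U s t; rewrite addr0.
- by move=> U a s ra; rewrite act0r.
- by move=> U V VU s; rewrite res0.
Defined.

End Sheaves.

(** * Constructions of sheaves *)

Section Constructions.
Implicit Types (P Q : point X) (U V W : opens X) (F G H : module_sheaf X).

Definition constS (r : nat) : module_sheaf X.
Proof.
refine (@ModuleSheaf k X (fun _ => 'rV[K]_r) (fun _ _ s => s) (fun _ f s => f *: s)
  _ _ _ _ _ _ _ _ _) => //.
- by move=> U f _ s t; rewrite scalerDr.
- by move=> U f g _ _ s; rewrite scalerDl.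
- by move=> U f g _ _ s; rewrite scalerA.
- by move=> U s; rewrite scale1r.
- move=> U D DU cov s hs.
  have [P UP] := open_point U; have [V DV VP] := cov P UP.
  exists (s V); split=> [W DW|t ht]; last by rewrite (ht V).
  exact: (hs V W (capO V W) DV DW (@capOl V W) (@capOr V W)).
Defined.

Definition prodS F G : module_sheaf X.
Proof.
refine (@ModuleSheaf k X (fun U => (F U * G U)%type) (fun _ V s => (res V s.1, res V s.2))
  (fun _ f s => (act f s.1, act f s.2)) _ _ _ _ _ _ _ _ _).
- by move=> U V VU [a b] [c d] /=; rewrite !resD.
- by move=> U [a b]; rewrite !res_id.
- by move=> U V W VU WV [a b] /=; rewrite !res_comp.
- by move=> U f rf [a b] [c d] /=; rewrite !actDr.
- by move=> U f g rf rg [a b] /=; rewrite !actDl.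
- by move=> U f g rf rg [a b] /=; rewrite !actM.
- by move=> U [a b]; rewrite !act1.
- by move=> U V VU f rf [a b] /=; rewrite !res_act.
move=> U D DU cov s hs.
have [|a [ha ua]] := @glue _ _ F U D DU cov (fun V => (s V).1).
  by move=> V V' W DV DV' WV WV'; have := hs V V' W DV DV' WV WV'; case.
have [|b [hb ub]] := @glue _ _ G U D DU cov (fun V => (s V).2).
  by move=> V V' W DV DV' WV WV'; have := hs V V' W DV DV' WV WV'; case.
exists (a, b); split=> [V DV /=|[a' b'] h].
  by rewrite ha // hb //; case: (s V).
by rewrite (ua a') ?(ub b') // => V DV; have := h V DV; rewrite /= => <-.
Defined.

(** The last condition, locality, is what gluing in the subsheaf needs. *)
Record subcond G := SubCond {
  cond :> forall U, set (G U);
  cond_sub : forall U, @cond U 0 /\ forall s t, @cond U s -> @cond U t -> @cond U (s - t);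
  cond_act : forall U f s, regular U f -> @cond U s -> @cond U (act f s);
  cond_res : forall U V s, V `<=` U -> @cond U s -> @cond V (res V s);
  cond_loc : forall U s, (forall P, open_set U P -> exists V, [/\ V `<=` U, open_set V P & @cond V (res V s)]) ->
    @cond U s }.
Arguments cond {G} s U _ : rename.

Section SubSheaf.
Variables (G : module_sheaf X) (S : subcond G).
Let T U := subZ (cond_sub S U).

Definition sub_res U V (s : T U) : T V :=
  if pselect (V `<=` U) is left h then mkZ _ (cond_res h (subZ_P s)) else 0.
Definition sub_act U f (s : T U) : T U :=
  if pselect (regular U f) is left h then mkZ _ (cond_act h (subZ_P s)) else 0.

Lemma sub_resE U V (s : T U) : V `<=` U -> subZ_val (sub_res V s) = res V (subZ_val s).
Proof. by move=> h; rewrite /sub_res; case: pselect. Qed.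
Lemma sub_actE U f (s : T U) : regular U f -> subZ_val (sub_act f s) = act f (subZ_val s).
Proof. by move=> h; rewrite /sub_act; case: pselect. Qed.

Definition subS : module_sheaf X.
Proof.
refine (@ModuleSheaf k X T sub_res sub_act _ _ _ _ _ _ _ _ _).
- move=> U V VU s t; apply: subZ_eq; rewrite sub_resE //= resD //.
  by rewrite -!sub_resE.
- by move=> U s; apply: subZ_eq; rewrite sub_resE // res_id.
- move=> U V W VU WV s; apply: subZ_eq; rewrite !sub_resE ?res_comp //.
  exact: subset_trans VU.
- by move=> U f rf s t; apply: subZ_eq; rewrite sub_actE //= actDr // -!sub_actE.
- move=> U f g rf rg s; apply: subZ_eq; rewrite sub_actE /= ?actDl -?sub_actE //.
  exact: regularD.
- move=> U f g rf rg s; apply: subZ_eq; rewrite !sub_actE ?actM //.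
  exact: regularM.
- by move=> U s; apply: subZ_eq; rewrite sub_actE ?act1 //; exact: regular1.
- move=> U V VU f rf s; apply: subZ_eq.
  rewrite sub_resE // !sub_actE ?res_act ?sub_resE //; exact: regular_sub rf.
move=> U D DU cov s hs.
have [|t [ht ut]] := @glue _ _ G U D DU cov (fun V => subZ_val (s V)).
  by move=> V V' W DV DV' WV WV'; have /(congr1 (@subZ_val _ _ _)) := hs V V' W DV DV' WV WV'; rewrite !sub_resE.
have St : S U t.
  apply: cond_loc => P UP; have [V DV VP] := cov P UP; exists V; split=> //; first exact: DU.
  by rewrite ht //; exact: subZ_P.
exists (mkZ _ St); split=> [V DV|t' ht']; apply: subZ_eq.
  by rewrite sub_resE ?ht //; exact: DU.
by apply: ut => V DV; rewrite -(ht' V DV) sub_resE //; exact: DU.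
Defined.

Definition sub_mk U s (h : S U s) : subS U := mkZ _ h.
Definition sub_val U (s : subS U) : G U := subZ_val s.

Lemma sub_valP U (s : subS U) : S U (sub_val s).
Proof. exact: subZ_P. Qed.
Lemma sub_eq U (s t : subS U) : sub_val s = sub_val t -> s = t.
Proof. exact: subZ_eq. Qed.
Lemma sub_val_res U V (s : subS U) : V `<=` U -> sub_val (res V s) = res V (sub_val s).
Proof. exact: sub_resE. Qed.
Lemma sub_val_act U f (s : subS U) : regular U f -> sub_val (act f s) = act f (sub_val s).
Proof. exact: sub_actE. Qed.
Lemma sub_val0 U : sub_val (0 : subS U) = 0.
Proof. by []. Qed.
Lemma sub_val_sum U n (s : 'I_n -> subS U) : sub_val (\sum_i s i) = \sum_i sub_val (s i).
Proof. by elim/big_rec2: _ => // i y1 y2 _ <-. Qed.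

Definition sub_incl : hom subS G.
Proof.
exists sub_val => // [U f s rf|U V VU s]; [exact: sub_val_act|exact: sub_val_res].
Defined.

Definition sub_hom F (h : hom F G) (hS : forall U s, S U (h U s)) : hom F subS.
Proof.
exists (fun U s => sub_mk (hS U s)).
- by move=> U s t; apply: sub_eq; rewrite /= homD.
- by move=> U f s rf; apply: sub_eq; rewrite sub_val_act //= homZ.
- by move=> U V VU s; apply: sub_eq; rewrite sub_val_res //= hom_res.
Defined.

End SubSheaf.

(** * The sheaf of sections of a bundle *)

Implicit Types (A B E : bun).

Lemma lat_nbhd E (v : 'rV[K]_(rk E)) : finite_set [set Q | ~ lat E Q v].
Proof.
apply: (@sub_finite_set _ _ ([set Q | gen E Q <> 1%:M] `|` [set Q | ~ imx Q v])).
  move=> Q /= h; apply: contrapT => /not_orP [/contrapT e /contrapT i]; apply: h.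
  by rewrite /lat /= e invmx1 mulmx1.
by rewrite finite_setU; split; [exact: gen_fin|exact: pole_finite].
Qed.

Definition lat_cond E : subcond (constS (rk E)).
Proof.
exists (fun U => [set v | forall P, open_set U P -> lat E P v]).
- move=> U; split=> [P _|s t hs ht P UP]; first exact: lat0.
  by apply: latB; [exact: hs|exact: ht].
- by move=> U f s rf hs P UP; apply: lat_reg; [exact: rf|exact: hs].
- by move=> U V s VU hs P /VU; exact: hs.
- by move=> U s h P UP; have [V [VU VP hV]] := h P UP; exact: hV.
Defined.

Definition latS E : module_sheaf X := subS (lat_cond E).
Definition vec E U (s : latS E U) : 'rV[K]_(rk E) := sub_val s.
Definition mklat E U v (h : forall P, open_set U P -> lat E P v) : latS E U := @sub_mk _ (lat_cond E) U v h.

Lemma vecP E U (s : latS E U) P : open_set U P -> lat E P (vec s).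
Proof. exact: (sub_valP s). Qed.
Lemma vec_inj E U (s t : latS E U) : vec s = vec t -> s = t.
Proof. exact: (@sub_eq _ (lat_cond E)). Qed.
Lemma vec_mk E U v h : vec (@mklat E U v h) = v. Proof. by []. Qed.
Lemma vec_res E U V (s : latS E U) : V `<=` U -> vec (res V s) = vec s.
Proof. exact: (@sub_val_res _ (lat_cond E)). Qed.
Lemma vec_act E U f (s : latS E U) : regular U f -> vec (act f s) = f *: vec s.
Proof. exact: (@sub_val_act _ (lat_cond E)). Qed.
Lemma vecD E U (s t : latS E U) : vec (s + t) = vec s + vec t. Proof. by []. Qed.
Lemma vec0 E U : vec (0 : latS E U) = 0. Proof. by []. Qed.
Lemma vec_sum E U n (s : 'I_n -> latS E U) : vec (\sum_i s i) = \sum_i vec (s i).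
Proof. exact: (@sub_val_sum _ (lat_cond E)). Qed.

Section MxHom.
Variables (A B : bun) (M : 'M[K]_(rk A, rk B)) (hM : H0 A B M).

Lemma mx_lat U (s : latS A U) P : open_set U P -> lat B P (vec s *m M).
Proof. by move=> UP; apply: homL_lat (hM P) (vecP s UP). Qed.

Definition mx_fun U (s : latS A U) : latS B U := mklat (mx_lat s).

Lemma mx_funE U (s : latS A U) : vec (mx_fun s) = vec s *m M.
Proof. by []. Qed.

Lemma mx_funD U (s t : latS A U) : mx_fun (s + t) = mx_fun s + mx_fun t.
Proof. by apply: vec_inj; rewrite vecD !mx_funE vecD mulmxDl. Qed.

Lemma mx_funZ U f (s : latS A U) : regular U f -> mx_fun (act f s) = act f (mx_fun s).
Proof. by move=> rf; apply: vec_inj; rewrite vec_act // !mx_funE vec_act // scalemxAl. Qed.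

Lemma mx_fun_res U V : V `<=` U -> forall s : latS A U, mx_fun (res V s) = res V (mx_fun s).
Proof. by move=> VU s; apply: vec_inj; rewrite vec_res // !mx_funE vec_res. Qed.

Definition mx_hom : hom (latS A) (latS B) := Hom mx_funD mx_funZ mx_fun_res.

Lemma mx_homE U s : vec (mx_hom U s) = vec s *m M.
Proof. exact: mx_funE. Qed.

End MxHom.
Lemma lat_open E n (M : 'M[K]_(n, rk E)) U P : open_set U P -> (forall i, lat E P (row i M)) ->
  exists V, [/\ V `<=` U, open_set V P & forall i Q, open_set V Q -> lat E Q (row i M)].
Proof.
move=> UP hf; have [|V [VU VP h]] := shrink_family (fun i => lat_nbhd (row i M)) UP.
  by move=> i; apply.
by exists V; split=> // i Q /(h i) /contrapT.
Qed.

Lemma gen_nbhd E U P : open_set U P -> exists V, [/\ V `<=` U, open_set V P,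
  forall i Q, open_set V Q -> lat E Q (row i (gen E P)) &
  forall Q v, open_set V Q -> lat E Q v -> imx Q (v *m invmx (gen E P))].
Proof.
move=> UP.
have [V [VU VP hV]] := lat_open UP (fun i => lat_gen (E := E) P i).
pose A := [set Q | gen E Q <> 1%:M] `|` [set Q | ~ imx Q (invmx (gen E P))].
have fA : finite_set (A `\ P).
  apply: (@sub_finite_set _ _ A) => [Q []//|]; rewrite finite_setU.
  by split; [exact: gen_fin|exact: pole_finite].
have [|W [WV WP hW]] := shrink fA VP; first by case=> _ /=; apply.
exists W; split=> // [|i Q /WV|Q v WQ hv]; [exact: subset_trans VU|exact: hV|].
have [e|ne] := pselect (Q = P); first by subst Q; exact: hv.
have /not_orP [/contrapT e /contrapT i] : ~ A Q by move=> h; exact: (hW Q WQ).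
by apply: imxM => //; move: hv; rewrite /lat /= e invmx1 mulmx1.
Qed.

Lemma latS_frame E P : exists U (e : 'I_(rk E) -> latS E U),
  [/\ open_set U P, frame e & forall i, vec (e i) = row i (gen E P)].
Proof.
have [T TP] : exists T : opens X, open_set T P.
  have fT : finite_set (~` [set: point X]) by rewrite setCT.
  by exists (Opens fT).
have [U [_ UP h1 h2]] := gen_nbhd E TP.
pose e i := mklat (h1 i); exists U, e; split=> // V VU s.
exists (vec s *m invmx (gen E P)); split=> [|f [rf ->]].
  split=> [i Q VQ|]; first by apply: (h2 Q (vec s) (VU Q VQ) (vecP s VQ)).
  have rf i : regular V ((vec s *m invmx (gen E P)) 0 i).
    by move=> Q VQ; apply: (h2 Q (vec s) (VU Q VQ) (vecP s VQ)).
  apply: vec_inj; rewrite vec_sum (eq_bigr (fun i => (vec s *m invmx (gen E P)) 0 i *: row i (gen E P))).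
    by rewrite -mulmx_sum_row mulmxKV ?gen_unit.
  by move=> i _; rewrite vec_act // vec_res.
rewrite vec_sum (eq_bigr (fun i => f 0 i *: row i (gen E P))).
  by rewrite -mulmx_sum_row mulmxK ?gen_unit.
by move=> i _; rewrite vec_act // vec_res.
Qed.

Lemma frame_presented F U r (e : 'I_r -> F U) : frame e ->
  presented e (fun (j : 'I_0) (i : 'I_r) => 0 : K).
Proof.
move=> fe; split=> [[]//|[]//|V VU s Q VQ|V VU f rf ef Q VQ].
  exists V; split=> //; have [c [[rc ->] _]] := fe V VU s.
  exists (fun i => c 0 i); split=> //; rewrite res_id //.
exists V; split=> //; exists (fun _ => 0); split=> [[]//|i].
have [c [_ uc]] := fe V VU 0; rewrite big_ord0.
have -> : f i = (\row_j f j) 0 i by rewrite mxE.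
rewrite -(uc (\row_j f j)) ?(uc 0) ?mxE //.
  split=> [j|]; first by rewrite mxE; exact: regular0.
  by rewrite big1 // => j _; rewrite mxE act0l.
split=> [j|]; first by rewrite mxE.
rewrite -{1}ef; apply: eq_bigr => j _; by rewrite mxE.
Qed.

Lemma latS_coherent E : coherent (latS E).
Proof.
move=> P; have [U [e [UP fe _]]] := latS_frame E P.
exists U; split=> //; exists (rk E), e, 0%N, (fun j i => 0); exact: frame_presented.
Qed.

Definition latC E : coh X := Coh (@latS_coherent E).

End Constructions.

Section Coherent.
Implicit Types (P Q : point X) (U V W : opens X) (G H : module_sheaf X).

(** * The rank of a coherent sheaf *)

(** Linear algebra over K turns a presentation into a basis on the open set
    where the matrices that occur are regular. *)
Lemma frame_exists (F : coh X) : exists U r (e : 'I_r -> F U), frame e.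
Proof.
have [U [UP [n [e [m [a [ra ea sp rl]]]]]]] := cohP F pinf.
pose M : 'M[K]_(m, n) := \matrix_(j, i) a j i.
pose q := \rank (cokermx M); pose Q : 'M[K]_(n, q) := col_base (cokermx M).
pose S : 'M[K]_(q, n) := pinvmx Q.
have SQ : S *m Q = 1%:M by apply: mulVpmx; exact: col_base_full.
have MQ : M *m Q = 0.
  have : M *m Q *m row_base (cokermx M) = 0 by rewrite -mulmxA mulmx_base mulmx_coker.
  move=> /(congr1 (mulmx^~ (pinvmx (row_base (cokermx M))))).
  by rewrite -[LHS]/(_ *m _ *m _) mulmxKp ?row_base_free // mul0mx.
have [D eD] : exists D, 1%:M - Q *m S = D *m M.
  suff /submxP [D ->] : (1%:M - Q *m S <= M)%MS by exists D.
  rewrite submxE -(mulmx_base (cokermx M)) -/Q mulmxA mulmxBl mul1mx -mulmxA SQ mulmx1 subrr.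
  by rewrite mul0mx.
pose A := [set P | ~ imx P Q] `|` ([set P | ~ imx P S] `|` [set P | ~ imx P D]).
have fA : finite_set A by rewrite !finite_setU; do !split; exact: pole_finite.
pose U' := remO U fA.
have U'U : U' `<=` U by move=> P [].
have rS V i j : V `<=` U' -> regular V (S i j).
  by move=> VU P /VU [_ /= h]; apply: contrapT => h'; apply: h; right; left => /(_ i j).
have rD V i j : V `<=` U' -> regular V (D i j).
  by move=> VU P /VU [_ /= h]; apply: contrapT => h'; apply: h; right; right => /(_ i j).
have rQ V i j : V `<=` U' -> regular V (Q i j).
  by move=> VU P /VU [_ /= h]; apply: contrapT => h'; apply: h; left => /(_ i j).
pose b (j : 'I_q) : F U' := \sum_i act (S j i) (res U' (e i)).
have resb V j : V `<=` U' -> res V (b j) = \sum_i act (S j i) (res V (e i)).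
  move=> VU; rewrite res_sum //; apply: eq_bigr => i _.
  rewrite res_act ?res_comp //; exact: rS.
have comb V (h : 'rV[K]_q) : V `<=` U' -> (forall j, regular V (h 0 j)) ->
    \sum_j act (h 0 j) (res V (b j)) = \sum_i act ((h *m S) 0 i) (res V (e i)).
  move=> VU rh; rewrite (eq_bigr (fun j => \sum_i act (h 0 j * S j i) (res V (e i)))).
    rewrite exchange_big; apply: eq_bigr => i _; rewrite mxE act_suml // => j.
    by apply: regularM => //; exact: rS.
  move=> j _; rewrite resb // act_sumr //; apply: eq_bigr => i _; rewrite actM //; exact: rS.
have uniq0 V (h : 'rV[K]_q) : V `<=` U' -> (forall j, regular V (h 0 j)) ->
    \sum_j act (h 0 j) (res V (b j)) = 0 -> h = 0.
  move=> VU rh; rewrite comb // => e0; have [P VP] := open_point V.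
  have rhS i : regular V ((h *m S) 0 i).
    by rewrite mxE; apply: regular_sum => j; apply: regularM => //; exact: rS.
  have [W [WV WP [c [rc ec]]]] := rl V (subset_trans VU U'U) (fun i => (h *m S) 0 i) rhS e0 P VP.
  have ehS : h *m S = (\row_j c j) *m M.
    by apply/rowP => i; rewrite ec mxE; apply: eq_bigr => j _; rewrite !mxE.
  by rewrite -[h]mulmx1 -SQ mulmxA ehS -mulmxA MQ mulmx0.
have uniqE V (h h' : 'rV[K]_q) : V `<=` U' -> (forall j, regular V (h 0 j)) -> (forall j, regular V (h' 0 j)) ->
    \sum_j act (h 0 j) (res V (b j)) = \sum_j act (h' 0 j) (res V (b j)) -> h = h'.
  move=> VU rh rh' ehh; apply/eqP; rewrite -subr_eq0; apply/eqP/(uniq0 V) => //.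
    by move=> j; rewrite !mxE; apply: regularD => //; exact: regularN.
  rewrite (eq_bigr (fun j => act (h 0 j) (res V (b j)) - act (h' 0 j) (res V (b j)))).
    by rewrite sumrB ehh subrr.
  by move=> j _; rewrite !mxE actDl ?actNl //; exact: regularN.
have local V (s : F V) P : V `<=` U' -> open_set V P -> exists W, [/\ W `<=` V, open_set W P &
    exists h : 'rV[K]_q, (forall j, regular W (h 0 j)) /\ res W s = \sum_j act (h 0 j) (res W (b j))].
  move=> VU VP; have [W [WV WP [f [rf es]]]] := sp V (subset_trans VU U'U) s P VP.
  have WU : W `<=` U' by exact: subset_trans VU.
  pose h := (\row_i f i) *m Q; have rh j : regular W (h 0 j).
    by rewrite mxE; apply: regular_sum => i; rewrite mxE; apply: regularM => //; exact: rQ.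
  exists W; split=> //; exists h; split=> //; rewrite comb // es.
  apply/eqP; rewrite -subr_eq0 -sumrB; apply/eqP.
  have rhS i : regular W ((h *m S) 0 i).
    by rewrite mxE; apply: regular_sum => j; apply: regularM => //; exact: rS.
  pose c := (\row_i f i) *m D; have rc j : regular W (c 0 j).
    by rewrite mxE; apply: regular_sum => i; rewrite mxE; apply: regularM => //; exact: rD.
  have WUU : W `<=` U by exact: subset_trans U'U.
  have raW j i : regular W (a j i) by apply: regular_sub (ra j i).
  have efc i : f i - (h *m S) 0 i = \sum_j c 0 j * a j i.
    have : (\row_i f i) *m (1%:M - Q *m S) = c *m M by rewrite eD mulmxA.
    rewrite mulmxBr mulmx1 mulmxA -/h => /rowP /(_ i) e1.
    have eL : (\row_i f i - h *m S) 0 i = f i - (h *m S) 0 i.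
      by rewrite mxE [X in X + _]mxE [X in _ + X]mxE.
    by rewrite -eL e1 mxE; apply: eq_bigr => j _; rewrite [M j i]mxE.
  rewrite (eq_bigr (fun i => \sum_j act (c 0 j) (act (a j i) (res W (e i))))).
    rewrite exchange_big big1 // => j _; rewrite -act_sumr //.
    rewrite (eq_bigr (fun i => res W (act (a j i) (e i)))) => [|i _]; last by rewrite res_act.
    by rewrite -res_sum // ea res0 // act0r.
  move=> i _; rewrite -actNl // -actDl //; last exact: regularN.
  rewrite efc act_suml => [|j]; last exact: regularM.
  by apply: eq_bigr => j _; rewrite actM.
exists U', q, b => V VU s.
have [P0 VP0] := open_point V.
have [W0 [W0V W0P [h [rh eh]]]] := local V s P0 VU VP0.
have same W (h' : 'rV[K]_q) : W `<=` V -> (forall j, regular W (h' 0 j)) ->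
    res W s = \sum_j act (h' 0 j) (res W (b j)) -> h' = h.
  move=> WV rh' eh'; pose I := capO W W0.
  have IV : I `<=` V by move=> R [/WV].
  have IU : I `<=` U' by exact: subset_trans VU.
  have IW : I `<=` W := @capOl W W0. have IW0 : I `<=` W0 := @capOr W W0.
  have r1 j : regular I (h' 0 j) by apply: regular_sub (rh' j).
  have r2 j : regular I (h 0 j) by apply: regular_sub (rh j).
  apply: (uniqE I) => //.
  transitivity (res I s).
    rewrite -(res_comp WV IW) eh' res_sum //; apply: eq_bigr => j _.
    by rewrite res_act // res_comp // => R /WV /VU.
  rewrite -(res_comp W0V IW0) eh res_sum //; apply: eq_bigr => j _.
  by rewrite res_act // res_comp // => R /W0V /VU.
have rV j : regular V (h 0 j).
  move=> R VR; have [W [WV WR [h' [rh' eh']]]] := local V s R VU VR.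
  by rewrite -(same W h' WV rh' eh'); exact: rh'.
exists h; split=> [|h' [rh' eh']]; last by apply/esym/(same V) => //; rewrite res_id.
split=> //; apply: separated => R VR; have [W [WV WR [h' [rh' eh']]]] := local V s R VU VR.
exists W; split=> //; rewrite eh' (same W h' WV rh' eh') res_sum //.
apply: eq_bigr => j _; rewrite res_act // res_comp //; exact: VU.
Qed.

Section Coordinates.
Variables (F : module_sheaf X) (U0 : opens X) (r : nat) (e : 'I_r -> F U0).
Hypothesis fe : frame e.

Lemma coord_ex U (s : F U) : exists v : 'rV[K]_r, (forall i, regular (capO U U0) (v 0 i)) /\
  res (capO U U0) s = \sum_i act (v 0 i) (res (capO U U0) (e i)).
Proof. by have [v [h _]] := fe (@capOr U U0) (res (capO U U0) s); exists v. Qed.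

Definition fcoord U (s : F U) : 'rV[K]_r := projT1 (cid (coord_ex s)).

Lemma coordP U (s : F U) : (forall i, regular (capO U U0) (fcoord s 0 i)) /\
  res (capO U U0) s = \sum_i act (fcoord s 0 i) (res (capO U U0) (e i)).
Proof. by rewrite /fcoord; case: cid. Qed.

Lemma coord_on U V (s : F U) : V `<=` U -> V `<=` U0 -> (forall i, regular V (fcoord s 0 i)) /\
  res V s = \sum_i act (fcoord s 0 i) (res V (e i)).
Proof.
move=> VU VU0; have VW := capOS VU VU0; have [rs es] := coordP s.
split=> [i|]; first exact: regular_sub (rs i).
rewrite -(res_comp (@capOl U U0) VW) es res_sum //; apply: eq_bigr => i _.
by rewrite res_act // res_comp //; exact: capOr.
Qed.

Lemma coord_eq U V (s : F U) (v : 'rV[K]_r) : V `<=` U -> V `<=` U0 -> (forall i, regular V (v 0 i)) ->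
  res V s = \sum_i act (v 0 i) (res V (e i)) -> fcoord s = v.
Proof.
move=> VU VU0 rv ev; have [r1 e1] := coord_on s VU VU0.
by have [w [_ uw]] := fe VU0 (res V s); rewrite -(uw v) ?(uw (fcoord s)).
Qed.

Lemma coord_res U V (s : F U) : V `<=` U -> fcoord (res V s) = fcoord s.
Proof.
move=> VU; have h : capO V U0 `<=` U by move=> P [/VU].
have [r1 e1] := coord_on s h (@capOr V U0).
apply: coord_eq r1 _; [exact: capOl|exact: capOr|rewrite res_comp //; exact: capOl].
Qed.

Lemma coordD U (s t : F U) : fcoord (s + t) = fcoord s + fcoord t.
Proof.
have [r1 e1] := coordP s; have [r2 e2] := coordP t.
apply: (@coord_eq _ (capO U U0)); [exact: capOl|exact: capOr| |].
  by move=> i; rewrite mxE; exact: regularD.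
rewrite resD ?e1 ?e2; last exact: capOl.
by rewrite -big_split; apply: eq_bigr => i _; rewrite mxE actDl.
Qed.

Lemma coordZ U f (s : F U) : regular U f -> fcoord (act f s) = f *: fcoord s.
Proof.
move=> rf; have [r1 e1] := coordP s; have rf' : regular (capO U U0) f by apply: regular_sub rf; exact: capOl.
apply: (@coord_eq _ (capO U U0)); [exact: capOl|exact: capOr| |].
  by move=> i; rewrite mxE; exact: regularM.
rewrite res_act ?e1 //; last exact: capOl.
by rewrite act_sumr //; apply: eq_bigr => i _; rewrite mxE actM.
Qed.

Definition coord_hom : hom F (constS r) := @Hom _ _ F (constS r) (fun U (s : F U) => fcoord s) coordD coordZ (fun U V VU s => coord_res s VU).

Lemma coord_comb U n (f : 'I_n -> K) (s : 'I_n -> F U) : (forall i, regular U (f i)) ->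
  fcoord (\sum_i act (f i) (s i)) = \sum_i f i *: fcoord (s i).
Proof.
move=> rf; rewrite -[LHS]/(coord_hom U _) hom_sum; apply: eq_bigr => i _.
exact: coordZ.
Qed.

Lemma coord_reg U (s : F U) P i : open_set U P -> open_set U0 P -> regular_at P (fcoord s 0 i).
Proof. by move=> UP U0P; have [rs _] := coordP s; apply: rs. Qed.

Lemma coord_inj U (s : F U) : U `<=` U0 -> fcoord s = 0 -> s = 0.
Proof.
move=> UU e0; have [_] := coord_on s (@subset_refl _ _) UU.
by rewrite res_id e0 big1 // => i _; rewrite mxE act0l.
Qed.

Lemma coord_e U i : U `<=` U0 -> fcoord (res U (e i)) = delta_mx 0 i.
Proof.
move=> UU; have rd j : regular U ((delta_mx 0 i : 'rV[K]_r) 0 j).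
  by rewrite mxE; case: (_ && _); [exact: regular1|exact: regular0].
apply: (coord_eq (@subset_refl _ _) UU) => //; rewrite res_id (bigD1 i) //= mxE !eqxx act1.
by rewrite big1 ?addr0 // => j ne; rewrite mxE (negPf ne) andbF act0l.
Qed.

(** The stalk at P modulo torsion, as a lattice in the generic fibre. *)
Definition latF P : set 'rV[K]_r := [set v | exists U (s : F U), open_set U P /\ fcoord s = v].

Hypothesis cF : coherent F.

Lemma germs P : exists U n (g : 'I_n -> F U), open_set U P /\
  forall V, V `<=` U -> forall (s : F V) Q, open_set V Q -> exists W, [/\ W `<=` V, open_set W Q &
    exists f : 'I_n -> K, (forall i, regular W (f i)) /\ res W s = \sum_i act (f i) (res W (g i))].
Proof. by have [U [UP [n [g [m [a [_ _ h _]]]]]]] := cF P; exists U, n, g. Qed.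

Lemma latF_good P : open_set U0 P -> forall v, latF P v <-> imx P v.
Proof.
move=> U0P v; split=> [[U [s [UP <-]]] i j|iv]; first by rewrite ord1; exact: coord_reg.
have [|V [VU VP rV]] := @regular_nbhd r (fun i => v 0 i) U0 P U0P; first by [].
exists V, (\sum_i act (v 0 i) (res V (e i))); split=> //.
rewrite coord_comb // [RHS]row_sum_delta; apply: eq_bigr => i _; by rewrite coord_e.
Qed.

Lemma latF_lattice P : is_lattice P (latF P).
Proof.
have [U [n [g [UP hg]]]] := germs P.
split.
- move=> _ _ [V [s [VP <-]]] [W [t [WP <-]]].
  exists (capO V W), (res (capO V W) s + res (capO V W) t); split=> //.
  by rewrite coordD !coord_res //; [exact: capOr|exact: capOl].
- move=> c _ rc [V [s [VP <-]]].
  have [|W [WV WP rW]] := @regular_nbhd 1 (fun=> c) V P VP; first by [].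
  exists W, (act c (res W s)); split=> //; rewrite coordZ ?coord_res //; exact: (rW 0).
- pose M : 'M[K]_(n, r) := \matrix_i fcoord (g i); have [N hN] := imx_pole P M.
  exists N => _ [V [s [VP <-]]].
  have hV : capO V U `<=` U := @capOr V U.
  have [W [WV WP [f [rf ef]]]] := hg _ hV (res (capO V U) s) P (conj VP UP).
  have WV' : W `<=` V by move=> Q /WV [].
  have -> : fcoord s = (\row_i f i) *m M.
    rewrite -(coord_res s WV') -(res_comp (@capOl V U) WV) ef coord_comb // mulmx_sum_row.
    apply: eq_bigr => i _; rewrite mxE rowK coord_res // => Q /WV []; exact.
  rewrite scalemxAr; apply: imxM; last exact: hN.
  by move=> i j; rewrite mxE; exact: rf.
have [Q [UQ U0Q]] := open_point (capO U U0).
have /choice [c hc] i : exists f : 'I_n -> K, delta_mx 0 i = \sum_l f l *: fcoord (g l).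
  have [W [WV WQ [f [rf ef]]]] := hg _ (@capOl U U0) (res (capO U U0) (e i)) Q (conj UQ U0Q).
  have WU : W `<=` U by move=> R /WV [].
  exists f; rewrite -(coord_e i (subset_trans WV (@capOr U U0))).
  rewrite -(res_comp (@capOr U U0) WV) ef coord_comb //.
  by apply: eq_bigr => l _; rewrite coord_res.
pose D : 'M[K]_(r, n) := \matrix_(i, l) c i l.
have hD i : delta_mx 0 i = \sum_l D i l *: fcoord (g l).
  by rewrite hc; apply: eq_bigr => l _; rewrite mxE.
have [N hN] := imx_pole P D; exists N => v iv.
pose f := v *m (tau P ^+ N *: D).
have rf : imx P f by apply: imxM => //; exact: hN.
have [|W [WU WP rW]] := @regular_nbhd n (fun l => f 0 l) U P UP; first by [].
exists W, (\sum_l act (f 0 l) (res W (g l))); split=> //.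
rewrite coord_comb // [in RHS](row_sum_delta v) scaler_sumr.
rewrite (eq_bigr (fun l => \sum_i (tau P ^+ N * v 0 i * D i l) *: fcoord (g l))).
  rewrite exchange_big; apply: eq_bigr => i _; rewrite hD !scaler_sumr.
  by apply: eq_bigr => l _; rewrite !scalerA.
move=> l _; rewrite coord_res // -scaler_suml /f -scalemxAr mxE mxE mulr_sumr; congr (_ *: _).
by apply: eq_bigr => i _; rewrite mulrA.
Qed.

Lemma bar_exists : exists (g : point X -> 'M[K]_r) (gU : forall P, g P \in unitmx)
  (gf : finite_set [set P | g P <> 1%:M]), forall P v, latF P v <-> lat (Bun gU gf) P v.
Proof.
apply: (@bundle_of_lattices r latF); first exact: latF_lattice.
apply: sub_finite_set (open_cofinite U0) => P /= h U0P; apply: h; exact: latF_good.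
Qed.

End Coordinates.

(** A coherent sheaf F maps onto a bundle N with a kernel supported at finitely
    many points, and the map has a section, which is unique away from these
    points and exists around each of them. *)
Lemma coh_structure (F : coh X) : exists (N : bun) (U0 : opens X) (q : hom F (latS N)) (sg : hom (latS N) F),
  [/\ loc_surj q, forall U (s : F U), U `<=` U0 -> q U s = 0 -> s = 0,
      forall U v, q U (sg U v) = v & has_rank F (rk N)].
Proof.
have [U0 [r [e fe]]] := frame_exists F; have cF := cohP F.
have [g [gU [gf hg]]] := bar_exists fe cF; pose N := Bun gU gf.
pose cd := @fcoord F U0 r e fe.
have hq U (s : F U) P : open_set U P -> lat N P (cd U s) by move=> UP; apply/hg; exists U, s.
pose q : hom F (latS N) := sub_hom (S := lat_cond N) (h := coord_hom fe) hq.
have vq U (s : F U) : vec (q U s) = cd U s by [].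
have qs : loc_surj q.
  move=> U v P UP; have /hg [V [s [VP es]]] := vecP v UP.
  exists (capO U V); split=> //; first exact: capOl.
  exists (res (capO U V) s); apply: vec_inj; rewrite vq vec_res; last exact: capOl.
  rewrite -es; apply: coord_res; exact: capOr.
have qi U (s : F U) : U `<=` U0 -> q U s = 0 -> s = 0.
  by move=> UU /(congr1 (@vec _ _)); rewrite vq => h; exact: coord_inj UU h.
(* Around each point, lifts of the rows of gen N. *)
have /choice [t ht] P : exists t : {V & 'I_r -> F V}, [/\ open_set (tag t) P,
    forall i, cd _ (tagged t i) = row i (g P),
    forall Q v, open_set (tag t) Q -> lat N Q v -> imx Q (v *m invmx (g P))
    & forall Q, open_set (tag t) Q -> Q <> P -> open_set U0 Q].
  have /choice [u hu] i : exists u : {U & F U}, open_set (tag u) P /\ cd _ (tagged u) = row i (g P).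
    by have /hg [U [s hs]] := lat_gen (E := N) P i; exists (existT _ U s).
  pose Ui i := tag (u i); pose si i : F (Ui i) := tagged (u i).
  have siP i : open_set (Ui i) P /\ cd _ (si i) = row i (g P) := hu i.
  have fT : finite_set (~` [set: point X]) by rewrite setCT.
  have TP : open_set (Opens fT) P by [].
  have [V1 [_ V1P _ hV1]] := gen_nbhd N TP.
  pose A := (~` open_set U0 `|` \bigcup_(i in [set: 'I_r]) ~` open_set (Ui i)) `\ P.
  have fA : finite_set A.
    apply: finite_setD; rewrite finite_setU; split; first exact: open_cofinite.
    by apply: finite_family => i; exact: open_cofinite.
  have [|V [VV1 VP hV]] := shrink fA V1P; first by case=> _; apply.
  have VUi i : V `<=` Ui i.
    move=> Q VQ; have [->|ne] := pselect (Q = P); first by case: (siP i).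
    by apply: contrapT => n; apply: (hV Q VQ); split=> //; right; exists i.
  exists (existT _ V (fun i => res V (si i))); split=> //=.
  - by move=> i; rewrite /cd coord_res //; case: (siP i).
  - by move=> Q v /VV1; exact: hV1.
  - by move=> Q VQ ne; apply: contrapT => n; apply: (hV Q VQ); split=> //; left.
pose V P := tag (t P); pose s P : 'I_r -> F (V P) := tagged (t P).
have sP P : [/\ open_set (V P) P, forall i, cd _ (s P i) = row i (g P),
    forall Q v, open_set (V P) Q -> lat N Q v -> imx Q (v *m invmx (g P))
    & forall Q, open_set (V P) Q -> Q <> P -> open_set U0 Q] := ht P.
pose h P W (v : latS N W) : F W := \sum_i act ((vec v *m invmx (g P)) 0 i) (res W (s P i)).
have rh P W (v : latS N W) i : W `<=` V P -> regular W ((vec v *m invmx (g P)) 0 i).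
  by move=> WV Q WQ; have [_ _ hv _] := sP P; apply: hv (WV Q WQ) (vecP v WQ) 0 i.
have ch P W (v : latS N W) : W `<=` V P -> cd W (h P W v) = vec v.
  move=> WV; rewrite /cd coord_comb => [|i]; last exact: rh.
  rewrite (eq_bigr (fun i => (vec v *m invmx (g P)) 0 i *: row i (g P))) => [|i _].
    by rewrite -mulmx_sum_row mulmxKV.
  by congr (_ *: _); have [_ e1 _ _] := sP P; rewrite -(e1 i); exact: coord_res.
have [|P W v w WV|P W f v WV rf|P W W' v WV WW|P Q W v WP WQ|sg hsg] := @hom_glue (latS N) F V h.
- by move=> P; case: (sP P).
- rewrite /h -big_split; apply: eq_bigr => i _; rewrite vecD mulmxDl mxE actDl //; exact: rh.
- rewrite /h act_sumr //; apply: eq_bigr => i _; rewrite vec_act // -scalemxAl mxE actM //; exact: rh.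
- rewrite /h res_sum //; apply: eq_bigr => i _; rewrite vec_res // res_act ?res_comp //; exact: rh.
- have [->|ne] := pselect (P = Q); first by [].
  have WU : W `<=` U0.
    move=> R WR; have [_ _ _ h1] := sP P; have [_ _ _ h2] := sP Q.
    have [eRP|] := pselect (R = P); last by apply: h1; exact: WP.
    by apply: h2; [exact: WQ|rewrite eRP].
  apply/eqP; rewrite -subr_eq0; apply/eqP; apply: (qi _ _ WU); apply: vec_inj; rewrite homB.
  by rewrite -[LHS]/(vec (q W (h P W v)) - vec (q W (h Q W v))) !vq !ch // subrr.
exists N, U0, q, sg; split=> // [U v|]; last by exists U0, e.
have [P UP] := open_point U; apply: vec_inj; rewrite vq.
have hV : open_set (V P) P by case: (sP P).
rewrite /cd -(coord_res fe (sg U v) (@capOl U (V P))) -hom_res; last exact: capOl.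
rewrite (hsg P); last exact: capOr.
by rewrite -/cd ch ?vec_res //; [exact: capOl|exact: capOr].
Qed.

End Coherent.

Section HomMatrices.
Implicit Types (P Q : point X) (U V W : opens X) (A B E F : bun).

Definition fullO : opens X.
Proof. exists [set: point X]; rewrite setCT; exact: finite_set0. Defined.

(** * Homomorphisms of bundles are matrices *)

Lemma vec_section A (v : 'rV[K]_(rk A)) : exists U (s : latS A U), vec s = v.
Proof.
have fA := lat_nbhd v; pose U := remO fullO fA.
have h P : open_set U P -> lat A P v by move=> [_ h]; exact: contrapT h.
by exists U, (mklat h).
Qed.

Lemma vec_section_at A P (v : 'rV[K]_(rk A)) : lat A P v ->
  exists U (s : latS A U), open_set U P /\ vec s = v.
Proof.
move=> hv; have fA := lat_nbhd v; pose U := remO fullO fA.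
have h Q : open_set U Q -> lat A Q v by move=> [_ h]; exact: contrapT h.
by exists U, (mklat h); split=> //; split=> //= n; apply: n.
Qed.

Definition has_mx A B (h : hom (latS A) (latS B)) (M : 'M[K]_(rk A, rk B)) : Prop :=
  forall U (s : latS A U), vec (h U s) = vec s *m M.

Lemma mx_ext A n (M M' : 'M[K]_(rk A, n)) :
  (forall U (s : latS A U), vec s *m M = vec s *m M') -> M = M'.
Proof.
move=> h; apply/row_matrixP => i; rewrite !rowE.
by have [U [s es]] := vec_section (delta_mx 0 i); rewrite -es; exact: h.
Qed.

Lemma has_mx_H0 A B h M : @has_mx A B h M -> H0 A B M.
Proof.
move=> hM P; apply: lat_homL => v /vec_section_at [U [s [UP <-]]].
by rewrite -hM; exact: vecP.
Qed.

(** Homomorphisms commute with multiplication by functions, so they are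
    K-linear on the generic fibre. *)
Lemma lat_hom_mx A B (h : hom (latS A) (latS B)) : exists M, has_mx h M.
Proof.
have [U [e [_ fe ve]]] := latS_frame A pinf.
pose G := gen A pinf; pose M := invmx G *m \matrix_i vec (h U (e i)); exists M => V s.
have [c [[rc ec] _]] := fe _ (@capOr V U) (res (capO V U) s).
have WV := @capOl V U; have WU := @capOr V U.
have es : vec s = c *m G.
  rewrite -(vec_res s WV) ec vec_sum mulmx_sum_row; apply: eq_bigr => i _.
  by rewrite vec_act // vec_res // ve.
rewrite es /M mulmxA mulmxK ?gen_unit // -(vec_res _ WV) -hom_res // ec hom_sum vec_sum mulmx_sum_row.
by apply: eq_bigr => i _; rewrite homZ // vec_act // hom_res // vec_res // rowK.
Qed.

Lemma has_mx_family A B n (f : 'I_n -> hom (latS A) (latS B)) : exists M, forall a, has_mx (f a) (M a).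
Proof. by have [M hM] := choice (fun a => lat_hom_mx (f a)); exists M. Qed.

Lemma has_mx_mx_hom A B M (hM : H0 A B M) : has_mx (mx_hom hM) M.
Proof. by move=> U s; exact: mx_homE. Qed.

Lemma has_mx_id A : has_mx (hom_id (latS A)) 1%:M.
Proof. by move=> U s; rewrite mulmx1. Qed.

Lemma has_mx_scalar A c : has_mx (hom_scalar c (latS A)) (C c)%:M.
Proof. by move=> U s; rewrite mul_mx_scalar -vec_act //; exact: regular_cst. Qed.

Lemma vec_comb A U n (c : 'rV[k]_n) (s : 'I_n -> latS A U) :
  vec (\sum_i act (C (c 0 i)) (s i)) = \sum_i C (c 0 i) *: vec (s i).
Proof. by rewrite vec_sum; apply: eq_bigr => i _; rewrite vec_act //; exact: regular_cst. Qed.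

Lemma hom_basisP A B n (f : 'I_n -> hom (latS A) (latS B)) (M : 'I_n -> 'M[K]_(rk A, rk B)) :
  (forall i, has_mx (f i) (M i)) -> hom_basis f <-> basis C (H0 A B) M.
Proof.
move=> fM.
have key h N (c : 'rV[k]_n) : has_mx h N -> (forall U s, h U s = \sum_i act (C (c 0 i)) (f i U s)) <->
    N = klin C c M.
  move=> hN; have e U (s : latS A U) : vec (\sum_i act (C (c 0 i)) (f i U s)) = vec s *m klin C c M.
    rewrite vec_comb mulmx_sumr; apply: eq_bigr => i _; rewrite fM //.
    by rewrite -scalemxAr.
  split=> [h1|eN U s]; last by apply: vec_inj; rewrite e hN eN.
  by apply: mx_ext => U s; rewrite -hN h1 e.
split=> [hb|[hM hb] h].
  split=> [i|N hN]; first exact: has_mx_H0 (fM i).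
  have [c [hc uc]] := hb (mx_hom hN); have hh := has_mx_mx_hom hN.
  exists c; split=> [|c' ec']; first exact/(key _ _ _ hh).
  by apply: uc; apply/(key _ _ _ hh).
have [N hN] := lat_hom_mx h; have [c [ec uc]] := hb _ (has_mx_H0 hN).
exists c; split=> [|c' hc']; first exact/(key _ _ _ hN).
by apply: uc; apply/(key _ _ _ hN).
Qed.

Lemma hom_dim_lat A B n : hom_dim (latS A) (latS B) n <-> h0 A B n.
Proof.
split=> [[f hf]|h].
  have [M hM] := has_mx_family f.
  have [h1 h2] := (hom_basisP hM).1 hf.
  by apply: (qdim_of_basis _ h1 h2); exact: ksub_H0.
have [M hM] := h0_basis h; have hM0 i : H0 A B (M i) by case: hM.
exists (fun i => mx_hom (hM0 i)); apply/(hom_basisP (fun i => has_mx_mx_hom (hM0 i))).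
exact: hM.
Qed.

(** * Extensions of bundles *)

Lemma exact_short_exact J E F (B : 'M[K]_(rk J, rk E)) (A : 'M[K]_(rk E, rk F)) (ex : exact_seq B A) (hB : H0 J E B) (hA : H0 E F A) :
  short_exact (mx_hom hB) (mx_hom hA).
Proof.
have [fB kA _ oA lJ] := ex; split.
- move=> U s t /(congr1 (@vec _ _)); rewrite !mx_homE => e; apply: vec_inj.
  by rewrite -[vec s]mulmx1 -(mulmxVp fB) mulmxA e -mulmxA mulmxVp // mulmx1.
- move=> U s; apply: vec_inj; rewrite !mx_homE vec0.
  by apply/kA; exists (vec s).
- move=> U s /(congr1 (@vec _ _)); rewrite mx_homE vec0 => /kA [w ew].
  have hw P : open_set U P -> lat J P w by move=> UP; apply/lJ; rewrite -ew; exact: vecP.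
  by exists (mklat hw); apply: vec_inj; rewrite mx_homE.
move=> U s P UP; have [u hu eu] := oA P _ (vecP s UP).
have [V [t [VP et]]] := vec_section_at hu.
exists (capO U V); split=> //; first exact: capOl.
exists (res (capO U V) t); apply: vec_inj; rewrite mx_homE !vec_res ?et //; [exact: capOl|exact: capOr].
Qed.

Section Std.
Variables (A B : bun) (b : 'M[K]_(rk A, rk B)).

(** The extension of A by B with class b: a rational splitting over the affine
    curve, altered by b at infinity. *)
Definition ext_gen P : 'M[K]_(rk B + rk A) :=
  block_mx (gen B P) 0 (if P == pinf then gen A P *m b else 0) (gen A P).

Lemma ext_unit P : ext_gen P \in unitmx.
Proof. by rewrite unitmxE det_lblock unitrM -!unitmxE !gen_unit. Qed.

Lemma ext_fin : finite_set [set P | ext_gen P <> 1%:M].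
Proof.
apply: (@sub_finite_set _ _ ([set P | gen A P <> 1%:M \/ gen B P <> 1%:M] `|` [set pinf])).
  move=> P /= h; apply: contrapT => /not_orP [/not_orP [/contrapT e1 /contrapT e2] /eqP/negPf n].
  by apply: h; rewrite /ext_gen n e1 e2 -scalar_mx_block.
by rewrite finite_setU; split; [exact: bad_finite|exact: finite_set1].
Qed.

Definition extB : bun := Bun ext_unit ext_fin.

Lemma lat_extB P w v : lat extB P (row_mx w v) <->
  lat A P v /\ lat B P (if P == pinf then w - v *m b else w).
Proof.
have e : row_mx w v = row_mx ((if P == pinf then w - v *m b else w) *m invmx (gen B P))
    (v *m invmx (gen A P)) *m ext_gen P.
  rewrite mul_row_block mulmx0 add0r !mulmxKV ?gen_unit //; case: ifP => _.
    by rewrite mulmxA mulmxKV ?gen_unit // subrK.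
  by rewrite mulmx0 addr0.
rewrite /lat /= e mulmxK ?ext_unit //; split=> [/imx_row_mx []//|[? ?]].
by apply/imx_row_mx.
Qed.

Lemma extB_inj : H0 B extB (row_mx 1%:M 0).
Proof.
move=> P; apply: lat_homL => v hv; rewrite mul_mx_row mulmx1 mulmx0; apply/lat_extB.
by split; [exact: lat0|rewrite mul0mx subr0; case: ifP].
Qed.

Lemma extB_prj : H0 extB A (col_mx 0 1%:M).
Proof.
move=> P; apply: lat_homL => u; rewrite -(hsubmxK u) => /lat_extB [h _].
by rewrite mul_row_col mulmx0 add0r mulmx1.
Qed.

Lemma extB_exact : exact_seq (J := B) (E := extB) (F := A) (row_mx 1%:M 0) (col_mx 0 1%:M).
Proof.
split=> [|u||P v hv|P w].
- by apply/row_freeP; exists (col_mx 1%:M 0); rewrite mul_row_col mulmx1 mul0mx addr0.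
- split=> [|[w ->]]; last by rewrite mul_mx_row mulmx1 mulmx0 mul_row_col mulmx0 mul0mx addr0.
  rewrite -{1}(hsubmxK u) mul_row_col mulmx0 add0r mulmx1 => e; exists (lsubmx u).
  by rewrite mul_mx_row mulmx1 mulmx0 -e hsubmxK.
- exact: extB_prj.
- exists (row_mx (if P == pinf then v *m b else 0) v).
    apply/lat_extB; split=> //; case: (P == pinf); last exact: lat0.
    by rewrite subrr; exact: lat0.
  by rewrite mul_row_col mulmx0 add0r mulmx1.
rewrite mul_mx_row mulmx1 mulmx0; split=> [h|/lat_extB [_]].
  by apply/lat_extB; split; [exact: lat0|rewrite mul0mx subr0; case: ifP].
by rewrite mul0mx subr0; case: ifP.
Qed.

Definition std : ext1 (latC A) (latC B) :=
  @Ext1 _ _ (latC A) (latC B) (latC extB) _ _ (exact_short_exact extB_exact extB_inj extB_prj).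

Lemma std_injE U (s : latS B U) : vec (ext_inj std U s) = vec s *m row_mx 1%:M 0.
Proof. exact: mx_homE. Qed.

Lemma std_prjE U (s : latS extB U) : vec (ext_prj std U s) = vec s *m col_mx 0 1%:M.
Proof. exact: mx_homE. Qed.

Lemma std_split : split_ext std -> sumS (Linf A B) (Laff A B) b.
Proof.
move=> [r hr]; have [R hR] := @lat_hom_mx A extB r.
pose Y := lsubmx R; have eR : R = row_mx Y 1%:M.
  rewrite -(hsubmxK R); congr row_mx; apply: mx_ext => U s; rewrite mulmx1.
  have /(congr1 (@vec _ _)) := hr U s; rewrite std_prjE hR => e1.
  by rewrite -[RHS]e1 -{2}(hsubmxK R) -mulmxA mul_row_col mulmx0 add0r mulmx1.
have hR0 := has_mx_H0 hR.
have key P v : lat A P v -> lat B P (if P == pinf then v *m Y - v *m b else v *m Y).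
  move=> hv; have := homL_lat (hR0 P) hv; rewrite eR mul_mx_row mulmx1 => /lat_extB []//.
exists (b - Y), Y; split; last by rewrite subrK.
  by rewrite -opprB; apply: homLN; apply: lat_homL => v /key; rewrite eqxx mulmxBr.
by move=> P /eqP/negPf nP; apply: lat_homL => v /key; rewrite nP.
Qed.

End Std.

(** The entry Y lies in Laff A B', and Y + f b' - b g in Linf A B'. *)
Lemma std_mor A B A' B' (f : 'M[K]_(rk A, rk A')) (g : 'M[K]_(rk B, rk B'))
    (b : 'M[K]_(rk A, rk B)) (b' : 'M[K]_(rk A', rk B')) : H0 A A' f -> H0 B B' g ->
  (exists Y, H0 (extB b) (extB b') (block_mx g 0 Y f)) <->
  sumS (Linf A B') (Laff A B') (f *m b' - b *m g).
Proof.
move=> hf hg; split=> [[Y hY]|[L1 [L2 [h1 h2 e]]]].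
  have key P v : lat A P v ->
      lat B' P (if P == pinf then v *m (b *m g + Y - f *m b') else v *m Y).
    move=> hv; have hu : lat (extB b) P (row_mx (if P == pinf then v *m b else 0) v).
      apply/lat_extB; split=> //; case: (P == pinf); last exact: lat0.
      by rewrite subrr; exact: lat0.
    have := homL_lat (hY P) hu; rewrite mul_row_block mulmx0 add0r => /lat_extB [_].
    by case: (P == pinf); rewrite ?mul0mx ?add0r // !mulmxDr mulmxN !mulmxA.
  exists (- (b *m g + Y - f *m b')), Y; split.
  - by apply: homLN; apply: lat_homL => v /key; rewrite eqxx.
  - by move=> P /eqP/negPf nP; apply: lat_homL => v /key; rewrite nP.
  - by rewrite opprB opprD addrA subrK.
exists L2 => P; apply: lat_homL => u; rewrite -(hsubmxK u).
move: (lsubmx u) (rsubmx u) => w v /lat_extB [hv hw].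
rewrite mul_row_block mulmx0 add0r; apply/lat_extB; split; first exact: homL_lat (hf P) hv.
case: ifP hw => [/eqP eP|/eqP nP] hw; last first.
  by apply: latD; [exact: homL_lat (hg P) hw|exact: homL_lat (h2 P nP) hv].
have -> : w *m g + v *m L2 - v *m f *m b' = (w - v *m b) *m g - v *m L1.
  have -> : L1 = f *m b' - b *m g - L2 by rewrite e addrK.
  rewrite mulmxBl !mulmxBr !mulmxA.
  move: (w *m g) (v *m L2) (v *m f *m b') (v *m b *m g) => a c d x.
  by apply/rowP => j; rewrite !mxE; ring.
apply: latB; first exact: homL_lat (hg P) hw.
by subst P; exact: homL_lat h1 hv.
Qed.

Definition cls A B (xi : ext1 (latC A) (latC B)) (b : 'M[K]_(rk A, rk B)) : Prop :=
  exists (m : hom (latS (extB b)) (ext_mid xi)) (m' : hom (ext_mid xi) (latS (extB b))),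
  [/\ iso m m', forall U s, m U (ext_inj (std b) U s) = ext_inj xi U s
   & forall U s, ext_prj xi U (m U s) = ext_prj (std b) U s].

Lemma cls_std A B b : @cls A B (std b) b.
Proof. by exists (hom_id _), (hom_id _); split. Qed.

Lemma torsionfree_res A U V (s : latS A U) : V `<=` U -> res V s = 0 -> s = 0.
Proof. by move=> VU /(congr1 (@vec _ _)); rewrite vec_res // => h; exact: vec_inj. Qed.

(** Homomorphisms to a bundle kill torsion. *)
Lemma hom_descend_lat A N (F : module_sheaf X) (U0 : opens X) (q : hom F (latS N)) (m : hom F (latS A)) :
  loc_surj q -> (forall U s, U `<=` U0 -> q U s = 0 -> s = 0) ->
  exists f : hom (latS N) (latS A), forall U s, f U (q U s) = m U s.
Proof.
move=> ql q0; apply: hom_descend ql _ => U s e; have VU := @capOl U U0.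
apply: (torsionfree_res VU); rewrite -hom_res // [res _ s]q0 ?hom0 //; first exact: capOr.
by rewrite hom_res // e res0.
Qed.

Lemma torsionfree_iso (F : coh X) : (forall U V (s : F U), V `<=` U -> res V s = 0 -> s = 0) ->
  exists (N : bun) (q : hom F (latS N)) (q' : hom (latS N) F), iso q q' /\ has_rank F (rk N).
Proof.
move=> tf; have [N [U0 [q [sg [qs qi qsg rF]]]]] := coh_structure F.
exists N, q, sg; split=> //; split=> // U s.
apply/eqP; rewrite -subr_eq0; apply/eqP; apply: (tf _ (capO U U0)); first exact: capOl.
apply: qi; first exact: capOr.
by rewrite hom_res ?homB ?qsg ?subrr ?res0 //; exact: capOl.
Qed.

(** The middle term is torsion-free, hence a bundle, and the class is the
    difference of a section at infinity and a section over the affine curve. *)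
Lemma cls_ex A B (xi : ext1 (latC A) (latC B)) : exists b, cls xi b.
Proof.
have [inji pi ex sp] := ext_exact xi; set i := ext_inj xi in inji pi ex *.
set p := ext_prj xi in pi ex sp *; set M := ext_mid xi in i p inji pi ex sp *.
have i0 U s : i U s = 0 -> s = 0 by move=> e; apply: inji; rewrite e hom0.
have [N [q [q' [[q'q qq'] _]]]] : exists (N : bun) (q : hom M (latS N)) (q' : hom (latS N) M),
    iso q q' /\ has_rank M (rk N).
  apply: torsionfree_iso => U V s VU e.
  have : p U s = 0.
    apply: (torsionfree_res VU); transitivity (p V (res V s)); first exact: (esym (hom_res p VU s)).
    by rewrite e hom0.
  move=> /ex [t et]; rewrite -et; suff -> : t = 0 by rewrite hom0.
  by apply: (torsionfree_res VU); apply: i0; rewrite hom_res // et.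
have [Bm hB] := @lat_hom_mx B N (hom_comp i q).
have [Am hA] := @lat_hom_mx N A (hom_comp q' p).
have fB : row_free Bm.
  rewrite -kermx_eq0; apply/eqP/row_matrixP => j; rewrite row0.
  have [U [s es]] := @vec_section B (row j (kermx Bm)).
  have : vec (q U (i U s)) = 0 by rewrite -[LHS]/(vec (hom_comp i q U s)) hB es -row_mul mulmx_ker row0.
  move=> e; rewrite -es; suff -> : s = 0 by rewrite vec0.
  by apply: i0; rewrite -[LHS]q'q -(hom0 q' U); congr (q' U _); exact: vec_inj.
have exA : exact_seq (J := B) (E := N) (F := A) Bm Am.
  have lift U (s : latS N U) : vec s *m Am = 0 -> exists t : latS B U, vec t *m Bm = vec s.
    move=> e; have : p U (q' U s) = 0 by apply: vec_inj; rewrite -[LHS]/(vec (hom_comp q' p U s)) hA.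
    move=> /ex [t et]; exists t; rewrite -hB -[hom_comp i q U t]/(q U (i U t)) et qq' //.
  split=> // [v||P v hv|P w].
  - split=> [e|[w ->]].
      have [U [s es]] := @vec_section N v; have [|t et] := lift U s; first by rewrite es.
      by exists (vec t); rewrite et.
    have [U [s es]] := @vec_section B w.
    rewrite -es -hB -hA -[X in vec X]/(p U (q' U (q U (i U s)))) q'q pi; exact: vec0.
  - exact: has_mx_H0 hA.
  - have [U [s [UP es]]] := vec_section_at hv; have [V [VU VP [t et]]] := sp U s P UP.
    exists (vec (q V t)); first exact: vecP.
    by rewrite -hA -[X in vec X]/(p V (q' V (q V t))) q'q et vec_res.
  split=> [h|h]; first exact: homL_lat (has_mx_H0 hB P) h.
  have [U [s [UP es]]] := vec_section_at h.
  have [|t et] := lift U s; last first.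
    have -> : w = vec t; last exact: vecP.
    apply: (row_free_inj fB); by rewrite et es.
  rewrite es; have [U' [s' es']] := @vec_section B w.
  rewrite -es' -hB -hA -[X in vec X]/(p U' (q' U' (q U' (i U' s')))) q'q pi; exact: vec0.
have [Si hSi eSi] := local_section exA pinf; have [Sa hSa eSa] := affine_section exA.
have [b eb] : exists b, Si - Sa = b *m Bm.
  by apply: (exact_kill exA); rewrite mulmxBl eSi eSa subrr.
exists b; pose T : 'M[K]_(rk B + rk A, rk N) := col_mx Bm Sa.
have hB0 := has_mx_H0 hB.
have hT : H0 (extB b) N T.
  move=> P; apply: lat_homL => u; rewrite -(hsubmxK u).
  move: (lsubmx u) (rsubmx u) => w v /lat_extB [hv hw]; rewrite mul_row_col.
  case: ifP hw => [/eqP eP|/eqP nP] hw; last first.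
    by apply: latD; [exact: homL_lat (hB0 P) hw|exact: homL_lat (hSa P nP) hv].
  have -> : w *m Bm + v *m Sa = (w - v *m b) *m Bm + v *m Si.
    have -> : Si = b *m Bm + Sa by rewrite -eb subrK.
    by rewrite mulmxBl mulmxDr !mulmxA addrA subrK.
  by apply: latD; [exact: homL_lat (hB0 P) hw|subst P; exact: homL_lat hSi hv].
have [T' [hT' [TT' T'T]]] : exists T', H0 N (extB b) T' /\ T *m T' = 1%:M /\ T' *m T = 1%:M.
  have [D eD] : exists D, 1%:M - Am *m Sa = D *m Bm.
    by apply: (exact_kill exA); rewrite mulmxBl mul1mx -mulmxA eSa mulmx1 subrr.
  have BA := exact_comp0 exA.
  have BD : Bm *m D = 1%:M.
    apply: (row_free_inj fB); rewrite -mulmxA -eD mulmxBr mulmx1 mulmxA BA mul0mx subr0 mul1mx //.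
  have SD : Sa *m D = 0.
    apply: (row_free_inj fB); rewrite -mulmxA -eD mulmxBr mulmx1 mulmxA eSa mul1mx subrr mul0mx //.
  exists (row_mx D Am); split; last split.
  - move=> P; apply: lat_homL => v hv; rewrite mul_mx_row; apply/lat_extB.
    have hvA := homL_lat (has_mx_H0 hA P) hv; split=> //.
    have [_ _ _ _ lJ] := exA; apply/lJ.
    case: ifP => [/eqP eP|/eqP nP].
      have -> : (v *m D - v *m Am *m b) *m Bm = v - v *m Am *m Si.
        have -> : Si = b *m Bm + Sa by rewrite -eb subrK.
        rewrite mulmxBl -(mulmxA v D) -eD mulmxBr mulmx1 mulmxDr opprD !mulmxA addrA.
        by rewrite addrAC.
      by apply: latB => //; subst P; exact: homL_lat hSi hvA.
    rewrite -mulmxA -eD mulmxBr mulmx1 mulmxA; apply: latB => //.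
    exact: homL_lat (hSa P nP) hvA.
  - by rewrite mul_col_row BD BA SD eSa -scalar_mx_block.
  - by rewrite mul_row_col -eD subrK.
exists (hom_comp (mx_hom hT) q'), (hom_comp q (mx_hom hT')); split.
- split=> U s; rewrite !hom_compE.
    by apply: (@vec_inj (extB b)); rewrite mx_homE qq' mx_homE -mulmxA TT' mulmx1.
  by rewrite -[RHS]q'q; congr (q' U _); apply: vec_inj; rewrite !mx_homE -mulmxA T'T mulmx1.
- move=> U s; rewrite hom_compE -[RHS]q'q; congr (q' U _); apply: vec_inj.
  rewrite mx_homE std_injE mul_mx_row mulmx1 mulmx0 mul_row_col mul0mx addr0 -hB //.
move=> U s; rewrite hom_compE; apply: vec_inj; rewrite -[LHS]/(vec (hom_comp q' p U _)) hA mx_homE std_prjE -mulmxA.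
by rewrite mul_col_mx (exact_comp0 exA) eSa.
Qed.

Lemma cls_mor A B A' B' (xi : ext1 (latC A) (latC B)) (zeta : ext1 (latC A') (latC B'))
    (f : hom (latC A) (latC A')) (g : hom (latC B) (latC B')) M N b b' :
  cls xi b -> cls zeta b' -> has_mx f M -> has_mx g N ->
  ext1_mor f g xi zeta <-> sumS (Linf A B') (Laff A B') (M *m b' - b *m N).
Proof.
move=> [m [m' [[m'm mm'] mi mp]]] [n [n' [[n'n nn'] ni np]]] hM hN.
rewrite -(std_mor b b' (has_mx_H0 hM) (has_mx_H0 hN)); split=> [[h hh]|[Y hY]].
  have [T hT] := @lat_hom_mx (extB b) (extB b') (hom_comp (hom_comp m h) n').
  have e1 : row_mx 1%:M 0 *m T = row_mx N 0.
    apply: (@mx_ext B) => U s.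
    have := (hh U).1 s => e.
    transitivity (vec (n' U (h U (m U (ext_inj (std b) U s))))).
      rewrite -[n' U _]/(hom_comp (hom_comp m h) n' U _) hT mulmxA; congr (_ *m T).
    by rewrite mi e -ni n'n std_injE hN -mulmxA mul_mx_row mulmx1 mulmx0.
  have e2 : T *m col_mx 0 1%:M = col_mx 0 M.
    apply: (@mx_ext (extB b)) => U s.
    have := (hh U).2 (m U s) => e.
    transitivity (vec (ext_prj (std b') U (n' U (h U (m U s))))).
      by rewrite std_prjE -[n' U _]/(hom_comp (hom_comp m h) n' U _) hT mulmxA.
    rewrite -np nn' e mp hM std_prjE -mulmxA mul_col_mx mul0mx mul1mx //.
  exists (dlsubmx T); have := has_mx_H0 hT; congr (H0 _ _ _).
  rewrite -[LHS]submxK; congr block_mx.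
  - have := congr1 lsubmx e1; rewrite -{1}(submxK T) mul_row_block !mul1mx !mul0mx !addr0.
    by rewrite !row_mxKl.
  - have := congr1 rsubmx e1; rewrite -{1}(submxK T) mul_row_block !mul1mx !mul0mx !addr0.
    by rewrite !row_mxKr.
  - have := congr1 dsubmx e2; rewrite -{1}(submxK T) mul_block_col !mulmx0 !mulmx1 !add0r.
    by rewrite !col_mxKd.
exists (hom_comp (hom_comp m' (mx_hom hY)) n) => U; split=> s; rewrite !hom_compE.
  rewrite -mi m'm -ni; congr (n U _); apply: vec_inj; rewrite mx_homE !std_injE hN.
  have e : row_mx 1%:M 0 *m block_mx N 0 Y M = N *m row_mx 1%:M (0 : 'M[K]_(rk B', rk A')).
    by rewrite mul_row_block mul_mx_row !mul1mx !mul0mx !addr0 mulmx1 mulmx0.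
  by rewrite -[LHS]mulmxA -[RHS]mulmxA; congr (_ *m _); exact: e.
rewrite np -{2}[s]mm' mp; apply: vec_inj; rewrite hM !std_prjE mx_homE -!mulmxA.
by rewrite mul_block_col mul_col_mx !mulmx0 mul0mx !mulmx1 mul1mx !add0r.
Qed.

Lemma h1_0P A B : h1 A B 0 <-> forall b, sumS (Linf A B) (Laff A B) b.
Proof.
split=> [[phi [_ _ h]] b|h]; first by apply/(h b I)/rowP => [[]].
exists (fun=> 0); split=> [c u v _ _|w|v _]; first by rewrite scaler0 addr0.
  by exists 0 => //; apply/rowP => [[]].
by split=> // _; exact: h.
Qed.

Lemma ksub_S A B : ksub (sumS (Linf A B) (Laff A B)).
Proof. by apply: ksub_sumS; [exact: ksub_homL|exact: ksub_Laff]. Qed.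

Lemma h1_Ext1 A B : h1 A B 0 -> Ext_vanishes 1 (latC A) (latC B).
Proof.
move=> /h1_0P h xi zeta; apply: rst_step.
have [b hb] := cls_ex xi; have [b' hb'] := cls_ex zeta.
by apply/(cls_mor hb hb' (@has_mx_id A) (@has_mx_id B)); exact: h.
Qed.

Lemma Ext1_h1 A B : Ext_vanishes 1 (latC A) (latC B) -> h1 A B 0.
Proof.
move=> h; apply/h1_0P => b; have kS := ksub_S A B.
have inv (xi zeta : ext1 (latC A) (latC B)) : clos_refl_sym_trans _
    (@ext1_mor _ _ (latC A) (latC B) (latC A) (latC B) (hom_id _) (hom_id _)) xi zeta ->
    forall c c', cls xi c -> cls zeta c' -> sumS (Linf A B) (Laff A B) (c' - c).
  elim=> [x z r c c' hc hc'|x c c' hc hc'|x z _ IH c c' hc hc'|x y z _ IH _ IH' c c' hc hc'].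
  - have := (cls_mor hc hc' (@has_mx_id A) (@has_mx_id B)).1 r; by rewrite mul1mx mulmx1.
  - have r : ext1_mor (hom_id (latC A)) (hom_id (latC B)) x x by exists (hom_id _).
    by have := (cls_mor hc hc' (@has_mx_id A) (@has_mx_id B)).1 r; rewrite mul1mx mulmx1.
  - by rewrite -opprB; apply: (ksubN kS); exact: IH.
  - have [d hd] := cls_ex y; rewrite -(subrK d c') -addrA; apply: (ksubD kS); [exact: IH'|exact: IH].
by have := inv _ _ (h (std b) (std 0)) b 0 (cls_std b) (cls_std 0); rewrite sub0r => /(ksubN kS); rewrite opprK.
Qed.

(** By duality Ext^1(E, E) has the dimension of Hom(E, E). *)
Lemma simple_Ext1_dim1 E : simple E -> Ext1_dim1 (latC E) (latC E).
Proof.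
move=> /simple_h0 /(serre) [phi [lphi sphi kphi]]; have kS := ksub_S E E.
have [b0 _ eb0] := sphi 1; exists (std b0) => xi; have [b hb] := cls_ex xi.
have key c : ext1_scale c (std b0) xi <-> phi b = c%:M.
  rewrite /ext1_scale (cls_mor (cls_std b0) hb (@has_mx_id E) (@has_mx_scalar E c)) mul1mx.
  rewrite mul_mx_scalar -(kphi _ I).
  have -> : b - C c *: b0 = C (- c) *: b0 + b by rewrite rmorphN scaleNr addrC.
  rewrite lphi // eb0 scalemx1 raddfN /= addrC; split=> [/subr0_eq//|->]; exact: subrr.
exists (phi b 0 0); split=> [|c /key ->]; last by rewrite mxE eqxx mulr1n.
by apply/key; rewrite -mx11_scalar.
Qed.

End HomMatrices.

Section Separation.
Implicit Types (P Q : point X).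

(** Finitely generated modules over the valuation ring of P are separated by
    functionals: if c is not in the span of the rows of a, some functional is
    integral on that span and has a simple pole at c. *)
Lemma separation P m n (a : 'M[K]_(m, n)) (c : 'rV[K]_n) :
  ~ (exists2 d, imx P d & c = d *m a) ->
  exists (y : 'cV[K]_n) u, [/\ unit_at P u, imx P (a *m y) & (c *m y) 0 0 = u / tau P].
Proof.
move=> nc; have t0 := tau_neq0 P.
have [ca|] := boolP (c <= a)%MS; last first.
  rewrite submxE => /matrix0Pn [i [j]]; rewrite ord1 => h.
  set w := (c *m cokermx a) 0 j in h.
  exists ((w * tau P)^-1 *: (cokermx a *m (delta_mx j 0 : 'cV[K]_n))), 1; split; first exact: unit1.
    by rewrite -scalemxAr mulmxA mulmx_coker mul0mx scaler0; exact: imx0.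
  rewrite -scalemxAr mulmxA -colE mxE [X in _ * X]mxE -/w invfM mulrAC mulVf ?mul1r //.
pose r := \rank a; pose L : set 'rV[K]_r := [set z | exists2 d, imx P d & z = d *m col_base a].
have fR : row_base a *m pinvmx (row_base a) = 1%:M by apply: mulmxVp; exact: row_base_free.
have SC : pinvmx (col_base a) *m col_base a = 1%:M by apply: mulVpmx; exact: col_base_full.
have hL : is_lattice P L.
  split=> [_ _ [d hd ->] [d' hd' ->]|f _ hf [d hd ->]||].
  - by exists (d + d'); [exact: imxD|rewrite mulmxDl].
  - by exists (f *: d); [exact: imxZ|rewrite scalemxAl].
  - have [N hN] := imx_pole P (col_base a); exists N => _ [d hd ->].
    by rewrite scalemxAr; apply: imxM => //; exact: hN.
  - have [N hN] := imx_pole P (pinvmx (col_base a)); exists N => v iv /=.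
    exists (v *m (tau P ^+ N *: pinvmx (col_base a))); first by apply: imxM => //; exact: hN.
    by rewrite -scalemxAr -scalemxAl -mulmxA SC mulmx1.
have [g ug hg] := lattice_free hL.
have /submxP [z0 ez0] := ca; pose z := z0 *m col_base a.
have ez : c = z *m row_base a by rewrite /z -mulmxA mulmx_base.
have nz : ~ imx P (z *m invmx g).
  move=> /hg [d hd ed]; apply: nc; exists d => //.
  by rewrite ez ed -mulmxA mulmx_base.
have [j hj] : exists j, ~ regular_at P ((z *m invmx g) 0 j).
  by apply/existsNP => h; apply: nz => i j; rewrite ord1.
pose y0 := pinvmx (row_base a) *m (invmx g *m (delta_mx j 0 : 'cV[K]_r)).
have cy0 : (c *m y0) 0 0 = (z *m invmx g) 0 j.
  by rewrite ez /y0 mulmxA -(mulmxA z) fR mulmx1 mulmxA -colE mxE.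
have ay0 : imx P (a *m y0).
  rewrite -{1}(mulmx_base a) /y0 mulmxA -(mulmxA (col_base a)) fR mulmx1.
  apply/imx_row => i; rewrite row_mul mulmxA -colE => i' j'; rewrite mxE.
  have : L (row i (col_base a)) by exists (delta_mx 0 i); [move=> ? ?; rewrite mxE; case: (_ && _); [exact: reg1|exact: reg0]|rewrite rowE].
  by move=> /hg; exact.
have h0 : (z *m invmx g) 0 j != 0 by apply: contra_notN hj => /eqP ->; exact: reg0.
have [u [uu eu]] := ord_decomp P h0.
have o1 : ord P ((z *m invmx g) 0 j) <= -1.
  have : ~ (0 <= ord P ((z *m invmx g) 0 j)) by move=> /(ord_ge0 P h0).
  by move: (ord P _) => o; lia.
move: (ord P ((z *m invmx g) 0 j)) o1 eu => o o1 eu.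
exists (tau P ^ (- o - 1) *: y0), u; split=> //.
  rewrite -scalemxAr; apply: imxZ => //.
  by apply: reg_tauz; lia.
rewrite -scalemxAr mxE cy0 eu mulrCA -expfzDr //; congr (u * _).
by rewrite -exprN1; congr (_ ^ _); lia.
Qed.

End Separation.

(** * Extensions of a coherent sheaf by a bundle *)

Lemma presented_res (F : module_sheaf X) (U V : opens X) n
    (e : 'I_n -> F U) m (a : 'I_m -> 'I_n -> K) :
  presented e a -> V `<=` U -> presented (fun i => res V (e i)) a.
Proof.
move=> [p1 p2 p3 p4] VU; split.
- by move=> j i; exact: regular_sub (p1 j i).
- move=> j; transitivity (res V (\sum_i act (a j i) (e i))); last by rewrite p2 res0.
  rewrite res_sum //; apply: eq_bigr => i _; by rewrite res_act.
- move=> W WV s R WR; have [W' [WW WR' [f [rf ef]]]] := p3 W (subset_trans WV VU) s R WR.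
  exists W'; split=> //; exists f; split=> //; rewrite ef; apply: eq_bigr => i _.
  by rewrite res_comp //; exact: subset_trans WV.
move=> W WV f rf ef R WR; apply: (p4 W (subset_trans WV VU) f rf _ R WR).
by rewrite -[RHS]ef; apply: eq_bigr => i _; rewrite res_comp.
Qed.

Section ExtM.
Implicit Types (P Q : point X) (U V W : opens X).
Variables (F : coh X) (E : bun) (P : point X) (U1 : opens X) (U1P : open_set U1 P).
Variables (n m : nat) (e : 'I_n -> F U1) (a : 'I_m -> 'I_n -> K).
Hypothesis pr : presented e a.
Variables (Y : 'M[K]_(n, rk E)) (hY : forall j, lat E P ((\row_i a j i) *m Y)).

Local Notation G := (prodS F (constS (rk E))).

Definition comb_at W (s : F W) (c : 'I_n -> K) : Prop :=
  (forall i, regular W (c i)) /\ s = \sum_i act (c i) (res W (e i)).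

(** Around P the sheaf F is generated by the e_i with relations a. Gluing in
    the lifts (e_i, Y_i) at P, which a permits, gives an extension of F by E
    that is trivial on the complement of P. *)
Definition extM_set U : set (G U) := [set s |
  (forall Q, open_set U Q -> Q <> P -> lat E Q s.2) /\
  (open_set U P -> exists W c, [/\ W `<=` U, W `<=` U1, open_set W P,
     comb_at (res W s.1) c & lat E P (s.2 - (\row_i c i) *m Y)])].

Lemma row_const0 l : \row_(i < l) (0 : K) = 0. Proof. by apply/rowP => i; rewrite !mxE. Qed.

Lemma comb_at_null W : comb_at (0 : F W) (fun=> 0).
Proof.
split=> [i|]; first exact: regular0.
by rewrite big1 // => i _; exact: act0l.
Qed.

Lemma extM_right U v : (forall Q, open_set U Q -> lat E Q v) -> extM_set (U := U) (0, v).
Proof.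
move=> hv; split=> [Q UQ _|UP]; first exact: hv.
exists (capO U U1), (fun=> 0); split=> //; [exact: capOl|exact: capOr| |].
  by rewrite /= res0; [exact: comb_at_null|exact: capOl].
by rewrite row_const0 mul0mx subr0; exact: hv.
Qed.

Lemma comb_at_res W W' (s : F W) c : W' `<=` W -> W `<=` U1 -> comb_at s c -> comb_at (res W' s) c.
Proof.
move=> WW WU [rc ->]; split=> [i|]; first exact: regular_sub (rc i).
by rewrite res_sum //; apply: eq_bigr => i _; rewrite res_act // res_comp.
Qed.

Lemma comb_atB W (s t : F W) c d : comb_at s c -> comb_at t d -> comb_at (s - t) (fun i => c i - d i).
Proof.
move=> [rc ->] [rd ->]; split=> [i|]; first by apply: regularD => //; exact: regularN.
by rewrite -sumrB; apply: eq_bigr => i _; rewrite actDl ?actNl //; exact: regularN.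
Qed.

Lemma comb_at_act W f (s : F W) c : regular W f -> comb_at s c -> comb_at (act f s) (fun i => f * c i).
Proof.
move=> rf [rc ->]; split=> [i|]; first exact: regularM.
by rewrite act_sumr //; apply: eq_bigr => i _; rewrite actM.
Qed.

Lemma comb_at0 W c Q : W `<=` U1 -> open_set W Q -> comb_at (0 : F W) c ->
  exists2 d : 'rV[K]_m, imx Q d & \row_i c i = d *m \matrix_(j, i) a j i.
Proof.
move=> WU WQ [rc e0]; have [_ _ _ h4] := pr.
have [W' [WW WP' [d [rd ed]]]] := h4 W WU c rc (esym e0) Q WQ.
exists (\row_j d j); first by move=> i j; rewrite mxE; exact: rd.
by apply/rowP => i; rewrite !mxE ed; apply: eq_bigr => j _; rewrite !mxE.
Qed.

Lemma comb_at_Y W c : W `<=` U1 -> open_set W P -> comb_at (0 : F W) c -> lat E P ((\row_i c i) *m Y).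
Proof.
move=> WU WP /(comb_at0 WU WP) [d id ->].
rewrite -mulmxA mulmx_sum_row; apply: (big_ind (lat E P)); [exact: lat0|exact: latD|].
move=> j _; apply: lat_reg => //; rewrite row_mul.
by have := hY j; congr (lat E P (_ *m _)); apply/rowP => i; rewrite !mxE.
Qed.

(** The condition at P does not depend on the chosen expression of s. *)
Lemma extM_any U (s : G U) W c : extM_set s -> W `<=` U -> W `<=` U1 -> open_set W P ->
  comb_at (res W s.1) c -> lat E P (s.2 - (\row_i c i) *m Y).
Proof.
move=> [_ h] WU WU1 WP hc; have [W' [c' [WU' WU1' WP' hc' hl]]] := h (WU P WP).
have hl2 : lat E P ((\row_i (c' i - c i)) *m Y).
  apply: (@comb_at_Y (capO W W') _ _ _); [exact: subset_trans (@capOl W W') WU1|by []|].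
  have h1 := comb_at_res (@capOl W W') WU1 hc.
  have h2 := comb_at_res (@capOr W W') WU1' hc'.
  rewrite !res_comp // in h1 h2; try exact: capOl; try exact: capOr.
  by have := comb_atB h2 h1; rewrite subrr.
have -> : s.2 - (\row_i c i) *m Y = s.2 - (\row_i c' i) *m Y + (\row_i (c' i - c i)) *m Y.
  have -> : \row_i (c' i - c i) = \row_i c' i - \row_i c i by apply/rowP => i; rewrite !mxE.
  by rewrite mulmxBl addrA subrK.
exact: latD.
Qed.

Lemma extM_lat U v Q : extM_set (U := U) (0, v) -> open_set U Q -> lat E Q v.
Proof.
move=> hv UQ; have [eQ|nQ] := pselect (Q = P); last by case: hv => h _; exact: h.
subst Q; have := extM_any hv (W := capO U U1) (c := fun=> 0).
rewrite row_const0 mul0mx subr0; apply=> //; [exact: capOl|exact: capOr|].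
by rewrite /= res0; [exact: comb_at_null|exact: capOl].
Qed.

Definition extM_cond : subcond G.
Proof.
exists extM_set.
- move=> U; split=> [|s t [s1 s2] [t1 t2]].
    by apply: extM_right => Q _; exact: lat0.
  split=> [Q UQ nQ|UP]; first by apply: latB; [exact: s1|exact: t1].
  have [W [c [WU WU1 WP hc hl]]] := s2 UP; have [W' [c' [WU' WU1' WP' hc' hl']]] := t2 UP.
  exists (capO W W'), (fun i => c i - c' i); split=> //.
  + exact: subset_trans (@capOl W W') WU.
  + exact: subset_trans (@capOl W W') WU1.
  + have h1 := comb_at_res (@capOl W W') WU1 hc.
    have h2 := comb_at_res (@capOr W W') WU1' hc'.
    rewrite !res_comp // in h1 h2; try exact: capOl; try exact: capOr.
    rewrite resB; first exact: comb_atB.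
    exact: subset_trans (@capOl W W') WU.
  have -> : \row_i (c i - c' i) = \row_i c i - \row_i c' i by apply/rowP => i; rewrite !mxE.
  rewrite -[(s - t).2]/(s.2 - t.2) mulmxBl.
  have -> : s.2 - t.2 - ((\row_i c i) *m Y - (\row_i c' i) *m Y) =
      (s.2 - (\row_i c i) *m Y) - (t.2 - (\row_i c' i) *m Y).
    by move: (s.2) (t.2) (_ *m Y) (_ *m Y) => x1 x2 x3 x4; apply/rowP => j; rewrite !mxE; ring.
  exact: latB.
- move=> U f s rf [s1 s2]; split=> [Q UQ nQ|UP]; first by apply: lat_reg; [exact: rf|exact: s1].
  have [W [c [WU WU1 WP hc hl]]] := s2 UP; exists W, (fun i => f * c i); split=> //.
    by rewrite res_act //; apply: comb_at_act => //; exact: regular_sub rf.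
  have -> : \row_i (f * c i) = f *: \row_i c i by apply/rowP => i; rewrite !mxE.
  by rewrite -scalemxAl -scalerBr; apply: lat_reg => //; exact: rf.
- move=> U V s VU [s1 s2]; split=> [Q VQ|VP]; first by apply: s1; exact: VU.
  have [W [c [WU WU1 WP hc hl]]] := s2 (VU P VP).
  exists (capO V W), c; split=> //; [exact: capOl|exact: subset_trans (@capOr V W) WU1|].
  rewrite /= res_comp //; last exact: capOl.
  rewrite -(res_comp WU (@capOr V W)); apply: comb_at_res => //; exact: capOr.
- move=> U s h; split=> [Q UQ nQ|UP].
    by have [V [VU VQ [h1 _]]] := h Q UQ; exact: h1.
  have [V [VU VP [_ h2]]] := h P UP; have [W [c [WV WU1 WP hc hl]]] := h2 VP.
  exists W, c; split=> //; first exact: subset_trans VU.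
  by rewrite /= res_comp // in hc.
Defined.

Local Notation M := (subS extM_cond).

(** M is locally presented by the generators of F, lifted, and of E. *)
Lemma extM_presented Q U2 n2 (e2 : 'I_n2 -> F U2) m2 (a2 : 'I_m2 -> 'I_n2 -> K) (Y2 : 'M[K]_(n2, rk E)) :
  presented e2 a2 ->
  (forall i, extM_set (U := U2) (e2 i, row i Y2)) ->
  (forall i R, open_set U2 R -> lat E R (row i (gen E Q))) ->
  (forall R v, open_set U2 R -> lat E R v -> imx R (v *m invmx (gen E Q))) ->
  exists nn (ee : 'I_nn -> M U2) mm (aa : 'I_mm -> 'I_nn -> K), presented ee aa.
Proof.
move=> [p1 p2 p3 p4] he hg1 hg2.
pose A2 : 'M[K]_(m2, n2) := \matrix_(j, i) a2 j i.
pose H : 'M[K]_(m2, rk E) := - (A2 *m Y2 *m invmx (gen E Q)).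
have hgen i : extM_set (U := U2) (0, row i (gen E Q)) by apply: extM_right => R; exact: hg1.
pose ee (i : 'I_(n2 + rk E)) : M U2 := match fintype.split i with
  | inl b => @sub_mk _ extM_cond U2 _ (he b) | inr b => @sub_mk _ extM_cond U2 _ (hgen b) end.
pose aa (j : 'I_m2) (i : 'I_(n2 + rk E)) : K := row_mx A2 H j i.
have el b : sub_val (ee (lshift _ b)) = (e2 b, row b Y2).
  by rewrite /ee (unsplitK (inl b)).
have er b : sub_val (ee (rshift _ b)) = (0, row b (gen E Q)).
  by rewrite /ee (unsplitK (inr b)).
have fstS U l (s : 'I_l -> G U) : (\sum_i s i).1 = \sum_i (s i).1.
  by elim/big_rec2: _ => // i y1 y2 _ <-.
have sndS U l (s : 'I_l -> G U) : (\sum_i s i).2 = \sum_i (s i).2.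
  by elim/big_rec2: _ => // i y1 y2 _ <-.
have comb V (f : 'I_(n2 + rk E) -> K) : V `<=` U2 -> (forall i, regular V (f i)) ->
    sub_val (\sum_i act (f i) (res V (ee i))) =
    (\sum_i act (f (lshift _ i)) (res V (e2 i)),
     (\row_i f (lshift _ i)) *m Y2 + (\row_i f (rshift _ i)) *m gen E Q).
  move=> VU rf; rewrite sub_val_sum; rewrite [LHS]surjective_pairing; congr pair.
    rewrite fstS big_split_ord /= [X in _ + X]big1 ?addr0 => [|i _]; last first.
      by rewrite sub_val_act // sub_val_res // er /= res0 // act0r.
    by apply: eq_bigr => i _; rewrite sub_val_act // sub_val_res // el.
  rewrite sndS big_split_ord /= !mulmx_sum_row; congr (_ + _); apply: eq_bigr => i _.
    by rewrite sub_val_act // sub_val_res // el mxE.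
  by rewrite sub_val_act // sub_val_res // er mxE.
have AY j R : open_set U2 R -> lat E R (row j (A2 *m Y2)).
  move=> UR; apply: (extM_lat (U := U2)) UR.
  have e0 : (\sum_i act (a2 j i) (e2 i), \sum_i a2 j i *: row i Y2) = (0, row j (A2 *m Y2)) :> G U2.
    rewrite p2; congr pair; rewrite row_mul mulmx_sum_row; apply: eq_bigr => i _.
    by rewrite !mxE.
  rewrite -e0; pose t i : M U2 := @sub_mk _ extM_cond U2 _ (he i).
  have := sub_valP (\sum_i act (a2 j i) (t i)); rewrite sub_val_sum.
  congr (extM_set _); rewrite [LHS]surjective_pairing; congr pair; rewrite ?fstS ?sndS.
    by apply: eq_bigr => i _; rewrite sub_val_act.
  by apply: eq_bigr => i _; rewrite sub_val_act.
have rA V j i : V `<=` U2 -> regular V (aa j i).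
  move=> VU R VR; rewrite /aa -(splitK i); case: fintype.split => b /=.
    by rewrite row_mxEl mxE; apply: p1 (VU R VR).
  rewrite row_mxEr mxE; apply: regN.
  have := hg2 R _ (VU R VR) (AY j R (VU R VR)); rewrite -row_mul => /(_ 0 b).
  by rewrite mxE.
exists (n2 + rk E)%N, ee, m2, aa; split.
- by move=> j i; exact: rA.
- move=> j; apply: sub_eq; rewrite sub_val0.
  rewrite (eq_bigr (fun i => act (aa j i) (res U2 (ee i)))) => [|i _]; last by rewrite res_id.
  rewrite comb // => [|i]; last exact: rA.
  congr pair.
    rewrite -[RHS](p2 j); apply: eq_bigr => i _; by rewrite res_id /aa row_mxEl mxE.
  have -> : \row_i aa j (lshift (rk E) i) = row j A2 by apply/rowP => i; rewrite !mxE /aa row_mxEl mxE.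
  have -> : \row_i aa j (rshift n2 i) = row j H by apply/rowP => i; rewrite !mxE /aa row_mxEr !mxE.
  by rewrite -!row_mul /H mulNmx mulmxKV ?gen_unit // -raddfD subrr raddf0.
- move=> V VU s R VR; have [W [WV WR [f [rf ef]]]] := p3 V VU (sub_val s).1 R VR.
  have WU : W `<=` U2 by exact: subset_trans VU.
  pose v := (sub_val s).2 - (\row_i f i) *m Y2.
  have hv : extM_set (U := W) (0, v).
    pose t : M W := res W s - \sum_i act (f i) (res W (@sub_mk _ extM_cond U2 _ (he i))).
    have := sub_valP t; congr (extM_set _).
    have -> : sub_val t = sub_val (res W s) - sub_val (\sum_i act (f i) (res W (@sub_mk _ extM_cond U2 _ (he i)))) by [].
    rewrite sub_val_res // sub_val_sum [LHS]surjective_pairing; congr pair.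
      rewrite -[LHS]/((res W (sub_val s).1) - (\sum_i sub_val (act (f i) (res W (@sub_mk _ extM_cond U2 _ (he i))))).1).
      rewrite fstS ef -sumrB big1 // => i _.
      by rewrite sub_val_act // sub_val_res // subrr.
    rewrite -[LHS]/((sub_val s).2 - (\sum_i sub_val (act (f i) (res W (@sub_mk _ extM_cond U2 _ (he i))))).2).
    rewrite sndS /v mulmx_sum_row; congr (_ - _); apply: eq_bigr => i _.
    by rewrite sub_val_act // sub_val_res // mxE.
  have hvW R' : open_set W R' -> lat E R' v by exact: extM_lat hv.
  pose h := v *m invmx (gen E Q).
  have rh i : regular W (h 0 i) by move=> R' WR'; apply: (hg2 R' v) => //; [exact: WU|exact: hvW].
  pose ff (i : 'I_(n2 + rk E)) := match fintype.split i with inl b => f b | inr b => h 0 b end.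
  have fl b : ff (lshift _ b) = f b by rewrite /ff (unsplitK (inl b)).
  have fr b : ff (rshift _ b) = h 0 b by rewrite /ff (unsplitK (inr b)).
  have rff i : regular W (ff i) by rewrite /ff; case: fintype.split.
  exists W; split=> //; exists ff; split=> //; apply: sub_eq; rewrite comb // sub_val_res //.
  rewrite [LHS]surjective_pairing; congr pair.
    by rewrite -[LHS]/(res W (sub_val s).1) ef; apply: eq_bigr => i _; rewrite fl.
  have -> : \row_i ff (lshift (rk E) i) = \row_i f i by apply/rowP => i; rewrite !mxE fl.
  have -> : \row_i ff (rshift n2 i) = h by apply/rowP => i; rewrite mxE fr.
  by rewrite /h mulmxKV ?gen_unit // addrC subrK.
move=> V VU f rf ef R VR.
have := congr1 (@sub_val _ extM_cond V) ef; rewrite comb // sub_val0 => -[e1 e3].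
have [W [WV WR [d [rd ed]]]] := p4 V VU (fun i => f (lshift _ i)) (fun i => rf _) e1 R VR.
exists W; split=> //; exists d; split=> // i.
have edl : \row_i f (lshift (rk E) i) = (\row_j d j) *m A2.
  by apply/rowP => l; rewrite !mxE ed; apply: eq_bigr => j _; rewrite !mxE.
have edr : \row_i f (rshift n2 i) = (\row_j d j) *m H.
  move/eqP: e3; rewrite addrC addr_eq0 => /eqP /(congr1 (mulmx^~ (invmx (gen E Q)))) /=.
  by rewrite mulmxK ?gen_unit // => ->; rewrite edl /H mulmxN mulNmx !mulmxA.
rewrite -(splitK i); case: fintype.split => b /=.
  rewrite ed; apply: eq_bigr => j _; by rewrite /aa row_mxEl mxE.
have := congr1 (fun z : 'rV[K]_(rk E) => z 0 b) edr; rewrite mxE => ->.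
by rewrite mxE; apply: eq_bigr => j _; rewrite /aa row_mxEr mxE.
Qed.

End ExtM.

Section ExtSheaf.
Implicit Types (P Q : point X) (U V W : opens X).

Definition hom_pair (H F G : module_sheaf X) (f : hom H F) (g : hom H G) : hom H (prodS F G).
Proof.
exists (fun U s => (f U s, g U s)).
- by move=> U s t; rewrite !homD.
- by move=> U c s rc; rewrite !homZ.
- by move=> U V VU s; rewrite !hom_res.
Defined.

Definition hom_fst (F G : module_sheaf X) : hom (prodS F G) F.
Proof. by exists (fun U s => s.1). Defined.
Definition hom_snd (F G : module_sheaf X) : hom (prodS F G) G.
Proof. by exists (fun U s => s.2). Defined.

Section Ext.
Variables (F : coh X) (E : bun) (P : point X) (U1 : opens X) (U1P : open_set U1 P).
Variables (n m : nat) (e : 'I_n -> F U1) (a : 'I_m -> 'I_n -> K).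
Hypothesis pr : presented e a.
Variables (Y : 'M[K]_(n, rk E)) (hY : forall j, lat E P ((\row_i a j i) *m Y)).
Local Notation cond := (extM_cond U1P e Y).
Local Notation M := (subS cond).
Local Notation mset := (extM_set P e Y).

Lemma ext_coherent : coherent M.
Proof.
move=> Q; have [eQP|nQP] := pselect (Q = P).
  subst Q; have [V [VU VP hg1 hg2]] := gen_nbhd E U1P.
  have fA : finite_set ((\bigcup_(i in [set: 'I_n]) [set R | ~ lat E R (row i Y)]) `\ P).
    by apply: finite_setD; apply: finite_family => i; exact: lat_nbhd.
  have [|U2 [U2V U2P h2]] := shrink fA VP; first by case=> _; apply.
  have U2U := subset_trans U2V VU; exists U2; split=> //.
  apply: (extM_presented U1P pr hY (presented_res pr U2U) (Y2 := Y)).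
  - move=> i; split=> [R U2R nR|_] /=.
      by apply: contrapT => nl; apply: (h2 R U2R); split=> //; exists i.
    exists U2, (fun l => (delta_mx 0 i : 'rV[K]_n) 0 l); split=> //.
      split=> [l|]; first by rewrite mxE; case: (_ && _); [exact: regular1|exact: regular0].
      rewrite res_id (bigD1 i) //= mxE !eqxx act1 big1 ?addr0 // => l ne.
      by rewrite mxE (negPf ne) andbF act0l.
    rewrite (_ : \row_l _ = delta_mx 0 i); last by apply/rowP => l; rewrite mxE.
    by rewrite -rowE subrr; exact: lat0.
  - by move=> i R /U2V; exact: hg1.
  - by move=> R v /U2V; exact: hg2.
have [U3 [U3Q [n3 [e3 [m3 [a3 pr3]]]]]] := cohP F Q.
have [V [VU VQ hg1 hg2]] := gen_nbhd E U3Q.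
have [|U2 [U2V U2Q h2]] := shrink (finite_set1 P) VQ; first by [].
have U2U := subset_trans U2V VU; exists U2; split=> //.
apply: (extM_presented U1P pr hY (presented_res pr3 U2U) (Y2 := 0)).
- move=> i; split=> [R U2R nR|U2P]; last by case: (h2 P U2P).
  by rewrite /= row0; exact: lat0.
- by move=> i R /U2V; exact: hg1.
- by move=> R v /U2V; exact: hg2.
Qed.

Let MC : coh X := Coh ext_coherent.

Lemma ext_inj_cond U (s : latS E U) : mset (U := U) (0, vec s).
Proof.
by apply: (extM_right U1P) => Q; exact: vecP.
Qed.

Let inj : hom (latC E) MC :=
  sub_hom (S := cond) (h := hom_pair (hom_null (latS E) F) (sub_incl (lat_cond E))) ext_inj_cond.
Let prj : hom MC F := hom_comp (sub_incl cond) (hom_fst F (constS (rk E))).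

Lemma ext_sheaf_exact : short_exact inj prj.
Proof.
have prjE U (s : M U) : prj U s = (sub_val s).1 by [].
split.
- by move=> U s t /(congr1 (@sub_val _ cond U)) [e1]; exact: vec_inj.
- by move=> U s.
- move=> U s; rewrite prjE => e0; have := sub_valP s; rewrite [sub_val s]surjective_pairing e0 => hs.
  have hv Q : open_set U Q -> lat E Q (sub_val s).2 by exact: (extM_lat U1P pr hY hs).
  exists (mklat hv); apply: sub_eq; rewrite [RHS]surjective_pairing e0 //.
move=> U s Q UQ; have [eQ|nQ] := pselect (Q = P); last first.
  have [|V [VU VQ h2]] := shrink (finite_set1 P) UQ; first by [].
  exists V; split=> //; have h : mset (U := V) (res V s, 0).
    split=> [R VR _|VP]; first by have h0 := @lat0 E R; exact: h0.
    by case: (h2 P VP).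
  by exists (@sub_mk _ cond V _ h).
subst Q; have [_ _ h3 _] := pr.
have [W [WU WP [c [rc ec]]]] := h3 _ (@capOr U U1) (res (capO U U1) s) P (conj UQ U1P).
pose v := (\row_i c i) *m Y.
have fA : finite_set ([set R | ~ lat E R v] `\ P) by apply: finite_setD; exact: lat_nbhd.
have [|V [VW VP h2]] := shrink fA WP; first by case=> _; apply.
have VU : V `<=` U by move=> R /VW /WU [].
have VU1 : V `<=` U1 by move=> R /VW /WU [].
exists V; split=> //; have h : mset (U := V) (res V s, v).
  split=> [R VR nR|_] /=; first by apply: contrapT => nl; exact: (h2 R VR).
  exists V, c; split=> //; last by rewrite subrr; exact: lat0.
  rewrite res_id; split=> [i|]; first exact: regular_sub (rc i).
  rewrite -(res_comp (@capOl U U1) (subset_trans VW WU)) -(res_comp WU VW) ec res_sum //.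
  apply: eq_bigr => i _; rewrite res_act // res_comp // => R /WU [] //.
by exists (@sub_mk _ cond V _ h).
Qed.

(** A homomorphism to the middle term is a pair of homomorphisms to F and to
    the constant sheaf K^(rk E). *)
Lemma ext_sheaf : exists xi : ext1 F (latC E), forall (G : module_sheaf X) (u : hom G F) (v : hom G (constS (rk E))),
  (forall U s, mset (U := U) (u U s, v U s)) -> exists h : hom G (ext_mid xi),
   (forall U s, ext_prj xi U (h U s) = u U s) /\
   (forall U s w, u U s = 0 -> v U s = vec w -> h U s = ext_inj xi U w).
Proof.
exists (@Ext1 _ _ F (latC E) MC inj prj ext_sheaf_exact) => G u v huv.
exists (sub_hom (S := cond) (h := hom_pair u v) huv); split=> [//|U s w eu ev].
by apply: sub_eq; rewrite /= eu ev.
Qed.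

End Ext.

(** * Detecting homomorphisms to a sheaf by extensions *)

Lemma regular_mx_nbhd (m n : nat) (A : 'M[K]_(m, n)) U P : open_set U P -> imx P A ->
  exists V, [/\ V `<=` U, open_set V P & forall i j, regular V (A i j)].
Proof.
move=> UP iA; have [|V [VU VP h]] := shrink (pole_finite A) UP; first by apply.
by exists V; split=> // i j Q VQ; have := h Q VQ => /contrapT; apply.
Qed.

Lemma open_inter U P n (W : 'I_n -> opens X) : open_set U P -> (forall i, open_set (W i) P) ->
  exists V, [/\ V `<=` U, open_set V P & forall i, V `<=` W i].
Proof.
move=> UP WP; have [|V [VU VP h]] := shrink_family (fun i => open_cofinite (W i)) UP.
  by move=> i; apply.
by exists V; split=> // i Q /(h i) /contrapT.
Qed.

Definition constM A n (M : 'M[K]_(rk A, n)) : hom (latS A) (constS n).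
Proof.
exists (fun U (s : latS A U) => (vec s *m M : constS n U)).
- by move=> U s t; rewrite vecD mulmxDl.
- by move=> U f s rf; rewrite vec_act // -scalemxAl.
- by move=> U V VU s; rewrite vec_res.
Defined.

(** For an affine point P, strong approximation gives g that is integral at
    the other affine points and close to D at P. Then D at P and - g at
    infinity define isomorphic extensions. *)
Lemma local_class E P (D : 'M[K]_(rk E)) : exists b g : 'M[K]_(rk E),
  [/\ forall Q w v, Q <> P -> lat (extB (A := E) (B := E) b) Q (row_mx w v) -> lat E Q (w + v *m g),
      forall w v, lat (extB (A := E) (B := E) b) P (row_mx w v) -> lat E P (w + v *m g - v *m D)
    & sumS (Linf E E) (Laff E E) b -> exists T, (forall Q, Q <> P -> homL E E Q T) /\ homL E E P (T - D)].
Proof.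
have [eP|nP] := pselect (P = pinf).
  subst P; exists D, 0; split.
  - by move=> Q w v /eqP/negPf nQ /lat_extB; rewrite nQ mulmx0 addr0 => -[].
  - by move=> w v /lat_extB; rewrite eqxx mulmx0 addr0 => -[].
  - move=> [L1 [L2 [h1 h2 ->]]]; exists L2; split=> //.
    by rewrite opprD addrCA subrr addr0; exact: homLN.
have [N hN] := homL_bound E E.
have [g [[D' iD eD] hg]] := approx_homL (E := E) (F := E) D N nP.
have gD : homL E E P (g - D) by rewrite eD; exact: hN.
exists (- g), g; split.
- move=> Q w v nQ /lat_extB [hv]; case: eqP => [_|nQi] hw; first by rewrite -[v *m g]opprK -mulmxN.
  by apply: latD => //; exact: homL_lat (hg Q nQi nQ) hv.
- move=> w v /lat_extB [hv]; case: eqP => // _ hw; rewrite -addrA -mulmxBr.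
  by apply: latD => //; exact: homL_lat gD hv.
- move=> [L1 [L2 [h1 h2 e]]]; exists (g + L2); split=> [Q nQ|].
    have [eQ|nQi] := pselect (Q = pinf).
      subst Q; have -> : g + L2 = - L1 by rewrite -[g]opprK e opprD subrK.
      exact: homLN.
    by apply: homLD; [exact: hg|exact: h2].
  by rewrite addrAC; apply: homLD => //; exact: h2.
Qed.

(** If f : E -> F is not zero, it is not zero at some point P.  There a
    functional separates the image of f from zero, and twisting with it gives
    an extension of F by E whose pullback to E has a trace with a simple pole
    at P only, which no split extension has. *)
Lemma pairing_left E (F : coh X) (f : hom (latC E) F) : ~ hom_zero f ->
  exists (xi : ext1 F (latC E)) (zeta : ext1 (latC E) (latC E)),
    ext1_pullback f xi zeta /\ ~ split_ext zeta.
Proof.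
move=> nf; have [U [s ns]] : exists U s, f U s <> 0.
  by apply: contrapT => h; apply: nf => U s; apply: contrapT => h'; apply: h; exists U, s.
(* A point where the germ of f s is not zero. *)
have [P [UP hP]] : exists P, open_set U P /\ forall V, V `<=` U -> open_set V P -> res V (f U s) <> 0.
  apply: contrapT => h; apply: ns; apply: separated => P UP; apply: contrapT => h'; apply: h.
  exists P; split=> // V VU VP e; apply: h'; exists V; split=> //; by rewrite e res0.
have [U1 [U1P [n [e [m [a pr]]]]]] := cohP F P.
have [U3 [g [U3P fg vg]]] := latS_frame E P.
pose V0 := capO U1 U3; have V0P : open_set V0 P by [].
have V0U1 : V0 `<=` U1 := @capOl U1 U3. have V0U3 : V0 `<=` U3 := @capOr U1 U3.
have [_ _ p3 p4] := pr.
have hl l : exists W (c : 'I_n -> K), [/\ W `<=` V0, open_set W P, forall i, regular W (c i) &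
    res W (f V0 (res V0 (g l))) = \sum_i act (c i) (res W (e i))].
  by have [W [WV WP [c [rc ec]]]] := p3 V0 V0U1 (f V0 (res V0 (g l))) P V0P; exists W, c.
have [Wl /choice [cl hl']] := choice hl.
(* The images under f of the frame g, in terms of the generators e. *)
pose Cm : 'M[K]_(rk E, n) := \matrix_(l, i) cl l i.
have hC l : [/\ Wl l `<=` V0, open_set (Wl l) P, forall i, regular (Wl l) (Cm l i) &
    res (Wl l) (f V0 (res V0 (g l))) = \sum_i act (Cm l i) (res (Wl l) (e i))].
  have [h1 h2 h3 h4] := hl' l.
  by split=> // [i|]; [rewrite mxE|rewrite h4; apply: eq_bigr => i _; rewrite mxE].
have [|W [WV0 WP WW]] := open_inter (U := V0) (W := Wl) V0P; first by move=> l; case: (hC l).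
have rC l i V : V `<=` W -> regular V (Cm l i).
  by move=> VW; have [_ _ h _] := hC l; apply: regular_sub (h i); exact: subset_trans (WW l).
have WU1 : W `<=` U1 := subset_trans WV0 V0U1. have WU3 : W `<=` U3 := subset_trans WV0 V0U3.
have fgE l V : V `<=` W -> f V (res V (g l)) = \sum_i act (Cm l i) (res V (e i)).
  move=> VW; have [h1 _ h3 h4] := hC l; have VWl : V `<=` Wl l := subset_trans VW (WW l).
  have := congr1 (res V) h4; rewrite res_comp // -hom_res; last exact: subset_trans h1.
  rewrite res_comp //; last exact: subset_trans h1.
  move=> ->; rewrite res_sum //; apply: eq_bigr => i _.
  by rewrite res_act // res_comp //; exact: subset_trans V0U1.
pose Gm := gen E P.
have fE V (v : latS E V) : V `<=` W -> comb_at (F := F) e (f V v) (fun i => (vec v *m invmx Gm *m Cm) 0 i).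
  move=> VW; have VU3 : V `<=` U3 := subset_trans VW WU3; have [b [[rb eb] _]] := fg V VU3 v.
  have ev : vec v = b *m Gm.
    rewrite eb vec_sum mulmx_sum_row; apply: eq_bigr => l _.
    by rewrite vec_act // vec_res // vg.
  have rbC i : regular V ((b *m Cm) 0 i).
    by rewrite mxE; apply: regular_sum => l; apply: regularM => //; exact: rC.
  rewrite ev mulmxK ?gen_unit //; split=> //.
  rewrite {1}eb hom_sum (eq_bigr (fun l => \sum_i act (b 0 l * Cm l i) (res V (e i)))).
    rewrite exchange_big; apply: eq_bigr => i _; rewrite mxE act_suml // => l.
    by apply: regularM => //; exact: rC.
  move=> l _; rewrite homZ // fgE // act_sumr //; apply: eq_bigr => i _.
  by rewrite actM //; exact: rC.
pose Am : 'M[K]_(m, n) := \matrix_(j, i) a j i.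
(* If every row of Cm were a combination of relations, f would vanish near P. *)
have [l nl] : exists l, ~ (exists2 d, imx P d & row l Cm = d *m Am).
  apply: contrapT => h; have /choice [d hd] l : exists d, imx P d /\ row l Cm = d *m Am.
    by apply: contrapT => h'; apply: h; exists l => -[d id ed]; apply: h'; exists d.
  pose D : 'M[K]_(rk E, m) := \matrix_l d l.
  have eD : Cm = D *m Am by apply/row_matrixP => l; rewrite row_mul rowK (hd l).2.
  have iD : imx P D by apply/imx_row => l; rewrite rowK; exact: (hd l).1.
  have [V [VW VP rD]] := regular_mx_nbhd (U := capO U W) (conj UP WP) iD.
  have VU : V `<=` U by move=> R /VW [].
  have VW' : V `<=` W by move=> R /VW [].
  apply: (hP V VU VP); rewrite -hom_res //.
  have [_ ->] := fE V (res V s) VW'.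
  have [b [[rb eb] _]] := fg V (subset_trans VW' WU3) (res V s).
  have ev : vec (res V s) = b *m Gm.
    rewrite eb vec_sum mulmx_sum_row; apply: eq_bigr => l _.
    by rewrite vec_act // vec_res ?vg //; exact: subset_trans WU3.
  rewrite ev mulmxK ?gen_unit // eD mulmxA.
  have rbD j : regular V ((b *m D) 0 j) by rewrite mxE; apply: regular_sum => l; exact: regularM.
  have VU1 : V `<=` U1 := subset_trans VW' WU1.
  have [p1 p2 _ _] := pr.
  have ra j i : regular V (a j i) by apply: regular_sub (p1 j i).
  rewrite (eq_bigr (fun i => \sum_j act ((b *m D) 0 j) (act (a j i) (res V (e i))))).
    rewrite exchange_big big1 // => j _; rewrite -act_sumr //.
    rewrite (eq_bigr (fun i => res V (act (a j i) (e i)))) => [|i _]; last by rewrite res_act.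
    by rewrite -res_sum // p2 res0 // act0r.
  move=> i _; rewrite mxE act_suml => [|j]; last by rewrite [Am j i]mxE; exact: regularM.
  by apply: eq_bigr => j _; rewrite [Am j i]mxE actM.
have [y [u [uu iy ey]]] := separation nl.
pose Y := y *m row l Gm.
have hY j : lat E P ((\row_i a j i) *m Y).
  rewrite /Y mulmxA (_ : (\row_i a j i) = row j Am); last by apply/rowP => i; rewrite !mxE.
  rewrite -row_mul (mx11_scalar (row j (Am *m y))) mul_scalar_mx; apply: lat_reg; last exact: lat_gen.
  by rewrite mxE; exact: iy.
pose D := invmx Gm *m Cm *m Y.
(* The trace of the local class has a simple pole. *)
have trD : \tr D = u / tau P.
  rewrite /D /Y rowE !mulmxA mxtrace_mulC !mulmxA mulmxV ?gen_unit // mul1mx -mulmxA mxtrace_mulC.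
  by rewrite -mulmxA mxtrace_mulC -rowE trace_mx11 ey.
have [b [gm [b1 b2 b3]]] := local_class P D.
have [xi hxi] := ext_sheaf U1P pr hY.
pose uh : hom (latS (extB b)) F := hom_comp (ext_prj (std b)) f.
pose vh : hom (latS (extB b)) (constS (rk E)) := constM (A := extB b) (col_mx 1%:M gm).
have [|h [h1 h2]] := hxi _ uh vh.
  move=> V t.
  have e1 Q : open_set V Q -> lat (extB b) Q (row_mx (lsubmx (vec t)) (rsubmx (vec t))).
    by move=> VQ; rewrite hsubmxK; exact: vecP.
  have e2 : vec t *m col_mx 1%:M gm = lsubmx (vec t) + rsubmx (vec t) *m gm.
    by rewrite -{1}(hsubmxK (vec t)) mul_row_col mulmx1.
  have e3 : vec (ext_prj (std b) V t) = rsubmx (vec t).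
    by rewrite std_prjE -{1}(hsubmxK (vec t)) mul_row_col mulmx0 add0r mulmx1.
  split=> [Q VQ nQ|VP].
    by rewrite -[X in lat E Q X]/(vec t *m col_mx 1%:M gm) e2; apply: b1 nQ (e1 Q VQ).
  pose V' := capO V W; have V'V : V' `<=` V := @capOl V W. have V'W : V' `<=` W := @capOr V W.
  exists V', (fun i => (vec (res V' (ext_prj (std b) V t)) *m invmx Gm *m Cm) 0 i); split=> //.
  - exact: subset_trans WU1.
  - by rewrite -[X in res V' X]/(f V (ext_prj (std b) V t)) -hom_res //; exact: fE.
  rewrite (_ : \row_i _ = vec (res V' (ext_prj (std b) V t)) *m invmx Gm *m Cm); last first.
    by apply/rowP => i; rewrite mxE.
  rewrite vec_res // e3 -[X in lat E P (X - _)]/(vec t *m col_mx 1%:M gm) e2.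
  by have := b2 _ _ (e1 P VP); rewrite /D !mulmxA.
exists xi, (std b); split.
  exists h => V; split=> [t|t]; last exact: h1.
  apply: h2.
    by rewrite -[LHS]/(f V (ext_prj (std b) V (ext_inj (std b) V t))); have [_ -> _ _] := ext_exact (std b); rewrite hom0.
  rewrite -[LHS]/(vec (ext_inj (std b) V t) *m col_mx 1%:M gm) std_injE mul_mx_row mulmx1 mulmx0.
  by rewrite mul_row_col mulmx1 mul0mx addr0.
move=> /std_split /b3 [T [hT hTP]].
have trr Q A : homL E E Q A -> regular_at Q (\tr A).
  by move=> hA; have := homL_tr hA (homL1 Q); rewrite mulmx1.
apply: (no_simple_pole (P := P) (f := \tr T) uu).
  by rewrite -trD -raddfB; exact: trr.
by move=> Q nQ; apply: trr; exact: hT.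
Qed.

End ExtSheaf.

(** * Detecting extensions of a sheaf by homomorphisms *)

Section PairingRight.
Implicit Types (P Q : point X) (U V W : opens X) (A B E N : bun).

(** Torsion is supported at finitely many points, and around each of them the
    inclusion of B in an extension has a retraction: so homomorphisms from B
    to torsion extend. *)
Lemma torsion_extension A B (b : 'M[K]_(rk A, rk B)) (F : module_sheaf X) N (U0 : opens X)
    (q : hom F (latS N)) (delta : hom (latS B) F) :
  (forall U s, U `<=` U0 -> q U s = 0 -> s = 0) -> (forall U s, q U (delta U s) = 0) ->
  exists dt : hom (latS (extB b)) F, (forall U s, dt U (ext_inj (std b) U s) = delta U s) /\
    forall U s, q U (dt U s) = 0.
Proof.
move=> q0 qd.
pose R P : 'M[K]_(rk B + rk A, rk B) := col_mx 1%:M (if P == pinf then - b else 0).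
have hR P v : lat (extB b) P v -> lat B P (v *m R P).
  rewrite -{1}(hsubmxK v) => /lat_extB [_].
  rewrite -[v in v *m R P](@hsubmxK _ 1 (rk B) (rk A)) mul_row_col mulmx1.
  by case: (P == pinf); rewrite ?mulmxN // mulmx0 addr0.
pose bad P := [set Q | ~ homL (extB b) B Q (R P)] `|` ~` open_set U0.
have fbad P : finite_set (bad P `\ P).
  apply: finite_setD; rewrite finite_setU; split; last exact: open_cofinite.
  apply: (sub_finite_set (B := [set Q | ~ imx Q (R P)] `|` [set Q | gen (extB b) Q <> 1%:M \/ gen B Q <> 1%:M])).
    move=> Q /= nh; have [g1|] := pselect (gen (extB b) Q <> 1%:M \/ gen B Q <> 1%:M); first by right.
    move=> /not_orP [/contrapT g1 /contrapT g2]; left => iR; apply: nh.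
    by apply/homL_good.
  rewrite finite_setU; split; [exact: pole_finite|exact: bad_finite].
pose V P := remO fullO (fbad P).
have VP P : open_set (V P) P by split=> // -[_]; apply.
have VR P W (s : latS (extB b) W) Q : W `<=` V P -> open_set W Q -> lat B Q (vec s *m R P).
  move=> WV WQ; have [eQ|nQ] := pselect (Q = P).
    by rewrite -eQ; apply: hR; exact: vecP.
  have [_ h] := WV Q WQ; have h1 : homL (extB b) B Q (R P).
    by apply: contrapT => nh; apply: h; split=> //; left.
  by apply: homL_lat h1 _; exact: vecP.
have VU0 P Q W : P <> Q -> W `<=` V P -> W `<=` V Q -> W `<=` U0.
  move=> nPQ WP WQ S WS; apply: contrapT => nS.
  have [eS|nSP] := pselect (S = P).
    by have [_] := WQ S WS; apply; split; [right|move=> e; apply: nPQ; rewrite -eS e].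
  by have [_] := WP S WS; apply; split; [right|].
pose ret P W (s : latS (extB b) W) : latS B W :=
  if pselect (forall Q, open_set W Q -> lat B Q (vec s *m R P)) is left h then mklat h else 0.
have retE P W s : W `<=` V P -> vec (ret P W s) = vec s *m R P.
  move=> WV; rewrite /ret; case: pselect => // h; case: h => Q; exact: VR.
have [|P W s t WV|P W f s WV rf|P W W' s WV WW|P Q W s WP WQ|dt hdt] :=
    @hom_glue (latS (extB b)) F V (fun P W s => delta W (ret P W s)).
- exact: VP.
- by rewrite -homD; congr hom_fun; apply: vec_inj; rewrite vecD !retE // vecD mulmxDl.
- rewrite -homZ //; congr hom_fun; apply: vec_inj.
  by rewrite vec_act // !retE // vec_act // scalemxAl.
- rewrite -hom_res //; congr hom_fun; apply: vec_inj.
  by rewrite vec_res // !retE // ?vec_res //; exact: subset_trans WV.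
- have [->//|nPQ] := pselect (P = Q); have WU := VU0 _ _ _ nPQ WP WQ.
  by rewrite (q0 _ _ WU (qd _ _)) (q0 _ _ WU (qd _ _)).
have glue_at U (s : latS (extB b) U) P : dt (capO U (V P)) (res (capO U (V P)) s) =
    delta _ (ret P _ (res (capO U (V P)) s)) by apply: hdt; exact: capOr.
exists dt; split=> U s; apply: separated => P UP; exists (capO U (V P)); split=> //; try exact: capOl.
  rewrite -!hom_res; try exact: capOl.
  rewrite (hdt P); last exact: capOr.
  congr hom_fun; apply: vec_inj; rewrite retE; last exact: capOr.
  rewrite std_injE !vec_res; try exact: capOl.
  by rewrite /R -mulmxA mul_row_col mulmx1 mul0mx addr0 mulmx1.
rewrite -!hom_res; try exact: capOl.
by rewrite glue_at qd res0 //; exact: capOl.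
Qed.

Lemma retraction_split (A B : coh X) (xi : ext1 A B) (r : hom (ext_mid xi) B) :
  (forall U b, r U (ext_inj xi U b) = b) -> split_ext xi.
Proof.
move=> hr; have [_ e2 e3 e4] := ext_exact xi.
pose m := hom_add (hom_id (ext_mid xi)) (hom_opp (hom_comp r (ext_inj xi))).
have mE U s : m U s = s - ext_inj xi U (r U s) by [].
have [|f hf] := hom_descend (m := m) e4.
  by move=> U s /e3 [t <-]; rewrite mE hr subrr.
exists f => U a; apply: separated => P UP; have [V [VU VP [t et]]] := e4 U a P UP.
by exists V; split=> //; rewrite -!hom_res // -et hf mE homB e2 subr0.
Qed.

(** If xi does not split, E being simple, no homomorphism from the
    torsion-free quotient N of its middle term to E restricts to an
    isomorphism of E; by duality the non-trivial class of Ext^1(E, E) dies in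
    Ext^1(E, N), so that E -> N extends over the non-split extension of E by E
    and the quotient map is a suitable f. *)
Lemma pairing_right E (F : coh X) (xi : ext1 F (latC E)) : simple E -> ~ split_ext xi ->
  exists (f : hom (latC E) F) (zeta : ext1 (latC E) (latC E)),
    ext1_pullback f xi zeta /\ ~ split_ext zeta.
Proof.
move=> sE nxi; have [_ end1] := sE; have [N [U0 [q [sg [_ q0 qsg _]]]]] := coh_structure (ext_mid xi).
have [_ e2 e3 e4] := ext_exact xi.
have [I hI] := lat_hom_mx (hom_comp (ext_inj xi) q); have I0 := has_mx_H0 hI.
have Irho rho : H0 N E rho -> I *m rho = 0.
  move=> hrho; have [c ec] : exists c, I *m rho = (C c)%:M.
    by apply: end1 => P; apply: homL_comp (I0 P) (hrho P).
  have [c0|c0] := eqVneq c 0; first by rewrite ec c0 rmorph0 raddf0.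
  case: nxi; pose r := hom_comp (hom_comp q (mx_hom hrho)) (hom_scalar c^-1 (latS E)).
  apply: (@retraction_split _ _ xi r) => U b; apply: vec_inj.
  rewrite -[LHS]/(vec (act (C c^-1) (mx_hom hrho U (q U (ext_inj xi U b))))).
  rewrite vec_act; last exact: regular_cst.
  rewrite mx_homE; have := hI U b; rewrite hom_compE => ->.
  by rewrite -mulmxA ec mul_mx_scalar scalerA -rmorphM mulVf // rmorph1 scale1r.
have /(serre) [phi [lphi sphi kphi]] := simple_h0 sE.
have [b _ eb] := sphi 1.
have nb : ~ sumS (Linf E E) (Laff E E) b.
  move=> hS; have := (kphi b Logic.I).2 hS; rewrite eb => /matrixP /(_ 0 0) /eqP.
  by rewrite !mxE eqxx oner_eq0.
have [|A1 [A2 [hA1 hA2 eA]]] := @serre_duality E N (b *m I).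
  by move=> B hB; rewrite -mulmxA Irho // mulmx0 raddf0 lam0.
pose T : 'M[K]_(rk (extB b), rk N) := col_mx I (- A2).
have hT : H0 (extB b) N T.
  move=> P; apply: lat_homL => v; rewrite -{1}(hsubmxK v) => /lat_extB [h1 h2].
  rewrite -(@hsubmxK _ 1 (rk E) (rk E) v) mul_row_col mulmxN; move: h2; case: eqP => [eP|nP] h2.
    subst P; have -> : lsubmx v *m I - rsubmx v *m A2 = (lsubmx v - rsubmx v *m b) *m I + rsubmx v *m A1.
      by rewrite mulmxBl -(mulmxA _ b) eA mulmxDr opprD addrA addrAC subrK.
    by apply: latD; [exact: homL_lat (I0 _) h2|exact: homL_lat hA1 h1].
  by apply: latB; [exact: homL_lat (I0 _) h2|exact: homL_lat (hA2 P nP) h1].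
pose sI := hom_comp (mx_hom I0) sg.
pose delta := hom_add sI (hom_opp (ext_inj xi)).
have dE U s : delta U s = sI U s - ext_inj xi U s by [].
have [|dt [hdt _]] := torsion_extension b (delta := delta) q0.
  move=> U s; rewrite dE homB -[q U (sI U s)]/(q U (sg U (mx_hom I0 U s))) qsg.
  by apply: vec_inj; rewrite -[LHS]/(vec (mx_hom I0 U s) - vec (hom_comp (ext_inj xi) q U s)) mx_homE hI subrr.
pose m := hom_add (hom_comp (mx_hom hT) sg) (hom_opp dt).
have m_inj U s : m U (ext_inj (std b) U s) = ext_inj xi U s.
  rewrite -[LHS]/(sg U (mx_hom hT U (ext_inj (std b) U s)) - dt U (ext_inj (std b) U s)).
  rewrite hdt dE -[sI U s]/(sg U (mx_hom I0 U s)).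
  have -> : mx_hom hT U (ext_inj (std b) U s) = mx_hom I0 U s.
    by apply: vec_inj; rewrite !mx_homE -mulmxA mul_row_col mul1mx mul0mx addr0.
  by rewrite opprB addrC subrK.
have [_ _ s3 s4] := ext_exact (std b).
have [|f hf] := hom_descend (m := hom_comp m (ext_prj xi)) s4.
  by move=> U s /s3 [t <-]; rewrite hom_compE m_inj e2.
exists f, (std b); split; last by move/std_split.
exists m => U; split=> [t|s]; first exact: m_inj.
by rewrite hf.
Qed.

Lemma simple_pairing E (F : coh X) : simple E -> pairing_nondegenerate (latC E) F.
Proof. by move=> sE; split=> [f|xi]; [exact: pairing_left|exact: pairing_right]. Qed.

End PairingRight.

(** * Vanishing of the higher Ext groups *)

Section HigherExt.
Implicit Types (P Q : point X) (U V W : opens X) (A B E N : bun).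

(** ** Direct sums and the zero sheaf *)

Local Notation Z := (latC (triv 0)).

Lemma zeroC U (s : Z U) : s = 0.
Proof. by apply: vec_inj; apply/rowP => -[]. Qed.

Lemma sum_exact E (G : coh X) : exists (M : coh X) (i : hom G M) (p : hom M (latC E)) (r : hom M G),
  short_exact i p /\ forall U s, r U (i U s) = s.
Proof.
have [U1 [UP [n [e [m [a pr]]]]]] := cohP G pinf.
have hY j : lat E pinf ((\row_i a j i) *m (0 : 'M[K]_(n, rk E))) by rewrite mulmx0; exact: lat0.
pose cond := extM_cond UP e (0 : 'M[K]_(n, rk E)).
have ic U (s : G U) : cond U (s, 0).
  split=> [Q _ _|UQ]; first exact: lat0.
  have [_ _ h3 _] := pr.
  have [W [WV WP [c [rc ec]]]] := h3 _ (@capOr U U1) (res (capO U U1) s) pinf (conj UQ UP).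
  have WU : W `<=` U := subset_trans WV (@capOl U U1).
  exists W, c; split=> //; [exact: subset_trans WV (@capOr U U1)| |].
    by split=> //; rewrite -(res_comp (@capOl U U1) WV).
  by rewrite mulmx0 subr0; exact: lat0.
have pc U (s : subS cond U) : lat_cond E U (sub_val s).2.
  have [h1 h2] := sub_valP s => Q UQ; have [eQ|] := pselect (Q = pinf); last exact: h1.
  by subst Q; have [W [c [_ _ _ _]]] := h2 UQ; rewrite mulmx0 subr0.
pose i : hom G (Coh (ext_coherent UP pr hY)) :=
  sub_hom (S := cond) (h := hom_pair (hom_id G) (hom_null G (constS (rk E)))) ic.
pose p : hom (subS cond) (latS E) := sub_hom (S := lat_cond E) (h := hom_comp (sub_incl cond) (hom_snd G (constS (rk E)))) pc.
exists (Coh (ext_coherent UP pr hY)), i, p, (hom_comp (sub_incl cond) (hom_fst G (constS (rk E)))).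
split=> //; split.
- by move=> U s t /(congr1 (@sub_val _ cond U)) [].
- by move=> U s; exact: vec_inj.
- move=> U s /(congr1 (@vec _ _)) e0; exists (sub_val s).1.
  by apply: sub_eq; rewrite [RHS]surjective_pairing; congr pair; exact: esym e0.
move=> U s P VP; exists U; split=> //; exists (@sub_mk _ cond U (0, vec s) (ext_inj_cond UP e 0 s)).
by rewrite res_id; apply: vec_inj.
Qed.

Lemma zero_left (F : coh X) : short_exact (hom_null Z F) (hom_id F).
Proof.
split=> //.
- by move=> U s t _; rewrite (zeroC s) (zeroC t).
- by move=> U s /= ->; exists 0.
- by move=> U s P UP; exists U; split=> //; exists s; rewrite res_id.
Qed.

Lemma zero_right (F : coh X) : short_exact (hom_id F) (hom_null F Z).
Proof.
split=> //.
- by move=> U s t.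
- by move=> U s _; exists s.
- by move=> U s P UP; exists U; split=> //; exists 0; rewrite (zeroC (res U s)).
Qed.

Definition ext_zl (F : coh X) : ext1 F Z := Ext1 (zero_left F).
Definition ext_zr (F : coh X) : ext1 Z F := Ext1 (zero_right F).

(** ** Trivialising an exact sequence from the right *)

(** The sequence 0 -> B -> B -> 0 -> ... -> 0, which maps to every sequence
    starting from B. *)
Fixpoint ycanon n (B : coh X) : yext n Z B :=
  match n return yext n Z B with
  | 0 => ext_zr B
  | n'.+1 => existT _ Z (ext_zr Z, ycanon n' B)
  end.

Definition ytriv n (A B : coh X) : yext n.+1 A B := existT _ Z (ext_zl A, ycanon n B).

Lemma ycanon_mor n (A B : coh X) (r : yext n A B) : yext_mor (hom_null Z A) (hom_id B) (ycanon n B) r.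
Proof.
elim: n A r => [|n IH] A r /=.
  exists (ext_inj r) => U; split=> // s; by have [_ -> _ _] := ext_exact r.
case: r => G [zeta t] /=; exists (hom_null Z G); split; last exact: IH.
exists (hom_null Z (ext_mid zeta)) => U; split=> s /=; last by rewrite hom0.
by rewrite hom0.
Qed.

Lemma yext_mor_id n (A B : coh X) (r : yext n A B) : yext_mor (hom_id A) (hom_id B) r r.
Proof.
elim: n A r => [|n IH] A r /=; first by exists (hom_id _).
by exists (hom_id _); split; [exists (hom_id _)|exact: IH].
Qed.

(** Pulling back the second of two consecutive extensions along a suitable
    homomorphism from a bundle splits it, while the first one lifts: it comes
    from an extension by the torsion-free quotient of the middle term. *)
Lemma lift_step A (F G : coh X) (xi : ext1 (latC A) F) (eta : ext1 F G) :
  exists (E : bun) (xi1 : ext1 (latC A) (latC E)) (h : hom (latC E) F) (l : hom (latC E) (ext_mid eta)),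
    ext1_mor (hom_id (latC A)) h xi1 xi /\ forall U s, ext_prj eta U (l U s) = h U s.
Proof.
have [x1 x2 x3 x4] := ext_exact xi; have [y1 y2 y3 y4] := ext_exact eta.
have [M [U0 [q [sg [ql q0 qsg _]]]]] := coh_structure (ext_mid xi).
have [E [U1 [q' [sg' [ql' q0' qsg' _]]]]] := coh_structure (ext_mid eta).
have [pi hpi] := hom_descend_lat (ext_prj xi) ql q0.
have [p hp] := lat_hom_mx pi; have p0 := has_mx_H0 hp.
have po : onto p.
  move=> P v lv; have [U [s [UP es]]] := vec_section_at lv.
  have [V [VU VP [t et]]] := x4 U s P UP.
  exists (vec (q V t)); first exact: vecP.
  by rewrite -hp hpi et vec_res.
have [J [B ex]] := kernel_bundle p0 po; have B0 := exact_H0 ex.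
(* sJ : J -> F is the restriction of sg, and qJ : F -> J that of q. *)
have [sJ hsJ] : exists sJ : hom (latS J) F, forall U s, ext_inj xi U (sJ U s) = sg U (mx_hom B0 U s).
  pose m := hom_comp (mx_hom B0) sg.
  have prm U s : ext_prj xi U (m U s) = 0.
    rewrite -hpi hom_compE qsg; apply: vec_inj; rewrite hp mx_homE -mulmxA exact_comp0 ?mulmx0 //.
  by apply: (hom_lift (m := m) x1) => U s; exact: x3 (prm U s).
have [qJ hqJ] : exists qJ : hom F (latS J), forall U s, mx_hom B0 U (qJ U s) = q U (ext_inj xi U s).
  have prm U s : pi U (q U (ext_inj xi U s)) = 0 by rewrite hpi x2.
  have [b1 _ b3 _] := exact_short_exact ex B0 p0.
  apply: (hom_lift (m := hom_comp (ext_inj xi) q) b1) => U s; apply: b3; apply: vec_inj.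
  by rewrite mx_homE -hp prm.
have B_inj U (s t : latS J U) : mx_hom B0 U s = mx_hom B0 U t -> s = t.
  by have [h _ _ _] := exact_short_exact ex B0 p0; exact: h.
have qsJ U s : qJ U (sJ U s) = s by apply: B_inj; rewrite hqJ hsJ qsg.
(* P1 : E -> J is the surjection induced by ext_mid eta -> F -> J. *)
have [P1 hP1] := hom_descend_lat (hom_comp (ext_prj eta) qJ) ql' q0'.
have [r hr] := lat_hom_mx P1; have r0 := has_mx_H0 hr.
have ro : onto r.
  move=> P v lv; have [U [s [UP es]]] := vec_section_at lv.
  have [V [VU VP [t et]]] := y4 U (sJ U s) P UP.
  exists (vec (q' V t)); first exact: vecP.
  by rewrite -hr hP1 hom_compE et -hom_res // qsJ vec_res.
have [J' [B' ex2]] := kernel_bundle r0 ro.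
have [S _ Sr] := affine_section ex2.
have exJ : short_exact (mx_hom B0) (mx_hom p0) := exact_short_exact ex B0 p0.
pose xi0 := @Ext1 _ _ (latC A) (latC J) (latC M) _ _ exJ.
have [b0 [m0 [m0' [_ m0i m0p]]]] := cls_ex xi0.
pose b1 := b0 *m S.
pose h := hom_comp sg' (ext_prj eta).
have [Y hY] : exists Y, H0 (extB b1) (extB b0) (block_mx r 0 Y 1%:M).
  apply/std_mor => //; first by move=> P; exact: homL1.
  rewrite /b1 -mulmxA Sr mulmx1 mul1mx subrr; exists 0, 0; split; [exact: homL0|by move=> P _; exact: homL0|by rewrite addr0].
pose m1 := hom_comp (hom_comp (mx_hom hY) m0) sg.
pose delta := hom_add h (hom_opp (hom_comp P1 sJ)).
have dE U s : delta U s = h U s - sJ U (P1 U s) by [].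
have qd U s : hom_comp (ext_inj xi) q U (delta U s) = 0.
  rewrite hom_compE -hqJ dE homB qsJ -[qJ U (h U s)]/(hom_comp (ext_prj eta) qJ U (sg' U s)).
  by rewrite -hP1 qsg' subrr hom0.
have q0i U s : U `<=` U0 -> hom_comp (ext_inj xi) q U s = 0 -> s = 0.
  by move=> UU e; apply: (x1 U); rewrite hom0; apply: q0 UU e.
have [dt [hdt _]] := torsion_extension b1 q0i qd.
exists E, (std b1), h, sg'; split=> //.
exists (hom_add m1 (hom_comp dt (ext_inj xi))) => U; split=> s.
  rewrite -[LHS]/(sg U (m0 U (mx_hom hY U (ext_inj (std b1) U s))) + ext_inj xi U (dt U (ext_inj (std b1) U s))).
  rewrite hdt dE homB.
  have -> : mx_hom hY U (ext_inj (std b1) U s) = ext_inj (std b0) U (P1 U s).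
    apply: vec_inj; rewrite mx_homE !std_injE hr -!mulmxA; congr (_ *m _).
    by rewrite mul_row_block mul_mx_row !mul1mx !mul0mx !addr0 mulmx1 mulmx0.
  by rewrite m0i hsJ addrC subrK.
rewrite -[LHS]/(ext_prj xi U (sg U (m0 U (mx_hom hY U s)) + ext_inj xi U (dt U s))).
rewrite homD x2 addr0 -hpi qsg.
have -> : pi U (m0 U (mx_hom hY U s)) = ext_prj xi0 U (m0 U (mx_hom hY U s)).
  by apply: vec_inj; rewrite hp mx_homE.
rewrite m0p; apply: vec_inj; rewrite std_prjE mx_homE -[RHS]/(vec (ext_prj (std b1) U s)) std_prjE -mulmxA; congr (_ *m _).
by rewrite mul_block_col !mulmx0 !mulmx1 !add0r.
Qed.

(** By lift_step the sequence is equivalent to one whose second extension is a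
    direct sum, and which therefore maps to the trivial sequence. *)
Lemma yext_trivial n A (B : coh X) (z : yext n.+1 (latC A) B) : yext_equiv z (ytriv n (latC A) B).
Proof.
case: z => F [xi rest].
have key (G : coh X) (eta : ext1 F G) : exists (E : bun) (xi1 : ext1 (latC A) (latC E)) (h : hom (latC E) F)
    (sp : ext1 (latC E) G), [/\ ext1_mor (hom_id (latC A)) h xi1 xi, ext1_mor h (hom_id G) sp eta,
    ext1_mor (hom_id (latC A)) (hom_null (latC E) Z) xi1 (ext_zl (latC A)) &
    ext1_mor (hom_null (latC E) Z) (hom_id G) sp (ext_zr G)].
  have [E [xi1 [h [l [hx hl]]]]] := lift_step xi eta.
  have [M [i [p [r [ex er]]]]] := sum_exact E G; have [_ ep _ _] := ex.
  exists E, xi1, h, (Ext1 ex); split=> //.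
  - exists (hom_add (hom_comp p l) (hom_comp r (ext_inj eta))) => U; split=> s.
      rewrite -[LHS]/(l U (p U (i U s)) + ext_inj eta U (r U (i U s))).
      by rewrite ep er hom0 add0r.
    rewrite -[LHS]/(ext_prj eta U (l U (p U s) + ext_inj eta U (r U s))).
    by rewrite homD hl; have [_ -> _ _] := ext_exact eta; rewrite addr0.
  - exists (ext_prj xi1) => U; split=> s //=; by have [_ -> _ _] := ext_exact xi1.
  - by exists r => U; split=> s; [exact: er|rewrite (zeroC (hom_null _ _ _ _)) (zeroC (ext_prj _ _ _))].
have canon (t : yext n Z B) : yext_equiv (existT _ Z (ext_zl (latC A), t) : yext n.+1 (latC A) B) (ytriv n (latC A) B).
  apply: rst_sym; apply: rst_step; exists (hom_null Z Z); split; last exact: ycanon_mor.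
  exists (hom_id _) => U; split=> s //=.
move: canon rest; case: n => [|n] canon rest.
  have [E [xi1 [h [sp [h1 h2 h3 h4]]]]] := key B rest.
  apply: (rst_trans _ _ _ (existT _ (latC E) (xi1, sp) : yext 1 (latC A) B)).
    by apply: rst_sym; apply: rst_step; exists h.
  apply: rst_trans (canon (ext_zr B)).
  by apply: rst_step; exists (hom_null (latC E) Z).
case: rest => G [eta rest].
have [E [xi1 [h [sp [h1 h2 h3 h4]]]]] := key G eta.
apply: (rst_trans _ _ _ (existT _ (latC E) (xi1, existT _ G (sp, rest)) : yext n.+2 (latC A) B)).
  apply: rst_sym; apply: rst_step; exists h; split=> //.
  by exists (hom_id G); split=> //; exact: yext_mor_id.
apply: rst_trans (canon (existT _ G (ext_zr G, rest))).
apply: rst_step; exists (hom_null (latC E) Z); split=> //.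
by exists (hom_id G); split=> //; exact: yext_mor_id.
Qed.

Lemma Ext_vanishes_ge2 A (B : coh X) j : (1 < j)%N -> Ext_vanishes j (latC A) B.
Proof.
case: j => [|[|n]] // _ xi zeta; apply: rst_trans (yext_trivial xi) _.
by apply: rst_sym; exact: yext_trivial.
Qed.

Lemma simple_exceptional E : simple E -> elliptically_exceptional (latC E).
Proof.
move=> sE; split; [exact/hom_dim_lat/simple_h0|exact: simple_Ext1_dim1| |].
  by move=> j; exact: Ext_vanishes_ge2.
by move=> F; exact: simple_pairing.
Qed.

Lemma mutates_left_mutation E F G n (f : 'I_n -> 'M[K]_(rk E, rk F)) (g : 'I_n -> 'M[K]_(rk G, rk E)) :
  mutates f g -> h1 E F 0 -> left_mutation (latC E) (latC F) (latC G).
Proof.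
move=> mu h1EF; split=> [[|[|j]] // _|]; [exact: h1_Ext1|exact: Ext_vanishes_ge2|].
have hf a := mutates_H0f mu a; have hg a := mutates_H0g mu a.
have [fb fs fk gi fl] := mu.
exists n, (fun a => mx_hom (hf a)), (fun a => mx_hom (hg a)); split.
- have hb := @hom_basisP E F n (fun a => mx_hom (hf a)) f; apply/hb => //.
- move=> U s P UP; have [t ht et] := fs P (vec s) (vecP s UP).
  pose T : 'M[K]_(n, rk E) := \matrix_a t a.
  have [|V [VU VP hV]] := lat_open (M := T) UP; first by move=> a; rewrite rowK.
  exists V; split=> //.
  have hV' a Q : open_set V Q -> lat E Q (t a) by move=> VQ; have := hV a Q VQ; rewrite rowK.
  exists (fun a => mklat (hV' a)); apply: vec_inj; rewrite vec_res //.
  etransitivity; first exact: vec_sum.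
  etransitivity; last exact: (esym et).
  by apply: eq_bigr => a _; exact: mx_homE.
move=> U; split=> [s|t].
  apply: vec_inj; rewrite vec_sum vec0 (eq_bigr (fun a => vec s *m (g a *m f a))) => [|a _].
    by rewrite -mulmx_sumr mutates_comp // mulmx0.
  by rewrite !mx_homE mulmxA.
move=> et.
have et' : \sum_a vec (t a) *m f a = 0.
  rewrite -[RHS](vec0 F U) -et vec_sum; apply: eq_bigr => a _; by rewrite mx_homE.
have [v ev] := (fk _).1 et'.
have hv Q : open_set U Q -> lat G Q v.
  by move=> UQ; apply/fl => a; rewrite -ev; exact: vecP.
exists (mklat hv); split=> [a|s hs]; first by apply: vec_inj; rewrite mx_homE.
apply: vec_inj; apply/eqP; rewrite -subr_eq0; apply/eqP; apply: gi => a.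
by rewrite mulmxBl vec_mk -ev -hs mx_homE subrr.
Qed.

End HigherExt.

(** * Rank and degree of sheaves of lattices *)

Section RankDegree.
Implicit Types (P Q : point X) (U V W : opens X) (A B E N : bun) (F G : module_sheaf X).

Lemma frame_mx F U r (e : 'I_r -> F U) U' r' (e' : 'I_r' -> F U') (fe : frame e) (fe' : frame e') :
  (\matrix_i fcoord fe' (e i)) *m (\matrix_j fcoord fe (e' j)) = 1%:M :> 'M[K]_r.
Proof.
pose W := capO U U'; have WU : W `<=` U := @capOl U U'. have WU' : W `<=` U' := @capOr U U'.
apply/row_matrixP => i; rewrite row_mul rowK mulmx_sum_row row1.
rewrite -(coord_e fe i WU) coord_res //.
have [rf ef] := coord_on fe' (e i) WU WU'.
rewrite -[RHS](coord_res fe (e i) WU) ef coord_comb //.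
by apply: eq_bigr => j _; rewrite rowK coord_res.
Qed.

Lemma mulmx1_leq m n (A : 'M[K]_(m, n)) (B : 'M[K]_(n, m)) : A *m B = 1%:M -> (m <= n)%N.
Proof.
by move=> e; rewrite -(mxrank1 K m) -e; apply: leq_trans (mxrankM_maxl _ _) (rank_leq_col _).
Qed.

Lemma frame_uniq F U r (e : 'I_r -> F U) U' r' (e' : 'I_r' -> F U') : frame e -> frame e' -> r = r'.
Proof.
move=> fe fe'; apply/eqP; rewrite eqn_leq.
by rewrite (mulmx1_leq (frame_mx fe fe')) (mulmx1_leq (frame_mx fe' fe)).
Qed.

Lemma rankE F r : has_rank F r -> rank F = r.
Proof.
move=> hr; rewrite /rank; case: xgetP => [x _ [U [e fe]]|/(_ r)]; last by [].
by case: hr => U' [e' fe']; exact: frame_uniq fe fe'.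
Qed.

Lemma iso_frame F G (f : hom F G) (g : hom G F) U r (e : 'I_r -> F U) :
  iso f g -> frame e -> frame (fun i => f U (e i)).
Proof.
move=> [gf fg] fe V VU s; have [b [[rb eb] ub]] := fe V VU (g V s).
have comb c : (forall i, regular V (c 0 i)) ->
    \sum_i act (c 0 i) (res V (f U (e i))) = f V (\sum_i act (c 0 i) (res V (e i))).
  by move=> rc; rewrite hom_sum; apply: eq_bigr => i _; rewrite homZ // hom_res.
exists b; split=> [|c [rc ec]]; first by split=> //; rewrite comb // -eb fg.
by apply: ub; split=> //; rewrite ec comb // gf.
Qed.

Lemma iso_sym F G (f : hom F G) g : iso f g -> iso g f. Proof. by case. Qed.

Lemma iso_rank F G (f : hom F G) g r : iso f g -> has_rank F r -> has_rank G r.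
Proof. by move=> i [U [e fe]]; exists U, (fun i => f U (e i)); exact: iso_frame i fe. Qed.

Lemma iso_degree F G (f : hom F G) g n : iso f g -> has_degree F n -> has_degree G n.
Proof.
move=> i [r [U [e [m [fe loc en]]]]]; exists r, U, (fun i => f U (e i)), m; split=> //.
  exact: iso_frame i fe.
move=> P; have [V [W [e' [VP fe' WU WV h]]]] := loc P.
exists V, W, (fun i => f V (e' i)); split=> //; first exact: iso_frame i fe'.
move=> j; have [rm em] := h j; split=> //; rewrite -hom_res // em hom_sum.
by apply: eq_bigr => l _; rewrite homZ // hom_res.
Qed.

Lemma frame_gl E U (e : 'I_(rk E) -> latS E U) P : frame e -> open_set U P ->
  gl P ((\matrix_i vec (e i)) *m invmx (gen E P)).
Proof.
move=> fe UP; pose M : 'M[K]_(rk E) := \matrix_i vec (e i).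
have iM : imx P (M *m invmx (gen E P)).
  by apply/imx_row => i; rewrite row_mul rowK; exact: (vecP (e i) UP).
have /choice [c hc] i : exists f : 'rV[K]_(rk E), imx P f /\ row i (gen E P) = f *m M.
  have [V [s [VP es]]] := vec_section_at (lat_gen P i).
  have [f [[rf ef] _]] := fe (capO U V) (@capOl U V) (res (capO U V) s).
  exists f; split; first by move=> a b; rewrite ord1; apply: rf.
  rewrite -es -(@vec_res _ V (capO U V)); last exact: capOr.
  rewrite ef vec_sum mulmx_sum_row; apply: eq_bigr => j _.
  by rewrite vec_act // vec_res ?rowK //; exact: capOl.
pose f : 'M[K]_(rk E) := \matrix_i c i.
have iF : imx P f by apply/imx_row => i; rewrite rowK; case: (hc i).
have e1 : f *m (M *m invmx (gen E P)) = 1%:M.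
  rewrite mulmxA (_ : f *m M = gen E P) ?mulmxV ?gen_unit //.
  by apply/row_matrixP => i; rewrite row_mul rowK; case: (hc i).
have [_ uM] := mulmx1_unit e1; split=> //.
by rewrite -[invmx _]mul1mx -e1 mulmxK.
Qed.

(** A frame e of E over some U, written as a matrix M of rational vectors, is
    a rational section. The bases gen E P and the frames around P differ by
    invertible integral matrices (frame_gl), and the order of det M sums to
    zero. *)
Lemma has_degree_lat E n : has_degree (latS E) n <-> n = deg E.
Proof.
split=> [[r [U [e [m [fe loc ->]]]]]|->].
  have [U0 [e0 [_ fe0 _]]] := latS_frame E pinf.
  have er := frame_uniq fe fe0; subst r.
  pose M : 'M[K]_(rk E) := \matrix_i vec (e i).
  have [P0 UP0] := open_point U; have [uM _ _] := frame_gl fe UP0.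
  have dM : \det M != 0.
    by move: uM; rewrite unitmx_mul unitmx_inv gen_unit andbT unitmxE unitfE.
  apply: (sum_ord_div dM) => P.
  have [V [W [e' [VP fe' WU WV h]]]] := loc P; have gP := frame_gl fe' VP.
  pose M' : 'M[K]_(rk E) := \matrix_i vec (e' i).
  have eM : M = (m P)^T *m M'.
    apply/row_matrixP => j; rewrite row_mul rowK mulmx_sum_row.
    have [rm em] := h j; rewrite -(vec_res _ WU) em vec_sum; apply: eq_bigr => i _.
    by rewrite vec_act // vec_res // rowK !mxE.
  have eM' : ord P (\det M') = ord P (\det (gen E P)).
    by rewrite -(det_unitr (gen_unit E P) gP) mulmxKV ?gen_unit.
  move: dM; rewrite eM det_mulmx det_tr mulf_eq0 negb_or => /andP [d1 d2].
  by rewrite (ordM) // eM' addrK.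
have [U [e [_ fe ve]]] := latS_frame E pinf.
pose M := gen E pinf.
have dM : \det M != 0 by rewrite -unitfE -unitmxE gen_unit.
exists (rk E), U, e, (fun P => (M *m invmx (gen E P))^T); split=> // [P|]; last first.
  symmetry; apply: (sum_ord_div dM) => P.
  by rewrite det_tr det_mulmx det_inv (ordM) ?(ordV) // ?invr_eq0 -?unitfE -?unitmxE ?gen_unit.
have [V [e' [VP fe' ve']]] := latS_frame E P.
pose D := M *m invmx (gen E P).
have fA : finite_set ([set Q | ~ imx Q D] `\ P) by apply: finite_setD; exact: pole_finite.
pose W := capO U (capO V (remO fullO (pole_finite D))).
have WU : W `<=` U by move=> Q [].
have WV : W `<=` V by move=> Q [_ []].
exists V, W, e'; split=> // j.
have rD i : regular W (D^T i j).
  by move=> Q [_ [_ [_ h]]]; rewrite mxE; apply: (contrapT h).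
split=> //; apply: vec_inj; rewrite vec_res // ve vec_sum.
rewrite (eq_bigr (fun i => D j i *: row i (gen E P))) => [|i _].
  have -> : \sum_i D j i *: row i (gen E P) = row j D *m gen E P.
    by rewrite mulmx_sum_row; apply: eq_bigr => i _; rewrite [row j D 0 i]mxE.
  by rewrite -row_mul /D mulmxKV ?gen_unit.
by rewrite vec_act // vec_res // ve' mxE.
Qed.

Lemma has_rank_lat E : has_rank (latS E) (rk E).
Proof. by have [U [e [_ fe _]]] := latS_frame E pinf; exists U, e. Qed.

Lemma rank_iso F E (f : hom F (latS E)) g : iso f g -> rank F = rk E.
Proof. by move=> /iso_sym i; apply: rankE; exact: iso_rank i (has_rank_lat E). Qed.

Lemma degree_iso F E (f : hom F (latS E)) g : iso f g -> degree F = deg E.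
Proof.
move=> i; rewrite /degree; case: xgetP => [n _ /(iso_degree i) /has_degree_lat //|/(_ (deg E)) []].
by apply: (iso_degree (iso_sym i)); exact/has_degree_lat.
Qed.

Lemma iso_id F : iso (hom_id F) (hom_id F). Proof. by []. Qed.

Lemma rank_lat E : rank (latS E) = rk E. Proof. exact: rank_iso (iso_id _). Qed.
Lemma degree_lat E : degree (latS E) = deg E. Proof. exact: degree_iso (iso_id _). Qed.

End RankDegree.

(** * Terms of helices are sheaves of lattices *)

Section Terms.
Implicit Types (P Q : point X) (U V W : opens X) (A B E N : bun).

(** A torsion section s at P and a functional on the bundle N that is a unit
    at P give a nonzero homomorphism N -> F. *)
Lemma torsion_hom (F : module_sheaf X) N U V (s : F U) : (0 < rk N)%N -> V `<=` U -> res V s = 0 -> s <> 0 ->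
  exists (eps : hom (latS N) F) W v, eps W v <> 0.
Proof.
move=> rN VU s0 ns.
have [P [UP hP]] : exists P, open_set U P /\ forall W, W `<=` U -> open_set W P -> res W s <> 0.
  apply: contrapT => h; apply: ns; apply: separated => P UP; apply: contrapT => h'; apply: h.
  exists P; split=> // W WU WP e; apply: h'; exists W; split=> //; by rewrite e res0.
have [U1 [U1U U1P g1 g2]] := gen_nbhd N UP.
have fV : finite_set (~` open_set V `\ P) by apply: finite_setD; exact: open_cofinite.
have [|U2 [U2U1 U2P h2]] := shrink fV U1P; first by case=> _; apply.
have U2U := subset_trans U2U1 U1U.
have off W : W `<=` U2 -> ~ open_set W P -> W `<=` V.
  move=> WU nP Q WQ; apply: contrapT => nV; apply: (h2 Q (WU Q WQ)); split=> // e.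
  by apply: nP; rewrite -e.
pose j0 : 'I_(rk N) := Ordinal rN.
pose f W (v : latS N W) : K := (vec v *m invmx (gen N P)) 0 j0.
have rf W (v : latS N W) : W `<=` U2 -> regular W (f W v).
  by move=> WU Q WQ; apply: (g2 Q (vec v)) => //; [apply: U2U1; exact: WU|exact: vecP].
pose Vx Q := if pselect (Q = P) then U2 else remO fullO (finite_set1 P).
pose h Q W (v : latS N W) : F W := if pselect (Q = P) then act (f W v) (res W s) else 0.
have VxP W : W `<=` Vx P -> W `<=` U2 by rewrite /Vx; case: pselect.
have [|Q W v w WV|Q W c v WV rc|Q W W' v WV WW|Q Q' W v WQ WQ'|eps heps] := @hom_glue (latS N) F Vx h.
- by move=> Q; rewrite /Vx; case: pselect => [e|n] //=; rewrite e.
- move: WV; rewrite /h /Vx; case: pselect => [eq|n] WV; last by rewrite addr0.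
  rewrite -actDl; [|exact: rf|exact: rf].
  by congr act; rewrite /f vecD mulmxDl mxE.
- move: WV; rewrite /h /Vx; case: pselect => [eq|n] WV; last by rewrite act0r.
  rewrite -actM //; last exact: rf.
  by congr act; rewrite /f vec_act // -scalemxAl mxE.
- move: WV; rewrite /h /Vx; case: pselect => [eq|n] WV; last by rewrite res0.
  rewrite res_act //; last exact: rf.
  rewrite res_comp //; last exact: subset_trans U2U.
  by congr act; rewrite /f vec_res.
- have z W' (v' : latS N W') : W' `<=` U2 -> W' `<=` remO fullO (finite_set1 P) -> act (f W' v') (res W' s) = 0.
    move=> W2 WP; have WV : W' `<=` V by apply: off => // /WP [_ /=].
    by rewrite -(res_comp VU WV) s0 res0 // act0r //; exact: rf.
  move: WQ WQ'; rewrite /h /Vx; case: pselect => [e1|n1]; case: pselect => [e2|n2] // W1 W2.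
    exact: z.
  by rewrite z.
pose v : latS N U2 := mklat (fun Q UQ => g1 j0 Q (U2U1 Q UQ)).
exists eps, U2, v; rewrite (heps P) /h; last by rewrite /Vx; case: pselect => [n Q //|n]; case: (n erefl).
case: pselect => [e|n]; last by case: (n erefl).
rewrite /= /f vec_mk -row_mul mulmxV ?gen_unit // row1 mxE !eqxx act1.
exact: hP.
Qed.

(** A coherent sheaf of positive rank whose endomorphisms are scalars has no
    torsion: otherwise the sheaf maps onto its torsion-free quotient and from
    there to its torsion. *)
Lemma simple_torsionfree (F : coh X) : hom_dim F F 1 -> ~ has_rank F 0 ->
  exists E (f : hom F (latS E)) g, iso f g.
Proof.
move=> [b hb] r0; have [|N [q [q' [i _]]]] := @torsionfree_iso F; last by exists N, q, q'.
move=> U V s VU s0; apply: contrapT => ns.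
have [N [U0 [q [sg [ql q0 qsg rF]]]]] := coh_structure F.
have rN : (0 < rk N)%N by rewrite lt0n; apply/eqP => e; apply: r0; rewrite -e.
have [eps [W [v nv]]] := torsion_hom rN VU s0 ns.
have qs : q U s = 0 by apply: (torsionfree_res VU); rewrite -hom_res // s0 hom0.
have [c [hc _]] := hb (hom_id F); have [d [hd _]] := hb (hom_comp q eps).
have {}hc U' (t : F U') : t = act (C (c 0 0)) (b 0 U' t) by have := hc U' t; rewrite big_ord1.
have {}hd U' (t : F U') : eps U' (q U' t) = act (C (d 0 0)) (b 0 U' t).
  by have := hd U' t; rewrite big_ord1 hom_compE.
have c0 : c 0 0 != 0 by apply/eqP => e; apply: ns; rewrite (hc U s) e rmorph0 act0l.
have bE U' (t : F U') : b 0 U' t = act (C (c 0 0)^-1) t.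
  by rewrite {2}(hc U' t) -actM; [rewrite -rmorphM mulVf // rmorph1 act1|exact: regular_cst|exact: regular_cst].
have hd2 U' (t : F U') : eps U' (q U' t) = act (C (d 0 0 / c 0 0)) t.
  by rewrite hd bE -actM; [rewrite -rmorphM|exact: regular_cst|exact: regular_cst].
have d0 : d 0 0 / c 0 0 = 0.
  apply: contrapT => /eqP n0; apply: ns; have := hd2 U s; rewrite qs hom0 => e.
  rewrite -(act1 s) -(rmorph1 C) -(mulVf n0) rmorphM actM; try exact: regular_cst.
  by rewrite -e act0r //; exact: regular_cst.
by apply: nv; rewrite -(qsg W v) hd2 d0 rmorph0 act0l.
Qed.

(** ** Transport along isomorphisms *)

Lemma hom_dim_iso (F F' G G' : module_sheaf X) n (f : hom F F') f' (g : hom G G') g' :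
  iso f f' -> iso g g' -> hom_dim F G n -> hom_dim F' G' n.
Proof.
move=> [e1 e2] [e3 e4] [b hb]; exists (fun i => hom_comp (hom_comp f' (b i)) g) => h.
have [c [hc uc]] := hb (hom_comp (hom_comp f h) g').
have comb (c' : 'rV[k]_n) U s : \sum_i act (C (c' 0 i)) (g U (b i U (f' U s))) =
    g U (\sum_i act (C (c' 0 i)) (b i U (f' U s))).
  by rewrite hom_sum; apply: eq_bigr => i _; rewrite homZ //; exact: regular_cst.
exists c; split=> [U s|c' hc'].
  by have := hc U (f' U s); rewrite !hom_compE e2 => /(congr1 (g U)); rewrite e4 -comb.
apply: uc => U s; rewrite !hom_compE hc'.
have h1 : \sum_i act (C (c' 0 i)) (hom_comp (hom_comp f' (b i)) g U (f U s)) = _ := comb c' U (f U s).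
by rewrite h1 e1 e3.
Qed.

Section ExtIso.
Variables (A A' B B' : coh X) (f : hom A A') (f' : hom A' A) (g : hom B B') (g' : hom B' B).
Hypotheses (hf : iso f f') (hg : iso g g').

Lemma ext_transport_exact (xi : ext1 A B) : short_exact (hom_comp g' (ext_inj xi)) (hom_comp (ext_prj xi) f).
Proof.
have [e1 e2] := hf; have [e3 e4] := hg; have [x1 x2 x3 x4] := ext_exact xi; split.
- by move=> U s t /= /x1 h; rewrite -(e4 U s) h e4.
- by move=> U s; rewrite !hom_compE x2 hom0.
- move=> U s; rewrite hom_compE => h; have [|t et] := x3 U s; first by rewrite -(e1 U (ext_prj xi U s)) h hom0.
  by exists (g U t); rewrite hom_compE e3.
move=> U s P UP; have [V [VU VP [t et]]] := x4 U (f' U s) P UP.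
by exists V; split=> //; exists t; rewrite hom_compE et hom_res // e2.
Qed.

Definition ext_transport (xi : ext1 A B) : ext1 A' B' := Ext1 (ext_transport_exact xi).

Lemma ext_transport_mor xi zeta : ext1_mor (hom_id A) (hom_id B) xi zeta ->
  ext1_mor (hom_id A') (hom_id B') (ext_transport xi) (ext_transport zeta).
Proof.
move=> [m hm]; exists m => U; split=> s; rewrite /= ?hom_compE.
  by have [h _] := hm U; exact: h.
by have [_ h] := hm U; rewrite h.
Qed.

End ExtIso.

Lemma Ext1_iso (A A' B B' : coh X) (f : hom A A') f' (g : hom B B') g' :
  iso f f' -> iso g g' -> Ext_vanishes 1 A B -> Ext_vanishes 1 A' B'.
Proof.
move=> hf hg v xi zeta.
pose T := ext_transport hf hg; pose T' := ext_transport (iso_sym hf) (iso_sym hg).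
have hT x : yext_equiv (n := 0) x (T (T' x)).
  apply: rst_step; exists (hom_id _) => U; split=> s.
    by rewrite -[RHS]/(ext_inj x U (g U (g' U s))); have [_ ->] := hg.
  by rewrite -[LHS]/(f U (f' U (ext_prj x U s))); have [_ ->] := hf.
have hmap x y : yext_equiv (n := 0) x y -> yext_equiv (n := 0) (T x) (T y).
  elim=> {x y} [x y h|x|x y _ h|x y z _ h1 _ h2].
  - by apply: rst_step; exact: ext_transport_mor.
  - exact: rst_refl.
  - exact: rst_sym.
  - exact: rst_trans h1 h2.
apply: rst_trans (hT xi) _; apply: rst_trans (rst_sym _ _ _ _ (hT zeta)).
by apply: hmap; exact: v.
Qed.

(** ** The rank and degree of a mutation *)

Lemma mutates_rank_deg E F G n (f : 'I_n -> 'M[K]_(rk E, rk F)) (g : 'I_n -> 'M[K]_(rk G, rk E)) :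
  mutates f g -> (rk G + rk F = n * rk E)%N /\ deg G + deg F = n%:Z * deg E.
Proof.
move=> mu; have [fb fs fk gi fl] := mu.
have [S [i [p [pw rS dS]]]] := power_exists E n; have [hi hp _ _] := pw.
pose B : 'M[K]_(rk G, rk S) := \sum_a g a *m i a; pose A : 'M[K]_(rk S, rk F) := \sum_a p a *m f a.
have iA a : i a *m A = f a by exact: power_ip.
have Bp a : B *m p a = g a by exact: power_tp.
have ex : exact_seq B A.
  split.
  - rewrite -kermx_eq0; apply/rowV0P => v /sub_kermxP h; apply: gi => a.
    by rewrite -Bp mulmxA h mul0mx.
  - move=> v; have -> : v *m A = \sum_a (v *m p a) *m f a.
      by rewrite mulmx_sumr; apply: eq_bigr => a _; rewrite mulmxA.
    rewrite fk; split=> [[s hs]|[w ->]]; last by exists w => a; rewrite -mulmxA Bp.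
    exists s; rewrite -[v](power_vi pw) mulmx_sumr; apply: eq_bigr => a _; by rewrite hs mulmxA.
  - by move=> P; apply: homL_sum => a; exact: homL_comp (hp a P) (mutates_H0f mu a P).
  - move=> P v /fs [t ht ->]; exists (\sum_a t a *m i a).
      by apply: lat_sum => a; exact: homL_lat (hi a P) (ht a).
    by rewrite mulmx_suml; apply: eq_bigr => a _; rewrite -mulmxA iA.
  move=> P w; rewrite fl; split=> [h|h a]; last first.
    by rewrite -Bp mulmxA; exact: homL_lat (hp a P) h.
  rewrite mulmx_sumr; apply: lat_sum => a; rewrite mulmxA; exact: homL_lat (hi a P) (h a).
split; first by rewrite -rS (exact_rk ex).
by rewrite -dS (exact_deg ex).
Qed.

Lemma open_family P n (R : 'I_n -> opens X -> Prop) : (forall a U V, R a U -> V `<=` U -> R a V) ->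
  (forall a, exists U, open_set U P /\ R a U) -> exists U, open_set U P /\ forall a, R a U.
Proof.
move=> hR /choice [W hW].
have [|V [_ VP VW]] := @open_inter fullO P n W Logic.I; first by move=> a; case: (hW a).
by exists V; split=> // a; apply: hR (VW a); case: (hW a).
Qed.

Lemma left_mutation_mutates E F G n (f : 'I_n -> hom (latC E) (latC F)) (g : 'I_n -> hom (latC G) (latC E)) :
  [/\ hom_basis f, eval_surjective f & eval_kernel f g] ->
  exists (f : 'I_n -> 'M[K]_(rk E, rk F)) (g : 'I_n -> 'M[K]_(rk G, rk E)), mutates f g /\ h0 E F n.
Proof.
move=> [fb fs fk].
have [M hM] := has_mx_family f; have [L hL] := has_mx_family g.
have hb := (hom_basisP hM).1 fb.
have LM : \sum_a L a *m M a = 0.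
  apply: (@mx_ext G) => U s; rewrite mulmx0 mulmx_sumr.
  transitivity (vec (\sum_a f a U (g a U s))); last by rewrite (proj1 (fk U) s).
  by rewrite vec_sum; apply: eq_bigr => a _; rewrite hM hL mulmxA.
have ev V (t : 'I_n -> latS E V) : vec (\sum_a f a V (t a)) = \sum_a vec (t a) *m M a.
  by rewrite vec_sum; apply: eq_bigr => a _; rewrite hM.
have secs P (t : 'I_n -> 'rV[K]_(rk E)) : (forall a, lat E P (t a)) ->
    exists V (s : 'I_n -> latS E V), open_set V P /\ forall a, vec (s a) = t a.
  move=> ht; have [||V [VP hV]] := @open_family P n (fun a V => exists s : latS E V, vec s = t a).
  - by move=> a U V [s es] VU; exists (res V s); rewrite vec_res.
  - by move=> a; have [U [s [UP es]]] := vec_section_at (ht a); exists U; split=> //; exists s.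
  by have [s hs] := choice hV; exists V, s.
have inj (s : 'rV[K]_(rk G)) : (forall a, s *m L a = 0) -> s = 0.
  move=> hs; have [U [t et]] := vec_section s.
  have [s0 [_ us0]] := (fk U).2 (fun=> 0) (big1 _ _ _ (fun a _ => hom0 (f a) U)).
  rewrite -et -(vec0 G U); congr vec; rewrite -(us0 t) => [|a].
    by symmetry; rewrite -(us0 0) // => a; exact: hom0.
  by apply: vec_inj; rewrite hL et hs.
exists M, L; split; last exact/(hom_dim_lat)/(ex_intro _ f fb).
split=> //.
- move=> P v lv; have [U [s [UP es]]] := vec_section_at lv.
  have [V [VU VP [t et]]] := fs U s P UP.
  exists (fun a => vec (t a)); first by move=> a; exact: vecP.
  by rewrite -ev et vec_res // es.
- move=> t; split=> [ht|[s es]]; last first.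
    rewrite (eq_bigr (fun a => s *m (L a *m M a))) => [|a _]; last by rewrite es mulmxA.
    by rewrite -mulmx_sumr LM mulmx0.
  pose V := remO fullO (finite_family (fun a => lat_nbhd (t a))).
  have hV a Q : open_set V Q -> lat E Q (t a).
    by move=> [_ h]; apply: contrapT => n1; apply: h; exists a.
  have [|s [hs _]] := (fk V).2 (fun a => mklat (hV a)).
    by apply: vec_inj; rewrite ev.
  by exists (vec s) => a; rewrite -hL hs.
move=> P s; split=> [ls a|h]; first exact: homL_lat (has_mx_H0 (hL a) P) ls.
have [V [t [VP et]]] := secs P _ h.
have [|s' [hs' _]] := (fk V).2 t.
  apply: vec_inj; rewrite ev vec0 (eq_bigr (fun a => s *m (L a *m M a))) => [|a _]; last by rewrite et mulmxA.
  by rewrite -mulmx_sumr LM mulmx0.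
suff -> : s = vec s' by exact: vecP.
apply/eqP; rewrite -subr_eq0; apply/eqP; apply: inj => a.
by rewrite mulmxBl -hL hs' et subrr.
Qed.

End Terms.

(** * Simple bundles of integral slope *)

Section IntegralSlope.
Implicit Types (P Q : point X) (E F L : bun).

Lemma rs_mul P f g : regular_at P f -> regular_at P g -> rs P (f * g) = rs P f * rs P g.
Proof.
move=> rf rg; apply: (rs_uniq); first exact: regM.
have -> : f * g - C (rs P f * rs P g) = g * (f - C (rs P f)) + C (rs P f) * (g - C (rs P g)).
  by rewrite rmorphM; ring.
by apply: vanD; apply: vanM; [exact: rg|exact: rsP|exact: regC|exact: rsP].
Qed.

Lemma rs_sum P (I : Type) (s : seq I) (Q : pred I) (f : I -> K) : (forall i, regular_at P (f i)) ->
  rs P (\sum_(i <- s | Q i) f i) = \sum_(i <- s | Q i) rs P (f i).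
Proof.
move=> rf; elim: s => [|i s IH]; first by rewrite !big_nil -(rmorph0 C) (rs_C).
rewrite !big_cons; case: (Q i) => //.
rewrite -[f i]mul1r -(rmorph1 C) (rs_lin) ?mul1r ?rmorph1 ?mul1r ?IH //.
by apply: reg_sum.
Qed.

Lemma rs_prod P n (f : 'I_n -> K) : (forall i, regular_at P (f i)) -> rs P (\prod_i f i) = \prod_i rs P (f i).
Proof.
elim: n f => [|n IH] f rf; first by rewrite !big_ord0 -(rmorph1 C) (rs_C).
by rewrite !big_ord_recl rs_mul ?IH //; apply: reg_prod.
Qed.

Lemma rs_det P n (A : 'M[K]_n) : imx P A -> rs P (\det A) = \det (map_mx (rs P) A).
Proof.
move=> iA; have rp (s : 'S_n) : regular_at P (\prod_i A i (s i)) by apply: reg_prod.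
have rsg (s : 'S_n) : regular_at P ((-1) ^+ s * \prod_i A i (s i) : K).
  by apply: regM => //; have := regC P ((-1) ^+ s); rewrite rmorphXn rmorphN rmorph1.
rewrite /determinant rs_sum //; apply: eq_bigr => s _; rewrite rs_mul //.
  congr (_ * _); last by rewrite rs_prod //; apply: eq_bigr => i _; rewrite mxE.
  by rewrite -(rs_C P ((-1) ^+ s)) rmorphXn rmorphN rmorph1.
by have := regC P ((-1) ^+ s); rewrite rmorphXn rmorphN rmorph1.
Qed.

Definition twist_gen L P Q : 'M[K]_(rk L) := if Q == P then (tau P)^-1 *: gen L Q else gen L Q.

Lemma twist_unit L P Q : twist_gen L P Q \in unitmx.
Proof.
rewrite /twist_gen; case: eqP => _; last exact: gen_unit.
by rewrite unitmxZ ?gen_unit // unitfE invr_eq0 tau_neq0.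
Qed.

Lemma twist_fin L P : finite_set [set Q | twist_gen L P Q <> 1%:M].
Proof.
apply: (sub_finite_set (B := [set P] `|` [set Q | gen L Q <> 1%:M])).
  by move=> Q /=; rewrite /twist_gen; case: eqP => [->|_]; [left|right].
by rewrite finite_setU; split; [exact: finite_set1|exact: gen_fin].
Qed.

Definition twistP L P : bun := Bun (twist_unit L P) (twist_fin L P).

Lemma deg_twist_line z P : deg (twistP (line z) P) = z + 1.
Proof.
set L := line z; pose s := undup [:: pinf; P].
have us : uniq s := undup_uniq _.
have hinf : pinf \in s by rewrite mem_undup !inE eqxx.
have hP : P \in s by rewrite mem_undup !inE eqxx orbT.
have hL Q : gen L Q <> 1%:M -> Q \in s.
  by rewrite /= /line_gen; case: eqP => // ->.
have hT Q : gen (twistP L P) Q <> 1%:M -> Q \in s.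
  by rewrite /= /twist_gen; case: eqP => [->//|_]; exact: hL.
rewrite -(deg_line z) (deg_seq us hT) (deg_seq us hL).
have e Q : ord Q (\det (gen (twistP L P) Q)) = ord Q (\det (gen L Q)) - (if Q == P then 1 else 0).
  rewrite /= /twist_gen; case: eqP => [->|_]; last by rewrite subr0.
  have d0 : \det (gen L P) != 0 by rewrite -unitfE -unitmxE gen_unit.
  rewrite detZ expr1 (ordM) ?invr_eq0 ?tau_neq0 // (ordV) ?tau_neq0 //.
  have := ord_tauE 1 (unit1 P); rewrite mul1r expr1z => ->; ring.
rewrite (eq_bigr _ (fun Q _ => e Q)) sumrB opprB [RHS]addrC; congr (_ - _).
rewrite (bigD1_seq P) //= eqxx big1 ?addr0 // => Q /negPf ->; by [].
Qed.

(** Let L' be a line bundle of degree one less than the slope of E. By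
    Riemann-Roch Hom(L', E) has at least rk E independent elements; they
    become dependent at some point P, for degree reasons, so that a
    combination of them extends to L = L'(P). As L and E have the same slope,
    there is also a homomorphism E -> L, and E -> L -> E can only be a scalar
    if E has rank one. *)
Lemma simple_integral_slope E (m : int) : simple E -> deg E = m * (rk E)%:Z -> rk E = 1%N.
Proof.
move=> [r0 sE] dE; set r := rk E in r0 dE sE *.
pose L' := line (m - 1).
have [a [b [ha hb eab]]] := h0_h1 L' E.
have {}eab : a = (r + b)%N.
  apply/eqP; rewrite -eqz_nat; move: eab; rewrite (deg_line) dE -/r -[rk L']/1%N; nia.
subst a; have [f fb] := h0_basis ha; have [fH _] := fb.
pose D : 'M[K]_r := \matrix_i (f (lshift b i) : 'rV[K]_(rk E)).
pose u Q : K := if Q == pinf then tau pinf ^ (- (m - 1)) else 1.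
have genu Q : gen L' Q = (u Q)%:M by rewrite /= /line_gen /u; case: eqP.
have u0 Q : u Q != 0.
  by rewrite /u; case: (Q == pinf); [rewrite expfz_neq0 // tau_neq0|exact: oner_neq0].
pose DP Q : 'M[K]_r := u Q *: (D *m invmx (gen E Q)).
have DProw Q i : row i (DP Q) = gen L' Q *m f (lshift b i) *m invmx (gen E Q).
  rewrite genu mul_scalar_mx -scalemxAl /DP; apply/rowP => j; rewrite !mxE; congr (_ * _).
  by apply: eq_bigr => l _; rewrite mxE.
have iDP Q : imx Q (DP Q).
  by apply/imx_row => i; rewrite DProw; exact: fH.
have [P nu] : exists P, ~ unit_at P (\det (DP P)).
  apply: contrapT => h; have {}h Q : unit_at Q (\det (DP Q)).
    by apply: contrapT => n; apply: h; exists Q.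
  have detE Q : \det (DP Q) = u Q ^+ r * (\det D * (\det (gen E Q))^-1).
    by rewrite detZ det_mulmx det_inv.
  have D0 : \det D != 0.
    have [n0 _ _] := h pinf; move: n0; rewrite detE mulf_eq0 negb_or => /andP [_].
    by rewrite mulf_eq0 negb_or => /andP [].
  have dg Q : \det (gen E Q) != 0 by rewrite -unitfE -unitmxE gen_unit.
  have ordu Q : ord Q (u Q ^+ r) = r%:Z * ord Q (u Q).
    elim: (r) => [|l IH]; first by rewrite expr0 (ord_unit (unit1 Q)) mul0r.
    by rewrite exprS (ordM) ?expf_neq0 // IH; lia.
  have key := @sum_ord_div (\det D) (fun Q => - (r%:Z * ord Q (u Q))) E D0.
  have {}key : \sum_(Q \in [set: point X]) (- (r%:Z * ord Q (u Q))) = deg E.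
    apply: key => Q; have := ord_unit (h Q); rewrite detE.
    rewrite (ordM) ?expf_neq0 ?mulf_neq0 ?invr_eq0 // ordu (ordM) ?invr_eq0 //.
    rewrite (ordV) //; lia.
  move: key; rewrite (fsum_seq (s := [:: pinf])) // => [|Q]; last first.
    rewrite /u inE; case: (Q == pinf) => //; by rewrite (ord_unit (unit1 Q)) mulr0 oppr0 eqxx.
  rewrite big_seq1 /u eqxx; have := ord_tauE (- (m - 1)) (unit1 pinf); rewrite mul1r => ->.
  by rewrite dE -/r; nia.
have : \det (map_mx (rs P) (DP P)) == 0.
  rewrite -rs_det //; apply/eqP/(rs_eq0); first exact: imx_det.
  by apply: contrapT => nv; apply: nu; apply: van_unit => //; exact: imx_det.
move=> /det0P [c c0 cD].
pose cc : 'rV[k]_(r + b) := row_mx c 0.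
pose g := klin C cc f.
have g0 : g <> 0.
  move=> /(basis_free (ksub_H0 L' E) fb) e; move/eqP: c0; apply.
  by have := congr1 lsubmx e; rewrite row_mxKl => ->; apply/rowP => i; rewrite !mxE.
have gE : g = (map_mx C c) *m D :> 'rV[K]_r.
  rewrite /g /klin big_split_ord /= [X in _ + X]big1 ?addr0 => [|i _]; last by rewrite row_mxEr mxE rmorph0 scale0r.
  by rewrite mulmx_sum_row; apply: eq_bigr => i _; rewrite row_mxEl rowK [map_mx _ _ _ _]mxE.
have gvan j : van P ((u P *: (g *m invmx (gen E P))) 0 j).
  have -> : u P *: (g *m invmx (gen E P)) = map_mx C c *m DP P.
    by rewrite gE /DP -scalemxAr mulmxA.
  rewrite mxE; apply/(rs_eq0).
    by apply: reg_sum => i _; apply: regM; [rewrite mxE; exact: regC|exact: iDP].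
  rewrite rs_sum => [|i]; last by apply: regM; [rewrite mxE; exact: regC|exact: iDP].
  transitivity ((c *m map_mx (rs P) (DP P)) 0 j); last by rewrite cD mxE.
  rewrite mxE; apply: eq_bigr => i _; rewrite rs_mul; [|by rewrite mxE; exact: regC|exact: iDP].
  by rewrite [map_mx C c 0 i]mxE (rs_C) [in RHS]mxE.
pose L := twistP L' P.
have gH : H0 L E g.
  move=> Q; rewrite /homL /= /twist_gen; case: eqP => [->|_]; last first.
    by have hg : H0 L' E g := ksub_klin cc (ksub_H0 L' E) fH; exact: hg.
  move=> i j; rewrite -!scalemxAl mxE genu mul_scalar_mx -scalemxAl ord1.
  have [h rh ->] := van_factor (gvan j).
  by rewrite mulrA mulVf ?tau_neq0 // mul1r.
have dL : deg L = m by rewrite deg_twist_line subrK.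
have [x hx] := h0_exists L E; have [y hy] := h0_exists E L.
have exy : x = y.
  have := h0_chi hx hy; rewrite dL dE -/r -[rk L]/1%N mul1r [m * _]mulrC subrr => /eqP.
  by rewrite subr_eq0 => /eqP [].
have [g' hg' g'0] : exists2 g', H0 E L g' & g' <> 0.
  apply: contrapT => h; apply: g0.
  have z : h0 E L 0 by apply/h0_0P => A hA; apply: contrapT => nA; apply: h; exists A.
  rewrite exy (h0_uniq hy z) in hx; by move/h0_0P: hx; apply.
have [c' ec'] : exists c', g' *m g = (C c')%:M by apply: sE => Q; exact: homL_comp (hg' Q) (gH Q).
have [c0'|c0'] := eqVneq (C c') 0.
  have : (g' : 'cV[K]_r) *m (g : 'rV[K]_r) = 0 by rewrite ec' c0' raddf0.
  have [j hj] : exists j, (g : 'rV[K]_r) 0 j != 0 by apply/rV0Pn/eqP.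
  move=> /matrixP e; case: g'0; apply/matrixP => i i'; rewrite [i']ord1 [RHS]mxE.
  have := e i j; rewrite mxE [RHS]mxE big_ord1 => /eqP; rewrite mulf_eq0 (negPf hj) orbF => /eqP.
  exact.
have : (\rank ((g' : 'cV[K]_r) *m (g : 'rV[K]_r)) <= 1)%N by apply: leq_trans (mxrankM_maxl _ _) (rank_leq_col _).
rewrite ec' mxrank_unit; last by rewrite unitmxE det_scalar unitfE expf_neq0.
by move=> h; apply/eqP; rewrite eqn_leq h r0.
Qed.

End IntegralSlope.

(** * From helices of sheaves to helices of bundles and back *)

Section HelixBundles.
Implicit Types (P Q : point X) (U V W : opens X).

Lemma bun_elliptic_helix d (H : int -> bun) : bun_helix d H ->
  elliptic_helix (fun i => latC (H i)) /\ forall i, hom_dim (latC (H i)) (latC (H (i + 1))) d.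
Proof.
move=> bh; have [sH h01 hm] := bh; split; first split=> [i|i j lij|i].
- exact: simple_exceptional.
- by apply: h1_Ext1; apply/serre => //; exact: bun_helix_h0 bh _ _ lij.
- have [f [g [mu _]]] := hm i; apply: mutates_left_mutation mu _.
  by apply/serre.
move=> i; have [f [g [mu _]]] := hm (i + 1); rewrite addrK in f g mu.
have [fb _ _ _ _] := mu; have hb := @hom_basisP _ _ _ (fun a => mx_hom (mutates_H0f mu a)) f.
by exists (fun a => mx_hom (mutates_H0f mu a)); apply/hb.
Qed.

Lemma left_mutation_iso (E F G E' F' G' : coh X) (e : hom E E') e' (f : hom F F') f' (g : hom G G') g' n
    (b : 'I_n -> hom E F) (c : 'I_n -> hom G E) : iso e e' -> iso f f' -> iso g g' ->
  [/\ hom_basis b, eval_surjective b & eval_kernel b c] ->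
  exists (b' : 'I_n -> hom E' F') (c' : 'I_n -> hom G' E'),
    [/\ hom_basis b', eval_surjective b' & eval_kernel b' c'].
Proof.
move=> [e1 e2] [f1 f2] [g1 g2] [hb hs hk].
exists (fun i => hom_comp (hom_comp e' (b i)) f), (fun i => hom_comp (hom_comp g' (c i)) e).
have comb U (t : 'I_n -> E' U) : \sum_i hom_comp (hom_comp e' (b i)) f U (t i) = f U (\sum_i b i U (e' U (t i))).
  by rewrite hom_sum.
split.
- move=> h; have [d [hd ud]] := hb (hom_comp (hom_comp e h) f').
  have lin (d' : 'rV[k]_n) U s : \sum_i act (cst X (d' 0 i)) (hom_comp (hom_comp e' (b i)) f U s) =
      f U (\sum_i act (cst X (d' 0 i)) (b i U (e' U s))).
    by rewrite hom_sum; apply: eq_bigr => i _; rewrite homZ //; exact: regular_cst.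
  exists d; split=> [U s|d' hd']; first by rewrite lin -hd !hom_compE e2 f2.
  by apply: ud => U s; rewrite !hom_compE hd' lin f1 e1.
- move=> U s P UP; have [V [VU VP [t et]]] := hs U (f' U s) P UP.
  exists V; split=> //; exists (fun i => e V (t i)); rewrite comb (eq_bigr (fun i => b i V (t i))).
    by rewrite et -hom_res // f2.
  by move=> i _; rewrite e1.
move=> U; have [k1 k2] := hk U; split=> [s|t].
  rewrite comb (eq_bigr (fun i => b i U (c i U (g' U s)))) ?k1 ?hom0 // => i _.
  by rewrite !hom_compE e1.
rewrite comb => /(congr1 (f' U)); rewrite f1 hom0 => /k2 [s [hs' us]].
exists (g U s); split=> [i|s' hs'']; first by rewrite !hom_compE g1 hs' e2.
rewrite (us (g' U s')) ?g2 // => i.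
by rewrite -(hs'' i) !hom_compE e1.
Qed.

Local Notation numbers d H := (helix_numbers d (fun i => (rk (H i))%:Z) (fun i => deg (H i))).

Lemma mutates_cross d (E F : bun) : h0 E F d -> h0 F E 0 ->
  (rk E)%:Z * deg F - (rk F)%:Z * deg E = d%:Z.
Proof. by move=> h h'; rewrite -(h0_chi h h') subr0. Qed.

Lemma bun_helix_numbers d (H : int -> bun) : bun_helix d H -> numbers d H.
Proof.
move=> [sH h01 hm]; split=> [i|i|i|i].
- by have [] := sH i.
- by have [f [g [/mutates_rank_deg [] // e _ _]]] := hm i; rewrite -PoszD e PoszM.
- by have [f [g [/mutates_rank_deg [] // _ e _]]] := hm i.
- have [f [g [mu _]]] := hm i; apply: mutates_cross (h01 i).
  have [fb _ _ _ _] := mu; apply/(hom_dim_lat).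
  have hb := @hom_basisP _ _ _ (fun a => mx_hom (mutates_H0f mu a)) f.
  by exists (fun a => mx_hom (mutates_H0f mu a)); apply/hb.
Qed.

Lemma elliptic_helix_bundles d (E : int -> coh X) : elliptic_helix E ->
  (forall i, hom_dim (E i) (E (i + 1)) d) -> (forall i, ~ has_rank (E i) 0) ->
  exists H : int -> bun, [/\ forall i, simple (H i),
    forall i, rank (E i) = rk (H i) /\ degree (E i) = deg (H i) &
    numbers d H].
Proof.
move=> [exc ext mut] hd r0.
have /choice [H hH] i : exists H (f : hom (E i) (latS H)) g, iso f g.
  by have [h1 _ _ _] := exc i; apply: simple_torsionfree h1 (r0 i).
have rH i : (0 < rk (H i))%N.
  have [f [g fg]] := hH i; rewrite lt0n; apply/eqP => e; apply: (r0 i).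
  by rewrite -e; apply: iso_rank (iso_sym fg) _; exact: has_rank_lat.
have mu i : exists n f g, @mutates (H (i - 1)) (H i) (H (i - 2)) n f g /\ h0 (H (i - 1)) (H i) n.
  have [f1 [g1 i1]] := hH (i - 1); have [f2 [g2 i2]] := hH i; have [f3 [g3 i3]] := hH (i - 2).
  have [_ [n [b [c hbc]]]] := mut i.
  have [b' [c' hbc']] := left_mutation_iso (E' := latC (H (i - 1))) (F' := latC (H i)) (G' := latC (H (i - 2))) i1 i2 i3 hbc.
  by have [f [g hm]] := left_mutation_mutates hbc'; exists n, f, g.
have hHd i : h0 (H (i - 1)) (H i) d.
  have [f1 [g1 i1]] := hH (i - 1); have [f2 [g2 i2]] := hH i.
  apply/(hom_dim_lat); apply: hom_dim_iso i1 i2 _; have := hd (i - 1).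
  by rewrite subrK.
have hz i : h0 (H i) (H (i - 1)) 0.
  have [f1 [g1 i1]] := hH (i - 1); have [f2 [g2 i2]] := hH i.
  apply/serre => //; apply: (Ext1_h1).
  apply: (Ext1_iso (A' := latC (H (i - 1))) (B' := latC (H i)) i1 i2); apply: ext; lia.
have rd (i : int) : (rk (H (i - 2)%R) + rk (H i) = d * rk (H (i - 1)%R))%N /\ deg (H (i - 2)) + deg (H i) = d%:Z * deg (H (i - 1)).
  have [n [f [g [m hn]]]] := mu i; rewrite -(h0_uniq hn (hHd i)); exact: mutates_rank_deg m.
exists H; split=> [i|i|].
- have [f [g fg]] := hH i; apply: h0_simple (rH i) _; apply/(hom_dim_lat).
  by have [h1 _ _ _] := exc i; have h := hom_dim_iso fg fg h1; exact: h.
- by have [f [g fg]] := hH i; rewrite (rank_iso fg) (degree_iso fg).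
split=> [i|i|i|i]; first exact: rH.
- by rewrite -PoszD (rd i).1 PoszM.
- exact: (rd i).2.
- exact: mutates_cross (hHd i) (hz i).
Qed.

(** E_(i - 2) embeds in a power of E_(i - 1). *)
Lemma torsion_before (E : int -> coh X) i : elliptic_helix E -> has_rank (E i) 0 ->
  forall n : nat, has_rank (E (i - n%:Z)) 0.
Proof.
move=> [_ _ mut] r0; elim=> [|n [U [e fe]]]; first by rewrite subr0.
have [_ [l [f [g [_ _ hk]]]]] := mut (i - n%:Z + 1); rewrite addrK in f g hk.
have ei : i - n%:Z + 1 - 2 = i - n.+1%:Z by lia.
rewrite ei in f g hk.
have z V (t : E (i - n%:Z) V) : V `<=` U -> t = 0.
  by move=> VU; have [b [[_ ->] _]] := fe V VU t; rewrite big_ord0.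
have [e0 _] : exists e0 : 'I_0 -> E (i - n.+1%:Z) U, True by exists (fun=> 0).
exists U, e0 => V VU s.
have [|s0 [_ us]] := (hk V).2 (fun=> 0).
  by rewrite big1 // => a _; exact: hom0.
have s0E t : s0 = t by apply: us => a; exact: z.
exists 0; split; first by split=> [[]//|]; rewrite big_ord0 -(s0E s) (s0E 0).
by move=> b _; apply/rowP => -[].
Qed.

End HelixBundles.

(** * Twists and numerical classes *)

Section Twists.
Implicit Types (P Q : point X) (U V W : opens X).

Definition constS_mul r r' (M : 'M[K]_(r, r')) : hom (constS r) (constS r').
Proof.
exists (fun U (s : 'rV[K]_r) => (s *m M : constS r' U)) => //.
- by move=> U s t; exact: mulmxDl.
- by move=> U f s _; rewrite -[LHS]/((f *: (s : 'rV[K]_r)) *m M) -scalemxAl.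
Defined.

(** Let e, l and t be frames of E, L and T. The bilinear map sending (s, u)
    to the product of their coordinates factors through T; this gives the
    inverse of the matrix expressing the l (x) e_i in the t_j. *)
Lemma tensor_rank (L E T : coh X) : line_bundle L -> is_tensor L E T -> rank T = rank E.
Proof.
move=> lL [b [[bl br bZ bres] univ]].
have [U1 [r [e fe]]] := frame_exists E; have [U2 [r' [t ft]]] := frame_exists T.
have [U3 [_ [l fl]]] := lL pinf.
pose V := capO U1 (capO U2 U3).
have V1 : V `<=` U1 by move=> Q [].
have V2 : V `<=` U2 by move=> Q [_ []].
have V3 : V `<=` U3 by move=> Q [_ []].
pose b0 U (s : L U) (u : E U) : constS r U := fcoord fl s 0 0 *: fcoord fe u.
have b0_bil : bilinear_map b0.
  split.
  - by move=> U s s' u; rewrite /b0 coordD mxE scalerDl.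
  - by move=> U s u u'; rewrite /b0 coordD scalerDr.
  - move=> U f s u rf; rewrite /b0 !coordZ // mxE; split; first by rewrite -scalerA.
    by rewrite scalerA mulrC -scalerA.
  - by move=> U W WU s u; rewrite /b0 !coord_res.
have [[h hb] _] := univ _ _ b0_bil.
pose M : 'M[K]_(r, r') := \matrix_i fcoord ft (b V (res V (l 0)) (res V (e i))).
pose N : 'M[K]_(r', r) := \matrix_j (h V (res V (t j)) : 'rV[K]_r).
have hN (x : T V) : h V x = fcoord ft x *m N :> 'rV[K]_r.
  have [rx ex] := coord_on ft x (fun Q h => h) V2.
  rewrite -{1}(res_id x) ex hom_sum mulmx_sum_row; apply: eq_bigr => j _.
  by rewrite homZ // rowK.
have MN : M *m N = 1%:M.
  apply/row_matrixP => i; rewrite row_mul rowK -hN hb /b0 !coord_e // mxE !eqxx scale1r row1 //.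
have [rl er] : (forall W (s : L W), W `<=` V -> regular W (fcoord fl s 0 0)) /\
    (forall W (s : L W), W `<=` V -> s = act (fcoord fl s 0 0) (res W (l 0))).
  split=> W s WV; have [h1 h2] := coord_on fl s (fun Q h => h) (subset_trans WV V3); first exact: h1.
  by rewrite -{1}(res_id s) h2 big_ord1.
have compat U s u : fcoord ft (b U s u) = h U (b U s u) *m M :> 'rV[K]_r'.
  rewrite hb /b0; pose W := capO U V; have WU : W `<=` U := @capOl U V; have WV : W `<=` V := @capOr U V.
  rewrite -(coord_res ft (b U s u) WU) -bres // -(coord_res fl s WU) -(coord_res fe u WU).
  move: (res W s) (res W u) => {}s {}u.
  have [ru eu] := coord_on fe u (fun Q h => h) (subset_trans WV V1).
  rewrite {1}(er W s WV) (bZ W _ _ _ (rl W s WV)).1 coordZ; last exact: rl.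
  rewrite -scalemxAl; congr (_ *: _); rewrite -{1}(res_id u) eu.
  have bsum n (x : L W) (f : 'I_n -> K) (y : 'I_n -> E W) : (forall i, regular W (f i)) ->
      b W x (\sum_i act (f i) (y i)) = \sum_i act (f i) (b W x (y i)).
    move=> rf; elim: n f y rf => [|n IH] f y rf.
      by rewrite !big_ord0; apply: (addIr (b W x 0)); rewrite -br !addr0 add0r.
    by rewrite !big_ord_recl br (bZ W _ _ _ (rf ord0)).2 IH.
  rewrite bsum // coord_comb // mulmx_sum_row; apply: eq_bigr => i _; congr (_ *: _).
  by rewrite rowK -(coord_res ft _ WV) -bres // !res_comp.
have coord_bil : bilinear_map (fun U s u => fcoord ft (b U s u) : constS r' U).
  split.
  - by move=> U s s' u; rewrite bl coordD.
  - by move=> U s u u'; rewrite br coordD.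
  - by move=> U f s u rf; rewrite (bZ U f s u rf).1 (bZ U f s u rf).2 coordZ.
  - by move=> U W WU s u; rewrite bres // coord_res.
have [_ un] := univ _ _ coord_bil.
have NM : N *m M = 1%:M.
  apply/row_matrixP => j; rewrite row_mul rowK row1 -(coord_e ft j V2).
  by have hh := un (coord_hom ft) (hom_comp h (constS_mul M)) compat V (res V (t j)); exact: (esym hh).
have rr : r = r' by apply/eqP; rewrite eqn_leq (mulmx1_leq MN) (mulmx1_leq NM).
have -> : rank T = r' by apply: (rankE); exists U2, t.
by rewrite -rr; symmetry; apply: (rankE); exists U1, e.
Qed.

Local Notation O := (latC (line 0)).

Lemma lat_line0 P (v : 'rV[K]_1) : lat (line 0) P v <-> regular_at P (v 0 0).
Proof.
have e : invmx (line_gen 0 P) = 1%:M.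
  by rewrite /line_gen oppr0 expr0z; case: eqP => _; rewrite invmx1.
rewrite /lat /= e mulmx1; split=> [h|h i j]; first exact: h.
by rewrite !ord1.
Qed.

Lemma line_bundle_O : line_bundle O.
Proof. by move=> P; have [U [e [UP fe _]]] := latS_frame (line 0) P; exists U; split=> //; exists e. Qed.

Lemma tensor_O (E : coh X) : is_tensor O E E.
Proof.
have reg U (s : O U) : regular U ((vec s : 'rV[K]_1) 0 0) by move=> Q UQ; apply/lat_line0; exact: vecP.
have one U Q : open_set U Q -> lat (line 0) Q (1%:M : 'rV[K]_1).
  by move=> _; apply/lat_line0; rewrite mxE eqxx; exact: reg1.
pose u U : O U := mklat (one U).
exists (fun U (s : O U) t => act ((vec s : 'rV[K]_1) 0 0) t); split.
  split.
  - by move=> U s s' t; rewrite vecD mxE actDl.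
  - by move=> U s t t'; rewrite actDr.
  - move=> U f s t rf; rewrite vec_act // mxE actM // -actM // mulrC actM //.
  - by move=> U V VU s t; rewrite vec_res // res_act.
move=> G b' [bl br bZ bres].
have scal U (s : O U) t : b' U s t = act ((vec s : 'rV[K]_1) 0 0) (b' U (u U) t).
  rewrite -(bZ U _ _ _ (reg U s)).1; congr b'; apply: vec_inj; rewrite vec_act //.
  by rewrite vec_mk {1}[vec s]mx11_scalar scale_scalar_mx mulr1.
split.
  have hD U (s t : E U) : b' U (u U) (s + t) = b' U (u U) s + b' U (u U) t by exact: br.
  have hZ U f (s : E U) : regular U f -> b' U (u U) (act f s) = act f (b' U (u U) s).
    by move=> rf; rewrite (bZ U _ _ _ rf).2.
  have hr U V : V `<=` U -> forall s : E U, b' V (u V) (res V s) = res V (b' U (u U) s).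
    move=> VU s; rewrite -bres //; congr b'; apply: vec_inj; by rewrite vec_res.
  exists (Hom hD hZ hr) => U s t; rewrite -[LHS]/(b' U (u U) (act ((vec s : 'rV[K]_1) 0 0) t)).
  by rewrite hZ // -scal.
move=> h h' hh U x; have := hh U (u U) x.
by rewrite vec_mk mxE eqxx act1.
Qed.

(** Twisting by the trivial line bundle changes nothing. *)
Lemma same_class_of_numbers (E F : int -> coh X) (m : int) :
  (forall i, rank (E (i + m)) = rank (F i) /\ degree (E (i + m)) = degree (F i)) ->
  same_numerical_class E F.
Proof.
move=> h; exists m, O, (shift_helix m E); split=> //; split; first exact: line_bundle_O.
by move=> i; exact: tensor_O.
Qed.

Lemma same_class_rank (E F : int -> coh X) : same_numerical_class E F ->
  exists m : int, forall i, rank (E (i + m)) = rank (F i).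
Proof.
move=> [m [L [E' [[lL tE] ne]]]]; exists m => i.
by have [<- _] := ne i; symmetry; exact: tensor_rank lL (tE i).
Qed.

End Twists.

(** * Classification of helices *)

Section Classification.
Variables (R : realType) (d : nat) (d4 : (4 <= d)%N).
Local Notation mu := (mu R d).

Definition admissible (theta : R) : Prop :=
  exists q : rat, theta = ratr q - d%:R / (2 * (3 * d%:R - 10)) * Num.sqrt (d%:R ^+ 2 - 4).

Lemma admissible_neq0 (theta : R) : admissible theta -> theta <> 0.
Proof.
move=> [q eq] e0; have dR := @d_ge4R R d d4; pose M : int := 3 * d%:Z - 10.
have M0 : M%:~R != 0 :> R by rewrite intr_eq0; apply/eqP; rewrite /M; lia.
have eM : 3 * d%:R - 10 = M%:~R :> R by rewrite /M rmorphB rmorphM.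
have den0 : (denq q)%:~R != 0 :> R by rewrite intr_eq0 denq_neq0.
have eqq : ratr q = (numq q)%:~R / (denq q)%:~R :> R by [].
have key (m n e D : int) (s : R) : m%:~R != 0 :> R -> n%:~R != 0 :> R ->
    0 = e%:~R / n%:~R - D%:~R / (2 * m%:~R) * s -> (m * e + m * e)%:~R + (- (D * n))%:~R * s = 0 :> R.
  move=> m0 n0 h; rewrite !(rmorphD, rmorphN, rmorphM) /=.
  have -> : m%:~R * e%:~R + m%:~R * e%:~R + - (D%:~R * n%:~R) * s =
     2 * m%:~R * n%:~R * (e%:~R / n%:~R - D%:~R / (2 * m%:~R) * s) :> R by field; rewrite n0 m0.
  by rewrite -h mulr0.
have e1 : 0 = (numq q)%:~R / (denq q)%:~R - d%:Z%:~R / (2 * M%:~R) * Num.sqrt (d%:R ^+ 2 - 4) :> R.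
  by rewrite -eqq -eM -[LHS]e0.
have /eqP := sqrt_irr d4 (key _ _ _ _ _ M0 den0 e1).
by rewrite oppr_eq0 mulf_eq0 (negPf (denq_neq0 q)) orbF eqz_nat; move: d4; case: (d).
Qed.

Definition contracting (theta : R) (r delta : int -> int) : Prop := forall i,
  (delta (i - 1))%:~R - theta * (r (i - 1))%:~R = mu * ((delta i)%:~R - theta * (r i)%:~R).
Local Notation contr theta H := (contracting theta (fun i => (rk (H i))%:Z) (fun i => deg (H i))).
Local Notation numbers d H := (helix_numbers d (fun i => (rk (H i))%:Z) (fun i => deg (H i))).

(** The slopes of the terms before one of rank 0 are 0 by the convention on
    division, while theta is irrational. So all terms are bundles. *)
Lemma helix_data (theta : R) (E : int -> coh X) : admissible theta -> helix_with d theta E ->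
  exists H : int -> bun, [/\ forall i, simple (H i),
    forall i, rank (E i) = rk (H i) /\ degree (E i) = deg (H i),
    numbers d H,
    quad d (rk (H (-1)))%:Z (rk (H 0))%:Z = 3 * d%:Z - 10
    & contr theta H].
Proof.
move=> ad [eh hd lim].
have r0 i : ~ has_rank (E i) 0.
  move=> hi; apply: (admissible_neq0 ad).
  have z n : (`|i|%N <= n)%N -> (degree (E (- n%:Z)))%:~R / (rank (E (- n%:Z)))%:R = 0 :> R.
    move=> hn; have := torsion_before eh hi `|(i + n%:Z)%R|%N.
    have -> : i - `|(i + n%:Z)%R|%N%:Z = - n%:Z by lia.
    by move=> /(rankE) ->; rewrite invr0 mulr0.
  have z0 : (fun n : nat => (degree (E (- n%:Z)))%:~R / (rank (E (- n%:Z)))%:R : R) @ \oo --> (0 : R).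
    apply: (@cvg_near_cst nat R 0); exists `|i|%N => // n hn; exact: z.
  exact: (cvg_unique _ lim z0).
have [H [sH rH hn]] := elliptic_helix_bundles eh hd r0.
have lim' : (fun n : nat => (deg (H (- n%:Z)))%:~R / ((rk (H (- n%:Z)))%:Z)%:~R : R) @ \oo --> theta.
  have -> // : (fun n : nat => (deg (H (- n%:Z)))%:~R / ((rk (H (- n%:Z)))%:Z)%:~R : R) =
     (fun n : nat => (degree (E (- n%:Z)))%:~R / (rank (E (- n%:Z)))%:R).
  by apply/funext => n; have [-> ->] := rH (- n%:Z).
have sl := slope_limit d4 hn lim'.
exists H; split=> //; last by have hc := contracts d4 hn sl; exact: hc.
by have [q eq] := ad; exact: (quad_of_limit d4 hn sl eq).
Qed.

(** ** The two kinds of helices *)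

(** The consecutive ranks x, 1 characterise a helix up to its slope. *)
Definition of_kind (x : int) (H : int -> bun) (j : int) : Prop :=
  (rk (H j))%:Z = 1 /\ (rk (H (j - 1)))%:Z = x.

Lemma kinds (H : int -> bun) : numbers d H ->
  quad d (rk (H (-1)))%:Z (rk (H 0))%:Z = 3 * d%:Z - 10 ->
  exists j x, (x = 3 \/ x = d%:Z - 3) /\ of_kind x H j.
Proof.
move=> [p rec _ _] q; have [j [h1 h2]] := rank_descent d4 rec p q.
by exists j, (rk (H (j - 1)))%:Z.
Qed.

(** Shifting so that the terms 1 correspond makes the ranks agree by
    recurrence, and then the degrees, which they determine together with the
    slope. *)
Lemma same_kind_class (theta : R) (E F : int -> coh X) (H H' : int -> bun) (x : int) (j j' : int) :
  (forall i, rank (E i) = rk (H i) /\ degree (E i) = deg (H i)) ->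
  (forall i, rank (F i) = rk (H' i) /\ degree (F i) = deg (H' i)) ->
  numbers d H ->
  numbers d H' ->
  contr theta H ->
  contr theta H' ->
  of_kind x H j -> of_kind x H' j' -> same_numerical_class E F.
Proof.
move=> nE nF hn hn' c c' [k1 k2] [k1' k2'].
have [_ rec _ _] := hn; have [_ rec' _ _] := hn'.
have er i : (rk (H (i + (j - j'))))%:Z = (rk (H' i))%:Z.
  have := recurrent_eq rec rec' (etrans k2 (esym k2')) (etrans k1 (esym k1')) (i - j').
  by rewrite subrK => <-; congr (Posz (rk (H _))); lia.
apply: (same_class_of_numbers (m := j - j')) => i.
rewrite (nE _).1 (nE _).2 (nF _).1 (nF _).2; split.
  by have [] := er i.
symmetry; apply: (degrees_determined d4 (r := fun i => (rk (H' i))%:Z) (theta := theta) (delta' := fun i => deg (H (i + (j - j')))) (c' i)).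
have := c (i + (j - j')); rewrite -!er.
by have -> : i + (j - j') - 1 = i - 1 + (j - j') by lia.
Qed.

Lemma kind_slope (theta : R) (H : int -> bun) x j :
  numbers d H ->
  contr theta H ->
  of_kind x H j -> (theta - (deg (H j))%:~R) * (x%:~R - mu) = - d%:R.
Proof. by move=> hn c [k1 <-]; have := slope_at_one hn (c j) k1. Qed.

(** Helices of different kinds have different limit slopes, unless d is 4 or
    6, where there is only one kind, 5 or 10, or possibly 30. In the last case
    a helix of the first kind would have a simple term of rank three and
    degree divisible by three. *)
Lemma kinds_disjoint (theta : R) (H H' : int -> bun) j j' : d <> 5%N -> d <> 10%N ->
  (forall i, simple (H i)) ->
  numbers d H ->
  numbers d H' ->
  contr theta H ->
  contr theta H' ->
  of_kind 3 H j -> of_kind (d%:Z - 3) H' j' -> exists l, of_kind 3 H' l.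
Proof.
move=> n5 n10 sH hn hn' c c' k1 k2.
have := exceptional_d d4 (two_kinds d4 (kind_slope hn c k1) (kind_slope hn' c' k2)).
rewrite !inE => /orP [/eqP e|/orP [/eqP //|/orP [/eqP e|/orP [/eqP //|/eqP e]]]].
- have [h1 h2] := k2; have [_ rec _ _] := hn'; exists (j' - 1).
  have r2 := rec_prev (rec j').
  have a1 : j' - 1 - 1 = j' - 2 by lia.
  by split; rewrite ?a1 ?r2 h2 ?h1 e.
- by exists j'; have [h1 h2] := k2; split=> //; rewrite h2 e.
have [h1 h2] := k1; have [_ _ _ cr] := hn; have := cr j; rewrite h1 h2 e => h.
have := @simple_integral_slope (H (j - 1)) (deg (H j) - 10) (sH (j - 1)).
rewrite h2 => hs; have e1 : deg (H (j - 1)) = (deg (H j) - 10) * 3.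
  by move: h; move: (deg _) (deg _) => u v; lia.
by move: h2; rewrite (hs e1).
Qed.

Lemma one_class (theta : R) (E F : int -> coh X) : d <> 5%N -> d <> 10%N -> admissible theta ->
  helix_with d theta E -> helix_with d theta F -> same_numerical_class E F.
Proof.
move=> n5 n10 ad hE hF.
have [H [sH nE hn q c]] := helix_data ad hE; have [H' [sH' nF hn' q' c']] := helix_data ad hF.
have [j [x [hx kx]]] := kinds hn q; have [j' [x' [hx' kx']]] := kinds hn' q'.
have same y l l' : of_kind y H l -> of_kind y H' l' -> same_numerical_class E F.
  exact: (same_kind_class nE nF hn hn' c c').
case: hx kx => -> kx; case: hx' kx' => -> kx'; try exact: same kx kx'.
  by have [l kl] := kinds_disjoint n5 n10 sH hn hn' c c' kx kx'; exact: same kx kl.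
by have [l kl] := kinds_disjoint n5 n10 sH' hn' hn c' c kx' kx; exact: same kl kx'.
Qed.

(** ** Existence of helices *)

Lemma helix_of_kind (theta : R) (H : int -> bun) (x : int) : bun_helix d H -> of_kind x H 0 ->
  (theta - (deg (H 0))%:~R) * (x%:~R - mu) = - d%:R -> helix_with d theta (fun i => latC (H i)).
Proof.
move=> bh [k1 k2] e; have hn := bun_helix_numbers bh; have [h1 h2] := bun_elliptic_helix bh.
split=> //; rewrite /negative_limit_slope.
have -> : (fun n : nat => (degree (latC (H (- n%:Z))))%:~R / (rank (latC (H (- n%:Z))))%:R : R) =
   (fun n : nat => (deg (H (- n%:Z)))%:~R / ((rk (H (- n%:Z)))%:Z)%:~R : R).
  by apply/funext => n; rewrite rank_lat degree_lat.
apply: (slope_cvg d4 hn); have [_ _ _ cr] := hn; have := cr 0.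
move: k2; rewrite sub0r => k2; rewrite k1 k2 mul1r => /(congr1 (fun z : int => z%:~R : R)).
rewrite rmorphB rmorphM /= -[d%:Z%:~R]/(d%:R : R) => ec.
have -> : (deg (H (-1)))%:~R = x%:~R * (deg (H 0))%:~R - d%:R :> R by rewrite -ec; ring.
by move: e; move: ((deg (H 0))%:~R : R) (x%:~R : R) mu (d%:R : R) => a b m D; lra.
Qed.

Lemma kind_dual (H : int -> bun) x : bun_helix d H -> of_kind x H 0 ->
  bun_helix d (fun i => dual (H (- i))) /\ of_kind (d%:Z - x) (fun i => dual (H (- i))) 0.
Proof.
move=> bh [k1 k2]; split; first exact: bun_helix_dual bh.
have [_ rec _ _] := bun_helix_numbers bh; split; first by rewrite oppr0.
have := rec 1; rewrite subrr k1 mulr1 (_ : 1 - 2 = 0 - 1) // k2 => h.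
by rewrite sub0r opprK -h addrC addKr.
Qed.

Lemma different_kinds (H H' : int -> bun) (x x' : int) :
  numbers d H ->
  of_kind x H 0 -> of_kind x' H' 0 -> 1 < x -> x < d%:Z - 1 -> x <> x' ->
  ~ same_numerical_class (fun i => latC (H i)) (fun i => latC (H' i)).
Proof.
move=> [_ rec _ _] [k1 k2] [k1' k2'] x1 x2 xx /(same_class_rank) [m hm].
have {}hm i : rk (H (i + m)) = rk (H' i) by have := hm i; rewrite !rank_lat.
have m0 : m = 0.
  apply: (unique_one d4 rec k1); rewrite ?k2 //; last by rewrite -k1' -hm add0r.
  have := rec 1; rewrite subrr k1 mulr1 (_ : 1 - 2 = 0 - 1) // k2 => /(canRL (addKr _)) ->.
  lia.
by apply: xx; rewrite -k2 -k2' -hm m0 addr0.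
Qed.

Lemma two_classes (theta : R) (H H' : int -> bun) : admissible theta -> (6 < d)%N \/ d = 5%N ->
  bun_helix d H -> bun_helix d H' -> of_kind 3 H 0 -> of_kind (d%:Z - 3) H' 0 ->
  (theta - (deg (H 0))%:~R) * (3%:~R - mu) = - d%:R ->
  (theta - (deg (H' 0))%:~R) * ((d%:Z - 3)%:~R - mu) = - d%:R ->
  exactly_two_classes (fun E : int -> coh X => helix_with d theta E).
Proof.
move=> ad d56 bh bh' k1 k2 e1 e2.
have hw := helix_of_kind bh k1 e1; have hw' := helix_of_kind bh' k2 e2.
have hn := bun_helix_numbers bh; have hn' := bun_helix_numbers bh'.
exists (fun i => latC (H i)), (fun i => latC (H' i)); split=> //.
  by apply: (different_kinds hn k1 k2) => //; lia.
have nums (G : int -> bun) i : rank (latC (G i)) = rk (G i) /\ degree (latC (G i)) = deg (G i).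
  by rewrite rank_lat degree_lat.
have ctr (G : int -> bun) y : numbers d G ->
    of_kind y G 0 -> helix_with d theta (fun i => latC (G i)) ->
    contr theta G.
  move=> hG _ [_ _ lim]; apply: (contracts d4 hG); apply: (slope_limit d4 hG).
  have -> // : (fun n : nat => (deg (G (- n%:Z)))%:~R / ((rk (G (- n%:Z)))%:Z)%:~R : R) =
    (fun n : nat => (degree (latC (G (- n%:Z))))%:~R / (rank (latC (G (- n%:Z))))%:R : R).
  by apply/funext => n; rewrite rank_lat degree_lat.
move=> G hG; have [HG [_ nG hnG qG cG]] := helix_data ad hG.
have [j [x [hx kx]]] := kinds hnG qG.
case: hx kx => -> kx; [left|right].
  exact: (same_kind_class nG (nums H) hnG hn cG (ctr _ _ hn k1 hw) kx k1).
exact: (same_kind_class nG (nums H') hnG hn' cG (ctr _ _ hn' k2 hw') kx k2).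
Qed.

End Classification.

Section Existence.
Variable R : realType.

Lemma helix_exists (d n : nat) (a c : int) : (2 <= n)%N -> 0 < a -> d%:Z = (n.-1)%:Z * a + n%:Z ->
  (d * n.-1 > n.-1 ^ 2 + 1)%N ->
  exists H : int -> bun, [/\ bun_helix d H, of_kind (n.-1)%:Z H 0 & deg (H 0) = c].
Proof.
move=> n2 a0 e l; have [M [hp [rM _]]] := start_pair (c - a) n2 a0 e l.
have [H [bh h0 h1]] := pair_helix hp.
exists H; split=> //; last by rewrite h0 (deg_line) subrK.
by split; rewrite ?h0 // sub0r h1 rM.
Qed.

(** 5 = 2 * 1 + 3 gives consecutive ranks 2, 1, and the dual helix has 3, 1. *)
Lemma kinds5 (b b' : int) : exists H H' : int -> bun, [/\ bun_helix 5 H, bun_helix 5 H',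
  of_kind 3 H 0, of_kind 2 H' 0 & deg (H 0) = b /\ deg (H' 0) = b'].
Proof.
have [H' [bh' k' d']] := @helix_exists 5 3 1 b' isT isT erefl isT.
have [H [bh k0 d0]] := @helix_exists 5 3 1 (- b) isT isT erefl isT.
have [bhd kd] := kind_dual bh k0.
exists (fun i => dual (H (- i))), H'; split=> //; split=> //.
exact: (etrans (deg_dual (H 0)) (etrans (congr1 -%R d0) (opprK b))).
Qed.

(** 10 = 3 * 2 + 4 gives consecutive ranks 3, 1, and the dual helix has 7, 1. *)
Lemma kinds10 (b b' : int) : exists H H' : int -> bun, [/\ bun_helix 10 H, bun_helix 10 H',
  of_kind 3 H 0, of_kind 7 H' 0 & deg (H 0) = b /\ deg (H' 0) = b'].
Proof.
have [H' [bh' k' d']] := @helix_exists 10 4 2 b isT isT erefl isT.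
have [H [bh k0 d0]] := @helix_exists 10 4 2 (- b') isT isT erefl isT.
have [bhd kd] := kind_dual bh k0.
exists H', (fun i => dual (H (- i))); split=> //; split=> //.
exact: (etrans (deg_dual (H 0)) (etrans (congr1 -%R d0) (opprK b'))).
Qed.

Lemma mu5 : mu R 5 = 5 / 2 - 1 / 2 * Num.sqrt 21.
Proof.
rewrite /mu (_ : 5%:R ^+ 2 - 4 = 21 :> R); last by ring.
by field.
Qed.

Lemma mu10 : mu R 10 = 5 - 2 * Num.sqrt 6.
Proof.
rewrite /mu (_ : 10%:R ^+ 2 - 4 = 4 ^+ 2 * 6 :> R); last by ring.
rewrite sqrtrM ?sqr_ge0 // sqrtr_sqr ger0_norm //.
by field.
Qed.

Lemma slope5 (theta b : R) (x : int) : x = 3 \/ x = 5%:Z - 3 ->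
  (theta - b) * (x%:~R - mu R 5) = - 5%:R <-> theta = b + x%:~R - 5 / 2 - 1 / 2 * Num.sqrt 21.
Proof.
move=> hx; rewrite slope_value // mu5; set y : R := x%:~R; set s := Num.sqrt 21.
by split=> h; [lra|rewrite h; lra].
Qed.

Lemma slope10 (theta b : R) (x : int) : x = 3 \/ x = 10%:Z - 3 ->
  (theta - b) * (x%:~R - mu R 10) = - 10%:R <-> theta = b + (x%:~R - 5) / 2 - Num.sqrt 6.
Proof.
move=> hx; rewrite slope_value // mu10; set y : R := x%:~R; set s := Num.sqrt 6.
by split=> h; [lra|rewrite h; lra].
Qed.

End Existence.

End Curve.

Theorem proposition6p9 (R : realType) (k : closedFieldType)
    (char_k : [pchar k] =i pred0) (X : ellipticCurve k)
    (d : nat) (d_ge4 : (4 <= d)%N) :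
  (forall rm1 r0 dm1 d0 : int,
     0 < rm1 -> 0 < r0 ->
     coprimez rm1 dm1 -> coprimez r0 d0 ->
     d%:Z * rm1 * r0 - rm1 ^+ 2 - r0 ^+ 2 = 3 * d%:Z - 10 ->
     d%:Z = \det (mx22 rm1 dm1
                       r0  d0) ->
     exists n : int,
       cv2 rm1 r0 = mx22 0 1 (-1) d%:Z ^ n *m cv2 3 1 \/
       cv2 rm1 r0 = mx22 0 1 (-1) d%:Z ^ n *m cv2 (d%:Z - 3) 1) /\
  (forall theta : R,
     (exists q : rat,
        theta = ratr q
                - d%:R / (2 * (3 * d%:R - 10)) * Num.sqrt (d%:R ^+ 2 - 4)) ->
     [/\ d <> 5%N -> d <> 10%N ->
           forall E F : int -> coh X,
             helix_with d theta E -> helix_with d theta F ->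
             same_numerical_class E F,
         d = 10%N ->
           (~ (exists z : int, theta = z%:~R - Num.sqrt 6) ->
              ~ exists E : int -> coh X, helix_with d theta E) /\
           ((exists z : int, theta = z%:~R - Num.sqrt 6) ->
              exactly_two_classes (fun E : int -> coh X => helix_with d theta E))
       & d = 5%N ->
           (~ (exists z : int,
                 theta = z%:~R + 1 / 2 - 1 / 2 * Num.sqrt 21) ->
              ~ exists E : int -> coh X, helix_with d theta E) /\
           ((exists z : int,
               theta = z%:~R + 1 / 2 - 1 / 2 * Num.sqrt 21) ->
              exactly_two_classes (fun E : int -> coh X => helix_with d theta E))]).
Proof.
split=> [rm1 r0 dm1 d0 p1 p2 _ _ q _|theta ad]; first exact: orbits.
split=> [n5 n10 E F hE hF|e|e]; first exact: (one_class char_k d_ge4 n5 n10 ad).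
  subst d; split=> [nz [E hE]|[z ez]].
    have [H [_ _ hn q c]] := helix_data char_k d_ge4 ad hE.
    have [j [x [hx kx]]] := kinds d_ge4 hn q; apply: nz.
    rewrite ((slope10 _ _ hx).1 (kind_slope hn c kx)).
    case: hx => hx; [exists (deg (H j) - 1)|exists (deg (H j) + 1)].
      have -> : x%:~R = 3%:R :> R by rewrite hx.
      by rewrite rmorphB /=; lra.
    have -> : x%:~R = 7%:R :> R by rewrite hx.
    by rewrite rmorphD /=; lra.
  have [H [H' [bh bh' k1 k2 [e1 e2]]]] := kinds10 X char_k (z + 1) (z - 1).
  have k2' : of_kind (10%:Z - 3) H' 0 := k2.
  (* By slope10 the terms of rank one have degrees z + 1 and z - 1. *)
  have tc := two_classes char_k d_ge4 ad (or_introl isT) bh bh' k1 k2'; apply: tc.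
    have c3 : (3 : int)%:~R = 3%:R :> R by [].
    by apply/slope10; [left|rewrite c3 ez e1 rmorphD /=; lra].
  have c7 : (10%:Z - 3)%:~R = 7%:R :> R by [].
  by apply/slope10; [right|rewrite c7 ez e2 rmorphB /=; lra].
subst d; split=> [nz [E hE]|[z ez]].
  have [H [_ _ hn q c]] := helix_data char_k d_ge4 ad hE.
  have [j [x [hx kx]]] := kinds d_ge4 hn q; apply: nz.
  rewrite ((slope5 _ _ hx).1 (kind_slope hn c kx)).
  case: hx => hx; [exists (deg (H j))|exists (deg (H j) - 1)].
    have -> : x%:~R = 3%:R :> R by rewrite hx.
    by lra.
  have -> : x%:~R = 2%:R :> R by rewrite hx.
  by rewrite rmorphB /=; lra.
have [H [H' [bh bh' k1 k2 [e1 e2]]]] := kinds5 X char_k z (z + 1).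
have k2' : of_kind (5%:Z - 3) H' 0 := k2.
(* By slope5 the terms of rank one have degrees z and z + 1. *)
have tc := two_classes char_k d_ge4 ad (or_intror erefl) bh bh' k1 k2'; apply: tc.
  have c3 : (3 : int)%:~R = 3%:R :> R by [].
  by apply/slope5; [left|rewrite c3 ez e1; lra].
have c2 : (5%:Z - 3)%:~R = 2%:R :> R by [].
by apply/slope5; [right|rewrite c2 ez e2 rmorphD /=; lra].
Qed.
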